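(* Let $\beta>0$ and let $u_1<u_2<\dots<u_m$ be real numbers. Let $\{\omega_{i,j}\}_{(i,j)\in\mathbb{Z}^2}$ be i.i.d. exponential random variables with rate $1$, and for $t>0$ let $\mathcal{L}^+=\{(\lfloor-\beta t\rfloor,0)\}$, $\mathcal{L}^-=\{(0,\lfloor-\beta t\rfloor)\}$, $\mathcal{L}=\mathcal{L}^+\cup\mathcal{L}^-$ and $P_k=(\lfloor t+u_kt^{1/3}\rfloor,\lfloor t\rfloor)$. Then for all $s_1,\dots,s_m\in\mathbb{R}$, $$\lim_{t\to\infty}\mathbb{P}\left(\bigcap_{k=1}^m\{L_{\mathcal{L}\to P_k}\le(1+\sqrt{1+\beta})^2t+s_kt^{1/3}\}\right)=F_{\rm GUE}\left(\frac{\min_k\{s_k-\mu_+u_k\}}{\sigma}\right)F_{\rm GUE}\left(\frac{\min_k\{s_k-\mu_-u_k\}}{\sigma}\right),$$ with $\mu_+=1+1/\sqrt{1+\beta}$, $\mu_-=1+\sqrt{1+\beta}$ and $\sigma=\frac{(1+\sqrt{1+\beta})^{4/3}}{(1+\beta)^{1/6}}$.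
   Context: LPP: an up-right path is a sequence $\pi=(\pi(0),\dots,\pi(n))$ of points of $\mathbb{Z}^2$ with $\pi(i)-\pi(i-1)\in\{(1,0),(0,1)\}$; for $S_A\subset\mathbb{Z}^2$ and a point $B$, $L_{S_A\to B}=\max_\pi\sum_{(i,j)\in\pi\setminus S_A}\omega_{i,j}$ over up-right paths with $\pi(0)\in S_A$ and $\pi(n)=B$. $F_{\rm GUE}$ is the GUE Tracy–Widom distribution function. *)

(* Defs.v *)
From HB Require Import structures.
From mathcomp Require Import all_boot all_order all_algebra.
From mathcomp Require Import all_classical all_reals all_analysis.
From mathcomp Require Import exponential_distribution.
Set Implicit Arguments. Unset Strict Implicit. Unset Printing Implicit Defensive.
Import Order.TTheory GRing.Theory Num.Def Num.Theory.
Import numFieldTopology.Exports.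
Local Open Scope classical_set_scope.
Local Open Scope ring_scope.

Section Defs.
Context {R : realType}.
Local Notation mu := (@lebesgue_measure R).

Definition Airy (x : R) : R :=
  pi^-1 * lim ((Rintegral mu `[0, T]%classic (fun s => cos (s ^+ 3 / 3 + x * s)))
                  @[T --> +oo]).

Definition airy_kernel (x y : R) : R :=
  Rintegral mu `[0, +oo[%classic (fun z => Airy (x + z) * Airy (y + z)).

Fixpoint iter_int (s : R) (n : nat) (F : seq R -> R) : R :=
  match n with
  | 0 => F [::]
  | n'.+1 => Rintegral mu `]s, +oo[%classic
               (fun x => iter_int s n' (fun xs => F (x :: xs)))
  end.

Definition airy_det (n : nat) (xs : seq R) : R :=
  \det (\matrix_(i < n, j < n) airy_kernel (nth 0 xs i) (nth 0 xs j)).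

(** GUE Tracy-Widom distribution, as the Fredholm determinant
    det(I - K_Ai)_{L^2(s,+oo)} = \sum_n (-1)^n/n! \int_{(s,oo)^n} det[K_Ai(x_i,x_j)] dx *)
Definition F_GUE (s : R) : R :=
  \big[+%R/0%R]_(0 <= n <oo) ((-1) ^+ n / n`!%:R * iter_int s n (airy_det n)).

Definition up_right (p : seq (int * int)) : Prop :=
  p <> [::] /\
  forall i : nat, (i.+1 < size p)%N ->
    let a := nth (0, 0) p i in let b := nth (0, 0) p i.+1 in
    b = (a.1 + 1, a.2) \/ b = (a.1, a.2 + 1).

Definition LPP (w : int * int -> R) (SA : set (int * int)) (B : int * int) : R :=
  sup [set v | exists p : seq (int * int),
        [/\ up_right p, SA (head (0, 0) p), last (0, 0) p = B &
            v = \sum_(q <- p | q \notin SA) w q]].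

Definition mutually_independent d (T : measurableType d) (P : probability T R)
  (I : eqType) (X : I -> T -> R) : Prop :=
  forall (J : seq I) (B : I -> set R), uniq J ->
    (forall j, measurable (B j)) ->
    P (\bigcap_(j in [set j | j \in J]) (X j @^-1` B j)) =
    (\prod_(j <- J) P (X j @^-1` B j))%E.

End Defs.

(* Main.v *)
(* The time to P_k is the maximum of the passage times from (-bt, 0) and from (0, -bt).
   Let Q be the point at distance of order delta t behind P_k on the characteristic from
   (-bt, 0). By strict concavity of the limit shape (sqrt a + sqrt b)^2 a maximal path from
   (-bt, 0) to Q does not reach the diagonal, so the times from the two starting points to
   their points Q use disjoint sets of weights and are independent. The time to each P_k is
   at least the time to Q plus the time from Q to P_k, whose fluctuations are of order
   (delta t)^(1/3); both sides have asymptotically Tracy-Widom laws, and ordered variables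
   with nearly equal laws are close in probability. So the event of the theorem is, for each
   starting point, nearly an event on the time to Q alone, where only the smallest threshold
   matters.
   For the one-point law, the distribution of geometric passage times is a determinant
   obtained column by column; in the exponential limit it becomes a Gram determinant, hence
   det(1 - K) for the Laguerre kernel K, and the asymptotics of a circle integral for the
   Laguerre functions turn K into the Airy kernel at the edge. *)
Require Import Defs.
From HB Require Import structures.
From mathcomp Require Import all_boot all_order all_algebra perm.
From mathcomp Require Import all_classical all_reals all_analysis.
From mathcomp Require Import exponential_distribution measurable_realfun.
From mathcomp Require Import ring lra zify.
Set Implicit Arguments. Unset Strict Implicit. Unset Printing Implicit Defensive.
Import Order.TTheory GRing.Theory Num.Def Num.Theory.
Import numFieldTopology.Exports.
Local Open Scope classical_set_scope.
Local Open Scope ring_scope.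

Local Notation mu := (@lebesgue_measure _).
Local Notation RInt D f := (Rintegral mu D%classic f).
Local Notation Rge0 := (`[0, +oo[%classic).
Local Ltac derivable_continuous :=
  move=> ?; apply/differentiable_continuous; apply/derivable1_diffP; apply: ex_derive.
Local Ltac derive_eq := apply: is_derive_eq; rewrite /GRing.scale /=.

(** [F_GUE] is given only as an alternating series of iterated integrals, which shows neither its
    sign nor its continuity nor its tails. These are transferred from the Laguerre determinants
    [det(1 - K)], which the trace of [K] controls. Both [K] and [1 - K] are Gram matrices, hence
    positive semidefinite, and Hadamard's inequality reduces every domination to the diagonal. The
    constant in front of the determinantal formula stays implicit: two levels are compared, and one
    of them is sent to infinity. In the circle integral for the Laguerre functions the action has a
    double critical point [rho], and [e] is the width on which its cubic term is of order one. The
    circle of radius [rho - e] becomes, in the variable [z = (rho - w) / e], the line [Re z = 1] of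
    the Airy integral. For the multi-point statement only lower bounds by concatenated paths are
    available. The matching upper estimate compares distribution functions instead of paths, and
    this is why continuity and both tails of [F_GUE] are required. The second starting point is the
    mirror image of the first in the diagonal. *)

Lemma cvgry_ge (R : realType) (r : nat -> R) (M : R) : r @ \oo --> +oo -> \forall j \near \oo, M <= r j.
Proof. by move/cvgryPge. Qed.

Lemma continuous_measurable_funS (R : realType) (D : set R) (f : R -> R) : continuous f -> measurable_fun D f.
Proof. by move=> cf; apply: measurable_funTS; exact: continuous_measurable_fun. Qed.

Lemma integrable_subset (R : realType) (A B : set R) (f : R -> \bar R) :
  measurable A -> measurable B -> B `<=` A -> mu.-integrable A f -> mu.-integrable B f.
Proof. exact: (@integrableS _ (measurableTypeR R) R mu). Qed.

(** * Geometric weights: a determinant for the last passage time *)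

Section GeometricColumnChain.
Variables (F : numFieldType) (q : F).

(** Inverse of the operator [f y - q * f y.-1] on functions with [f 0 = 0]. Up to the factor [1 - q]
    it averages [f] over [y] lowered by a geometric weight. *)
Definition qsum (f : nat -> F) (y : nat) : F := \sum_(z < y.+1) q ^+ (y - z) * f z.

Fixpoint free_step (V : seq nat -> F) (x : seq nat) : F := if x is l :: x' then qsum (fun z => free_step (fun s => V (z :: s)) x') l else V [::].

(** One column of the growth model in the strictly decreasing coordinates of [encode], up to a power
    of [1 - q]: the new coordinate is at most the old one [l] and strictly below the previous new
    one [b], and the geometric weight is counted down from the smaller of these bounds. *)
Fixpoint column_step (V : seq nat -> F) (b : nat) (x : seq nat) : F := if x is l :: x' then \sum_(z < minn b l.+1) q ^+ ((minn b l.+1).-1 - z)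
       * column_step (fun s => V (nat_of_ord z :: s)) z x'
  else V [::].

(** Entry [i] is capped at [z - i - 1], the largest value it can take in a strictly decreasing
    sequence that starts below [z]. *)
Fixpoint clamp (z : nat) (b : seq nat) : seq nat := if b is c :: b' then minn z.-1 c :: clamp z.-1 b' else [::].

Lemma qsum_recr f y : qsum f y.+1 = q * qsum f y + f y.+1.
Proof.
rewrite /qsum big_ord_recr/= subnn expr0 mul1r; congr (_ + _).
rewrite mulr_sumr; apply: eq_bigr => i _.
by rewrite (subSn (ltn_ord i : (i <= y)%N)) exprS mulrA.
Qed.

Lemma qsum0 f : qsum f 0 = f 0%N.
Proof. by rewrite /qsum big_ord1 subnn expr0 mul1r. Qed.

Lemma eq_qsum f g y : (forall z, (z <= y)%N -> f z = g z) -> qsum f y = qsum g y.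
Proof. by move=> fg; apply: eq_bigr => z _; rewrite fg // -ltnS. Qed.

Lemma qsumD f g y : qsum (fun z => f z + g z) y = qsum f y + qsum g y.
Proof. by rewrite /qsum -big_split; apply: eq_bigr => z _; rewrite mulrDr. Qed.

Lemma qsumN f y : qsum (fun z => - f z) y = - qsum f y.
Proof. by rewrite /qsum -sumrN; apply: eq_bigr => z _; rewrite mulrN. Qed.

Lemma qsumZ a f y : qsum (fun z => a * f z) y = a * qsum f y.
Proof. by rewrite /qsum mulr_sumr; apply: eq_bigr => z _; rewrite mulrCA. Qed.

Lemma qsumB f g y : qsum (fun z => f z - g z) y = qsum f y - qsum g y.
Proof. by rewrite qsumD qsumN. Qed.

Lemma qsum_eq0 f y : (forall z, (z <= y)%N -> f z = 0) -> qsum f y = 0.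
Proof. by move=> f0; apply: big1 => z _; rewrite f0 ?mulr0 // -ltnS. Qed.

Lemma qsum_pred f y : f 0%N = 0 -> qsum f y - qsum f y.-1 = qsum (fun z => f z - f z.-1) y.
Proof.
move=> f0; elim: y => [|y IH] /=; first by rewrite !qsum0 /= subrr.
rewrite !qsum_recr -IH /=.
case: y {IH} => [|y] /=; first by rewrite !qsum0 f0; ring.
by rewrite !qsum_recr; ring.
Qed.

Lemma exchange_qsum (f : nat -> nat -> F) x y : qsum (fun z => qsum (f z) y) x = qsum (fun w => qsum (f^~ w) x) y.
Proof.
rewrite /qsum; under eq_bigr do rewrite mulr_sumr.
rewrite exchange_big /=; apply: eq_bigr => w _; rewrite mulr_sumr.
by apply: eq_bigr => z _; rewrite mulrCA.
Qed.

Lemma eq_free V V' x : V =1 V' -> free_step V x = free_step V' x.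
Proof.
elim: x V V' => [|l x IH] V V' VV' //=.
by apply: eq_qsum => z _; apply: IH => s; apply: VV'.
Qed.

Lemma free_stepN V x : free_step (fun s => - V s) x = - free_step V x.
Proof.
elim: x V => [|l x IH] V //=.
by rewrite -qsumN; apply: eq_qsum => z _; rewrite -IH.
Qed.

Lemma free_stepD V V' x : free_step (fun s => V s + V' s) x = free_step V x + free_step V' x.
Proof.
elim: x V V' => [|l x IH] V V' //=.
by rewrite -qsumD; apply: eq_qsum => z _; rewrite -IH.
Qed.

Lemma free_stepZ a V x : free_step (fun s => a * V s) x = a * free_step V x.
Proof.
elim: x V => [|l x IH] V //=.
by rewrite -qsumZ; apply: eq_qsum => z _; rewrite -IH.
Qed.

Lemma free_stepB V V' x : free_step (fun s => V s - V' s) x = free_step V x - free_step V' x.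
Proof. by rewrite free_stepD free_stepN. Qed.

Variable N : nat.

Definition vanishing (V : seq nat -> F) := forall s, ~~ all (leq N.+1) s -> V s = 0.

(* For a determinant whose row i+1 is the summation of row i, replacing row i+1 by
   its difference makes rows i and i+1 the same function, whence antisymmetry. *)
Definition skew (V : seq nat -> F) := forall s1 z w s2, V (s1 ++ [:: z, w & s2]) - V (s1 ++ [:: z, w.-1 & s2]) =
  - (V (s1 ++ [:: w, z & s2]) - V (s1 ++ [:: w, z.-1 & s2])).

Lemma vanishing_cons V z : vanishing V -> vanishing (fun s => V (z :: s)).
Proof. by move=> h s hs; apply: h => /=; rewrite negb_and hs orbT. Qed.

Lemma skew_cons V z : skew V -> skew (fun s => V (z :: s)).
Proof. by move=> h s1 a b s2; apply: (h (z :: s1)). Qed.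

(** The coordinates evolve independently, so differences pass through the sums, the boundary terms
    being zero by [vanishing]; exchanging the two sums over adjacent coordinates then preserves the
    antisymmetry. *)
Lemma free_skew V : vanishing V -> skew V -> skew (free_step V).
Proof.
move=> vV sV s1; elim: s1 V vV sV => [|l s1 IH] V vV sV z w s2; last first.
  rewrite /= -!qsumB -qsumN; apply: eq_qsum => x _.
  by apply: (IH (fun s => V (x :: s))); [apply: vanishing_cons|apply: skew_cons].
pose G a b := free_step (fun s => V [:: a, b & s]) s2.
have G0 a : G a 0%N = 0.
  have h t : V [:: a, 0%N & t] = 0 by apply: vV => /=; rewrite andbF.
  rewrite /G (eq_free _ h); elim: (s2) => //= c s IHs; exact: qsum_eq0.
have E a b : free_step V [:: a, b & s2] - free_step V [:: a, b.-1 & s2] = qsum (fun a' => qsum (fun b' => G a' b' - G a' b'.-1) b) a.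
  rewrite /= -qsumB; apply: eq_qsum => a' _.
  by rewrite (@qsum_pred (G a')).
rewrite !E exchange_qsum -qsumN; apply: eq_qsum => a _.
rewrite -qsumN; apply: eq_qsum => b _.
rewrite /G -!free_stepB -free_stepN; apply: eq_free => s.
by have := sV [::] b a s.
Qed.

(** At equal arguments the antisymmetric difference is its own opposite, hence zero in
    characteristic zero. *)
Lemma skew_adj V s1 a s2 : skew V -> V (s1 ++ [:: a, a & s2]) = V (s1 ++ [:: a, a.-1 & s2]).
Proof.
move=> sV; apply/eqP; rewrite -subr_eq0; have /eqP := sV s1 a a s2.
by rewrite -addr_eq0 -mulr2n mulrn_eq0 /=.
Qed.

Lemma clamp_rcons z b c : clamp z (rcons b c) = rcons (clamp z b) (minn (z - (size b).+1) c).
Proof.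
elim: b z => [|d b IH] z /=; first by rewrite subn1.
by rewrite IH; congr (_ :: rcons _ (minn _ _)); rewrite -subn1 -subnDA add1n.
Qed.

Lemma size_clamp z b : size (clamp z b) = size b.
Proof. by elim: b z => //= c b IH z; rewrite IH. Qed.

Lemma nth_clamp z b i : (i < size b)%N -> nth 0%N (clamp z b) i = minn (z - i.+1) (nth 0%N b i).
Proof.
elim: b z i => //= c b IH z [|i] ib; first by rewrite subn1.
by rewrite /= IH // -subn1 -subnDA add1n.
Qed.

Definition desc z r := [seq z - i | i <- iota 1 r]%N.

Lemma path_gtn_rcons (B c : nat) b : path gtn B (rcons b c) -> (c + size b < B)%N /\ forall i, (i < size b)%N -> (c + (size b - i) <= nth 0%N b i)%N.
Proof.
elim: b B => [|a b IH] B /=; first by rewrite andbT addn0.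
move=> /andP[aB /IH[h1 h2]]; split; first by move: aB => /=; lia.
by case=> [|i] /= ib; [lia|apply: h2].
Qed.

Lemma qsum_tail f k y : (k <= y)%N -> (forall z, (k < z)%N -> f z = 0) -> qsum f y = q ^+ (y - k) * qsum f k.
Proof.
elim: y => [|y IH] ky f0; first by move: ky; rewrite leqn0 => /eqP ->; rewrite mul1r.
move: ky; rewrite leq_eqVlt => /orP[/eqP <-|ky]; first by rewrite subnn mul1r.
by rewrite qsum_recr IH // f0 // addr0 subSn // exprS mulrA.
Qed.

(* The interaction of the first coordinate with all the others is removed one
   coordinate at a time, starting from the last one. *)
Lemma unclamp r (V : nat -> seq nat -> F) (B : nat) (b : seq nat) : size b = r -> (r <= N)%N -> (forall z s, (z <= N)%N -> V z s = 0) ->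
  (forall c s, size s = r.-1 -> qsum (fun z => V z (c :: s) - V z (c.-1 :: s)) c = 0) ->
  (forall z s1 a s2, V z (s1 ++ [:: a, a & s2]) = V z (s1 ++ [:: a, a.-1 & s2])) ->
  path gtn B.+1 b ->
  qsum (fun z => V z (clamp z b)) B = qsum (fun z => V z b) B.
Proof.
elim: r V B b => [|r IH] V B b sb rN V0 V1 V2 pB; first by rewrite (size0nil sb).
case/lastP: b sb pB => // b c; rewrite size_rcons => -[sb] pB.
have [cB bc] := path_gtn_rcons pB.
transitivity (qsum (fun z => V z (rcons (clamp z b) c)) B); last first.
  case: r IH sb rN V1 => [|r] IH sb rN V1; first by rewrite (size0nil sb).
  apply: (IH (fun z s => V z (rcons s c))) => //; first exact: ltnW.
  - by move=> z s zN; apply: V0.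
  - by move=> d s sr; rewrite -(V1 d (rcons s c)) // size_rcons sr.
  - by move=> z s1 a s2; rewrite !rcons_cat /= V2.
  - by move: pB; rewrite rcons_path => /andP[].
apply/eqP; rewrite -subr_eq0 -qsumB; apply/eqP.
(* The cap on the last coordinate is active only for [z <= c + r], and there the other clamped
   entries are [z - 1, ..., z - r]. So it remains to show that the sum of [D c] up to [c + r]
   vanishes, which goes by induction on [c]. *)
pose D c z := V z (rcons (desc z r) (z - r.+1)%N) - V z (rcons (desc z r) c).
have HD : forall c, qsum (D c) (c + r) = 0.
  elim=> [|{}c {bc cB pB} HD]; first by apply: qsum_eq0 => z zr; rewrite /D !V0 ?subrr //; lia.
  pose W z s := V z (rcons s c.+1) - V z (rcons s c).
  have WE z s : W z s = V z (rcons s c.+1) - V z (rcons s c) by [].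
  have DW z : D c.+1 z = D c z - W z (desc z r) by rewrite /D /W; ring.
  rewrite (@eq_qsum _ (fun z => D c z - W z (desc z r))); last by move=> *; rewrite DW.
  rewrite qsumB addSn qsum_recr HD mulr0 add0r.
  have -> : D c (c + r).+1 = 0 by rewrite /D (_ : _ - _ = c)%N ?subrr //; lia.
  rewrite sub0r; apply/eqP; rewrite oppr_eq0; apply/eqP.
  clearbody W; clear sb HD DW D; case: r IH rN V1 => [|r] IH rN V1.
    by rewrite addn0 -(V1 c.+1 [::]) //; apply: eq_qsum => z _; rewrite WE.
  have sd z : size (desc z r.+1) = r.+1 by rewrite size_map size_iota.
  have nd z i : (i < r.+1)%N -> nth 0%N (desc z r.+1) i = (z - i.+1)%N by move=> ir; rewrite (nth_map 0%N) ?size_iota // nth_iota.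
  (* Written as a clamp of [b'], the descending run is accessible to the induction hypothesis on
     [r], applied to the difference [W]. The unclamped list ends with [c.+1], where [V2] makes [W]
     vanish. *)
  pose b' := desc (c + r.+1).+1 r.+1.
  have <- : qsum (fun z => W z (clamp z b')) (c + r.+1).+1 = qsum (fun z => W z (desc z r.+1)) (c + r.+1).+1.
    apply: eq_qsum => z zc; congr (W _ _); apply: (@eq_from_nth _ 0%N).
      by rewrite size_clamp !sd.
    by rewrite size_clamp sd => i ir; rewrite nth_clamp ?sd // !nd //; lia.
  rewrite IH ?sd //; last 5 first.
  - exact: ltnW.
  - by move=> z s zN; rewrite WE !V0 // subrr.
  - move=> d s sr.
    have h e : size (rcons s e) = r.+1 by rewrite size_rcons sr.
    rewrite -[RHS]subr0 -{1}(V1 d (rcons s c.+1)) // -(V1 d (rcons s c)) // -qsumB.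
    by apply: eq_qsum => z _; rewrite !WE /=; ring.
  - by move=> z s1 a s2; rewrite !WE !rcons_cat /= !V2.
  - rewrite -[path _ _ _]/(sorted gtn ((c + r.+1).+2 :: b')).
    apply/(sortedP 0%N) => i; rewrite -[size _]/(size b').+1 (sd _ : size b' = r.+1) ltnS => ir.
    have nS k : nth 0%N ((c + r.+1).+2 :: b') k.+1 = nth 0%N b' k by [].
    rewrite nS; case: i ir => [|i] ir; rewrite ?nS !nd //=; lia.
  apply: qsum_eq0 => z _; rewrite WE.
  have -> : b' = rcons (take r b') c.+1.
    rewrite -[LHS](cat_take_drop r) -cats1; congr (_ ++ _).
    rewrite (drop_nth 0%N) ?sd // drop_oversize ?sd // nd //; congr [:: _]; lia.
  by rewrite -!cats1 -!catA /= V2 /= subrr.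
rewrite (@qsum_tail _ (c + r)); last 2 first.
- by lia.
- move=> z cz; rewrite clamp_rcons sb (_ : minn _ _ = c) ?subrr //; lia.
apply/eqP; rewrite mulf_eq0; apply/orP; right; apply/eqP; rewrite -[RHS](HD c).
apply: eq_qsum => z zc; rewrite /D clamp_rcons sb.
have -> : clamp z b = desc z r.
  apply: (@eq_from_nth _ 0%N); rewrite size_clamp ?size_map ?size_iota // sb => i ir.
  rewrite nth_clamp ?sb // (nth_map 0%N) ?size_iota // nth_iota //.
  by have := bc i; rewrite sb => /(_ ir); lia.
by have -> : minn (z - r.+1) c = (z - r.+1)%N by lia.
Qed.

Lemma column_step_vanish V b x : (forall s, V s = 0) -> column_step V b x = 0.
Proof.
elim: x V b => [|l x IH] V b V0 //=.
by apply: big1 => z _; rewrite IH ?mulr0.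
Qed.

Lemma free_step_vanish V x : (forall s, V s = 0) -> free_step V x = 0.
Proof.
elim: x V => [|l x IH] V V0 //=.
by apply: qsum_eq0 => z _; rewrite IH.
Qed.

Lemma path_clamp z y x : path gtn y x -> (size x <= z)%N -> path gtn (minn z y) (clamp z x).
Proof.
elim: x z y => [|a x IH] z y //= /andP[ay pa] xz.
apply/andP; split; first by move: ay => /=; lia.
by apply: IH => //; lia.
Qed.

Lemma clamp_clamp z b x : (z <= b)%N -> clamp z (clamp b x) = clamp z x.
Proof.
elim: x z b => [|a x IH] z b zb //=.
by rewrite IH; [congr (_ :: _); lia|lia].
Qed.

(** Once the first coordinate has moved to [z], the later ones are clamped by [z] under the sum over
    [z]. [unclamp] releases them, since skewness cancels the contribution of collisions; only the
    clamp by the initial bound [b] remains. *)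
Lemma column_clamp V b x : (size x <= N)%N -> vanishing V -> skew V -> sorted gtn x -> (0 < b)%N -> column_step V b x = free_step V (clamp b x).
Proof.
elim: x V b => [|l x IH] V b //= xN vV sV px b0.
have -> : minn b l.+1 = (minn b.-1 l).+1 by lia.
set c := minn b.-1 l.
rewrite -/(qsum (fun z => column_step (fun s => V (z :: s)) z x) c).
have V0 z s : (z <= N)%N -> V (z :: s) = 0 by move=> zN; apply: vV => /=; rewrite negb_and -ltnNge ltnS zN.
have [cN|cN] := leqP c N.
  rewrite !qsum_eq0 // => z zc.
    by rewrite free_step_vanish // => s; apply: V0; apply: leq_trans zc cN.
  by rewrite column_step_vanish // => s; apply: V0; apply: leq_trans zc cN.
pose W z s := free_step (fun t => V (z :: t)) s.
transitivity (qsum (fun z => W z (clamp z (clamp b.-1 x))) c).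
  apply: eq_qsum => z zc; rewrite /W clamp_clamp; last by rewrite /c in zc; lia.
  have [zN|zN] := leqP z N.
    by rewrite column_step_vanish ?free_step_vanish // => s; apply: V0.
  apply: IH; rewrite ?(path_sorted px) //; first exact: ltnW.
  - exact: vanishing_cons.
  - exact: skew_cons.
  - by lia.
rewrite (@unclamp (size x)) //.
- exact: size_clamp.
- exact: ltnW.
- by move=> z s zN; rewrite /W free_step_vanish // => t; apply: V0.
- move=> d s sx; rewrite /W qsumB.
  rewrite -[X in X - _]/(free_step V [:: d, d & s]) -[X in _ - X]/(free_step V [:: d, d.-1 & s]).
  by rewrite (@skew_adj _ [::] d s (free_skew vV sV)) subrr.
- move=> z s1 a s2; rewrite /W; apply: skew_adj; apply: free_skew.
    exact: vanishing_cons.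
  exact: skew_cons.
- have : path gtn (minn b.-1 l) (clamp b.-1 x) by apply: path_clamp => //; rewrite /c in cN; lia.
  by case: (clamp b.-1 x) => //= a t /andP[ac ->]; rewrite andbT; move: ac => /=; rewrite /c; lia.
Qed.

(** On strictly decreasing input below [b] the remaining clamp is the identity: the interaction of
    the coordinates disappears against skew functions. *)
Lemma column_free V b x : (size x <= N)%N -> vanishing V -> skew V -> path gtn b x -> column_step V b x = free_step V x.
Proof.
move=> xN vV sV px; have [b0|b0] := posnP b.
  by case: x px {xN} => // a x /=; rewrite b0 ltn0.
rewrite column_clamp //; last exact: path_sorted px.
congr (free_step V _).
elim: x b px {xN b0} => [|a x IH] b //= /andP[ab pa].
have {1}-> : minn b.-1 a = a by move: ab => /=; lia.
congr (_ :: _); apply: IH; case: x pa => //= d x /andP[da ->]; rewrite andbT.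
by move: ab da => /=; lia.
Qed.

Lemma eq_column V V' b x : (forall s, size s = size x -> path gtn b s -> V s = V' s) -> column_step V b x = column_step V' b x.
Proof.
elim: x V V' b => [|l x IH] V V' b VV' /=; first exact: VV'.
apply: eq_bigr => z _; congr (_ * _); apply: IH => s sx ps; apply: VV' => /=.
  by rewrite sx.
by rewrite ps andbT; case: z {ps} => z /=; lia.
Qed.

Lemma eq_free_size V V' x : (forall s, size s = size x -> V s = V' s) -> free_step V x = free_step V' x.
Proof.
elim: x V V' => [|l x IH] V V' VV' /=; first exact: VV'.
by apply: eq_qsum => z _; apply: IH => s sx; apply: VV'; rewrite /= sx.
Qed.

Lemma free_step_sum (I : Type) (r : seq I) (P : pred I) (V : I -> seq nat -> F) x :
  free_step (fun s => \sum_(i <- r | P i) V i s) x = \sum_(i <- r | P i) free_step (V i) x.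
Proof.
elim: r => [|a r IH].
  by rewrite big_nil; apply: free_step_vanish => s; rewrite big_nil.
rewrite big_cons -IH; case: ifP => Pa.
  by rewrite -free_stepD; apply: eq_free => s; rewrite big_cons Pa.
by apply: eq_free => s; rewrite big_cons Pa.
Qed.

Lemma free_step_prod n (g : nat -> nat -> F) x : size x = n -> free_step (fun s => \prod_(i < n) g i (nth 0%N s i)) x =
  \prod_(i < n) qsum (g i) (nth 0%N x i).
Proof.
elim: x n g => [|l x IH] [|n] g //=; first by rewrite !big_ord0.
move=> [xn]; rewrite big_ord_recl /= mulrC -qsumZ; apply: eq_qsum => z _.
rewrite -(IH n (fun i => g i.+1)) // mulrC -free_stepZ; apply: eq_free => s.
by rewrite big_ord_recl.
Qed.

Section ShiftDeterminant.
Variable n : nat.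
Implicit Type h : nat -> 'I_n -> nat -> F.

(** The value 0 on lists of the wrong length makes [vanishing] and [skew] hold for all lists. *)
Definition shift_det h (s : seq nat) : F := if size s == n then \det (\matrix_(i < n, j < n) h i j (nth 0%N s i)) else 0.

Lemma shift_det_vanishing h : (forall i j y, (y <= N)%N -> h i j y = 0) -> vanishing (shift_det h).
Proof.
move=> h0 s; rewrite /shift_det; case: eqP => // sn.
rewrite -has_predC => /(has_nthP 0%N)[i]; rewrite sn => ilt /=; rewrite -leqNgt => si.
rewrite /determinant big1 // => sg _; rewrite (bigD1 (Ordinal ilt)) //= mxE /=.
by rewrite h0 // mul0r mulr0.
Qed.

Lemma shift_det_skew h : (forall i j y, h i.+1 j y - h i.+1 j y.-1 = h i j y) -> skew (shift_det h).
Proof.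
move=> hS s1 z w s2.
rewrite /shift_det !size_cat /=; case: eqP => [sn|_]; last by rewrite !subrr oppr0.
have i0P : (size s1 < n)%N by lia.
have i1P : ((size s1).+1 < n)%N by lia.
pose i0 := Ordinal i0P; pose i1 := Ordinal i1P.
pose M (a b : nat) : 'M[F]_n := \matrix_(i, j) h i j (nth 0%N (s1 ++ [:: a, b & s2]) i).
pose D (a b : nat) : 'M[F]_n := \matrix_(i, j) if i == i1 then h (size s1) j b else h i j (nth 0%N (s1 ++ [:: a, b & s2]) i).
have nth0 a b : nth 0%N (s1 ++ [:: a, b & s2]) (size s1) = a by rewrite nth_cat ltnn subnn.
have nth1 a b : nth 0%N (s1 ++ [:: a, b & s2]) (size s1).+1 = b by rewrite nth_cat ltnNge leqnSn /= subSnn.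
have nthi a b a' b' (i : 'I_n) : i != i0 -> i != i1 -> nth 0%N (s1 ++ [:: a, b & s2]) i = nth 0%N (s1 ++ [:: a', b' & s2]) i.
  rewrite -!val_eqE /= => ii0 ii1; rewrite !nth_cat; case: ltnP => // si.
  by have -> : (i - size s1 = (i - size s1).-2.+2)%N by lia.
have E a b : \det (M a b) - \det (M a b.-1) = \det (D a b).
  rewrite (@determinant_multilinear _ _ (M a b) (M a b.-1) (D a b) i1 1 1).
  - ring.
  - by apply/rowP => j; rewrite !mxE /= eqxx !nth1 !mul1r -(hS (size s1) j b) addrC subrK.
  - apply/matrixP => i j; rewrite !mxE; congr (h _ _ _).
    have [->|nei] := eqVneq (lift i1 i) i0; first by rewrite /= !nth0.
    by apply: nthi => //; rewrite eq_sym neq_lift.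
  - apply/matrixP => i j; rewrite !mxE [lift _ _ == _]eq_sym (negbTE (neq_lift _ _)) //.
have X : D w z = xrow i0 i1 (D z w).
  apply/matrixP => i j; rewrite !mxE.
  have i01 : (i1 == i0) = false by rewrite -val_eqE /=; lia.
  case: tpermP => [->|->|/eqP ii0 /eqP ii1].
  - by rewrite eqxx eq_sym i01 /= nth0.
  - by rewrite eqxx eq_sym i01 /= nth0.
  - by rewrite (negbTE ii1) (nthi w z z w).
rewrite -!/(M _ _) !E X xrowE det_mulmx det_perm odd_tperm.
have -> : i0 != i1 by rewrite -val_eqE /=; lia.
by rewrite expr1; ring.
Qed.

(** Each term of the Leibniz expansion is a product of functions of single coordinates, and the free
    step acts on such a product factor by factor. *)
Lemma free_step_shift_det h s : size s = n -> free_step (shift_det h) s = shift_det (fun i j => qsum (h i j)) s.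
Proof.
move=> sn; rewrite {2}/shift_det sn eqxx.
pose G (sg : {perm 'I_n}) (k : nat) : nat -> F := if insub k is Some i then h k (perm.fun_of_perm sg i) else fun=> 0.
have GE sg (i : 'I_n) y : G sg i y = h i (perm.fun_of_perm sg i) y by rewrite /G valK.
rewrite (@eq_free_size _ (fun s => \sum_(sg : {perm 'I_n}) (-1) ^+ sg * \prod_(i < n) G sg i (nth 0%N s i))); last first.
  move=> t; rewrite sn => tn; rewrite /shift_det tn eqxx; apply: eq_bigr => sg _.
  by congr (_ * _); apply: eq_bigr => i _; rewrite mxE GE.
rewrite free_step_sum; apply: eq_bigr => sg _; rewrite free_stepZ (@free_step_prod n (G sg)) //.
congr (_ * _); apply: eq_bigr => i _; rewrite mxE.
by apply: eq_qsum => z _; rewrite GE.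
Qed.

Fixpoint columns (m : nat) (V : seq nat -> F) (x : seq nat) : F := if m is m'.+1 then column_step (columns m' V) (head 0%N x).+1 x else V x.

Definition shift_family h := (forall i j y, (y <= N)%N -> h i j y = 0) /\ (forall i j y, h i.+1 j y - h i.+1 j y.-1 = h i j y).

Lemma shift_family_qsum h : shift_family h -> shift_family (fun i j => qsum (h i j)).
Proof.
move=> [h0 hS]; split=> i j y; last first.
  by rewrite qsum_pred ?h0 //; apply: eq_qsum => z _; rewrite hS.
by move=> yN; apply: qsum_eq0 => z zy; apply: h0; apply: leq_trans zy yN.
Qed.

Lemma shift_family_iter m h : shift_family h -> shift_family (fun i j => iter m qsum (h i j)).
Proof. by move=> hh; elim: m => //= m /shift_family_qsum. Qed.

(** Summation preserves the shift relations, so the result of one column is again an admissible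
    input for the next. *)
Lemma columns_shift_det m h x : (n <= N)%N -> shift_family h -> size x = n -> sorted gtn x ->
  columns m (shift_det h) x = shift_det (fun i j => iter m qsum (h i j)) x.
Proof.
move=> nN hh; elim: m x => [|m IH] x xn sx //=.
rewrite (@eq_column _ (shift_det (fun i j => iter m qsum (h i j)))); last first.
  by move=> s; rewrite xn => sn /path_sorted ss; apply: IH.
have [h0 hS] := shift_family_iter m hh.
rewrite column_free ?xn //.
- by rewrite free_step_shift_det.
- exact: shift_det_vanishing.
- exact: shift_det_skew.
- by case: x sx {xn} => //= a x ->; rewrite andbT.
Qed.

End ShiftDeterminant.
End GeometricColumnChain.

(** * Expectations over truncated geometric weights *)

Section GeometricExpectation.
Variables (F : numFieldType) (q : F) (B : nat).

(** The truncation at [B] makes this a finite sum; it is the exact expectation for a function that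
    vanishes as soon as some weight reaches [B]. *)
Fixpoint gexp (k : nat) (f : seq nat -> F) : F := if k is k'.+1 then \sum_(w < B) (1 - q) * q ^+ w * gexp k' (fun s => f (nat_of_ord w :: s))
  else f [::].

Lemma eq_gexp k f g : (forall s, size s = k -> f s = g s) -> gexp k f = gexp k g.
Proof.
elim: k f g => [|k IH] f g fg /=; first exact: fg.
by apply: eq_bigr => w _; congr (_ * _); apply: IH => s sk; apply: fg; rewrite /= sk.
Qed.

Lemma gexp_cat k l f : gexp (k + l) f = gexp k (fun s => gexp l (fun t => f (s ++ t))).
Proof.
elim: k f => [|k IH] f //=.
by apply: eq_bigr => w _; rewrite IH.
Qed.

Lemma gexpZ a k f : gexp k (fun s => a * f s) = a * gexp k f.
Proof.
elim: k f => [|k IH] f //=.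
by rewrite mulr_sumr; apply: eq_bigr => w _; rewrite IH mulrCA.
Qed.

Lemma gexp_vanish k f : (forall s, f s = 0) -> gexp k f = 0.
Proof.
elim: k f => [|k IH] f f0 //=.
by apply: big1 => w _; rewrite IH ?mulr0.
Qed.

Lemma gexpM k l f g : gexp (k + l) (fun s => f (take k s) * g (drop k s)) = gexp k f * gexp l g.
Proof.
rewrite gexp_cat mulrC -gexpZ; apply: eq_gexp => s sk; rewrite mulrC -gexpZ.
by apply: eq_gexp => t tl; rewrite take_size_cat ?drop_size_cat.
Qed.
End GeometricExpectation.

(** * Column heights of the growth model *)

Section Heights.

(** The last passage recursion along one column: [x] holds the times of the previous column and [y]
    the time of the preceding cell in the current one. *)
Fixpoint col_heights (y : nat) (x w : seq nat) : seq nat := match x, w with | a :: x', b :: w' => (maxn y a + b)%N :: col_heights (maxn y a + b) x' w'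
  | _, _ => [::]
  end.

Fixpoint lpp_cols (m n : nat) (x w : seq nat) : seq nat := if m is m'.+1 then lpp_cols m' n (col_heights 0 x (take n w)) (drop n w) else x.

(** Subtracting weakly increasing times from [c, c - 1, ...] produces strictly decreasing
    coordinates. A time that is too large is sent to 0 by the truncated subtraction, and there
    [vanishing] functions are zero. *)
Fixpoint encode (c : nat) (x : seq nat) : seq nat := if x is a :: x' then (c - a)%N :: encode c.-1 x' else [::].

Lemma size_col_heights y x w : size w = size x -> size (col_heights y x w) = size x.
Proof. by elim: x y w => [|a x IH] y [|b w] //= [wx]; rewrite IH. Qed.

Lemma path_col_heights y x w : path leq y (col_heights y x w).
Proof.
elim: x y w => [|a x IH] y [|b w] //=.
by rewrite IH andbT; lia.
Qed.

Lemma size_encode c x : size (encode c x) = size x.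
Proof. by elim: x c => //= a x IH c; rewrite IH. Qed.

Lemma nth_encode c x i : (i < size x)%N -> nth 0%N (encode c x) i = (c - i - nth 0%N x i)%N.
Proof.
elim: x c i => //= a x IH c [|i] ix /=; first by rewrite subn0.
by rewrite IH //; lia.
Qed.

Variables (F : numFieldType) (q : F) (N : nat).

Lemma column_step_vanishing V b : vanishing N V -> vanishing N (column_step q V b).
Proof.
move=> vV s; elim: s V vV b => [|l s IH] V vV b /=; first by [].
rewrite negb_and => /orP[lN|hs].
  apply: big1 => z _; rewrite column_step_vanish ?mulr0 // => t.
  apply: vV => /=; rewrite negb_and; apply/orP; left.
  by case: z => z /=; move: lN; lia.
by apply: big1 => z _; rewrite IH ?mulr0 //; apply: vanishing_cons.
Qed.

Lemma columns_vanishing V m : vanishing N V -> vanishing N (columns q m V).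
Proof.
move=> vV; elim: m => //= m IH s hs.
exact: (column_step_vanishing _ IH).
Qed.

(** A weight [w] lowers the encoded coordinate from [m] to [z = m - w], which turns the expectation
    into the sum defining [column_step]. Weights beyond [m] contribute nothing because the
    coordinate is then 0; [c < B] places all others below the truncation. *)
Lemma gexp_column B V c y x : vanishing N V -> (c < B)%N -> gexp q B (size x) (fun w => V (encode c (col_heights y x w))) =
  (1 - q) ^+ size x * column_step q V (c.+1 - y) (encode c x).
Proof.
elim: x V c y => [|a x IH] V c y vV cB /=; first by rewrite mul1r.
pose P z := column_step q (fun s => V (z :: s)) z (encode c.-1 x).
have P0 : P 0%N = 0 by rewrite /P column_step_vanish // => s; apply: vV.
set m := (c - maxn y a)%N.
transitivity (\sum_(w < B) (1 - q) * q ^+ w * ((1 - q) ^+ size x * P (m - w)%N)).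
  apply: eq_bigr => w _; congr (_ * _).
  have E : (c - (maxn y a + w) = m - w)%N by rewrite subnDA.
  rewrite E; have [z0|z0] := posnP (m - w)%N.
    by rewrite z0 P0 mulr0 gexp_vanish // => s; apply: vV.
  rewrite (IH (fun s => V ((m - w)%N :: s))) //; last 2 first.
  - exact: vanishing_cons.
  - by apply: leq_ltn_trans cB; apply: leq_pred.
  by rewrite /P; congr (_ * column_step q _ _ _); lia.
have -> : \sum_(w < B) (1 - q) * q ^+ w * ((1 - q) ^+ size x * P (m - w)%N) = (1 - q) ^+ (size x).+1 * \sum_(w < m.+1) q ^+ w * P (m - w)%N.
  rewrite mulr_sumr (big_ord_widen B (fun w => (1 - q) ^+ (size x).+1 * (q ^+ w * P (m - w)%N))); last first.
    by rewrite /m; lia.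
  rewrite [RHS]big_mkcond; apply: eq_bigr => w _; case: ifP => wm.
    by rewrite exprS; ring.
  by rewrite (_ : m - w = 0)%N ?P0 ?mulr0 //; lia.
congr (_ * _).
have [ac|ca] := leqP (maxn y a) c.
  have -> : (minn (c.+1 - y) (c - a).+1 = m.+1)%N by rewrite /m; lia.
  rewrite (reindex_inj rev_ord_inj) /=; apply: eq_bigr => z _.
  rewrite subSS; have zm : (z <= m)%N by rewrite -ltnS.
  by rewrite subKn.
have m0 : m = 0%N by rewrite /m; lia.
rewrite m0 big_ord1 P0 mulr0.
have : (minn (c.+1 - y) (c - a).+1 <= 1)%N by lia.
case: (minn _ _) => [|[|]] // _; first by rewrite big_ord0.
by rewrite big_ord1 /= -/(P 0%N) P0 mulr0.
Qed.

Lemma gexp_columns B V c n m x : vanishing N V -> (c < B)%N -> size x = n -> gexp q B (m * n) (fun w => V (encode c (lpp_cols m n x w))) =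
  (1 - q) ^+ (m * n) * columns q m V (encode c x).
Proof.
move=> vV cB; elim: m x => [|m IH] x xn /=; first by rewrite mul0n mul1r.
rewrite mulSn gexp_cat.
rewrite (@eq_gexp _ _ _ _ _ (fun s => (1 - q) ^+ (m * n) * columns q m V (encode c (col_heights 0 x s)))); last first.
  move=> s sn; rewrite -IH; last by rewrite size_col_heights ?xn.
  by apply: eq_gexp => t _; rewrite take_size_cat ?drop_size_cat.
rewrite gexpZ -xn gexp_column //; last exact: columns_vanishing.
rewrite exprD mulrCA mulrA; congr (_ * _).
rewrite subn0; case: x xn => //= a x _.
by have -> : (minn c.+1 (c - a).+1 = minn (c - a).+1 (c - a).+1)%N by lia.
Qed.

End Heights.

Lemma lpp_cols_sorted m n x w : sorted leq x -> sorted leq (lpp_cols m n x w).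
Proof.
elim: m x w => //= m IH x w _; apply: IH.
by have := path_col_heights 0 x (take n w); apply: path_sorted.
Qed.

Lemma size_lpp_cols m n x w : size x = n -> size w = (m * n)%N -> size (lpp_cols m n x w) = n.
Proof.
elim: m x w => //= m IH x w xn; rewrite mulSn => wn; apply: IH.
  by rewrite size_col_heights ?xn // size_take wn; case: ltnP => //; lia.
by rewrite size_drop wn; lia.
Qed.

Section GeometricLPP.
Variables (F : numFieldType) (q : F) (n : nat).

(** The [i]-fold partial sums of the indicator of [y >= n + 1 + j]. With this choice the determinant
    is constant on admissible configurations and zero on the others, so that it encodes the event to
    be computed. *)
Definition binom_family (i : nat) (j : 'I_n) (y : nat) : F := if (n.+1 + j <= y)%N then 'C(y - (n.+1 + j) + i, i)%:R else 0.

Lemma binom_family_shift : shift_family n binom_family.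
Proof.
split=> i j y; rewrite /binom_family; first by case: ifP => //; lia.
case: (ltngtP (n.+1 + j) y) => h.
- rewrite (_ : n.+1 + j <= y.-1)%N; last by lia.
  have -> : (y - (n.+1 + j) + i.+1 = (y.-1 - (n.+1 + j) + i.+1).+1)%N by lia.
  rewrite binS natrD addrC addKr; congr ('C(_, _)%:R); lia.
- by rewrite ifF ?subrr //; lia.
- by rewrite ifF -?h ?subnn ?add0n ?binn ?subr0 //; lia.
Qed.

Lemma sorted_gtn_nth s i : sorted gtn s -> (forall k, k \in s -> (n < k)%N) -> (i < size s)%N -> (n + (size s - i) <= nth 0%N s i)%N.
Proof.
elim: s i => // a s IH [|i] /= ps sn; last first.
  move=> si; apply: IH => //; first exact: path_sorted ps.
  by move=> k ks; apply: sn; rewrite inE ks orbT.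
move=> _; case: s IH ps sn => [|b s] IH ps sn.
  by have := sn a; rewrite inE eqxx => /(_ isT) /=; lia.
have := IH 0%N; rewrite /= ltnS => /(_ _ _ isT); move: ps => /= /andP[ba ->].
move=> /(_ isT) h; have := h _; move: ba => /= ba; rewrite subn0 => {}h.
have : (n + (size s).+1 <= b)%N by rewrite -[X in (n + X)%N]subn0; apply: h => k ks; apply: sn; rewrite inE ks orbT.
by lia.
Qed.

Definition binom_det : F := \det (\matrix_(a < n, j < n) 'C(n.-1 - j, a)%:R).

(* Vandermonde's convolution factors the matrix through a unitriangular one. *)
Lemma shift_det_binom s : size s = n -> sorted gtn s -> shift_det binom_family s = if all (leq n.+1) s then binom_det else 0.
Proof.
move=> sn ss; case: ifPn => [/allP sN|]; last first.
  by apply: shift_det_vanishing => i j y; apply binom_family_shift.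
rewrite /shift_det sn eqxx.
have -> : \matrix_(i < n, j < n) binom_family i j (nth 0%N s i) =
   (\matrix_(i < n, a < n) if (a <= i)%N then 'C(nth 0%N s i + i - (n + n), i - a)%:R else 0) *m
   (\matrix_(a < n, j < n) 'C(n.-1 - j, a)%:R) :> 'M[F]_n.
  apply/matrixP => i j; rewrite !mxE.
  have := @sorted_gtn_nth s i ss sN; rewrite sn => /(_ (ltn_ord i)) si.
  have jn := ltn_ord j; have lin := ltn_ord i.
  transitivity (('C((nth 0%N s i + i - (n + n)) + (n.-1 - j), i))%:R : F).
    rewrite /binom_family; case: ifP => h; first by congr ('C(_, _)%:R); lia.
    by rewrite bin_small //; lia.
  rewrite -binomial.Vandermonde natr_sum.
  rewrite (big_ord_widen n (fun k => ('C(nth 0%N s i + i - (n + n), k) * 'C(n.-1 - j, i - k))%:R : F)) //.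
  rewrite big_mkcond /=.
  transitivity (\sum_(k < n | (k <= i)%N) (('C(nth 0%N s i + i - (n + n), i - k) * 'C(n.-1 - j, k))%:R : F)); last first.
    rewrite big_mkcond; apply: eq_bigr => k _; rewrite !mxE.
    by case: ifP => _; rewrite ?mul0r ?natrM.
  rewrite -big_mkcond /=.
  rewrite -(big_ord_widen n (fun k => ('C(nth 0%N s i + i - (n + n), k) * 'C(n.-1 - j, i - k))%:R : F)) //.
  rewrite (eq_bigl (fun k : 'I_n => (k < i.+1)%N)) //.
  rewrite -(big_ord_widen n (fun k => ('C(nth 0%N s i + i - (n + n), i - k) * 'C(n.-1 - j, k))%:R : F)) //.
  rewrite (reindex_inj rev_ord_inj) /=; apply: eq_bigr => k _; rewrite subSS.
  by rewrite subKn // -ltnS.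
rewrite det_mulmx det_trig ?big1 ?mul1r //.
  by move=> i _; rewrite mxE leqnn subnn bin0.
by apply/is_trig_mxP => i j ij; rewrite mxE leqNgt ij.
Qed.

(** The base [n + n + t] is chosen so that the smallest encoded coordinate, [n + 1 + t] minus the
    last time, exceeds [n] exactly when the last time is at most [t]. *)
Lemma shift_det_encode t x : size x = n -> sorted leq x -> shift_det binom_family (encode (n + n + t) x) =
  if (last 0%N x <= t)%N then binom_det else 0.
Proof.
move=> xn sx.
have sE : size (encode (n + n + t) x) = n by rewrite size_encode.
have xl i : (i < n)%N -> (nth 0%N x i <= last 0%N x)%N.
  move=> lin; rewrite -nth_last; apply: (sorted_leq_nth leq_trans leqnn 0%N sx); rewrite ?inE ?xn //; lia.
have xS i : (i.+1 < n)%N -> (nth 0%N x i <= nth 0%N x i.+1)%N.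
  by move=> lin; apply: (sorted_leq_nth leq_trans leqnn 0%N sx); rewrite ?inE ?xn //; lia.
case: leqP => lt.
  have ss : sorted gtn (encode (n + n + t) x).
    apply/(sortedP 0%N) => i; rewrite sE => lin /=.
    rewrite !nth_encode ?xn //; last by lia.
    by have := xS i lin; have := xl i.+1 lin; lia.
  rewrite shift_det_binom // ifT //.
  apply/(all_nthP 0%N) => i; rewrite sE => lin; rewrite nth_encode ?xn //.
  by have := xl i lin; lia.
apply: shift_det_vanishing; first by move=> i j y; apply binom_family_shift.
have n0 : (0 < n)%N by case: (x) xn lt => //= a l <-.
apply/negP => /(all_nthP 0%N) /(_ n.-1); rewrite sE nth_encode ?xn; last by lia.
by move: lt; rewrite -nth_last xn; lia.
Qed.

Definition lpp_last m w := last 0%N (lpp_cols m n (nseq n 0%N) w).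

Lemma gexp_lpp B m t : (n + n + t < B)%N -> binom_det * gexp q B (m * n) (fun w => (lpp_last m w <= t)%N%:R) = (1 - q) ^+ (m * n) *
  \det (\matrix_(i < n, j < n) iter m (qsum q) (binom_family i j) (n + n + t - i)%N).
Proof.
move=> tB.
have s0 : sorted leq (nseq n 0%N) by elim: (n) => // -[|k] //= ->.
transitivity (gexp q B (m * n) (fun w => shift_det binom_family (encode (n + n + t) (lpp_cols m n (nseq n 0%N) w)))).
  rewrite -gexpZ; apply: eq_gexp => w wn.
  rewrite shift_det_encode ?size_lpp_cols ?size_nseq //; last exact: lpp_cols_sorted.
  by rewrite /lpp_last; case: leqP; rewrite ?mulr1 ?mulr0.
rewrite (@gexp_columns F q n) ?size_nseq //; last first.
  by apply: shift_det_vanishing => i j y; apply binom_family_shift.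
congr (_ * _).
have se : size (encode (n + n + t) (nseq n 0%N)) = n by rewrite size_encode size_nseq.
have ne i : (i < n)%N -> nth 0%N (encode (n + n + t) (nseq n 0%N)) i = (n + n + t - i)%N.
  by move=> lin; rewrite nth_encode ?size_nseq // nth_nseq lin subn0.
rewrite (@columns_shift_det _ q n n) //; first last.
- by apply/(sortedP 0%N) => i; rewrite se => lin /=; rewrite !ne //; lia.
- exact: binom_family_shift.
rewrite /shift_det se eqxx; congr (\det _); apply/matrixP => i j.
by rewrite !mxE ne.
Qed.

Definition qdiff (f : nat -> F) (y : nat) : F := f y - q * f y.-1.

Lemma qdiff_qsum f : f 0%N = 0 -> qdiff (qsum q f) =1 f.
Proof.
move=> f0 [|y]; rewrite /qdiff /= ?qsum0 ?f0 ?mulr0 ?subrr //.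
by rewrite qsum_recr addrC addKr.
Qed.

Lemma iter_qdiffE f a y : iter a qdiff f y = \sum_(j < a.+1) ((1 - q *: 'X) ^+ a)`_j * f (y - j)%N.
Proof.
elim: a y => [|a IH] y; first by rewrite big_ord1 expr0 coef1 mul1r subn0.
rewrite iterS /qdiff !IH exprS mulrBl mul1r.
under [RHS]eq_bigr do rewrite coefB -scalerAl coefZ coefXM mulrBl.
rewrite sumrB; congr (_ - _).
  rewrite [RHS]big_ord_recr /= [X in _ = _ + X](_ : _ = 0) ?addr0 //.
  rewrite nth_default ?mul0r //.
  apply: leq_trans (size_poly_exp_leq _ _) _.
  have : (size (1 - q *: 'X)%R <= 2)%N.
    rewrite (leq_trans (size_polyD _ _)) // size_polyN size_poly1 geq_max /=.
    by rewrite (leq_trans (size_scale_leq _ _)) // size_polyX.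
  by case: (size _) => [|[|[|k]]] //=; lia.
rewrite mulr_sumr [RHS]big_ord_recl /= mulr0 mul0r add0r.
apply: eq_bigr => j _; rewrite /= mulrA; congr (_ * f _); rewrite /bump /=; lia.
Qed.

Lemma iter_qdiff_iter_qsum f a m : f 0%N = 0 -> (a <= m)%N -> iter a qdiff (iter m (qsum q) f) =1 iter (m - a) (qsum q) f.
Proof.
move=> f0; have z k : iter k (qsum q) f 0%N = 0.
  by elim: k => //= k IH; rewrite qsum0.
have ext g h k : g =1 h -> iter k qdiff g =1 iter k qdiff h by move=> gh; elim: k => //= k IH y; rewrite /qdiff !IH.
elim: a m => [|a IH] [|m] am y //; rewrite ?subn0 //.
rewrite iterSr subSS -IH //; apply: ext => {}y /=; exact: qdiff_qsum.
Qed.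

(** The columns of the matrix are shifts by [j] of one function, so combining them with the
    coefficients of [(1 - q X)^a] undoes [a] of the [m] summations in column [a]. Columns that
    differ by the number of summations stay distinct in the scaling limit, where mere shifts would
    become equal. The constant [K] is left implicit; comparing two levels [t] eliminates it. *)
Lemma gexp_lpp_det m : (n <= m)%N -> exists K : F, forall B t, (n + n + t < B)%N -> K * gexp q B (m * n) (fun w => (lpp_last m w <= t)%N%:R) =
  (1 - q) ^+ (m * n) * \det (\matrix_(i < n, a < n)
     iter (m - a) (qsum q) (fun y => if (n < y)%N then 'C(y - n.+1 + i, i)%:R else 0) (n + n + t - i)%N).
Proof.
move=> nm.
pose P : 'M[F]_n := \matrix_(j < n, a < n) if (j < a.+1)%N then ((1 - q *: 'X) ^+ a)`_j else 0.
exists (binom_det * \det P) => B t tB.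
rewrite mulrAC gexp_lpp // -mulrA -det_mulmx; congr (_ * \det _).
apply/matrixP => i a; rewrite !mxE.
set f := (fun y : nat => if (n < y)%N then _ else 0).
have f0 : f 0%N = 0 by [].
rewrite -(@iter_qdiff_iter_qsum f a m f0); last by apply: leq_trans nm; apply: ltnW.
rewrite iter_qdiffE (big_ord_widen n (fun j => ((1 - q *: 'X) ^+ a)`_j * iter m (qsum q) f (n + n + t - i - j)%N)) // [RHS]big_mkcond.
apply: eq_bigr => j _; rewrite !mxE mulrC; case: ifP => _; rewrite ?mul0r ?mulr0 //.
congr (_ * _).
have bE y : binom_family i j y = f (y - j)%N by rewrite /binom_family /f; do 2!case: ifP; rewrite ?subnDA //; try lia; rewrite subnAC.
have : forall k y, iter k (qsum q) (binom_family i j) y = iter k (qsum q) f (y - j)%N.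
  elim=> [|k IH] y /=; first exact: bE.
  elim: y => [|y IHy]; first by rewrite !qsum0 IH.
  rewrite qsum_recr IHy IH; have [jy|yj] := leqP j y; first by rewrite subSn // qsum_recr.
  have -> : (y.+1 - j = 0)%N by lia.
  have -> : (y - j = 0)%N by lia.
  rewrite qsum0; have -> : iter k (qsum q) f 0%N = 0 by elim: (k) => //= k' IH'; rewrite qsum0.
  by rewrite mulr0 addr0.
by move=> ->.
Qed.

(** The weights are negative binomial; after scaling they become [x^k / k!] times [e^(-x)]. *)
Lemma iter_qsumE k f y : f 0%N = 0 -> iter k.+1 (qsum q) f y = \sum_(z < y.+1) 'C(z + k, k)%:R * q ^+ z * f (y - z)%N.
Proof.
move=> f0; elim: k y => [|k IH] y.
  rewrite /= /qsum (reindex_inj rev_ord_inj) /=; apply: eq_bigr => z _.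
  by rewrite bin0 mul1r subSS subKn // -ltnS.
elim: y => [|y IHy].
  rewrite iterS qsum0 IH !big_ord1 !binn !subn0.
  by rewrite f0 !mulr0.
rewrite iterS qsum_recr -iterS IHy IH.
transitivity (\sum_(z < y.+2) 'C(z + k, k.+1)%:R * q ^+ z * f (y.+1 - z)%N + \sum_(z < y.+2) 'C(z + k, k)%:R * q ^+ z * f (y.+1 - z)%N); last first.
  by rewrite -big_split; apply: eq_bigr => z _; rewrite addnS binS natrD /=; ring.
congr (_ + _); rewrite [RHS]big_ord_recl /= bin_small // !mul0r add0r mulr_sumr.
apply: eq_bigr => z _; rewrite /bump /= add1n subSS exprS addSnnS; ring.
Qed.

End GeometricLPP.

(** * Fredholm series *)

Section PrincipalMinors.
Variable F : numFieldType.

(* Sylvester's identity, from two factorisations of the same block matrix. *)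
Lemma det_sylvester m n (X : 'M[F]_(m, n)) (Y : 'M[F]_(n, m)) : \det (1%:M - X *m Y) = \det (1%:M - Y *m X).
Proof.
have E1 : block_mx 1%:M X Y 1%:M = block_mx 1%:M X 0 1%:M *m block_mx (1%:M - X *m Y) 0 Y 1%:M :> 'M[F]_(m + n).
  by rewrite mulmx_block !mul1mx !mul0mx !mulmx1 subrK !add0r.
have E2 : block_mx 1%:M X Y 1%:M = block_mx 1%:M 0 Y 1%:M *m block_mx 1%:M X 0 (1%:M - Y *m X) :> 'M[F]_(m + n).
  by rewrite mulmx_block !mul1mx !mul0mx !mulmx1 !addr0 addrC subrK.
have := congr1 determinant E1; rewrite E2 !det_mulmx !det_ublock !det_lblock !det1 !mul1r !mulr1.
by [].
Qed.

Definition submx_at n N (f : 'I_n -> 'I_N) (A : 'M[F]_N) : 'M[F]_n := \matrix_(a, b) A (f a) (f b).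

(** Rows outside [S] are rows of the identity: the determinant is the principal minor of [A] on [S],
    while the size of the matrix does not depend on [S]. *)
Definition mixed_mx N (S : {set 'I_N}) (A : 'M[F]_N) : 'M[F]_N := \matrix_(i, j) if i \in S then A i j else (i == j)%:R.

(** Selecting rows and columns along an injective [f] is conjugation by a 0-1 matrix [E] with
    [E E^T = 1], and Sylvester's identity moves [E] to the other side. *)
Lemma det_submx_at n N (f : 'I_n -> 'I_N) (A : 'M[F]_N) : injective f -> \det (submx_at f A) = \det (mixed_mx [set x in codom f] A).
Proof.
move=> fi; pose E : 'M[F]_(n, N) := \matrix_(a, i) (f a == i)%:R.
have rE p (B : 'M[F]_(N, p)) a j : (E *m B) a j = B (f a) j.
  rewrite mxE (bigD1 (f a)) //= !mxE eqxx mul1r big1 ?addr0 // => i ne.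
  by rewrite !mxE eq_sym (negbTE ne) mul0r.
have EE : E *m E^T = 1%:M by apply/matrixP => a b; rewrite rE !mxE (inj_eq fi) eq_sym.
have -> : submx_at f A = 1%:M - (E - E *m A) *m E^T.
  rewrite mulmxBl EE opprB addrC subrK.
  apply/matrixP => a b; rewrite mxE [RHS]mxE (bigD1 (f b)) //= rE !mxE eqxx mulr1.
  rewrite big1 ?addr0 // => i ne.
  by rewrite [X in _ * X = _]mxE [X in _ * X = _]mxE eq_sym (negbTE ne) mulr0.
rewrite det_sylvester; congr (\det _); rewrite mulmxBr mulmxA.
have D : E^T *m E = \matrix_(i, j) ((i \in [set x in codom f]) && (i == j))%:R.
  apply/matrixP => i j; rewrite !mxE; case: (boolP (i \in _)) => /=.
    rewrite inE => /codomP[a ->].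
    rewrite (bigD1 a) //= !mxE eqxx mul1r big1 ?addr0 // => b ne.
    by rewrite !mxE (inj_eq fi) (negbTE ne) mul0r.
  rewrite inE => ni; apply: big1 => a _; rewrite !mxE; case: eqP => [fa|]; rewrite ?mul0r //.
  by case/negP: ni; rewrite -fa codom_f.
rewrite D; apply/matrixP => i j; rewrite !mxE.
under eq_bigr do rewrite mxE.
case: (boolP (i \in _)) => /= iS; last first.
  by rewrite !big1 ?subrr ?subr0 // => k _; rewrite mul0r.
by rewrite (bigD1 i) //= eqxx mul1r big1 ?addr0 ?opprB ?(addrC _ (_ - _)) ?subrK // => k ne; rewrite eq_sym (negbTE ne) mul0r.
Qed.

(** In the Leibniz formula each factor is a difference of two terms; expanding the product chooses
    one of them in every row, and [S] is the set of rows where [- A] is chosen. *)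
Lemma det1B_sum_mixed N (A : 'M[F]_N) : \det (1%:M - A) = \sum_(S : {set 'I_N}) (-1) ^+ #|S| * \det (mixed_mx S A).
Proof.
rewrite /determinant.
transitivity (\sum_(s : {perm 'I_N}) \sum_(S : {set 'I_N}) (-1) ^+ s * ((-1) ^+ #|S| * \prod_i mixed_mx S A i (perm.fun_of_perm s i))).
  apply: eq_bigr => s _; rewrite -mulr_sumr; congr (_ * _).
  transitivity (\prod_i (- A i (perm.fun_of_perm s i) + (i == perm.fun_of_perm s i)%:R)).
    by apply: eq_bigr => i _; rewrite !mxE addrC.
  rewrite bigA_distr; apply: eq_bigr => S _.
  transitivity (\prod_i ((if i \in S then -1 else 1) * mixed_mx S A i (perm.fun_of_perm s i))).
    by apply: eq_bigr => i _; rewrite mxE; case: ifP => _; rewrite ?mulN1r ?mul1r.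
  rewrite big_split; congr (_ * _).
  by rewrite -big_mkcond prodr_const.
rewrite exchange_big; apply: eq_bigr => S _; rewrite mulr_sumr.
by apply: eq_bigr => s _; rewrite mulrCA.
Qed.

(** The Fredholm series of a finite matrix. A non-injective index map repeats a row and contributes
    zero; each set of [n] indices is the image of [n!] injections, which explains the factorial. *)
Lemma det1B_expansion N (A : 'M[F]_N) : \det (1%:M - A) = \sum_(n < N.+1) (-1) ^+ n / n`!%:R * \sum_(f : {ffun 'I_n -> 'I_N}) \det (submx_at f A).
Proof.
rewrite det1B_sum_mixed (partition_big (fun S : {set 'I_N} => inord #|S| : 'I_N.+1) xpredT) //=.
apply: eq_bigr => n _.
have cS (S : {set 'I_N}) : (inord #|S| == n) = (#|S| == n).
  rewrite -val_eqE /= inordK // ltnS -[X in (_ <= X)%N]card_ord; exact: max_card.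
under eq_bigl do rewrite cS.
transitivity (\sum_(S : {set 'I_N} | #|S| == n) (-1) ^+ n * \det (mixed_mx S A)).
  by apply: eq_bigr => S /eqP ->.
rewrite -mulr_sumr -mulrA; congr (_ * _).
rewrite (bigID (fun f : {ffun 'I_n -> 'I_N} => injectiveb f)) /= [X in _ * (_ + X)]big1 ?addr0; last first.
  move=> f /injectivePn[a [b ab fab]].
  by apply: (determinant_alternate ab) => j; rewrite !mxE fab.
rewrite (partition_big (fun f : {ffun 'I_n -> 'I_N} => [set x in codom f]) (fun S => #|S| == n)) /=; last first.
  by move=> f /injectiveP fi; rewrite cardsE card_codom // card_ord.
rewrite mulr_sumr; apply: eq_bigr => S /eqP Sn.
rewrite (eq_bigr (fun=> \det (mixed_mx S A))); last first.
  by move=> f /andP[/injectiveP fi /eqP <-]; rewrite det_submx_at.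
rewrite big_const -Monoid.iteropE /= -mulr_natl.
set k := #|_|; have -> : k = n`!.
  have := card_inj_ffuns_on 'I_n (mem S); rewrite card_ord Sn ffactnn => <-.
  rewrite /k -cardsE; apply: eq_card => f; rewrite !inE.
  apply/andP/andP => [[fi /eqP fS]|[fS fi]]; split=> //.
    by apply/ffun_onP => a; rewrite -fS inE codom_f.
  rewrite eqEcard; apply/andP; split.
    by apply/fintype.subsetP => x; rewrite inE => /codomP[a ->]; move/forallP: fS; apply.
  by rewrite Sn cardsE card_codom ?card_ord //; apply/injectiveP.
rewrite mulr1; set dS := \det _; rewrite (_ : iterop _ _ _ _ = n`!%:R * dS); last by rewrite mulr_natl.
rewrite mulrA mulVf ?mul1r // pnatr_eq0 -lt0n fact_gt0.
Qed.

End PrincipalMinors.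

(** * Positive semidefinite matrices *)

Section Hadamard.
Variable R : realFieldType.

Definition psd n (A : 'M[R]_n) := A^T = A /\ forall v : 'rV_n, 0 <= (v *m A *m v^T) 0 0.

Lemma quad_block n (a t : R) (v w : 'rV[R]_n) (B : 'M[R]_n) : let x : 'rV_(1 + n) := row_mx t%:M w in (x *m block_mx a%:M v v^T B *m x^T) 0 0 =
  a * t ^+ 2 + 2 * t * (w *m v^T) 0 0 + (w *m B *m w^T) 0 0.
Proof.
rewrite /= tr_row_mx mul_row_block mul_row_col !mulmxDl.
rewrite tr_scalar_mx !mul_mx_scalar !mul_scalar_mx.
have -> : t *: v *m w^T = t *: (w *m v^T)^T by rewrite trmx_mul trmxK -scalemxAl.
rewrite !mxE /= mulr1n; ring.
Qed.

Lemma psd_diag n (A : 'M[R]_n) i : psd A -> 0 <= A i i.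
Proof.
move=> [_ /(_ (delta_mx 0 i))]; rewrite -rowE trmx_delta -colE.
by rewrite !mxE.
Qed.

Lemma psd_block n (A : 'M[R]_(1 + n)) : A^T = A -> A = block_mx (A 0 0)%:M (ursubmx A) (ursubmx A)^T (drsubmx A).
Proof.
move=> sA; rewrite -[LHS]submxK; congr block_mx.
  rewrite [ulsubmx A]mx11_scalar; congr (_%:M); rewrite !mxE; congr (A _ _); exact: val_inj.
by rewrite trmx_ursub sA.
Qed.

Lemma prod_diag_block n (A : 'M[R]_(1 + n)) : \prod_i A i i = A 0 0 * \prod_i (drsubmx A) i i.
Proof.
rewrite big_ord_recl; congr (_ * _); apply: eq_bigr => i _.
by rewrite !mxE; congr (A _ _); apply: val_inj.
Qed.

(** Hadamard's inequality by induction on the Schur complement [B'] of the first entry: it is again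
    positive semidefinite, and its diagonal is at most that of [B]. *)
Lemma psd_det n (A : 'M[R]_n) : psd A -> 0 <= \det A <= \prod_i A i i.
Proof.
elim: n A => [|n IH] A pA; first by rewrite det_mx00 big_ord0 ler01 lexx.
have [sA qA] := pA.
have EA := @psd_block n A sA.
set a := A 0 0 in EA; set v := ursubmx _ in EA; set B := drsubmx _ in EA.
have a0 : 0 <= a := psd_diag 0 pA.
have quad t (w : 'rV_n) : 0 <= a * t ^+ 2 + 2 * t * (w *m v^T) 0 0 + (w *m B *m w^T) 0 0 by rewrite -quad_block -EA; apply: qA.
have pB : psd B.
  split=> [|w]; last by have := quad 0 w; rewrite expr0n /= mulr0 mulr0 mul0r !add0r.
  by rewrite /B trmx_drsub; congr drsubmx.
rewrite (prod_diag_block (A : 'M[R]_(1 + n))) -/a -/B.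
have [a00|ane] := eqVneq a 0.
  rewrite a00 mul0r -eq_le eq_sym; apply/eqP.
  (* With a zero pivot and [v 0 j] nonzero, the form would be unbounded below along the first
     coordinate. *)
  have v0 : v = 0.
    apply/rowP => j; rewrite [RHS]mxE; apply/eqP; apply/negPn/negP => vj.
    pose w : 'rV[R]_n := delta_mx 0 j.
    have wv : (w *m v^T) 0 0 = v 0 j by rewrite -rowE !mxE.
    have := quad (- ((w *m B *m w^T) 0 0 + 1) / (2 * v 0 j)) w.
    rewrite wv a00 mul0r add0r => h.
    have : 0 <= (-1 : R) by apply: le_trans h _; rewrite le_eqVlt; apply/orP; left; apply/eqP; field.
    by rewrite ler0N1.
  rewrite EA a00 v0 trmx0.
  rewrite (_ : block_mx _ _ _ _ = block_mx 0%:M 0 (0 : 'M[R]_(n, 1)) B) //.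
  by rewrite (@det_lblock _ 1 n) det_mx11 mxE mul0r.
have ap : 0 < a by rewrite lt_def ane.
pose B' := B - a^-1 *: (v^T *m v).
have dA : \det A = a * \det B'.
  rewrite {1}EA.
  have -> : block_mx a%:M v v^T B = block_mx 1%:M 0 (a^-1 *: v^T) 1%:M *m block_mx a%:M v 0 B' :> 'M[R]_(1 + n).
    rewrite mulmx_block !mul1mx !mul0mx !addr0 -!scalemxAl mul_mx_scalar scalerA mulVf // scale1r.
    by rewrite /B' addrC subrK.
  by rewrite det_mulmx (@det_lblock _ 1 n) !det1 !mul1r (@det_ublock _ 1 n) det_mx11 mxE /= mulr1n.
have pB' : psd B'.
  split=> [|w].
    by rewrite /B' linearB /= linearZ /= trmx_mul trmxK; case: pB => ->.
  (* The first coordinate that minimises the form for given [w]; the minimum is the Schur complement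
     at [w]. *)
  have := quad (- (w *m v^T) 0 0 / a) w.
  have -> : w *m B' *m w^T = w *m B *m w^T - a^-1 *: ((w *m v^T) *m (w *m v^T)^T).
    by rewrite /B' mulmxBr mulmxBl -scalemxAr -scalemxAl trmx_mul trmxK !mulmxA.
  rewrite [X in _ -> 0 <= X]mxE [X in _ -> 0 <= _ + X]mxE [X in _ -> 0 <= _ + - X]mxE.
  rewrite [X in _ -> 0 <= _ - _ * X]mxE big_ord1 [X in _ -> 0 <= _ - _ * (_ * X)]mxE.
  move=> h; apply: le_trans h _; rewrite le_eqVlt; apply/orP; left; apply/eqP.
  by field.
have /andP[d0 dle] := IH B' pB'.
rewrite dA mulr_ge0 //= ler_wpM2l //; apply: le_trans dle _.
apply: ler_prod => i _; rewrite psd_diag //= /B' !mxE big_ord1 !mxE.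
by rewrite lerBlDr lerDl mulr_ge0 ?invr_ge0 // -expr2 sqr_ge0.
Qed.
End Hadamard.

Section FiniteLimits.
Context {R : realType} {T I : Type} {F : set_system T} {FF : Filter F}.
Variables (r : seq I) (P : pred I) (f : I -> T -> R) (l : I -> R).
Hypothesis fl : forall i, P i -> f i @ F --> l i.

Lemma cvg_sum : (fun x => \sum_(i <- r | P i) f i x) @ F --> \sum_(i <- r | P i) l i.
Proof. by apply: cvg_big => // -[x y]; apply: cvgD; [exact: cvg_fst|exact: cvg_snd]. Qed.

Lemma cvg_prod : (fun x => \prod_(i <- r | P i) f i x) @ F --> \prod_(i <- r | P i) l i.
Proof. by apply: cvg_big => // -[x y]; apply: cvgM; [exact: cvg_fst|exact: cvg_snd]. Qed.

End FiniteLimits.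

(** * Iterated integrals and step functions *)

Section IteratedIntegral.
Variable R : realType.

(** Measurability of every partially integrated section, as dominated convergence asks for at each
    level of [iter_int]. *)
Fixpoint nested_measurable (s : R) (n : nat) (F : seq R -> R) : Prop := if n is n'.+1 then
    measurable_fun `]s, +oo[%classic (fun x => iter_int s n' (fun xs => F (x :: xs))) /\
    forall x, s < x -> nested_measurable s n' (fun xs => F (x :: xs))
  else True.

Lemma cvg_Rintegral d (T : measurableType d) (nu : {measure set T -> \bar R}) (D : set T) (f_ : nat -> T -> R) (f g : T -> R) : measurable D ->
  (forall n, measurable_fun D (f_ n)) ->
  (forall x, D x -> f_ ^~ x @ \oo --> f x) ->
  nu.-integrable D (EFin \o g) ->
  (forall n x, D x -> `|f_ n x| <= g x) ->
  [/\ nu.-integrable D (EFin \o f), Rintegral nu D (f_ n) @[n --> \oo] --> Rintegral nu D f, (forall n, nu.-integrable D (EFin \o f_ n)) &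
      forall n, `|Rintegral nu D (f_ n)| <= Rintegral nu D g].
Proof.
move=> mD mf_ f_f ig f_g.
have mE n : measurable_fun D (EFin \o f_ n) by exact/measurable_EFinP.
have mf : measurable_fun D (EFin \o f) by apply/measurable_EFinP; apply: (measurable_fun_cvg mf_ f_f).
have ifn n : nu.-integrable D (EFin \o f_ n).
  apply: le_integrable ig => // x Dx /=; rewrite lee_fin.
  exact: le_trans (f_g n x Dx) (ler_norm _).
have c0 : \forall x \ae nu, D x -> (EFin \o f_ j) x @[j --> \oo] --> (EFin \o f) x by apply: aeW => x Dx; apply: cvg_EFin; [exact: nearW|exact: f_f].
have d0 : \forall x \ae nu, forall n, D x -> (`|(EFin \o f_ n) x| <= (EFin \o g) x)%E by apply: aeW => x n Dx; rewrite /= lee_fin; exact: f_g.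
have [iF _ cF] := dominated_convergence mD mE mf c0 ig d0.
split=> //.
  apply: (fine_cvg (f := fun n => (\int[nu]_(x in D) (EFin \o f_ n) x)%E)).
  by rewrite fineK //; apply: integrable_fin_num.
move=> n; apply: le_trans (le_normr_Rintegral mD (ifn n)) _.
apply: le_Rintegral => //.
- exact: integrable_norm.
- by move=> x Dx; apply: f_g.
Qed.

(** Dominated convergence level by level: the factor [g x] of the outer variable is absorbed into
    the constant [C] of the inner integral. *)
Lemma cvg_iter_int (s : R) (g : R -> R) (n : nat) (F_ : nat -> seq R -> R) (F : seq R -> R) (C : R) : mu.-integrable `]s, +oo[ (EFin \o g) ->
  (forall x, s < x -> 0 <= g x) ->
  0 <= C ->
  (forall j, nested_measurable s n (F_ j)) ->
  (forall xs, size xs = n -> all (> s) xs -> F_ ^~ xs @ \oo --> F xs) ->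
  (forall j xs, size xs = n -> all (> s) xs -> `|F_ j xs| <= C * \prod_(x <- xs) g x) ->
  ((iter_int s n (F_ j) @[j --> \oo] --> iter_int s n F) /\ (forall j, `|iter_int s n (F_ j)| <= C * (RInt `]s, +oo[ g) ^+ n)).
Proof.
move=> ig g0; elim: n F_ F C => [|n IH] F_ F C C0 mF cF bF.
  split=> [|j]; first exact: (cF [::]).
  by rewrite expr0 mulr1; have := bF j [::] erefl isT; rewrite big_nil mulr1.
set I := Rintegral _ _ _.
have I0 : 0 <= I by apply: Rintegral_ge0 => x /=; rewrite in_itv /= andbT => /g0.
have H x : s < x -> ((fun j => iter_int s n (fun xs => F_ j (x :: xs))) @ \oo --> iter_int s n (fun xs => F (x :: xs))) /\
  (forall j, `|iter_int s n (fun xs => F_ j (x :: xs))| <= C * g x * I ^+ n).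
  move=> sx; apply: (IH (fun j xs => F_ j (x :: xs)) (fun xs => F (x :: xs)) (C * g x)).
  - by rewrite mulr_ge0 // g0.
  - by move=> j; have [_ /(_ x sx)] := mF j.
  - by move=> xs sn axs; apply: (cF (x :: xs)); rewrite /= ?sn ?sx.
  - move=> j xs sn axs; have := bF j (x :: xs); rewrite /= sn sx axs big_cons mulrA.
    exact.
have mI j : measurable_fun `]s, +oo[%classic (fun x => iter_int s n (fun xs => F_ j (x :: xs))) by have [] := mF j.
have igC : mu.-integrable `]s, +oo[ (EFin \o (fun x => C * g x * I ^+ n)).
  rewrite (_ : _ \o _ = (fun x => ((C * I ^+ n)%:E * (EFin \o g) x)%E)); last first.
    by apply/funext => x /=; rewrite -EFinM mulrAC.
  exact: integrableZl.
have sin x : `]s, +oo[%classic x -> s < x by rewrite /= in_itv /= andbT.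
have [_ cI _ bI] := cvg_Rintegral (nu := mu) (measurable_itv _) mI (fun x Dx => (H x (sin x Dx)).1) igC (fun j x Dx => (H x (sin x Dx)).2 j).
split=> // j; apply: le_trans (bI j) _.
rewrite (_ : (fun x => C * g x * I ^+ n) = (fun x => (C * I ^+ n) * g x)); last first.
  by apply/funext => x; rewrite mulrAC.
by rewrite RintegralZl // exprS mulrA mulrAC -mulrA lexx.
Qed.
End IteratedIntegral.

Section SimpleFunctions.
Context d (T : measurableType d) (R : realType) (nu : {measure set T -> \bar R}).
Variables (D : set T) (mD : measurable D) (A : nat -> set T) (mA : forall k, measurable (A k)).
Hypothesis Afin : forall k, (nu (A k `&` D) < +oo)%E.

Lemma integrable_indic_on k : nu.-integrable D (EFin \o \1_(A k)).
Proof.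
apply/integrableP; split; first by apply/measurable_EFinP; exact: measurable_indic.
rewrite (eq_integral (fun x => (\1_(A k) x)%:E)) ?integral_indic //.
by move=> x _; rewrite /= ger0_norm.
Qed.

Lemma Rintegral_simple (G : nat -> R) N : nu.-integrable D (EFin \o (fun x => \sum_(k < N) G k * \1_(A k) x)) /\
  Rintegral nu D (fun x => \sum_(k < N) G k * \1_(A k) x) =
  \sum_(k < N) G k * fine (nu (A k `&` D)).
Proof.
elim: N => [|N [iN eN]].
  split.
    rewrite (_ : _ \o _ = cst 0%:E); last by apply/funext => x /=; rewrite big_ord0.
    exact: integrable0.
  rewrite big_ord0 (@eq_Rintegral _ _ _ _ _ (cst 0)) ?Rintegral_cst ?mul0r //.
  by move=> x _; rewrite big_ord0.
have E : (fun x => \sum_(k < N.+1) G k * \1_(A k) x) = (fun x => \sum_(k < N) G k * \1_(A k) x + G N * \1_(A N) x).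
  by apply/funext => x; rewrite big_ord_recr.
have iG : nu.-integrable D (EFin \o (fun x => G N * \1_(A N) x)).
  rewrite (_ : _ \o _ = (fun x => ((G N)%:E * (EFin \o \1_(A N)) x)%E)) //.
  by apply: integrableZl => //; exact: integrable_indic_on.
rewrite E; split.
  exact: (integrableD mD iN iG).
rewrite RintegralD // eN big_ord_recr /=; congr (_ + _).
rewrite RintegralZl //; last exact: integrable_indic_on.
by congr (_ * _); rewrite /Rintegral integral_indic.
Qed.

End SimpleFunctions.

Section StepFunctions.
Variable R : realType.
Variables (h s : R) (h0 : 0 < h).

(** With [h] cells per unit of length counted from [s], it reads a matrix index off a real variable,
    so that a matrix becomes a step kernel on the half line. *)
Definition cell_index (x : R) : nat := Num.truncn (h * (x - s)).

Definition cell (k : nat) : set R := `[s + k%:R / h, s + k.+1%:R / h[%classic.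

Lemma cellP k x : s <= x -> (cell_index x == k) = (x \in cell k).
Proof.
move=> sx; have hx : 0 <= h * (x - s) by apply: mulr_ge0; [exact: ltW|lra].
rewrite /cell mem_setE in_itv /= -lerBrDl ler_pdivrMr // -ltrBlDl ltr_pdivlMr // mulrC.
apply/eqP/idP => [<-|]; first exact: truncn_itv.
by move=> kx; apply: truncn_def.
Qed.

Lemma step_sum (G : nat -> R) N x : (forall k, (N <= k)%N -> G k = 0) -> s <= x -> G (cell_index x) = \sum_(k < N) G k * \1_(cell k) x.
Proof.
move=> G0 sx; have [Nk|kN] := leqP N (cell_index x).
  rewrite G0 // big1 // => k _; rewrite indicE -cellP //.
  by rewrite gtn_eqF ?mulr0 //; apply: leq_trans Nk.
rewrite (bigD1 (Ordinal kN)) //= indicE -cellP // eqxx mulr1 big1 ?addr0 // => k ne.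
rewrite indicE -cellP //; have -> : (cell_index x == k) = false; last by rewrite mulr0.
by apply/negbTE; rewrite eq_sym; exact: ne.
Qed.

Lemma measurable_cell k : measurable (cell k). Proof. exact: measurable_itv. Qed.

Lemma cell_measure k : mu (cell k `&` `[s, +oo[%classic) = (h^-1)%:E.
Proof.
rewrite (_ : _ `&` _ = cell k); last first.
  apply/setIidPl => x; rewrite /cell /= !in_itv /= andbT => /andP[+ _].
  by apply: le_trans; rewrite lerDl divr_ge0 // ltW.
rewrite /cell lebesgue_measure_itv /= lte_fin ifT.
  by rewrite -EFinB; congr (_%:E); rewrite -natr1; field; rewrite gt_eqF.
by rewrite ltrD2l ltr_pM2r ?invr_gt0 // ltr_nat.
Qed.

Lemma step_function (G : nat -> R) N : (forall k, (N <= k)%N -> G k = 0) -> measurable_fun `]s, +oo[%classic (fun x => G (cell_index x)) /\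
  RInt `]s, +oo[ (fun x => G (cell_index x)) = h^-1 * \sum_(k < N) G k.
Proof.
move=> G0.
have Efin k : (mu (cell k `&` `[s, +oo[%classic) < +oo)%E by rewrite cell_measure ltry.
have [iG eG] := @Rintegral_simple _ _ R mu `[s, +oo[%classic (measurable_itv _) cell measurable_cell Efin G N.
have iG' : mu.-integrable `[s, +oo[ (EFin \o (fun x => G (cell_index x))).
  apply: eq_integrable iG => //= x; rewrite inE /= in_itv /= andbT => sx.
  by congr (_%:E); rewrite -step_sum.
have iG2 : mu.-integrable `]s, +oo[ (EFin \o (fun x => G (cell_index x))).
  apply: integrableS iG' => // x /=; rewrite !in_itv /= !andbT; exact: ltW.
split; first by apply/measurable_EFinP; exact: measurable_int iG2.
rewrite Rintegral_itv_obnd_cbnd // mulr_sumr.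
transitivity (RInt `[s, +oo[ (fun x => \sum_(k < N) G k * \1_(cell k) x)).
  apply: eq_Rintegral => x; rewrite inE /= in_itv /= andbT => sx; exact: step_sum.
apply: (etrans eG); apply: eq_bigr => k _; rewrite mulrC; congr (_ * _).
exact: (congr1 fine (cell_measure k)).
Qed.

Fixpoint nested_sum (N n : nat) (Phi : seq nat -> R) : R :=
  if n is n'.+1 then \sum_(k < N) nested_sum N n' (fun ks => Phi (nat_of_ord k :: ks)) else Phi [::].

Lemma nested_sum_eq0 N n Phi : (forall ks, size ks = n -> Phi ks = 0) -> nested_sum N n Phi = 0.
Proof.
elim: n Phi => [|n IH] Phi P0 /=; first exact: P0.
by apply: big1 => k _; apply: IH => ks kn; apply: P0; rewrite /= kn.
Qed.

(** Vanishing at indices [>= N] turns the integral over an unbounded half line into a finite sum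
    over cells of length [1 / h]. *)
Lemma iter_int_step N n (Phi : seq nat -> R) : (forall ks, size ks = n -> has (leq N) ks -> Phi ks = 0) ->
  nested_measurable s n (fun xs => Phi (map cell_index xs)) /\
  iter_int s n (fun xs => Phi (map cell_index xs)) = h^-1 ^+ n * nested_sum N n Phi.
Proof.
elim: n Phi => [|n IH] Phi P0; first by rewrite /= mul1r.
have IHk k := IH (fun ks => Phi (k :: ks)).
have {}IHk k : nested_measurable s n (fun xs => Phi (k :: map cell_index xs)) /\ iter_int s n (fun xs => Phi (k :: map cell_index xs)) =
  h^-1 ^+ n * nested_sum N n (fun ks => Phi (k :: ks)).
  by apply: IHk => ks kn hk; apply: P0; rewrite /= ?kn // hk orbT.
pose G k := h^-1 ^+ n * nested_sum N n (fun ks => Phi (k :: ks)).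
have G0 k : (N <= k)%N -> G k = 0.
  move=> Nk; rewrite /G nested_sum_eq0 ?mulr0 // => ks kn.
  by apply: P0; rewrite /= ?kn ?Nk.
have EG : (fun x => iter_int s n (fun xs => Phi (map cell_index (x :: xs)))) = (fun x => G (cell_index x)).
  by apply/funext => x; have [] := IHk (cell_index x).
have [mG iG] := step_function G0.
split.
  split; first by rewrite EG.
  by move=> x sx; have [] := IHk (cell_index x).
rewrite [LHS](_ : _ = RInt `]s, +oo[ (fun x => G (cell_index x))); last by rewrite -EG.
by rewrite iG exprS -mulrA; congr (_ * _); rewrite mulr_sumr.
Qed.

End StepFunctions.

Lemma nested_sum_ffun (R : realType) N n (Phi : seq nat -> R) :
  nested_sum N n Phi = \sum_(f : {ffun 'I_n -> 'I_N}) Phi [seq nat_of_ord (f i) | i <- enum_mem (mem 'I_n)].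
Proof.
elim: n Phi => [|n IH] Phi /=.
  rewrite (eq_bigr (fun=> Phi [::])); last by move=> f _; rewrite (size0nil (size_enum_ord 0)).
  by rewrite big_const card_ffun !card_ord expn0 /= addr0.
under eq_bigr do rewrite IH.
rewrite pair_big /=.
pose g (p : 'I_N * {ffun 'I_n -> 'I_N}) : {ffun 'I_n.+1 -> 'I_N} := [ffun i => if unlift ord0 i is Some j then p.2 j else p.1].
pose g' (f : {ffun 'I_n.+1 -> 'I_N}) : 'I_N * {ffun 'I_n -> 'I_N} := (f ord0, [ffun j => f (lift ord0 j)]).
rewrite (reindex g) /=; last first.
  exists g' => [[k f] _|f _].
    congr pair; first by rewrite ffunE unlift_none.
    by apply/ffunP => j; rewrite !ffunE liftK.
  by apply/ffunP => i; rewrite ffunE; case: unliftP => [j ->|->]; rewrite ?ffunE.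
apply: eq_bigr => [[k f] _] /=.
rewrite enum_ordSl /= ffunE unlift_none; congr (Phi (_ :: _)).
by rewrite -map_comp; apply: eq_map => j /=; rewrite ffunE liftK.
Qed.

Lemma nth_map_enum_ord n (F : 'I_n -> nat) (x : 'I_n) : nth 0%N [seq F i | i <- enum_mem (mem 'I_n)] x = F x.
Proof. by rewrite (nth_map x) ?size_enum_ord // nth_ord_enum. Qed.

Section FredholmLimit.
Variable R : realType.

(* Tannery's theorem for the Fredholm series, dominated by the exponential series. *)
Lemma cvg_alternating_series (a : nat -> nat -> R) (b : nat -> R) (I : R) (N : nat -> nat) : 0 <= I -> (forall n, a ^~ n @ \oo --> b n) ->
  (forall j n, `|a j n| <= I ^+ n) ->
  (forall m, \forall j \near \oo, (m <= N j)%N) ->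
  (fun j => \sum_(n < N j) (-1) ^+ n / n`!%:R * a j n) @ \oo -->
  (\big[+%R/0%R]_(0 <= n <oo) ((-1) ^+ n / n`!%:R * b n)).
Proof.
move=> I0 ab aI NN.
pose c (n : nat) : R := (-1) ^+ n / n`!%:R.
have bI n : `|b n| <= I ^+ n.
  have h : (fun j => `|a j n|) @ \oo --> `|b n| by apply: cvg_norm; exact: ab.
  rewrite -(cvg_lim _ h) //; apply: limr_le; first by apply/cvg_ex; exists `|b n|.
  by near=> j; exact: aI.
have cI n x : `|x| <= I ^+ n -> `|c n * x| <= exp_coeff I n.
  move=> xI; rewrite normrM /c normrM normrX normrN1 expr1n mul1r /exp_coeff /= mulrC.
  by rewrite (ger0_norm (_ : 0 <= n`!%:R^-1)) ?invr_ge0 // ler_pM2r ?invr_gt0 ?ltr0n ?fact_gt0.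
pose E := series (exp_coeff I).
have nE : {homo E : n m / (n <= m)%N >-> n <= m}.
  apply/nondecreasing_seqP => n; rewrite /E /series /= big_nat_recr //= lerDl.
  by rewrite exp_coeff_ge0.
have cE : E @ \oo --> expR I by exact: is_cvg_series_exp_coeff.
have El k : E k <= expR I by exact: (nondecreasing_cvgn_le nE (is_cvg_series_exp_coeff I)).
have tail (x : nat -> R) m k : (forall n, `|x n| <= I ^+ n) -> (m <= k)%N ->
    `|series (fun n => c n * x n) k - series (fun n => c n * x n) m| <= expR I - E m.
  move=> xI mk; apply: le_trans (lerB (El k) (lexx (E m))).
  rewrite !sub_series_geq //; apply: le_trans (ler_norm_sum _ _ _) _.
  by apply: ler_sum => n _; exact: cI.
have cs : cvgn (series (fun n => c n * b n)).
  apply: normed_cvg; apply: (series_le_cvg _ _ _ (is_cvg_series_exp_coeff I)) => n /=.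
  - exact: normr_ge0.
  - by rewrite exp_coeff_ge0.
  - exact: cI.
set L := limn _; have cL : series (fun n => c n * b n) @ \oo --> L by exact: cs.
have tailL m : `|L - series (fun n => c n * b n) m| <= expR I - E m.
  have h : (fun k => `|series (fun n => c n * b n) k - series (fun n => c n * b n) m|) @ \oo --> `|L - series (fun n => c n * b n) m|.
    by apply: cvg_norm; apply: cvgB cL _; exact: cvg_cst.
  rewrite -(cvg_lim _ h) //; apply: limr_le; first by apply/cvg_ex; eexists; exact: h.
  by near=> k; apply: tail => //; near: k; exact: nbhs_infty_ge.
apply/cvgrPdist_le => e e0.
have e3 : 0 < e / 3 by rewrite divr_gt0.
have [m _ Hm] : \forall m \near \oo, `|expR I - E m| <= e / 3 by move/cvgrPdist_le: cE; apply.
have {}Hm : expR I - E m <= e / 3 by apply: le_trans (ler_norm _) (Hm m (leqnn m)).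
have cm : (fun j => series (fun n => c n * a j n) m) @ \oo --> series (fun n => c n * b n) m.
  rewrite /series /=; apply: cvg_sum => n _; apply: cvgM; first exact: cvg_cst.
  exact: ab.
near=> j.
have h1 : `|series (fun n => c n * b n) m - series (fun n => c n * a j n) m| <= e / 3 by near: j; move/cvgrPdist_le: cm; apply.
have h2 : (m <= N j)%N by near: j; exact: NN.
have h3 := tail (a j) m (N j) (aI j) h2.
have h4 := tailL m.
have -> : \sum_(n < N j) (-1) ^+ n / n`!%:R * a j n = series (fun n => c n * a j n) (N j) by rewrite /series /= big_mkord.
rewrite -/L.
have -> : L - series (fun n => c n * a j n) (N j) = (L - series (fun n => c n * b n) m) +
  (series (fun n => c n * b n) m - series (fun n => c n * a j n) m) -
  (series (fun n => c n * a j n) (N j) - series (fun n => c n * a j n) m) by ring.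
apply: le_trans (ler_normB _ _) _.
apply: le_trans (lerD (ler_normD _ _) (lexx _)) _.
apply: le_trans (lerD (lerD h4 h1) h3) _.
lra.
Unshelve. all: end_near. Qed.

Lemma psd_submx_at N n (f : 'I_n -> 'I_N) (A : 'M[R]_N) : psd A -> psd (submx_at f A).
Proof.
move=> [sA qA]; split; first by apply/matrixP => a b; rewrite !mxE -[in LHS]sA mxE.
move=> v; pose E : 'M[R]_(n, N) := \matrix_(a, i) (f a == i)%:R.
have -> : submx_at f A = E *m A *m E^T.
  apply/matrixP => a b; rewrite !mxE (bigD1 (f b)) //= !mxE eqxx mulr1.
  rewrite (bigD1 (f a)) //= !mxE eqxx mul1r !big1 ?addr0 // => i ne.
    by rewrite [X in _ * X]mxE [X in _ * X]mxE eq_sym (negbTE ne) mulr0.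
  by rewrite !mxE eq_sym (negbTE ne) mul0r.
have -> : v *m (E *m A *m E^T) *m v^T = (v *m E) *m A *m (v *m E)^T by rewrite trmx_mul !mulmxA.
exact: qA.
Qed.

(** Read as a step kernel of mesh [1 / h j], the matrix has a determinant whose expansion is a
    Fredholm series with integrals in place of sums. Positivity and Hadamard's inequality bound each
    minor by the product of its diagonal entries, so pointwise convergence of the kernel together
    with an integrable bound [g] on the diagonal suffices. The trace is the first order term; its
    limit serves the tail estimates. *)
Theorem fredholm_limit (s : R) (N : nat -> nat) (h : nat -> R) (k : nat -> nat -> nat -> R) (g : R -> R) :
  (forall m, \forall j \near \oo, (m <= N j)%N) ->
  (forall j, 0 < h j) ->
  (forall j, psd (\matrix_(a < N j, b < N j) k j a b)) ->
  (forall j a b, (N j <= a)%N || (N j <= b)%N -> k j a b = 0) ->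
  (forall x y, s < x -> s < y -> (fun j => h j * k j (cell_index (h j) s x) (cell_index (h j) s y)) @ \oo --> airy_kernel x y) ->
  mu.-integrable `]s, +oo[ (EFin \o g) ->
  (forall j x, s < x -> h j * k j (cell_index (h j) s x) (cell_index (h j) s x) <= g x) ->
  ((fun j => \det (1%:M - \matrix_(a < N j, b < N j) k j a b)) @ \oo --> F_GUE s) /\
  ((fun j => \sum_(a < N j) k j a a) @ \oo --> RInt `]s, +oo[ (fun x => airy_kernel x x)).
Proof.
move=> NN h0 kpsd k0 kc ig kg.
have kd j a : 0 <= k j a a.
  have [Na|aN] := leqP (N j) a; first by rewrite k0 // Na.
  by have := psd_diag (Ordinal aN) (kpsd j); rewrite mxE.
have g0 x : s < x -> 0 <= g x by move=> sx; apply: le_trans (kg 0%N x sx); rewrite mulr_ge0 // ltW.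
(* The factor [h j] sits inside the determinant, where the entries have a limit; the cell lengths
   [h^-1] compensate it in the integral. *)
pose Phi j n (ks : seq nat) : R := \det (\matrix_(a < n, b < n) (h j * k j (nth 0%N ks a) (nth 0%N ks b))).
have Phi0 j n ks : size ks = n -> has (leq (N j)) ks -> Phi j n ks = 0.
  move=> sn /(has_nthP 0%N)[i]; rewrite sn => lin Ni.
  rewrite /Phi (expand_det_row _ (Ordinal lin)) big1 // => b _; rewrite mxE /= k0 ?Ni //.
  by rewrite mulr0 mul0r.
have PhiE j n ks : size ks = n -> all (fun a => a < N j)%N ks ->
   Phi j n ks = (h j) ^+ n * \det (\matrix_(a < n, b < n) k j (nth 0%N ks a) (nth 0%N ks b)).
  move=> sn ksN; rewrite /Phi -detZ; congr (\det _); apply/matrixP => a b.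
  by rewrite !mxE.
have Phib j n ks : size ks = n -> `|Phi j n ks| <= \prod_(a <- ks) (h j * k j a a).
  move=> sn; have [hs|] := boolP (has (leq (N j)) ks).
    by rewrite Phi0 // normr0 prodr_ge0 // => a _; rewrite mulr_ge0 // ltW.
  rewrite -all_predC => /allP ha.
  have ks_lt i : (i < n)%N -> (nth 0%N ks i < N j)%N by move=> lin; rewrite ltnNge; apply: ha; rewrite mem_nth // sn.
  pose f (i : 'I_n) : 'I_(N j) := Ordinal (ks_lt i (ltn_ord i)).
  have pS := psd_submx_at f (kpsd j).
  have /andP[d0 d1] := psd_det pS.
  have dE : \det (\matrix_(a < n, b < n) k j (nth 0%N ks a) (nth 0%N ks b)) = \det (submx_at f (\matrix_(a < N j, b < N j) k j a b)).
    by congr (\det _); apply/matrixP => a b; rewrite !mxE.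
  rewrite PhiE //; last by apply/(all_nthP 0%N) => i; rewrite sn; exact: ks_lt.
  rewrite dE ger0_norm; last by rewrite mulr_ge0 // exprn_ge0 // ltW.
  rewrite big_split /= big_const_seq count_predT sn -Monoid.iteropE.
  rewrite [iterop _ _ _ _](_ : _ = h j ^+ n) //; apply: ler_wpM2l; first by rewrite exprn_ge0 // ltW.
  apply: le_trans d1 _; rewrite (big_nth 0%N) sn big_mkord.
  by apply: ler_prod => i _; rewrite !mxE kd /=.
pose a j n := iter_int s n (fun xs => Phi j n (map (cell_index (h j) s) xs)).
have cE xs : all (> s) xs -> forall x, x \in xs -> s < x by move/allP.
have conv n := @cvg_iter_int R s g n (fun j xs => Phi j n (map (cell_index (h j) s) xs)) (airy_det n) 1 ig g0 ler01.
have {}conv n : (a ^~ n @ \oo --> iter_int s n (airy_det n)) /\ (forall j, `|a j n| <= 1 * (RInt `]s, +oo[ g) ^+ n).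
  apply: conv.
  - by move=> j; have [] := iter_int_step s (h0 j) (Phi0 j n).
  - move=> xs sn axs; rewrite /Phi /airy_det /determinant.
    apply: cvg_sum => sg _; apply: cvgM; first exact: cvg_cst.
    apply: cvg_prod => i _.
    rewrite mxE; under eq_fun do rewrite mxE !(nth_map 0) ?sn //.
    by apply: kc; apply: (allP axs); rewrite mem_nth ?sn.
  - move=> j xs sn axs; rewrite mul1r; apply: le_trans (Phib j n _ _) _; first by rewrite size_map.
    rewrite big_map big_seq [leRHS]big_seq; apply: ler_prod => x xxs.
    apply/andP; split; first by rewrite mulr_ge0 // ltW.
    by apply: kg; apply: (allP axs).
have I0 : 0 <= RInt `]s, +oo[ g by apply: Rintegral_ge0 => x /=; rewrite in_itv /= andbT; exact: g0.
have aE j n : a j n = \sum_(f : {ffun 'I_n -> 'I_(N j)}) \det (submx_at f (\matrix_(a < N j, b < N j) k j a b)).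
  rewrite /a; have [_ ->] := iter_int_step s (h0 j) (Phi0 j n).
  rewrite nested_sum_ffun mulr_sumr; apply: eq_bigr => f _.
  rewrite PhiE; last 2 first.
  - by rewrite size_map -cardE card_ord.
  - by apply/allP => x /mapP[i _ ->].
  rewrite mulrA -exprMn mulVf ?gt_eqF // expr1n mul1r; congr (\det _).
  apply/matrixP => x y; rewrite [LHS]mxE [RHS]mxE mxE.
  by rewrite !(@nth_map_enum_ord n (fun i => nat_of_ord (f i))).
split.
  have aI j n : `|a j n| <= (RInt `]s, +oo[ g) ^+ n by have := (conv n).2 j; rewrite mul1r.
  have NN1 m : \forall j \near \oo, (m <= (N j).+1)%N by near=> j; apply: leqW; near: j; exact: NN.
  apply: cvg_trans (cvg_alternating_series (N := fun j => (N j).+1) I0 (fun n => (conv n).1) aI NN1).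
  apply: near_eq_cvg; near=> j; rewrite det1B_expansion.
  by apply: eq_bigr => n _; rewrite aE.
have [c1 _] := conv 1%N.
have -> : RInt `]s, +oo[ (fun x => airy_kernel x x) = iter_int s 1 (airy_det 1).
  rewrite /=; apply: eq_Rintegral => x _; rewrite /airy_det det_mx11 mxE /=.
  by [].
apply: cvg_trans c1; apply: near_eq_cvg; near=> j.
rewrite /a; have [_ ->] := iter_int_step s (h0 j) (Phi0 j 1%N).
rewrite expr1 /= mulr_sumr; apply: eq_bigr => x _.
by rewrite /Phi det_mx11 mxE /= mulrA mulVf ?mul1r // gt_eqF.
Unshelve. all: end_near. Qed.

End FredholmLimit.

(** * The Airy function *)

Section Calculus.
Variable R : realType.
Implicit Types f F : R -> R.

Lemma integrable_continuous_itv f a b : continuous f -> mu.-integrable `[a, b] (EFin \o f).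
Proof.
move=> cf; apply: continuous_compact_integrable; first exact: segment_compact.
exact: continuous_subspaceT.
Qed.

Lemma Rintegral_FTC2 F f a b : a <= b -> continuous f -> (forall x : R, is_derive x 1 F (f x)) -> RInt `[a, b] f = F b - F a.
Proof.
rewrite le_eqVlt => /orP[/eqP ->|ab] cf dF.
  by rewrite set_itv1 Rintegral_set1 subrr.
rewrite /Rintegral (@continuous_FTC2 _ f F a b ab) //.
- exact: continuous_subspaceT.
- have dcF (x : R) : F y @[y --> x] --> F x by have [dx _] := dF x; apply: differentiable_continuous; apply/derivable1_diffP.
  split=> [x _||].
  + by have [] := dF x.
  + by apply: cvg_at_right_filter; exact: dcF.
  + by apply: cvg_at_left_filter; exact: dcF.
- by move=> x _; rewrite derive1E; have [] := dF x.
Qed.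

Lemma is_derive_continuous f df : (forall x : R, is_derive x 1 f (df x)) -> continuous f.
Proof.
move=> dF x; have [dx _] := dF x.
by apply: differentiable_continuous; apply/derivable1_diffP.
Qed.

Lemma integrable_lebZ (D : set R) c f : measurable D -> mu.-integrable D (EFin \o f) -> mu.-integrable D (EFin \o (fun x => c * f x)).
Proof. by move=> mD fi; exact: (@integrableZl _ (measurableTypeR R) R mu D mD c _ fi). Qed.

Lemma integrable_leb_le (D : set R) f g : measurable D -> measurable_fun D f -> (forall x, D x -> `|f x| <= g x) -> mu.-integrable D (EFin \o g) ->
  mu.-integrable D (EFin \o f).
Proof.
move=> mD mf fg gi.
apply: (@le_integrable _ (measurableTypeR R) R mu D mD (EFin \o f) (EFin \o g) _ _ gi).
  exact/measurable_EFinP.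
by move=> x Dx /=; rewrite lee_fin; apply: le_trans (fg x Dx) (ler_norm _).
Qed.

Lemma integrable_leb_measurable (D : set R) f : mu.-integrable D (EFin \o f) -> measurable_fun D f.
Proof. by move=> fi; apply/measurable_EFinP; exact: measurable_int fi. Qed.

Lemma cvg_Rintegral_leb (D : set R) (f_ : nat -> R -> R) f g : measurable D -> (forall n, measurable_fun D (f_ n)) ->
  (forall x, D x -> f_ ^~ x @ \oo --> f x) ->
  mu.-integrable D (EFin \o g) ->
  (forall n x, D x -> `|f_ n x| <= g x) ->
  mu.-integrable D (EFin \o f) /\
  (RInt D (f_ n) @[n --> \oo] --> RInt D f).
Proof.
move=> mD mf cf gi fg.
by have [h1 h2 _ _] := @cvg_Rintegral R _ (measurableTypeR R) mu D f_ f g mD mf cf gi fg.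
Qed.

Lemma le_Rintegral_leb (D : set R) f g : measurable D -> mu.-integrable D (EFin \o f) -> mu.-integrable D (EFin \o g) ->
  (forall x, D x -> f x <= g x) -> RInt D f <= RInt D g.
Proof. by move=> mD fi gi fg; exact: (@le_Rintegral _ (measurableTypeR R)). Qed.

Lemma is_derive_under_integral (f df : R -> R -> R) (D : set R) (a e : R) (G : R -> R) : measurable D -> 0 < e ->
  (forall x, a - e < x < a + e -> mu.-integrable D (EFin \o f x)) ->
  (forall x y, a - e < x < a + e -> D y -> is_derive x 1 (f ^~ y) (df x y)) ->
  mu.-integrable D (EFin \o G) -> (forall y, 0 <= G y) ->
  (forall x y, a - e < x < a + e -> D y -> `|df x y| <= G y) ->
  is_derive a 1 (fun x => RInt D (f x)) (RInt D (df a)).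
Proof.
move=> mD e0 fi fd Gi G0 dG.
have Ia : `]a - e, a + e[%classic a by rewrite /= in_itv /=; apply/andP; split; lra.
have II x : `]a - e, a + e[%classic x -> a - e < x < a + e by rewrite /= in_itv.
have h1 x : `]a - e, a + e[%classic x -> mu.-integrable D (EFin \o f x) by move/II; exact: fi.
have h2 x y : `]a - e, a + e[%classic x -> D y -> derivable (f ^~ y) x 1 by move=> /II hx Dy; have [] := fd x y hx Dy.
have h3 x y : `]a - e, a + e[%classic x -> D y -> `|partial1of2 f x y| <= G y.
  by move=> /II hx Dy; rewrite partial1of2E; have [_ ->] := fd x y hx Dy; exact: dG.
apply: DeriveDef.
  exact: (@derivable_under_integral R _ (measurableTypeR R) mu f D mD _ _ _ Ia h1 h2 G G0 Gi h3).
rewrite -derive1E.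
rewrite (@differentiation_under_integral R _ (measurableTypeR R) mu f D mD _ _ _ Ia h1 h2 G G0 Gi h3).
apply: eq_Rintegral => y; rewrite inE => Dy; rewrite partial1of2E.
by have [_ ->] := fd a y (II _ Ia) Dy.
Qed.

Lemma integrable_expRN (c a : R) : 0 < c -> mu.-integrable `[a, +oo[ (EFin \o (fun x => expR (- (c * x)))).
Proof.
move=> c0; have cE : continuous (fun x : R => expR (- (c * x))) by derivable_continuous.
apply/integrableP; split.
  by apply/measurable_EFinP; exact: continuous_measurable_funS.
under eq_integral => x _ do rewrite /= ger0_norm ?expR_ge0 //.
have dF (x : R) : is_derive x 1 (fun x => - (c^-1 * expR (- (c * x)))) (expR (- (c * x))) by derive_eq; field; rewrite gt_eqF.
rewrite (@ge0_continuous_FTC2y _ _ (fun x => - (c^-1 * expR (- (c * x)))) _ 0).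
- by rewrite -EFinB ltry.
- by move=> x _; exact: expR_ge0.
- exact: continuous_subspaceT.
- rewrite -[X in _ --> X]oppr0 -[X in _ --> - X](mulr0 c^-1).
  apply: cvgN; apply: cvgM; first exact: cvg_cst.
  apply: (cvg_comp (fun x : R => c * x) (fun x => expR (- x))); last exact: cvgr_expR.
  exact: gt0_cvgMry.
- by move=> x _; have [] := dF x.
- by apply: cvg_at_right_filter; exact: (is_derive_continuous dF).
- by move=> x _; rewrite derive1E; have [] := dF x.
Qed.

(** Modulus, and in [airy_arg] the argument, of [e^(z^3/3 - x z)] at [z = d - i y]. *)
Definition airy_mod (d x y : R) := expR (d ^+ 3 / 3 - d * y ^+ 2 - x * d).
Definition airy_arg (d x y : R) := y ^+ 3 / 3 + x * y - d ^+ 2 * y.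

Lemma airy_is_derive_y (d x y : R) : is_derive y 1 (fun y => airy_mod d x y * sin (airy_arg d x y))
   (airy_mod d x y * ((y ^+ 2 + x - d ^+ 2) * cos (airy_arg d x y) - 2 * d * y * sin (airy_arg d x y))).
Proof. by rewrite /airy_mod /airy_arg; derive_eq; field. Qed.

(** A Cauchy-Riemann equation: the [d] derivative of the real part is the opposite of the [y]
    derivative of the imaginary part. *)
Lemma airy_is_derive_d (d x y : R) : is_derive d 1 (fun d => airy_mod d x y * cos (airy_arg d x y))
   (- (airy_mod d x y * ((y ^+ 2 + x - d ^+ 2) * cos (airy_arg d x y) - 2 * d * y * sin (airy_arg d x y)))).
Proof. by rewrite /airy_mod /airy_arg; derive_eq; field. Qed.

Lemma airy_integrand_continuous (d x : R) : continuous (fun y => airy_mod d x y * cos (airy_arg d x y)).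
Proof. by rewrite /airy_mod /airy_arg; derivable_continuous. Qed.

Lemma airy_dy_continuous (d x : R) :
  continuous (fun y => airy_mod d x y * ((y ^+ 2 + x - d ^+ 2) * cos (airy_arg d x y) - 2 * d * y * sin (airy_arg d x y))).
Proof. by rewrite /airy_mod /airy_arg; derivable_continuous. Qed.

(** After differentiation under the integral the integrand is an exact [y] derivative by
    Cauchy-Riemann. Only the end [T] contributes, because the argument is zero at [y = 0]. *)
Lemma airy_vertical_derive (x T d0 : R) : 0 <= T -> is_derive d0 1 (fun d => RInt `[0, T] (fun y => airy_mod d x y * cos (airy_arg d x y)))
    (- (airy_mod d0 x T * sin (airy_arg d0 x T))).
Proof.
move=> T0.
pose M := (T ^+ 2 + `|x| + (`|d0| + 1) ^+ 2 + 2 * (`|d0| + 1) * T) * expR ((`|d0| + 1) ^+ 3 / 3 + (`|d0| + 1) * T ^+ 2 + `|x| * (`|d0| + 1)).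
have dd d y := airy_is_derive_d d x y.
have M0 : 0 <= M by rewrite mulr_ge0 ?expR_ge0 // !addr_ge0 ?sqr_ge0 // !mulr_ge0 ?addr_ge0.
have h3 : mu.-integrable `[0, T] (EFin \o (fun=> M)) by apply: integrable_continuous_itv => y; exact: cst_continuous.
have h4 d y : d0 - 1 < d < d0 + 1 -> `[0, T]%classic y ->
   `|- (airy_mod d x y * ((y ^+ 2 + x - d ^+ 2) * cos (airy_arg d x y) - 2 * d * y * sin (airy_arg d x y)))| <= M.
  rewrite /= !in_itv /= => /andP[d1 d2] /andP[y1 y2].
  have dle : `|d| <= `|d0| + 1.
    have : `|d - d0| <= 1 by rewrite ler_norml; apply/andP; split; lra.
    by have := ler_normD d0 (d - d0); rewrite addrC subrK; lra.
  have y2T : y ^+ 2 <= T ^+ 2 by rewrite ler_sqr ?nnegrE.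
  have d2le : d ^+ 2 <= (`|d0| + 1) ^+ 2 by rewrite -[d ^+ 2]real_normK ?num_real // ler_sqr ?nnegrE ?addr_ge0.
  rewrite normrN normrM [X in X * _]ger0_norm ?expR_ge0 // mulrC.
  apply: ler_pM; rewrite ?normr_ge0 ?expR_ge0 //.
    apply: le_trans (ler_normB _ _) _; rewrite !normrM; apply: lerD.
      rewrite -[leRHS]mulr1; apply: ler_pM => //; last exact: cos_max.
      apply: le_trans (ler_normB _ _) _; apply: lerD.
        apply: le_trans (ler_normD _ _) _; apply: lerD => //.
        by rewrite ger0_norm ?sqr_ge0.
      by rewrite ger0_norm ?sqr_ge0.
    rewrite -[leRHS]mulr1; apply: ler_pM => //; last exact: sin_max.
    rewrite (ger0_norm (_ : 0 <= 2)) // (ger0_norm y1).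
    by rewrite -!mulrA ler_pM2l //; apply: ler_pM.
  rewrite /airy_mod ler_expR.
  have a1 : d ^+ 3 <= (`|d0| + 1) ^+ 3.
    apply: le_trans (ler_norm _) _; rewrite normrX.
    by apply: lerXn2r; rewrite ?nnegrE ?addr_ge0.
  have a2 : - (d * y ^+ 2) <= (`|d0| + 1) * T ^+ 2.
    apply: le_trans (ler_norm _) _; rewrite normrN normrM (ger0_norm (sqr_ge0 y)).
    by apply: ler_pM; rewrite ?sqr_ge0.
  have a3 : - (x * d) <= `|x| * (`|d0| + 1).
    apply: le_trans (ler_norm _) _; rewrite normrN normrM.
    by apply: ler_pM.
  by lra.
apply: is_derive_eq.
  apply: (is_derive_under_integral (measurable_itv _) ltr01 _ _ h3 (fun=> M0) h4) => //.
  by move=> d _; apply: integrable_continuous_itv; exact: airy_integrand_continuous.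
under eq_Rintegral do rewrite -mulN1r.
rewrite RintegralZl //; last by apply: integrable_continuous_itv; exact: airy_dy_continuous.
rewrite (Rintegral_FTC2 T0 (@airy_dy_continuous d0 x) (airy_is_derive_y d0 x)).
by rewrite /airy_arg !expr0n /= !mulr0 mul0r !addr0 subrr sin0 mulr0 subr0 mulN1r.
Qed.

(* Cauchy's theorem for e^(z^3/3 - x z) on the rectangle with sides Re z = 0, Re z = d,
   Im z = 0, Im z = -T. *)
Lemma airy_shift_itv (d x T : R) : 0 <= d -> 0 < T -> `|RInt `[0, T] (fun y => airy_mod d x y * cos (airy_arg d x y)) -
    RInt `[0, T] (fun y => cos (y ^+ 3 / 3 + x * y))| <=
  expR (d ^+ 3 / 3 + `|x| * d) / T ^+ 2.
Proof.
move=> d0 T0.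
set C := expR _.
pose J d := RInt `[0, T] (fun y => airy_mod d x y * cos (airy_arg d x y)).
have J0 : J 0 = RInt `[0, T] (fun y => cos (y ^+ 3 / 3 + x * y)).
  apply: eq_Rintegral => y _; rewrite /airy_mod /airy_arg !expr0n /= !mul0r mulr0 !subr0 expR0.
  by rewrite mul1r.
rewrite -J0 -/(J d).
have dJ (c : R) : is_derive c 1 J (- (airy_mod c x T * sin (airy_arg c x T))) by apply: airy_vertical_derive; exact: ltW.
have bJ c : 0 <= c <= d -> `|airy_mod c x T * sin (airy_arg c x T)| <= C * expR (- (T ^+ 2 * c)).
  move=> /andP[c0 cd]; rewrite normrM ger0_norm ?expR_ge0 // -[leRHS]mulr1.
  apply: ler_pM => //; rewrite ?expR_ge0 ?sin_max // -expRD ler_expR.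
  have : c ^+ 3 <= d ^+ 3 by apply: lerXn2r.
  have : - (x * c) <= `|x| * d.
    apply: le_trans (ler_norm _) _; rewrite normrN normrM (ger0_norm c0).
    by apply: ler_wpM2l.
  by rewrite [T ^+ 2 * c]mulrC; lra.
have T2 : 0 < T ^+ 2 by rewrite exprn_gt0.
(* Both signs at once: [G] is the integrated bound [C * expR (- (T ^+ 2 * c))] minus [e * J], hence
   nondecreasing on [[0, d]]. *)
have mono (e : R) : `|e| = 1 -> e * (J d - J 0) <= C / T ^+ 2 * (1 - expR (- (T ^+ 2 * d))).
  move=> e1.
  pose G c := C / T ^+ 2 * (1 - expR (- (T ^+ 2 * c))) - e * J c.
  have dG (c : R) : is_derive c 1 G (C * expR (- (T ^+ 2 * c)) + e * (airy_mod c x T * sin (airy_arg c x T))).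
    have dJc := dJ c; derive_eq.
    by field; rewrite gt_eqF.
  have : G 0 <= G d.
    apply: (@ger0_derive1_le_cc _ G 0 d) => //; rewrite ?in_itv /= ?lexx ?d0 //.
    - move=> c; rewrite in_itv /= => /andP[c0 cd].
      rewrite derive1E; have [_ ->] := dG c.
      have : 0 <= c <= d by rewrite (ltW c0) (ltW cd).
      move/bJ.
      have : `|e * (airy_mod c x T * sin (airy_arg c x T))| = `|airy_mod c x T * sin (airy_arg c x T)| by rewrite normrM e1 mul1r.
      by move=> <-; rewrite ler_norml => /andP[+ _]; lra.
    - by apply: continuous_subspaceT; exact: (is_derive_continuous dG).
  by rewrite /G mulr0 oppr0 expR0 subrr mulr0 sub0r; lra.
have Cb : C / T ^+ 2 * (1 - expR (- (T ^+ 2 * d))) <= C / T ^+ 2.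
  apply: ler_piMr; first by rewrite divr_ge0 ?expR_ge0 ?sqr_ge0.
  by have := expR_ge0 (- (T ^+ 2 * d)); lra.
rewrite ler_norml; apply/andP; split.
  have := mono (-1); rewrite normrN1 => /(_ erefl); lra.
by have := mono 1; rewrite normr1 => /(_ erefl); lra.
Qed.

Lemma airy_mod_le (d x y : R) : 0 <= d -> airy_mod d x y <= expR (d ^+ 3 / 3 - x * d + d) * expR (- (2 * d * y)).
Proof.
move=> d0; rewrite -expRD ler_expR.
have : 0 <= d * (y - 1) ^+ 2 by rewrite mulr_ge0 ?sqr_ge0.
by lra.
Qed.

Lemma airy_integrand_integrable (d x : R) : 0 < d -> mu.-integrable Rge0 (EFin \o (fun y => airy_mod d x y * cos (airy_arg d x y))).
Proof.
move=> d0; have cf := @airy_integrand_continuous d x.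
have i1 := @integrable_expRN (2 * d) 0 (mulr_gt0 (ltr0Sn _ 1) d0).
have := integrable_lebZ (expR (d ^+ 3 / 3 - x * d + d)) (measurable_itv _) i1.
apply: integrable_leb_le => //.
  by exact: continuous_measurable_funS.
move=> y _ /=; rewrite normrM -[leRHS]mulr1; apply: ler_pM => //; last exact: cos_max.
by rewrite ger0_norm ?expR_ge0 //; apply: airy_mod_le; exact: ltW.
Qed.

Lemma cvg_Rintegral_itvcy f (a : R) (T : nat -> R) : mu.-integrable `[a, +oo[ (EFin \o f) -> T @ \oo --> +oo ->
  (fun n => RInt `[a, T n] f) @ \oo --> RInt `[a, +oo[ f.
Proof.
move=> fi Ty.
have E n : RInt `[a, T n] f = RInt `[a, +oo[ (f \_ `[a, T n]%classic).
  rewrite -Rintegral_mkcondr; congr (Rintegral _ _ _); apply/esym/setIidPr => y /=.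
  by rewrite !in_itv /= andbT => /andP[].
under eq_fun do rewrite E.
have mf := integrable_leb_measurable fi.
have fn : mu.-integrable `[a, +oo[ (EFin \o (fun y => `|f y|)) by exact: (@integrable_norm _ (measurableTypeR R) _ mu).
have h1 n : measurable_fun `[a, +oo[%classic (f \_ `[a, T n]%classic) by apply/measurable_restrict => //; apply: measurable_funS mf => // y [].
have h2 y : `[a, +oo[%classic y -> (fun n => (f \_ `[a, T n]%classic) y) @ \oo --> f y.
  move=> ay; apply: cvg_near_cst; near=> n; rewrite patchE ifT // inE /=.
  move: ay; rewrite /= !in_itv /= andbT => -> /=.
  by near: n; move/cvgryPge : Ty; exact.
have h3 n y : `[a, +oo[%classic y -> `|(f \_ `[a, T n]%classic) y| <= `|f y| by move=> _; rewrite patchE; case: ifP => // _; rewrite normr0.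
exact: (cvg_Rintegral_leb (measurable_itv _) h1 h2 fn h3).2.
Unshelve. all: end_near. Qed.

(** The horizontal side at height [T] costs [O(T^-2)], so the conditionally convergent integral
    equals an absolutely convergent one on any line [Re z = d > 0]. The asymptotics use [d = 1], the
    positivity of [Airy 4] uses [d = 2]. *)
Theorem Airy_shift (d x : R) : 0 < d ->
  Airy x = pi^-1 * RInt Rge0 (fun y => airy_mod d x y * cos (airy_arg d x y)).
Proof.
move=> d0; rewrite /Airy; congr (_ * _).
set I := Rintegral _ _ _.
suff : (RInt `[0, T] (fun s => cos (s ^+ 3 / 3 + x * s))) @[T --> +oo] --> I.
  by move/cvg_lim => -> //.
apply/cvg_pinftyP => T Ty.
have c1 := cvg_Rintegral_itvcy (airy_integrand_integrable x d0) Ty.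
rewrite -/I in c1.
set C := expR (d ^+ 3 / 3 + `|x| * d).
have C0 : 0 < C by exact: expR_gt0.
apply/cvgrPdist_le => e e0.
have e2 : 0 < e / 2 by rewrite divr_gt0.
near=> n.
have T1 : 1 <= T n by near: n; move/cvgryPge : Ty; exact.
have T2 : C / (e / 2) <= T n by near: n; move/cvgryPge : Ty; exact.
have h1 : `|I - RInt `[0, T n] (fun y => airy_mod d x y * cos (airy_arg d x y))| <= e / 2 by near: n; move/cvgrPdist_le : c1; exact.
have T0 : 0 < T n by apply: lt_le_trans T1.
have h2 := airy_shift_itv x (ltW d0) T0; rewrite -/C in h2.
have h3 : C / T n ^+ 2 <= e / 2.
  rewrite ler_pdivrMr ?exprn_gt0 //; move: T2; rewrite ler_pdivrMr // => T2.
  apply: le_trans T2 _; rewrite mulrC ler_pM2l // expr2.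
  by rewrite -[leLHS]mul1r ler_pM2r.
set a := Rintegral _ _ (fun s => cos _) in h2 *.
set b := Rintegral _ _ _ in h1 h2.
rewrite (_ : I - a = (I - b) + (b - a)); last by ring.
by apply: le_trans (ler_normD _ _) _; lra.
Unshelve. all: end_near. Qed.
End Calculus.

(** * Taylor bounds for the elementary functions *)

Section ElementaryInequalities.
Variable R : realType.
Implicit Types (F G dF dG : R -> R).

Lemma le_of_derive_itv F G dF dG (a b : R) : (forall x : R, a <= x <= b -> is_derive x 1 F (dF x)) ->
  (forall x : R, a <= x <= b -> is_derive x 1 G (dG x)) ->
  F a <= G a -> (forall x, a <= x <= b -> dF x <= dG x) -> a <= b -> F b <= G b.
Proof.
move=> hF hG Fa FG ab.
have hH (y : R) : a <= y <= b -> is_derive y 1 (G - F) (dG y - dF y) by move=> yab; have h1 := hF y yab; have h2 := hG y yab; exact: is_deriveB.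
have : (G - F) a <= (G - F) b.
  have sub y : y \in `]a, b[ -> a <= y <= b by rewrite in_itv /= => /andP[/ltW -> /ltW ->].
  apply: (@ger0_derive1_le_cc _ (G - F) a b) => //; rewrite ?in_itv /= ?lexx ?ab //.
  - by move=> y /sub yab; have [] := hH y yab.
  - move=> y /sub yab; rewrite derive1E; have [_ ->] := hH y yab.
    by rewrite subr_ge0 FG.
  - apply: continuous_in_subspaceT => y; rewrite inE /= in_itv /= => yab.
    have [dx _] := hH y yab.
    by apply: differentiable_continuous; apply/derivable1_diffP.
by rewrite !fctE; lra.
Qed.

Lemma le_of_derive F G dF dG (a : R) : (forall x : R, is_derive x 1 F (dF x)) -> (forall x : R, is_derive x 1 G (dG x)) ->
  F a <= G a -> (forall x, a <= x -> dF x <= dG x) -> forall x, a <= x -> F x <= G x.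
Proof.
move=> hF hG Fa FG x ax; apply: (@le_of_derive_itv F G dF dG a x) => // y /andP[ay _].
exact: FG.
Qed.

Lemma sin_le (t : R) : 0 <= t -> sin t <= t.
Proof.
apply: (le_of_derive (F := sin) (G := id) (dF := cos) (dG := fun=> 1)) => //.
by rewrite sin0.
Qed.

Lemma cos_ge (t : R) : 0 <= t -> 1 - t ^+ 2 / 2 <= cos t.
Proof.
apply: (le_of_derive (F := fun t => 1 - t ^+ 2 / 2) (G := cos) (dF := fun t => - t) (dG := fun t => - sin t)) => //.
- by move=> x; derive_eq; field.
- by rewrite cos0 expr0n /=; lra.
- by move=> x x0; rewrite lerN2 sin_le.
Qed.

Lemma sin_ge (t : R) : 0 <= t -> t - t ^+ 3 / 6 <= sin t.
Proof.
apply: (le_of_derive (F := fun t => t - t ^+ 3 / 6) (G := sin) (dF := fun t => 1 - t ^+ 2 / 2) (dG := cos)) => //.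
- by move=> x; derive_eq; field.
- by rewrite sin0 expr0n /=; lra.
- by move=> x x0; exact: cos_ge.
Qed.

Lemma cos_le (t : R) : 0 <= t -> cos t <= 1 - t ^+ 2 / 2 + t ^+ 4 / 24.
Proof.
apply: (le_of_derive (F := cos) (G := fun t => 1 - t ^+ 2 / 2 + t ^+ 4 / 24) (dF := fun t => - sin t) (dG := fun t => - (t - t ^+ 3 / 6))) => //.
- by move=> x; derive_eq; field.
- by rewrite cos0 !expr0n /=; lra.
- by move=> x x0; rewrite lerN2 sin_ge.
Qed.

(** Up to 2 the fourth order Taylor bound suffices; between 2 and [pi] the cosine is at most 0 and
    [t ^+ 2 <= 16]. *)
Lemma onem_cos_ge (t : R) : 0 <= t <= pi -> t ^+ 2 / 16 <= 1 - cos t.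
Proof.
move=> /andP[t0 tpi].
have pi4 : pi <= 4 :> R by have := pihalf_lt2 R; lra.
have [t2|t2] := leP t 2.
  have := cos_le t0.
  have : 0 <= t ^+ 2 * (4 - t ^+ 2) by rewrite mulr_ge0 ?sqr_ge0 // subr_ge0 (_ : 4 = 2 ^+ 2) ?ler_sqr ?nnegrE //; lra.
  by have := sqr_ge0 t; rewrite (_ : t ^+ 4 = t ^+ 2 * t ^+ 2) -?exprD //; lra.
have : cos t <= 0.
  have := @cos_ge0_pihalf R (pi - t); rewrite cosB cospi sinpi mul0r addr0 mulN1r oppr_ge0.
  apply; apply/andP; split; first by have := pi_ge0 R; lra.
  by have := pihalf_lt2 R; lra.
have : t ^+ 2 <= 16 by rewrite (_ : 16 = 4 ^+ 2) ?ler_sqr ?nnegrE //; lra.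
by lra.
Qed.

Lemma is_derive_ln1D (u : R) : -1 < u -> is_derive u 1 (fun u => ln (1 + u)) (1 + u)^-1.
Proof.
move=> u1; have h : is_derive (1 + u) 1 (@ln R) (1 + u)^-1 by apply: is_derive1_ln; lra.
have h2 : is_derive u 1 (fun u : R => 1 + u) (0 + 1) by exact: is_deriveD.
rewrite add0r in h2.
have := is_derive1_comp h h2; rewrite mulr1; exact.
Qed.

Lemma ln1D_taylor (u : R) : 0 <= u ->
  - (u ^+ 4 / 4) <= ln (1 + u) - (u - u ^+ 2 / 2 + u ^+ 3 / 3) <= 0.
Proof.
move=> u0.
have dL (x : R) : 0 <= x <= u -> is_derive x 1 (fun u => ln (1 + u)) (1 + x)^-1 by move=> /andP[x0 _]; apply: is_derive_ln1D; lra.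
have inv x : 0 <= x <= u -> 0 < 1 + x by move=> /andP[]; lra.
have h1 : ln (1 + u) <= u - u ^+ 2 / 2 + u ^+ 3 / 3.
  apply: (@le_of_derive_itv (fun u => ln (1 + u)) (fun u => u - u ^+ 2 / 2 + u ^+ 3 / 3)
    (fun x => (1 + x)^-1) (fun x => 1 - x + x ^+ 2) 0 u dL) => //.
  - by move=> x _; derive_eq; field.
  - by rewrite addr0 ln1 !expr0n /= !mul0r subr0 addr0.
  - move=> x xu; rewrite -[(1 + x)^-1]mul1r ler_pdivrMr ?inv //.
    have : 0 <= x ^+ 3 by apply: exprn_ge0; case/andP: xu.
    by rewrite exprS; lra.
have h2 : u - u ^+ 2 / 2 + u ^+ 3 / 3 - u ^+ 4 / 4 <= ln (1 + u).
  apply: (@le_of_derive_itv (fun u => u - u ^+ 2 / 2 + u ^+ 3 / 3 - u ^+ 4 / 4) (fun u => ln (1 + u))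
    (fun x => 1 - x + x ^+ 2 - x ^+ 3) (fun x => (1 + x)^-1) 0 u _ dL) => //.
  - by move=> x _; derive_eq; field.
  - by rewrite addr0 ln1 !expr0n /= !mul0r subr0 addr0 subr0.
  - move=> x xu; rewrite -[(1 + x)^-1]mul1r ler_pdivlMr ?inv //.
    have : 0 <= x ^+ 4 by apply: exprn_ge0; case/andP: xu.
    by rewrite !exprS expr0; lra.
by apply/andP; split; lra.
Qed.

Lemma ln1B_taylor (u : R) : 0 <= u <= 2^-1 ->
  - (u ^+ 4 / 2) <= ln (1 - u) - (- u - u ^+ 2 / 2 - u ^+ 3 / 3) <= 0.
Proof.
move=> /andP[u0 u2].
have dL (x : R) : 0 <= x <= u -> is_derive x 1 (fun u => ln (1 - u)) (- (1 - x)^-1).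
  move=> /andP[x0 xu]; have h := @is_derive_ln1D (- x).
  have {}h : is_derive (- x) 1 (fun u => ln (1 + u)) (1 - x)^-1 by apply: h; lra.
  have h2 : is_derive x 1 (fun u : R => - u) (- 1) by exact: is_deriveN.
  by have := is_derive1_comp h h2; rewrite mulrN1; exact.
have inv x : 0 <= x <= u -> 0 < 1 - x by move=> /andP[]; lra.
have h1 : ln (1 - u) <= - u - u ^+ 2 / 2 - u ^+ 3 / 3.
  apply: (@le_of_derive_itv (fun u => ln (1 - u)) (fun u => - u - u ^+ 2 / 2 - u ^+ 3 / 3)
    (fun x => - (1 - x)^-1) (fun x => - 1 - x - x ^+ 2) 0 u dL) => //.
  - by move=> x _; derive_eq; field.
  - by rewrite subr0 ln1 !expr0n /= !mul0r !subr0 oppr0.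
  - move=> x xu; rewrite -!opprD lerN2 -[(1 - x)^-1]mul1r ler_pdivlMr ?inv //.
    have : 0 <= x ^+ 3 by apply: exprn_ge0; case/andP: xu.
    by rewrite !exprS expr0; lra.
have h2 : - u - u ^+ 2 / 2 - u ^+ 3 / 3 - u ^+ 4 / 2 <= ln (1 - u).
  apply: (@le_of_derive_itv (fun u => - u - u ^+ 2 / 2 - u ^+ 3 / 3 - u ^+ 4 / 2) (fun u => ln (1 - u))
    (fun x => - 1 - x - x ^+ 2 - 2 * x ^+ 3) (fun x => - (1 - x)^-1) 0 u _ dL) => //.
  - by move=> x _; derive_eq; field.
  - by rewrite subr0 ln1 !expr0n /= !mul0r !subr0 oppr0.
  - move=> x xu; rewrite -!opprD lerN2 -[(1 - x)^-1]mul1r ler_pdivrMr ?inv //.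
    have x3 : 0 <= x ^+ 3 by apply: exprn_ge0; case/andP: xu.
    have : 0 <= x ^+ 3 * (1 - 2 * x) by rewrite mulr_ge0 //; case/andP: xu; lra.
    by rewrite !exprS expr0; lra.
by apply/andP; split; lra.
Qed.
End ElementaryInequalities.

(** * Laguerre functions *)

Section LaguerreIntegral.
Variable R : realType.

(** The coefficient of [w^n] in [(1 - w)^m e^(x w)], which is [(-1)^n] times the Laguerre polynomial
    of degree [n] and parameter [m - n]. *)
Definition lagf (m n : nat) (x : R) : R := \sum_(k < n.+1) (-1) ^+ (n - k) * 'C(m, n - k)%:R * (x ^+ k / k`!%:R).

Lemma lagf_0l n x : lagf 0 n x = x ^+ n / n`!%:R.
Proof.
rewrite /lagf big_ord_recr /= subnn expr0 bin0 !mul1r big1 ?add0r // => k _.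
by rewrite bin0n subn_eq0 leqNgt ltn_ord mulr0 mul0r.
Qed.

Lemma lagf_0r m x : lagf m 0 x = 1.
Proof. by rewrite /lagf big_ord1 subnn !expr0 bin0 fact0 !mul1r invr1. Qed.

Lemma lagf_pascal m n x : lagf m.+1 n.+1 x = lagf m n.+1 x - lagf m n x.
Proof.
rewrite /lagf big_ord_recr [in X in _ = X - _]big_ord_recr /= !subnn !bin0 addrAC; congr (_ + _).
rewrite -sumrB; apply: eq_bigr => k _; rewrite subSn; last by rewrite -ltnS.
by rewrite binS natrD exprS; ring.
Qed.

(** Real part of [e^(z e^(i t)) e^(-i k t)]; its mean over the half circle extracts a Taylor
    coefficient of the exponential with real integrals only. *)
Definition wave (z : R) (k : int) (t : R) := expR (z * cos t) * cos (z * sin t - k%:~R * t).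
Definition wave_coef z k := pi^-1 * RInt `[0, pi] (wave z k).

Lemma wave_continuous z k : continuous (wave z k).
Proof. by rewrite /wave; derivable_continuous. Qed.

Lemma sinpi_int (k : int) : sin (k%:~R * pi) = 0 :> R.
Proof.
have h n : sin (n%:R * pi) = 0 :> R by elim: n => [|n IH]; rewrite ?mul0r ?sin0 // -natr1 mulrDl mul1r sinDpi IH oppr0.
by case: k => n; [exact: h|rewrite NegzE mulrNz mulNr sinN h oppr0].
Qed.

(** The imaginary part [expR (z * cos t) * sin (z * sin t - k%:~R * t)] vanishes at both ends of
    [[0, pi]]; integrating its derivative gives the recursion satisfied by [z^k / k!]. *)
Lemma wave_coef_rec z k : k%:~R * wave_coef z k = z * wave_coef z (k - 1).
Proof.
have cw j := wave_continuous (z := z) (k := j).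
have iw j := integrable_continuous_itv 0 pi (cw j).
have dF (t : R) : is_derive t 1 (fun t => expR (z * cos t) * sin (z * sin t - k%:~R * t)) (z * wave z (k - 1) t - k%:~R * wave z k t).
  derive_eq; rewrite /wave.
  have -> : z * sin t - (k - 1)%:~R * t = t + (z * sin t - k%:~R * t) by rewrite intrB; ring.
  move: (z * sin t - _) => B; rewrite (cosD t B); ring.
have cd : continuous (fun t => z * wave z (k - 1) t - k%:~R * wave z k t) by move=> t; apply: cvgB; apply: cvgM; first [exact: cvg_cst|exact: cw].
have := Rintegral_FTC2 (pi_ge0 R) cd dF.
rewrite sin0 cospi sinpi !mulr0 subrr sin0 mulr0 subr0 sub0r sinN sinpi_int oppr0 mulr0.
rewrite RintegralB //; last 2 first.
- by apply: integrable_lebZ => //; exact: iw.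
- by apply: integrable_lebZ => //; exact: iw.
rewrite !RintegralZl //; try exact: iw.
by rewrite /wave_coef => /eqP; rewrite subr_eq0 => /eqP h; rewrite !(mulrCA _ pi^-1) h.
Qed.

Lemma wave_coef_neg z k : k < 0 -> z != 0 -> wave_coef z k = 0.
Proof.
have h n : z != 0 -> wave_coef z (- n.+1%:Z) = 0.
  elim: n => [|n IH] z0.
    have := wave_coef_rec z 0; rewrite mul0r => /esym/eqP.
    by rewrite mulf_eq0 (negbTE z0) /= => /eqP.
  have := wave_coef_rec z (- n.+1%:Z); rewrite IH // mulr0 => /esym/eqP.
  rewrite mulf_eq0 (negbTE z0) /= => /eqP <-; congr (wave_coef _ _); lia.
case: k => // n _ z0; rewrite NegzE; exact: h.
Qed.

Lemma wave_coef_at0 k : k != 0 -> wave_coef 0 k = 0.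
Proof.
move=> k0; have := wave_coef_rec 0 k; rewrite mul0r => /eqP.
by rewrite mulf_eq0 intr_eq0 (negbTE k0) /= => /eqP.
Qed.

(** The [z] derivative of the coefficient of index 0 is the one of index -1, which the recursion
    shows to be zero; so the value is that at [z = 0]. *)
Lemma wave_coef0 z : wave_coef z 0 = 1.
Proof.
have dW (x : R) : is_derive x 1 (fun z => wave_coef z 0) 0.
  pose f (z t : R) := wave z 0 t.
  pose df (z t : R) := wave z (-1) t.
  have hd (w t : R) : is_derive w 1 (f ^~ t) (df w t).
    derive_eq; rewrite /df /wave /= mulN1r opprK mul0r subr0 cosD.
    by ring.
  have M0 : 0 <= expR (`|x| + 1) by exact: expR_ge0.
  have b1 (w t : R) : x - 1 < w < x + 1 -> `[0, pi]%classic t -> `|df w t| <= expR (`|x| + 1).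
    move=> /andP[w1 w2] _; rewrite normrM -[leRHS]mulr1; apply: ler_pM => //; last exact: cos_max.
    rewrite ger0_norm ?expR_ge0 // ler_expR; apply: le_trans (ler_norm _) _.
    rewrite normrM; apply: (@le_trans _ _ `|w|).
      by rewrite -[leRHS]mulr1 ler_wpM2l ?cos_max.
    have := ler_norm x; have := ler_norm (- x); rewrite normrN => h1 h2.
    by rewrite ler_norml; apply/andP; split; lra.
  have D := @is_derive_under_integral R f df `[0, pi]%classic x 1 (fun=> expR (`|x| + 1))
    (measurable_itv _) ltr01 (fun w _ => integrable_continuous_itv 0 pi (@wave_continuous w 0))
    (fun w t _ _ => hd w t) (integrable_continuous_itv 0 pi (@cst_continuous _ _ _)) (fun=> M0) b1.
  have E : wave_coef x (-1) = 0 by have [->|x0] := eqVneq x 0; [rewrite wave_coef_at0 | rewrite wave_coef_neg].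
  have D1 : is_derive x 1 (fun z => pi^-1 * RInt `[0, pi] (f z)) (pi^-1 * RInt `[0, pi] (df x)) by derive_eq.
  by move: D1; rewrite -/(wave_coef x (-1)) E.
have c0 : wave_coef 0 0 = 1.
  rewrite /wave_coef (@eq_Rintegral _ _ _ _ _ (fun=> 1)); last first.
    by move=> t _; rewrite /wave !mul0r subr0 cos0 expR0 mulr1.
  apply: (etrans (congr1 _ (@Rintegral_cst _ (measurableTypeR R) R mu _ (measurable_itv _) 1))).
  have E : mu `[0, pi]%classic = (pi : R)%:E by rewrite lebesgue_measure_itv /= lte_fin pi_gt0 -EFinD oppr0 addr0.
  apply: (etrans (congr1 (fun x => pi^-1 * (1 * fine x)) E)); rewrite mul1r /=.
  by rewrite mulVf // gt_eqF // pi_gt0.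
by rewrite -c0; exact: (@is_derive_0_is_cst R (fun z => wave_coef z 0) z 0 dW).
Qed.

Lemma wave_coef_pos z n : wave_coef z n%:Z = z ^+ n / n`!%:R.
Proof.
elim: n => [|n IH]; first by rewrite wave_coef0 expr0 fact0 divr1.
have := wave_coef_rec z n.+1; rewrite (_ : n.+1%:Z - 1 = n) ?IH; last by lia.
have n0 : (n.+1%:R : R) != 0 by rewrite pnatr_eq0.
rewrite -[_%:~R]/(n.+1%:R) => /(congr1 (fun x => n.+1%:R^-1 * x)); rewrite mulKf // => ->.
rewrite factS natrM exprS; field.
by rewrite nat1r n0 pnatr_eq0 -lt0n fact_gt0.
Qed.

Lemma wave_coef_lt0 z k : k < 0 -> wave_coef z k = 0.
Proof.
move=> k0; have [->|z0] := eqVneq z 0; last exact: wave_coef_neg.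
by apply: wave_coef_at0; rewrite lt_eqF.
Qed.

Variable r : R.
Hypotheses (r0 : 0 < r) (r1 : r < 1).

(** Squared modulus of [1 - r e^(i t)]; [chord_arg] is its argument. For [r < 1] the real part is
    positive, so an arctangent gives the argument. *)
Definition chord2 (t : R) := 1 - 2 * r * cos t + r ^+ 2.
Definition chord_arg (t : R) := - atan (r * sin t / (1 - r * cos t)).

Lemma chord_re_gt0 t : 0 < 1 - r * cos t.
Proof.
have : r * cos t <= r by rewrite -[leRHS]mulr1 ler_pM2l ?cos_le1.
by have := r1; lra.
Qed.

Lemma chord2E t : chord2 t = (1 - r * cos t) ^+ 2 + (r * sin t) ^+ 2.
Proof. by rewrite [(_ * sin _) ^+ 2]exprMn sin2cos2 /chord2; ring. Qed.

Lemma chord2_gt0 t : 0 < chord2 t.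
Proof. by rewrite chord2E ltr_pwDl ?sqr_ge0 // exprn_gt0 // chord_re_gt0. Qed.

Lemma chord_polar t : Num.sqrt (chord2 t) * cos (chord_arg t) = 1 - r * cos t /\ Num.sqrt (chord2 t) * sin (chord_arg t) = - (r * sin t).
Proof.
have a0 := chord_re_gt0 t.
set u := r * sin t / (1 - r * cos t).
have E : chord2 t = (1 - r * cos t) ^+ 2 * (1 + u ^+ 2) by rewrite chord2E /u; field; rewrite gt_eqF.
have sq : Num.sqrt (chord2 t) = (1 - r * cos t) * Num.sqrt (1 + u ^+ 2) by rewrite E sqrtrM ?sqr_ge0 // sqrtr_sqr gtr0_norm.
have s0 : Num.sqrt (1 + u ^+ 2) != 0 by rewrite sqrtr_eq0 -ltNge ltr_pwDl // sqr_ge0.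
have c : cos (chord_arg t) = (Num.sqrt (1 + u ^+ 2))^-1 by rewrite cosN cos_atan.
split; first by rewrite sq c mulfK.
have s : sin (chord_arg t) = - (u * cos (chord_arg t)).
  rewrite sinN cosN; congr (- _).
  have c0 : cos (atan u) != 0 by rewrite cos_atan invr_eq0.
  have tu := atanK u; rewrite /tan in tu.
  by rewrite -/u -[X in _ = X * _]tu mulfVK.
by rewrite s mulrN mulrCA sq c mulfK // /u mulfVK // gt_eqF.
Qed.

(** Real part of [(1 - r e^(i t))^m e^(z e^(i t)) e^(-i k t)]. *)
Definition lag_wave (m : nat) (z : R) (k : int) (t : R) := Num.sqrt (chord2 t) ^+ m * expR (z * cos t) *
  cos (m%:R * chord_arg t + z * sin t - k%:~R * t).

Lemma lag_waveS m z k t : lag_wave m.+1 z k t = lag_wave m z k t - r * lag_wave m z (k - 1) t.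
Proof.
have [c s] := chord_polar t.
rewrite /lag_wave.
set B := m%:R * chord_arg t + z * sin t - k%:~R * t.
have -> : m.+1%:R * chord_arg t + z * sin t - k%:~R * t = chord_arg t + B by rewrite /B -natr1; ring.
have -> : m%:R * chord_arg t + z * sin t - (k - 1)%:~R * t = t + B by rewrite /B intrB; ring.
have c1 := cosD (chord_arg t) B; have c2 := cosD t B; rewrite c1 c2 exprSr.
move: {c1 c2} (cos B) (sin B) => cB sB.
transitivity (Num.sqrt (chord2 t) ^+ m * expR (z * cos t) * ((Num.sqrt (chord2 t) * cos (chord_arg t)) * cB -
    (Num.sqrt (chord2 t) * sin (chord_arg t)) * sB)); first by ring.
by rewrite c s; ring.
Qed.

Lemma lag_wave_integrable m z k : mu.-integrable `[0, pi] (EFin \o lag_wave m z k).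
Proof.
elim: m k => [|m IH] k.
  rewrite (_ : lag_wave 0 z k = wave z k); last first.
    by apply/funext => t; rewrite /lag_wave expr0 !mul1r mul0r add0r.
  by apply: integrable_continuous_itv; exact: wave_continuous.
rewrite (_ : lag_wave m.+1 z k = (fun t => lag_wave m z k t - r * lag_wave m z (k - 1) t)); last first.
  by apply/funext => t; exact: lag_waveS.
have h : mu.-integrable `[0, pi] (EFin \o (fun t => r * lag_wave m z (k - 1) t)) by apply: integrable_lebZ => //; exact: IH.
exact: (@integrableB _ (measurableTypeR R) _ mu _ (measurable_itv _) _ _ (IH k) h).
Qed.

(** Cauchy's coefficient formula on the circle of radius [r], by induction on [m]: a factor
    [1 - r e^(i t)] acts through [lag_waveS] on the integral and through [lagf_pascal] on the
    coefficient. *)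
Lemma lag_wave_int m z k : pi^-1 * RInt `[0, pi] (lag_wave m z k) = if k is Posz n then r ^+ n * lagf m n (z / r) else 0.
Proof.
elim: m k => [|m IH] k.
  rewrite (_ : lag_wave 0 z k = wave z k); last first.
    by apply/funext => t; rewrite /lag_wave expr0 !mul1r mul0r add0r.
  rewrite -/(wave_coef z k); case: k => n; last by rewrite wave_coef_lt0.
  rewrite wave_coef_pos lagf_0l exprMn exprVn; field.
  by rewrite expf_neq0 ?gt_eqF // pnatr_eq0 -lt0n fact_gt0.
rewrite (_ : lag_wave m.+1 z k = (fun t => lag_wave m z k t - r * lag_wave m z (k - 1) t)); last first.
  by apply/funext => t; exact: lag_waveS.
rewrite RintegralB //; last 2 first.
- exact: lag_wave_integrable.
- by apply: integrable_lebZ => //; exact: lag_wave_integrable.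
rewrite RintegralZl //; last exact: lag_wave_integrable.
rewrite mulrBr mulrCA !IH; case: k => [[|n]|n].
- by rewrite !lagf_0r mulr0 subr0.
- have -> : n.+1%:Z - 1 = n by lia.
  by rewrite lagf_pascal exprS; ring.
- by rewrite (_ : Negz n - 1 = Negz n.+1) ?mulr0 ?subr0 //; lia.
Qed.

End LaguerreIntegral.

(** * Modulus and phase of the integrand on the circle *)

Section LaguerreProfile.
Variable R : realType.

Lemma continuous_rescale (c : R) (f : R -> R) : continuous f -> continuous (fun y : R => f (y / c)).
Proof.
move=> cf y; apply: (@cvg_comp _ _ _ (fun y => y / c) f (nbhs y) (nbhs (y / c))); last exact: cf.
by apply: (@cvgM _ _ _ _ id (fun=> c^-1)); [exact: cvg_id | exact: cvg_cst].
Qed.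

Lemma Rintegral_scale (c b : R) (f : R -> R) : 0 < c -> 0 <= b -> continuous f -> RInt `[0, b] f = c^-1 * RInt `[0, c * b] (fun y => f (y / c)).
Proof.
move=> c0 b0 cf; have cb0 : 0 <= c * b by rewrite mulr_ge0 // ltW.
have dF (x : R) : is_derive x 1 (fun y => y / c) c^-1.
  rewrite (_ : (fun y => _) = fun y => c^-1 * y); last by apply/funext => y; rewrite mulrC.
  by derive_eq; rewrite mulr1.
have dFE : derive1 (fun y : R => y / c) = (fun=> c^-1) by apply/funext => y; rewrite derive1E; have [_ ->] := dF y.
have cF := is_derive_continuous dF.
have cfc := @continuous_rescale c f cf.
have := @integration_by_substitution_increasing R (fun y => y / c) f 0 (c * b) cb0.
rewrite dFE mul0r (mulrAC c b) mulfV ?gt_eqF // mul1r => E.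
rewrite /Rintegral E.
- rewrite -[RHS]RintegralZl //; last exact: integrable_continuous_itv.
  by apply: eq_Rintegral => y _ /=; rewrite mulrC.
- by move=> y z _ _; rewrite ltr_pM2r ?invr_gt0.
- by move=> y _; exact: cvg_cst.
- exact: is_cvg_cst.
- exact: is_cvg_cst.
- split=> [y _||].
  + by have [] := dF y.
  + by apply: cvg_at_right_filter; exact: cF.
  + by apply: cvg_at_left_filter; exact: cF.
- exact: continuous_subspaceT.
Qed.

Lemma lag_wave_continuous (r : R) m z k : 0 < r -> r < 1 -> continuous (lag_wave r m z k).
Proof.
move=> r0 r1; elim: m k => [|m IH] k.
  rewrite (_ : lag_wave r 0 z k = wave z k); first exact: wave_continuous.
  by apply/funext => t; rewrite /lag_wave expr0 !mul1r mul0r add0r.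
rewrite (_ : lag_wave r m.+1 z k = (fun t => lag_wave r m z k t - r * lag_wave r m z (k - 1) t)); last first.
  by apply/funext => t; exact: lag_waveS.
by move=> t; apply: cvgB; [exact: IH | apply: cvgM; [exact: cvg_cst | exact: IH]].
Qed.

(** Logarithm of the modulus of the integrand, relative to its value at [t = 0]. *)
Definition lag_exp (m : nat) (r z t : R) := m%:R / 2 * ln (1 + 2 * r * (1 - cos t) / (1 - r) ^+ 2) - z * (1 - cos t).

Definition lag_phase (m n : nat) (r z t : R) := m%:R * chord_arg r t + z * sin t - n%:R * t.

(** The integrand as a function of the rescaled angle [y = c t], equal to 1 at [y = 0] and extended
    by 0 past the half circle, so that all integrals live on the same half line. *)
Definition lag_profile (m n : nat) (r x c y : R) := if y <= c * pi then expR (lag_exp m r (x * r) (y / c)) * cos (lag_phase m n r (x * r) (y / c))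
  else 0.

Section FixedParameters.
Variables (m n : nat) (r : R).
Hypotheses (r0 : 0 < r) (r1 : r < 1).

Let onemr : 0 < 1 - r. Proof. by rewrite subr_gt0. Qed.
Let D0 : 0 < (1 - r) ^+ 2. Proof. by rewrite exprn_gt0. Qed.
Let v0 (t : R) : 0 <= 1 - cos t. Proof. by rewrite subr_ge0 cos_le1. Qed.
Let u0 (t : R) : 0 <= 2 * r * (1 - cos t) / (1 - r) ^+ 2.
Proof. by rewrite divr_ge0 ?mulr_ge0 // ltW. Qed.

Lemma lag_waveE z t : lag_wave r m z n t = (1 - r) ^+ m * expR z * (expR (lag_exp m r z t) * cos (lag_phase m n r z t)).
Proof.
rewrite /lag_wave /lag_phase mulrA; congr (_ * _).
set u := 2 * r * (1 - cos t) / (1 - r) ^+ 2.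
have u1 : 0 < 1 + u by rewrite ltr_pwDl // /u u0.
have E : chord2 r t = (1 - r) ^+ 2 * (1 + u) by rewrite /chord2 /u; field; rewrite gt_eqF.
have -> : Num.sqrt (chord2 r t) = (1 - r) * expR (ln (1 + u) / 2).
  rewrite E sqrtrM ?sqr_ge0 // sqrtr_sqr gtr0_norm //; congr (_ * _).
  rewrite -[in LHS](lnK (x := 1 + u)) ?posrE // [in LHS](_ : ln (1 + u) = ln (1 + u) / 2 * 2%:R).
    by rewrite expRM_natr sqrtr_sqr ger0_norm // expR_ge0.
  by field.
rewrite exprMn -expRM_natr -!mulrA -!expRD; congr (_ * expR _).
by rewrite /lag_exp -/u; field.
Qed.

Lemma lag_exp_le x t : lag_exp m r (x * r) t <= r * (1 - cos t) * (m%:R / (1 - r) ^+ 2 - x).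
Proof.
rewrite /lag_exp; set u := 2 * r * (1 - cos t) / (1 - r) ^+ 2.
have : ln (1 + u) <= u by apply: le_ln1Dx; apply: lt_le_trans (u0 t); lra.
move=> /(ler_wpM2l (_ : 0 <= m%:R / 2)) => /(_ ltac:(by [])) h.
have E : m%:R / 2 * u = r * (1 - cos t) * (m%:R / (1 - r) ^+ 2) :> R by rewrite /u; field; rewrite gt_eqF.
by rewrite E in h; lra.
Qed.

Lemma ln1D_ge2 (u : R) : 0 <= u -> u - u ^+ 2 / 2 <= ln (1 + u).
Proof.
move=> u0'; apply: (@le_of_derive_itv R (fun u => u - u ^+ 2 / 2) (fun u => ln (1 + u)) (fun x => 1 - x) (fun x => (1 + x)^-1) 0 u) => //.
- by move=> x _; derive_eq; field.
- by move=> x /andP[x0 _]; apply: is_derive_ln1D; lra.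
- by rewrite addr0 ln1 expr0n /= mul0r subr0.
- move=> x /andP[x0 _]; rewrite -[(1 + x)^-1]mul1r ler_pdivlMr; last by lra.
  by have := sqr_ge0 x; rewrite expr2; lra.
Qed.

Lemma lag_exp_ge x t : r * (1 - cos t) * (m%:R / (1 - r) ^+ 2 - x)
   - m%:R * r ^+ 2 * (1 - cos t) ^+ 2 / (1 - r) ^+ 4 <= lag_exp m r (x * r) t.
Proof.
rewrite /lag_exp; set u := 2 * r * (1 - cos t) / (1 - r) ^+ 2.
have := ln1D_ge2 (u0 t); rewrite -/u.
move=> /(ler_wpM2l (_ : 0 <= m%:R / 2)) => /(_ ltac:(by [])) h.
have E : m%:R / 2 * (u - u ^+ 2 / 2) = r * (1 - cos t) * (m%:R / (1 - r) ^+ 2)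
    - m%:R * r ^+ 2 * (1 - cos t) ^+ 2 / (1 - r) ^+ 4 :> R.
  by rewrite /u; field; rewrite gt_eqF.
by rewrite E in h; lra.
Qed.

(** When [x] exceeds [m / (1 - r)^2] the modulus has its maximum over the circle at [t = 0]; [kap]
    measures the excess, and [onem_cos_ge] makes the decay Gaussian on the whole half circle. *)
Lemma lag_exp_gaussian x kap t : 0 <= kap -> m%:R / (1 - r) ^+ 2 + kap <= x -> 0 <= t <= pi -> lag_exp m r (x * r) t <= - (r * kap * t ^+ 2 / 16).
Proof.
move=> k0 hx tpi; apply: le_trans (lag_exp_le x t) _.
have rv : 0 <= r * (1 - cos t) by rewrite mulr_ge0 // ltW.
apply: (@le_trans _ _ (r * (1 - cos t) * - kap)); first by apply: ler_wpM2l => //; lra.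
rewrite mulrN lerN2 (_ : r * kap * t ^+ 2 / 16 = r * (t ^+ 2 / 16) * kap); last by ring.
by rewrite ler_wpM2r // ler_pM2l // onem_cos_ge.
Qed.

(** The derivative of the phase is [phase_drift] plus [(1 - cos t) * r] times this rate at
    [1 - cos t]. In the edge regime the drift gives the linear term of the Airy phase and the rate
    its cubic term. *)
Definition phase_rate (x v : R) := m%:R * (1 + r) / ((1 - r) * ((1 - r) ^+ 2 + 2 * r * v)) - x.

Definition phase_drift (x : R) := x * r - n%:R - m%:R * r / (1 - r).

Lemma is_derive_lag_phase (x t : R) : is_derive t 1 (lag_phase m n r (x * r)) (phase_drift x + (1 - cos t) * r * phase_rate x (1 - cos t)).
Proof.
have q0 := chord_re_gt0 r0 r1 t.
have q1 : 1 - r * cos t != 0 by rewrite gt_eqF.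
have q2 : 1 + (r * sin t / (1 - r * cos t)) ^+ 2 != 0 by rewrite gt_eqF // ltr_pwDl // sqr_ge0.
have E : (1 - r) ^+ 2 + 2 * r * (1 - cos t) = chord2 r t by rewrite /chord2; ring.
have q3 : chord2 r t != 0 by rewrite gt_eqF // chord2_gt0.
have dF1 : is_derive t 1 (fun t => 1 - r * cos t) (r * sin t) by derive_eq; ring.
have dF2 : is_derive t 1 (fun t => r * sin t) (r * cos t) by derive_eq; ring.
have dF3 : is_derive t 1 (fun t => (1 - r * cos t)^-1) (- (1 - r * cos t) ^- 2 * (r * sin t)).
  by have := @is_deriveV R (fun t => 1 - r * cos t) _ _ _ q1 dF1; rewrite /GRing.scale /=.
have dF4 : is_derive t 1 (fun t => r * sin t / (1 - r * cos t)) ((r * cos t - r ^+ 2) / (1 - r * cos t) ^+ 2).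
  derive_eq.
  rewrite (_ : r * cos t - r ^+ 2 = r * cos t * (1 - r * cos t) - r ^+ 2 * sin t ^+ 2).
    by field.
  by rewrite sin2cos2; ring.
have dF5 : is_derive t 1 (chord_arg r) (- ((r * cos t - r ^+ 2) / chord2 r t)).
  have h := @is_derive1_comp R atan (fun t => r * sin t / (1 - r * cos t)) t _ _ (is_derive1_atan _) dF4.
  have h2 := is_deriveN h.
  apply: is_derive_eq; congr (- _); rewrite chord2E; field.
  by rewrite q1 -chord2E q3.
rewrite /lag_phase; derive_eq.
rewrite /phase_drift /phase_rate E.
have q4 : 1 - r != 0 by rewrite gt_eqF.
by rewrite /chord2 in q3 *; field; rewrite q4 q3.
Qed.

Lemma phase_rate_anti x v w : 0 <= v -> v <= w -> phase_rate x w <= phase_rate x v.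
Proof.
move=> v0' vw; rewrite /phase_rate lerB // ler_pdivrMr; last first.
  by rewrite mulr_gt0 // ltr_pwDl // !mulr_ge0 // ?(ltW r0) // (le_trans v0').
rewrite mulrAC ler_pdivlMr; last by rewrite mulr_gt0 // ltr_pwDl // !mulr_ge0 // ltW.
apply: ler_wpM2l; first by rewrite mulr_ge0 // addr_ge0 // ltW.
by rewrite ler_pM2l // lerD2l ler_pM2l // mulr_gt0.
Qed.

(** The derivative of the phase is integrated, with the monotone rate replaced by its extreme
    values. The factor [1 - t ^+ 2 / 12] comes from [1 - cos s >= s^2 / 2 - s^4 / 24]. *)
Lemma lag_phase_bounds x t : 0 <= t -> t ^+ 2 <= 12 -> 0 <= phase_rate x (t ^+ 2 / 2) ->
  phase_drift x * t + r * phase_rate x (t ^+ 2 / 2) * (1 - t ^+ 2 / 12) * t ^+ 3 / 6 <= lag_phase m n r (x * r) t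
   <= phase_drift x * t + r * phase_rate x 0 * t ^+ 3 / 6.
Proof.
move=> t0 t12 G0.
have P0 : lag_phase m n r (x * r) 0 = 0 by rewrite /lag_phase /chord_arg sin0 !mulr0 mul0r atan0; ring.
have dP s := is_derive_lag_phase x s.
have Gs s : 0 <= s <= t -> phase_rate x (t ^+ 2 / 2) <= phase_rate x (1 - cos s) <= phase_rate x 0.
  move=> /andP[s0 st]; apply/andP; split; apply: phase_rate_anti => //.
  have := cos_ge s0; have : s ^+ 2 <= t ^+ 2 by rewrite ler_sqr ?nnegrE.
  by lra.
apply/andP; split.
- apply: (@le_of_derive_itv R (fun s => phase_drift x * s + r * phase_rate x (t ^+ 2 / 2) * (1 - t ^+ 2 / 12) * s ^+ 3 / 6)
    (lag_phase m n r (x * r)) (fun s => phase_drift x + r * phase_rate x (t ^+ 2 / 2) * (1 - t ^+ 2 / 12) * s ^+ 2 / 2) _ 0 t) => //.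
  + by move=> s _; derive_eq; field.
  + by rewrite P0 expr0n /= !mulr0 mul0r addr0.
  + move=> s st; have /andP[g1 g2] := Gs s st; case/andP: (st) => s0 st'.
    rewrite lerD2l (_ : _ / 2 = (1 - t ^+ 2 / 12) * (s ^+ 2 / 2) * r * phase_rate x (t ^+ 2 / 2)); last by field.
    have h1 : 0 <= (1 - t ^+ 2 / 12) * (s ^+ 2 / 2) by rewrite mulr_ge0 ?divr_ge0 ?sqr_ge0 // subr_ge0; lra.
    have h2 : (1 - t ^+ 2 / 12) * (s ^+ 2 / 2) <= 1 - cos s.
      have := cos_le s0; have : s ^+ 2 * s ^+ 2 <= s ^+ 2 * t ^+ 2.
        by rewrite ler_wpM2l ?sqr_ge0 // ler_sqr ?nnegrE.
      by rewrite -exprD; lra.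
    apply: ler_pM => //; first by rewrite mulr_ge0 // ltW.
    by rewrite ler_pM2r.
- apply: (@le_of_derive_itv R (lag_phase m n r (x * r)) (fun s => phase_drift x * s + r * phase_rate x 0 * s ^+ 3 / 6)
    _ (fun s => phase_drift x + r * phase_rate x 0 * s ^+ 2 / 2) 0 t) => //.
  + by move=> s _; derive_eq; field.
  + by rewrite P0 expr0n /= !mulr0 mul0r addr0.
  + move=> s st; have /andP[g1 g2] := Gs s st; case/andP: (st) => s0 st'.
    rewrite lerD2l (_ : _ / 2 = (s ^+ 2 / 2) * r * phase_rate x 0); last by field.
    apply: ler_pM => //.
    * by rewrite mulr_ge0 // ltW.
    * exact: le_trans g1.
    * by rewrite ler_pM2r //; have := cos_ge s0; lra.
Qed.

Lemma lag_profile_measurable x c (D : set R) : 0 < c -> measurable_fun D (lag_profile m n r x c).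
Proof.
move=> c0; apply: measurable_funTS.
set K := (1 - r) ^+ m * expR (x * r).
have K0 : K != 0 by rewrite mulf_neq0 ?gt_eqF ?exprn_gt0 ?expR_gt0.
have -> : lag_profile m n r x c = fun y => if y <= c * pi then K^-1 * lag_wave r m (x * r) n (y / c) else 0.
  apply/funext => y; rewrite /lag_profile; case: ifP => // _.
  by rewrite lag_waveE -/K mulKf.
apply: measurable_fun_ifT => //.
- exact: measurable_fun_ler.
- apply: continuous_measurable_fun => y; apply: cvgM; first exact: cvg_cst.
  by apply: continuous_rescale; exact: lag_wave_continuous.
Qed.

Lemma lagf_profile x c : 0 < c -> lagf m n x = (1 - r) ^+ m * expR (x * r) / (r ^+ n * c) * (pi^-1 * RInt Rge0 (lag_profile m n r x c)).
Proof.
move=> c0; have := lag_wave_int r0 r1 m (x * r) n; rewrite /= mulfK ?gt_eqF // => E.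
have {E} -> : lagf m n x = r ^- n * (pi^-1 * RInt `[0, pi] (lag_wave r m (x * r) n)) by rewrite E mulKf // expf_neq0 // gt_eqF.
rewrite (Rintegral_scale c0 (pi_ge0 R)); last exact: lag_wave_continuous.
set K := (1 - r) ^+ m * expR (x * r).
have cp : continuous (fun y : R => expR (lag_exp m r (x * r) (y / c)) * cos (lag_phase m n r (x * r) (y / c))).
  have K0 : K != 0 by rewrite mulf_neq0 ?gt_eqF ?exprn_gt0 ?expR_gt0.
  rewrite (_ : (fun y => _) = fun y => K^-1 * lag_wave r m (x * r) n (y / c)); last first.
    by apply/funext => y; rewrite lag_waveE -/K mulKf.
  move=> y; apply: cvgM; first exact: cvg_cst.
  by apply: continuous_rescale; exact: lag_wave_continuous.
have -> : RInt `[0, c * pi] (fun y => lag_wave r m (x * r) n (y / c)) = K * RInt Rge0 (lag_profile m n r x c).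
  transitivity (RInt `[0, c * pi] (fun y => K * (expR (lag_exp m r (x * r) (y / c)) * cos (lag_phase m n r (x * r) (y / c))))).
    by apply: eq_Rintegral => y _; exact: lag_waveE.
  rewrite RintegralZl //; last exact: integrable_continuous_itv.
  congr (_ * _).
  have -> : `[0, c * pi]%classic = Rge0 `&` `[0, c * pi]%classic by apply/esym/setIidPr => y /=; rewrite !in_itv /= andbT => /andP[].
  rewrite Rintegral_mkcondr; apply: eq_Rintegral => y; rewrite inE /= in_itv /= andbT => y0.
  rewrite patchE /lag_profile; case: ifPn => [|]; rewrite !(inE, notin_setE) /= in_itv /= y0 /=; first by move=> ->.
  by move/negP/negbTE => ->.
move: pi^-1 (Rintegral _ _ _) => p I; field.
by rewrite expf_neq0 ?gt_eqF.
Qed.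

End FixedParameters.
End LaguerreProfile.

(** * Ratios of factorials *)

Section StirlingRemainder.
Variable R : realType.

(** Only differences of this remainder enter, since the normalisation of the Laguerre functions
    contains [n! / (n + al)!]; the constant of Stirling's formula cancels. *)
Definition stirling_rem (n : nat) : R := ln n`!%:R - (n%:R * ln n%:R - n%:R + ln n%:R / 2).

(** At [u = 1 / n] this is exactly the inequality that makes [stirling_rem] nonincreasing. *)
Lemma ln1D_pade (u : R) : 0 <= u -> 2 * u / (2 + u) <= ln (1 + u).
Proof.
move=> u0; apply: (@le_of_derive_itv R (fun u => 2 * u / (2 + u)) (fun u => ln (1 + u)) (fun x => 4 / (2 + x) ^+ 2) (fun x => (1 + x)^-1) 0 u) => //.
- move=> x /andP[x0 _]; have x2 : 2 + x != 0 by rewrite gt_eqF; lra.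
  have d1 : is_derive x 1 (fun u : R => 2 + u) 1 by rewrite -[X in is_derive _ _ _ X](add0r (1 : R)); exact: is_deriveD.
  have d2 : is_derive x 1 (fun u : R => (2 + u)^-1) (- (2 + x) ^- 2).
    by have := @is_deriveV R (fun u => 2 + u) _ _ _ x2 d1; rewrite /GRing.scale /= mulr1.
  by derive_eq; field.
- by move=> x /andP[x0 _]; apply: is_derive_ln1D; lra.
- by rewrite !addr0 ln1 mulr0 mul0r.
- move=> x /andP[x0 _]; rewrite -[(1 + x)^-1]mul1r ler_pdivlMr; last by lra.
  rewrite mulrAC ler_pdivrMr; last by rewrite exprn_gt0 //; lra.
  by rewrite mul1r; have := sqr_ge0 x; rewrite expr2 sqrrD; lra.
Qed.

Lemma stirling_remB n : (0 < n)%N -> stirling_rem n - stirling_rem n.+1 = (n%:R + 2^-1) * ln (1 + n%:R^-1) - 1.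
Proof.
move=> n0; have n0' : 0 < n%:R :> R by rewrite ltr0n.
have f0 : 0 < n`!%:R :> R by rewrite ltr0n fact_gt0.
have E : n.+1%:R = n%:R * (1 + n%:R^-1) :> R by rewrite mulrDr mulr1 mulfV ?gt_eqF // natr1.
have i0 : 0 < 1 + n%:R^-1 :> R by rewrite addr_gt0 // invr_gt0.
rewrite /stirling_rem factS natrM lnM ?posrE ?ltr0n ?fact_gt0 //.
have -> : ln n.+1%:R = ln n%:R + ln (1 + n%:R^-1) :> R by rewrite E lnM ?posrE.
by rewrite -natr1; field.
Qed.

Lemma stirling_rem_step n : (0 < n)%N -> 0 <= stirling_rem n - stirling_rem n.+1 <= (n%:R^-1 - n.+1%:R^-1) / 2.
Proof.
move=> n0; have n0' : 0 < n%:R :> R by rewrite ltr0n.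
rewrite stirling_remB //; set u : R := n%:R^-1.
have nE : n%:R = u^-1 :> R by rewrite /u invrK.
have u0 : 0 < u by rewrite invr_gt0.
have u1 : u <= 1 by rewrite invf_le1 // ler1n.
have up : u^-1 + 2^-1 = (2 + u) / (2 * u) by field; rewrite gt_eqF.
rewrite nE up; apply/andP; split.
- have := ln1D_pade (ltW u0); rewrite ler_pdivrMr ?addr_gt0 // => h.
  by rewrite subr_ge0 mulrAC ler_pdivlMr ?mulr_gt0 //; lra.
- have /andP[_ h] := ln1D_taylor (ltW u0).
  have -> : n.+1%:R^-1 = u / (1 + u) by rewrite -natr1 nE; field; rewrite !gt_eqF ?ltr_pwDl // ltW.
  have E2 : (u - u / (1 + u)) / 2 = u ^+ 2 / (2 * (1 + u)) by field; rewrite gt_eqF // ltr_pwDl // ltW.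
  rewrite E2; have : (2 + u) / (2 * u) * ln (1 + u) <= (2 + u) / (2 * u) * (u - u ^+ 2 / 2 + u ^+ 3 / 3).
    rewrite ler_wpM2l //; last by lra.
    by rewrite divr_ge0 ?mulr_ge0 ?addr_ge0 // ltW.
  have -> : (2 + u) / (2 * u) * (u - u ^+ 2 / 2 + u ^+ 3 / 3) = 1 + u ^+ 2 / 12 + u ^+ 3 / 6 by field; rewrite gt_eqF.
  move=> h2; have : u ^+ 2 / 4 <= u ^+ 2 / (2 * (1 + u)).
    by rewrite ler_wpM2l ?sqr_ge0 // lef_pV2 ?posrE ?mulr_gt0 //; lra.
  have : u ^+ 3 <= u ^+ 2 by rewrite exprS -[leRHS]mul1r ler_wpM2r ?sqr_ge0.
  by lra.
Qed.

Lemma stirling_rem_diff n m : (0 < n <= m)%N -> 0 <= stirling_rem n - stirling_rem m <= (n%:R^-1 - m%:R^-1) / 2.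
Proof.
move=> /andP[n0]; elim: m => [|m IH]; first by rewrite leqn0 => /eqP E; rewrite E in n0.
rewrite leq_eqVlt => /orP[/eqP <-|]; first by rewrite !subrr mul0r lexx.
rewrite ltnS => nm; have /andP[h1 h2] := IH nm.
by have /andP[h3 h4] := stirling_rem_step (leq_trans n0 nm); move: h1 h2 h3 h4;
  move: (m.+1%:R^-1) (m%:R^-1) (n%:R^-1) => a b c *; apply/andP; split; lra.
Qed.

Lemma stirling_rem_diff_le n m : (0 < n <= m)%N -> 0 <= stirling_rem n - stirling_rem m <= n%:R^-1 / 2.
Proof.
move=> h; have /andP[-> h2] := stirling_rem_diff h; apply: (le_trans h2).
by rewrite ler_pM2r // gerBl invr_ge0.
Qed.
End StirlingRemainder.

(** * Laguerre functions near the edge of their oscillation *)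

Section LaguerreScaling.
Variable R : realType.

(** The orthonormal Laguerre functions of parameter [al], up to the sign [(-1)^n]. *)
Definition lag_fun (al n : nat) (x : R) : R := Num.sqrt (n`!%:R / (n + al)`!%:R * x ^+ al * expR (- x)) * lagf (n + al) n x.

(** For [n = rho^3 (1 - rho) / e^3] and [m = n + al = rho (1 - rho)^3 / e^3] this is
    [(sqrt m + sqrt n)^2]. At this [x] the action [m ln (1 - w) + x w - n ln w] has vanishing first
    and second derivatives at [w = rho], and its third derivative there is [-2 / e^3]. Hence [e] is
    the width of the critical region in [w], and [1 / e] the unit for [x]. *)
Definition edge (rho e : R) := rho * (1 - rho) / e ^+ 3.
Definition edge_pt (rho e xi : R) := edge rho e + xi / e.

Section Fixed.
Variables (al n : nat) (rho e xi A : R).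
Hypotheses (rho0 : 0 < rho) (rho2 : rho <= 2^-1) (e0 : 0 < e) (A0 : 0 <= A) (eA : e * (4 * A + 2) <= rho) (xiA : - A <= xi)
  (nE : n%:R = rho ^+ 3 * (1 - rho) / e ^+ 3)
  (mE : (n + al)%:R = rho * (1 - rho) ^+ 3 / e ^+ 3).

Let r := rho - e.
Let x := edge_pt rho e xi.

Lemma edge_small : e <= rho / 2 /\ 4 * A * e <= rho.
Proof.
have := mulr_ge0 (ltW e0) A0; move: eA; rewrite mulrDr mulrCA => h1 h2.
have := e0; move=> e0'; rewrite (_ : 4 * A * e = 4 * (e * A)); last by ring.
by split; lra.
Qed.

Let e_rho : e <= rho / 2. Proof. by case: edge_small. Qed.
Let r0 : 0 < r. Proof. by rewrite /r; have := e_rho; have := rho0; lra. Qed.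
Let r1 : r < 1. Proof. by rewrite /r; have := e0; have := rho2; lra. Qed.
Let rr : rho / 2 <= r. Proof. by rewrite /r; have := e_rho; lra. Qed.
Let onerho : 2^-1 <= 1 - rho. Proof. by have := rho2; lra. Qed.
Let onerho0 : 0 < 1 - rho. Proof. by have := rho2; lra. Qed.

Let u := xi * e ^+ 2 / (rho * (1 - rho)).

Lemma edge_ratio_ge : - 2^-1 <= u.
Proof.
have [_ h] := edge_small.
rewrite /u ler_pdivlMr ?mulr_gt0 //.
have h1 : - (A * e ^+ 2) <= xi * e ^+ 2 by rewrite -mulNr ler_pM2r ?exprn_gt0.
apply: le_trans h1; rewrite mulNr lerN2.
have h2 : A * e ^+ 2 <= rho * e / 4 by rewrite expr2 mulrA (_ : rho * e / 4 = (rho / 4) * e); [rewrite ler_pM2r //; lra | ring].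
apply: (le_trans h2); rewrite (_ : rho * e / 4 = rho * (e / 4)); last by ring.
rewrite (_ : 2^-1 * _ = rho * ((1 - rho) / 2)); last by ring.
rewrite ler_pM2l //.
by have := e_rho; have := rho2; have := onerho; lra.
Qed.

Lemma edge_ptE : x = edge rho e * (1 + u).
Proof. by rewrite /x /edge_pt /edge /u; field; rewrite !gt_eqF. Qed.

Lemma edge_gt0 : 0 < edge rho e.
Proof. by rewrite /edge divr_gt0 ?mulr_gt0 // exprn_gt0. Qed.

Lemma edge_pt_gt0 : 0 < x.
Proof. by rewrite edge_ptE mulr_gt0 ?edge_gt0 //; have := edge_ratio_ge; lra. Qed.

Lemma n_gt0 : (0 < n)%N.
Proof. by rewrite -(ltr0n R) nE divr_gt0 ?mulr_gt0 // exprn_gt0. Qed.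

(** Increment of the action from the critical point [rho] to the point [r = rho - e] of the circle;
    the cubic term alone contributes [1/3]. *)
Definition edge_action := (n + al)%:R * ln (1 + e / (1 - rho)) - edge rho e * e - n%:R * ln (1 - e / rho).

Definition edge_log :=
  - ln (1 - e / rho) + (stirling_rem R n - stirling_rem R (n + al)) / 2 + edge_action
  + al%:R / 2 * ln (1 + u) - xi / e / 2 + xi / e * r.

Definition edge_pref := Num.sqrt (rho * (1 - rho)) / r * (Num.sqrt (n`!%:R / (n + al)`!%:R * x ^+ al * expR (- x)) *
   ((1 - r) ^+ (n + al) * expR (x * r) / r ^+ n)).

(** In logarithms, the powers of [rho], [1 - rho] and [e] coming from the factorials cancel those
    coming from the integrand and from [x ^+ al]. *)
Lemma edge_prefE : edge_pref = expR edge_log.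
Proof.
have q0 : 0 < 1 - e / rho by rewrite subr_gt0 ltr_pdivrMr //; have := e_rho; have := rho0; lra.
have p0 : 0 < 1 + e / (1 - rho) by rewrite addr_gt0 // divr_gt0.
have u1 : 0 < 1 + u by have := edge_ratio_ge; lra.
have rE : r = rho * (1 - e / rho) by rewrite /r; field; rewrite gt_eqF.
have r1E : 1 - r = (1 - rho) * (1 + e / (1 - rho)) by rewrite /r; field; rewrite gt_eqF.
have x0 := edge_pt_gt0.
have f1 : 0 < n`!%:R :> R by rewrite ltr0n fact_gt0.
have f2 : 0 < (n + al)`!%:R :> R by rewrite ltr0n fact_gt0.
have sq (y : R) : 0 < y -> Num.sqrt y = expR (ln y / 2).
  move=> y0; rewrite -[in LHS](lnK (x := y)) ?posrE // [in LHS](_ : ln y = ln y / 2 * 2%:R).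
    by rewrite expRM_natr sqrtr_sqr ger0_norm // expR_ge0.
  by field.
have y0 : 0 < n`!%:R / (n + al)`!%:R * x ^+ al * expR (- x) by rewrite !mulr_gt0 ?invr_gt0 ?expR_gt0 ?exprn_gt0.
have r1' : 0 < 1 - r by rewrite subr_gt0.
have rL : r = expR (ln r) by rewrite lnK ?posrE.
have r1L : 1 - r = expR (ln (1 - r)) by rewrite lnK ?posrE.
have rr0 : 0 < rho * (1 - rho) by rewrite mulr_gt0.
rewrite /edge_pref !sq //.
rewrite (_ : expR _ / r = expR (ln (rho * (1 - rho)) / 2) / expR (ln r)); last by rewrite {1}rL.
rewrite (_ : (1 - r) ^+ _ * _ / _ = expR (ln (1 - r)) ^+ (n + al) * expR (x * r) / expR (ln r) ^+ n); last first.
  by rewrite -r1L -rL.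
rewrite -!expRM_natr -!expRN -!expRD; congr expR.
have xa0 : 0 < x ^+ al by rewrite exprn_gt0.
have ex0 : 0 < expR (- x) by exact: expR_gt0.
have q1 : 0 < n`!%:R / (n + al)`!%:R :> R by rewrite divr_gt0.
rewrite (lnM (x := _ * _)) ?posrE ?(mulr_gt0 q1) // expRK (lnM (x := _ / _)) ?posrE //.
rewrite ln_div ?posrE // lnXn // -(mulr_natr (ln x)) (lnM (x := rho)) ?posrE //.
have -> : ln r = ln rho + ln (1 - e / rho) by rewrite {1}rE lnM ?posrE.
have -> : ln (1 - r) = ln (1 - rho) + ln (1 + e / (1 - rho)) by rewrite {1}r1E lnM ?posrE.
have -> : ln x = ln rho + ln (1 - rho) - 3 * ln e + ln (1 + u).
  rewrite {1}edge_ptE lnM ?posrE ?edge_gt0 // /edge ln_div ?posrE ?mulr_gt0 ?exprn_gt0 //.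
  by rewrite lnM ?posrE // lnXn // -(mulr_natl (ln e)).
have sn := erefl (stirling_rem R n); rewrite {1}/stirling_rem in sn.
have sm := erefl (stirling_rem R (n + al)); rewrite {1}/stirling_rem in sm.
have lnn : ln n%:R = 3 * ln rho + ln (1 - rho) - 3 * ln e.
  rewrite nE ln_div ?posrE ?mulr_gt0 ?exprn_gt0 // lnM ?posrE ?exprn_gt0 // !lnXn //.
  by rewrite -(mulr_natl (ln e)) -(mulr_natl (ln rho)).
have lnm : ln (n + al)%:R = ln rho + 3 * ln (1 - rho) - 3 * ln e.
  rewrite mE ln_div ?posrE ?mulr_gt0 ?exprn_gt0 // lnM ?posrE ?exprn_gt0 // !lnXn //.
  by rewrite -(mulr_natl (ln e)) -(mulr_natl (ln (1 - rho))).
have -> : ln n`!%:R = stirling_rem R n + (n%:R * ln n%:R - n%:R + ln n%:R / 2) by rewrite -sn; ring.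
have -> : ln (n + al)`!%:R = stirling_rem R (n + al) + ((n + al)%:R * ln (n + al)%:R - (n + al)%:R + ln (n + al)%:R / 2) by rewrite -sm; ring.
rewrite /edge_log /edge_action lnn lnm.
have alE : al%:R = (n + al)%:R - n%:R :> R by rewrite natrD; ring.
rewrite alE nE mE /x /edge_pt /edge /r.
move: (ln rho) (ln (1 - rho)) (ln e) (ln (1 + u)) (ln (1 - e / rho)) (ln (1 + e / (1 - rho))).
move: (stirling_rem R n) (stirling_rem R (n + al)) => s1 s2 l1 l2 l3 l4 l5 l6.
by field; rewrite gt_eqF.
Qed.

Lemma edge_action_bounds : 3^-1 - rho * e / (4 * (1 - rho)) <= edge_action <= 3^-1 + (1 - rho) * e / (2 * rho).
Proof.
have p0 : 0 <= e / (1 - rho) by rewrite divr_ge0 // ltW.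
have q0 : 0 <= e / rho <= 2^-1.
  rewrite divr_ge0 ?(ltW e0) ?(ltW rho0) //= ler_pdivrMr //; have := e_rho; lra.
have /andP[h1 h2] := ln1D_taylor p0.
have /andP[h3 h4] := ln1B_taylor q0.
have E : (n + al)%:R * (e / (1 - rho) - (e / (1 - rho)) ^+ 2 / 2 + (e / (1 - rho)) ^+ 3 / 3)
   - edge rho e * e - n%:R * (- (e / rho) - (e / rho) ^+ 2 / 2 - (e / rho) ^+ 3 / 3) = 3^-1.
  by rewrite nE mE /edge; field; rewrite !gt_eqF.
have n0 : 0 <= n%:R :> R by [].
have m0 : 0 <= (n + al)%:R :> R by [].
have {h1} := ler_wpM2l m0 h1; have {h2} := ler_wpM2l m0 h2.
have {h3} := ler_wpM2l n0 h3; have {h4} := ler_wpM2l n0 h4.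
have E1 : (n + al)%:R * - ((e / (1 - rho)) ^+ 4 / 4) = - (rho * e / (4 * (1 - rho))) by rewrite mE; field; rewrite !gt_eqF.
have E2 : n%:R * - ((e / rho) ^+ 4 / 2) = - ((1 - rho) * e / (2 * rho)) by rewrite nE; field; rewrite !gt_eqF.
rewrite E1 E2 !mulr0 !mulrBr.
rewrite /edge_action; move: E; rewrite !mulrBr; lra.
Qed.

(** There is no upper restriction on [xi]: the linear bound on [ln (1 + u)] turns all terms in [xi]
    into exactly [- xi], and the remaining ones add up to less than 2. *)
Lemma edge_log_le : edge_log <= 2 - xi.
Proof.
have u1 : -1 < u by have := edge_ratio_ge; lra.
have alE : al%:R = (n + al)%:R - n%:R :> R by rewrite natrD; ring.
have h1 : al%:R / 2 * ln (1 + u) <= al%:R / 2 * u by rewrite ler_wpM2l // le_ln1Dx.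
have h2 : al%:R / 2 * u - xi / e / 2 + xi / e * r = - xi by rewrite alE nE mE /u /r; field; rewrite !gt_eqF.
have h3 : - ln (1 - e / rho) <= 1.
  have q2 : 2^-1 <= 1 - e / rho.
    have : e / rho <= 2^-1 by rewrite ler_pdivrMr //; have := e_rho; lra.
    by lra.
  have q0 : 0 < 1 - e / rho by apply: lt_le_trans q2.
  rewrite -lnV ?posrE //; have -> : (1 - e / rho)^-1 = 1 + ((1 - e / rho)^-1 - 1) by ring.
  have i2 : (1 - e / rho)^-1 <= 2 by rewrite invf_ple ?posrE.
  apply: le_trans (le_ln1Dx _) _; last by lra.
  by have : 0 < (1 - e / rho)^-1 by [rewrite invr_gt0]; lra.
have /andP[_ h4] := edge_action_bounds.
have h5 : (1 - rho) * e / (2 * rho) <= 4^-1.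
  rewrite ler_pdivrMr ?mulr_gt0 //; have : (1 - rho) * e <= 1 * e by rewrite ler_pM2r //; have := rho0; lra.
  by have := e_rho; lra.
have /andP[_ h6] : 0 <= stirling_rem R n - stirling_rem R (n + al) <= n%:R^-1 / 2 by apply: stirling_rem_diff_le; rewrite n_gt0 leq_addr.
have h7 : n%:R^-1 <= 1 :> R by rewrite invf_le1 ?ltr0n ?ler1n n_gt0.
by rewrite /edge_log; lra.
Qed.

Let c := r / e.
Let c0 : 0 < c. Proof. by rewrite divr_gt0. Qed.

Lemma lag_fun_profile : Num.sqrt (rho * (1 - rho)) / e * lag_fun al n x = edge_pref * (pi^-1 * RInt Rge0 (lag_profile (n + al) n r x c)).
Proof.
rewrite /lag_fun (lagf_profile (n + al) n r0 r1 x c0) /edge_pref /c.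
move: pi^-1 (Rintegral _ _ _) => p I; field; by rewrite expf_neq0 ?gt_eqF.
Qed.

Lemma lag_profile_le y : 0 <= y -> `|lag_profile (n + al) n r x c y| <= expR 1 * expR (- (4^-1 * y)).
Proof.
move=> y0; rewrite /lag_profile; case: ifPn => yc; last by rewrite normr0 mulr_ge0 ?expR_ge0.
rewrite normrM ger0_norm ?expR_ge0 // -expRD -[leRHS]mulr1; apply: ler_pM => //; last exact: cos_max.
(* Half of the gap [rho / (2 e^2)] between the edge and [m / (1 - r)^2]. The other half absorbs a
   negative [xi], thanks to [4 * A * e <= rho]. *)
rewrite ler_expR; set kap := rho / (4 * e ^+ 2).
have k0 : 0 <= kap by rewrite divr_ge0 ?mulr_ge0 ?sqr_ge0 // ltW.
have r1' : 0 < 1 - r by rewrite subr_gt0.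
have [_ eA4] := edge_small.
have hx : (n + al)%:R / (1 - r) ^+ 2 + kap <= x.
  have E : edge rho e - (n + al)%:R / (1 - r) ^+ 2 = rho * (1 - rho) * (2 - rho - r) / (e ^+ 2 * (1 - r) ^+ 2).
    rewrite mE /edge /r; field; rewrite gt_eqF //=; move: r1'; rewrite /r => h; rewrite gt_eqF //; lra.
  have h1 : rho / (2 * e ^+ 2) <= rho * (1 - rho) * (2 - rho - r) / (e ^+ 2 * (1 - r) ^+ 2).
    rewrite (_ : _ / (2 * _) = (rho / e ^+ 2) * 2^-1); last by field; rewrite gt_eqF.
    rewrite (_ : rho * _ * _ / _ = (rho / e ^+ 2) * ((1 - rho) * (2 - rho - r) / (1 - r) ^+ 2)); last first.
      by field; rewrite gt_eqF //=; move: r1'; rewrite subr_gt0 => h; rewrite gt_eqF // subr_gt0.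
    apply: ler_wpM2l; first by rewrite divr_ge0 ?sqr_ge0 // ltW.
    rewrite ler_pdivlMr ?exprn_gt0 //.
    have : (1 - r) ^+ 2 <= 1 by rewrite exprn_ile1 ?(ltW r1') //; have := r0; lra.
    have : 2^-1 * 1 <= (1 - rho) * (2 - rho - r) by apply: ler_pM => //; have := onerho; have := e0; rewrite /r; lra.
    by lra.
  have h2 : - kap <= xi / e.
    rewrite ler_pdivlMr // /kap (_ : - _ * e = - (rho / (4 * e))); last by field; rewrite gt_eqF.
    apply: le_trans xiA; rewrite lerN2 ler_pdivlMr ?mulr_gt0 //; lra.
  have E2 : rho / (2 * e ^+ 2) = kap + kap by rewrite /kap; field; rewrite gt_eqF.
  by rewrite /x /edge_pt; lra.
have ty : 0 <= y / c <= pi by rewrite divr_ge0 ?(ltW c0) //= ler_pdivrMr // mulrC.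
apply: le_trans (lag_exp_gaussian r0 r1 k0 hx ty) _.
have -> : r * kap * (y / c) ^+ 2 / 16 = (rho / r) * (y ^+ 2 / 64) by rewrite /kap /c; field; rewrite !gt_eqF.
have : 1 * (y ^+ 2 / 64) <= rho / r * (y ^+ 2 / 64).
  rewrite ler_wpM2r ?divr_ge0 ?sqr_ge0 // ler_pdivlMr // mul1r /r; have := e0; lra.
by have := sqr_ge0 (y / 8 - 1); rewrite sqrrB; lra.
Qed.

Definition lag_const : R := expR 2 * (pi^-1 * RInt Rge0 (fun y => expR 1 * expR (- (4^-1 * y)))).

Lemma lag_dom_integrable : mu.-integrable Rge0 (EFin \o (fun y : R => expR 1 * expR (- (4^-1 * y)))).
Proof. by apply: integrable_lebZ => //; apply: integrable_expRN. Qed.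

(** A bound with exponential decay in [xi], uniform in the degree and the parameter; it dominates
    the kernel for degrees comparable with the top one. *)
Lemma lag_fun_le : `|Num.sqrt (rho * (1 - rho)) / e * lag_fun al n x| <= lag_const * expR (- xi).
Proof.
rewrite lag_fun_profile edge_prefE normrM ger0_norm ?expR_ge0 //.
have mp := @lag_profile_measurable R (n + al) n r r0 r1 x c Rge0 c0.
have pl y : Rge0 y -> `|lag_profile (n + al) n r x c y| <= expR 1 * expR (- (4^-1 * y)) by rewrite /= in_itv /= andbT; exact: lag_profile_le.
have ip := integrable_leb_le (measurable_itv _) mp pl lag_dom_integrable.
have pi0 : 0 <= pi^-1 :> R by rewrite invr_ge0 pi_ge0.
have h1 : expR edge_log <= expR 2 * expR (- xi) by rewrite -expRD ler_expR edge_log_le.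
rewrite /lag_const -mulrA [X in _ <= _ * X]mulrC mulrA; apply: ler_pM => //; rewrite ?expR_ge0 //.
rewrite normrM (ger0_norm pi0); apply: ler_wpM2l => //.
apply: le_trans (@le_normr_Rintegral _ (measurableTypeR R) R mu _ _ (measurable_itv _) ip) _.
apply: le_Rintegral_leb => //; last exact: lag_dom_integrable.
exact: (@integrable_norm _ (measurableTypeR R) _ mu).
Qed.

End Fixed.
End LaguerreScaling.
Arguments lag_const : clear implicits.

Section CvgTools.
Variable R : realType.
Implicit Types (f g : nat -> R) (l : R).

Lemma cvg_as f g l l' : g @ \oo --> l -> (forall j, f j = g j) -> l = l' -> f @ \oo --> l'.
Proof. by move=> gl fg <-; rewrite (_ : f = g) //; exact/funext. Qed.

Lemma cvg_eq f l l' : f @ \oo --> l -> l = l' -> f @ \oo --> l'.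
Proof. by move=> fl <-. Qed.

Lemma cvg_pow f l k : f @ \oo --> l -> (fun j => f j ^+ k) @ \oo --> l ^+ k.
Proof.
move=> fl; elim: k => [|k IH]; first by apply: cvg_as (cvg_cst (1 : R)) _ _ => // j; rewrite expr0.
by apply: cvg_as (cvgM fl IH) _ _ => [j|]; rewrite exprS.
Qed.

Lemma cvg_inv f l : l != 0 -> f @ \oo --> l -> (fun j => (f j)^-1) @ \oo --> l^-1.
Proof. by move=> l0 fl; apply: cvgV. Qed.

Lemma cvg_ln f l : 0 < l -> f @ \oo --> l -> (fun j => ln (f j)) @ \oo --> ln l.
Proof. by move=> l0 fl; apply: continuous_cvg => //; exact: continuous_ln. Qed.

Lemma cvg_exp f l : f @ \oo --> l -> (fun j => expR (f j)) @ \oo --> expR l.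
Proof. by move=> fl; apply: continuous_cvg => //; exact: continuous_expR. Qed.

Lemma squeeze_seq f g h l : (forall j, f j <= g j <= h j) -> f @ \oo --> l -> h @ \oo --> l -> g @ \oo --> l.
Proof. by move=> fgh fl hl; apply: (squeeze_cvgr _ fl hl); near=> j; exact: fgh. Unshelve. all: end_near. Qed.

Lemma cvg_adds f g l l' : f @ \oo --> l -> g @ \oo --> l' -> (fun j => f j + g j) @ \oo --> l + l'.
Proof. exact: cvgD. Qed.

Lemma cvg_subs f g l l' : f @ \oo --> l -> g @ \oo --> l' -> (fun j => f j - g j) @ \oo --> l - l'.
Proof. exact: cvgB. Qed.

Lemma cvg_opps f l : f @ \oo --> l -> (fun j => - f j) @ \oo --> - l.
Proof. exact: cvgN. Qed.

Lemma cvg_muls f g l l' : f @ \oo --> l -> g @ \oo --> l' -> (fun j => f j * g j) @ \oo --> l * l'.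
Proof. exact: cvgM. Qed.
End CvgTools.

(** Splits the limit of a rational expression along its syntax; limits of the atoms are taken from
    the context, and denominators have to be nonzero in the limit. *)
Ltac cvg_rat := repeat first [ lazymatch goal with
    | |- cvg_to (nbhs (fmap (fun j => @Algebra.add _ (@?f j) (@Algebra.opp _ (@?g j))) _)) _ => apply: (@cvg_subs _ f g)
    | |- cvg_to (nbhs (fmap (fun j => @Algebra.add _ (@?f j) (@?g j)) _)) _ => apply: (@cvg_adds _ f g)
    | |- cvg_to (nbhs (fmap (fun j => @Algebra.opp _ (@?f j)) _)) _ => apply: (@cvg_opps _ f)
    | |- cvg_to (nbhs (fmap (fun j => @GRing.mul _ (@?f j) (@?g j)) _)) _ => apply: (@cvg_muls _ f g)
    | |- cvg_to (nbhs (fmap (fun j => @GRing.inv _ (@?f j)) _)) _ => apply: (@cvg_inv _ f)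
    | |- cvg_to (nbhs (fmap (fun j => @GRing.exp _ (@?f j) ?k) _)) _ => apply: (@cvg_pow _ f)
    | |- cvg_to (nbhs (fmap (fun j => ?c) _)) _ => exact: cvg_cst
    | |- is_true _ => by rewrite ?mulf_neq0 ?expf_neq0 ?pnatr_eq0
    end
  | assumption ].

(** * Convergence to the Airy function *)

Section EdgeLimit.
Variable R : realType.
Variables (al n : nat -> nat) (rho e xi : nat -> R) (A rhoL xiL : R).
Hypotheses (rho0 : forall j, 0 < rho j) (rho2 : forall j, rho j <= 2^-1) (e0 : forall j, 0 < e j)
  (A0 : 0 <= A) (eA : forall j, e j * (4 * A + 2) <= rho j) (xiA : forall j, - A <= xi j)
  (nE : forall j, (n j)%:R = rho j ^+ 3 * (1 - rho j) / e j ^+ 3)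
  (mE : forall j, (n j + al j)%:R = rho j * (1 - rho j) ^+ 3 / e j ^+ 3)
  (rhoL0 : 0 < rhoL) (rhoL2 : rhoL <= 2^-1)
  (rho_cvg : rho @ \oo --> rhoL) (e_cvg : e @ \oo --> 0) (xi_cvg : xi @ \oo --> xiL).

Let r j := rho j - e j.
Let r_cvg : r @ \oo --> rhoL.
Proof. by apply: cvg_as (cvgB rho_cvg e_cvg) _ _ => //; rewrite subr0. Qed.
Let e2 j : e j <= rho j / 2.
Proof. by have [] := edge_small (e0 j) A0 (eA j). Qed.
Let r0 j : 0 < r j. Proof. by rewrite /r; have := e2 j; have := rho0 j; lra. Qed.
Let r1 j : r j < 1. Proof. by rewrite /r; have := e0 j; have := rho2 j; lra. Qed.
Let rhoLn : rhoL != 0. Proof. by rewrite gt_eqF. Qed.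
Let onerhoL : 1 - rhoL != 0. Proof. by rewrite gt_eqF //; have := rhoL2; lra. Qed.
Let onerho j : 0 < 1 - rho j. Proof. by have := rho2 j; lra. Qed.

Lemma edge_log_cvg : (fun j => edge_log (al j) (n j) (rho j) (e j) (xi j)) @ \oo --> 3^-1 - xiL.
Proof.
have c1 : (fun j => - ln (1 - e j / rho j)) @ \oo --> (0 : R).
  apply: cvg_as (cvgN (cvg_ln (l := 1 - 0 / rhoL) _ _)) _ _ => //.
  - by rewrite mul0r subr0.
  - by cvg_rat.
  - by rewrite mul0r subr0 ln1 oppr0.
have c2 : (fun j => (stirling_rem R (n j) - stirling_rem R (n j + al j)) / 2) @ \oo --> (0 : R).
  apply: (squeeze_seq (f := fun=> 0) (h := fun j => e j ^+ 3 / (rho j ^+ 3 * (1 - rho j)) / 4)).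
  - move=> j; have n0 := n_gt0 (rho0 j) (rho2 j) (e0 j) (nE j).
    have /andP[h1 h2] := @stirling_rem_diff_le R (n j) (n j + al j) ltac:(by rewrite n0 leq_addr).
    apply/andP; split; first by lra.
    have -> : e j ^+ 3 / (rho j ^+ 3 * (1 - rho j)) = (n j)%:R^-1 by rewrite nE invf_div.
    by lra.
  - exact: cvg_cst.
  - apply: (@cvg_eq _ _ (0 ^+ 3 / (rhoL ^+ 3 * (1 - rhoL)) / 4)); first cvg_rat.
    by rewrite expr0n /= !mul0r.
have c3 : (fun j => edge_action (al j) (n j) (rho j) (e j)) @ \oo --> (3^-1 : R).
  apply: (squeeze_seq (f := fun j => 3^-1 - rho j * e j / (4 * (1 - rho j))) (h := fun j => 3^-1 + (1 - rho j) * e j / (2 * rho j))).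
  - by move=> j; exact: (edge_action_bounds (rho0 j) (rho2 j) (e0 j) A0 (eA j) (nE j) (mE j)).
  - apply: (@cvg_eq _ _ (3^-1 - rhoL * 0 / (4 * (1 - rhoL)))); first cvg_rat.
    by rewrite mulr0 mul0r subr0.
  - apply: (@cvg_eq _ _ (3^-1 + (1 - rhoL) * 0 / (2 * rhoL))); first cvg_rat.
    by rewrite mulr0 mul0r addr0.
pose u j := xi j * e j ^+ 2 / (rho j * (1 - rho j)).
have c4 : (fun j => (al j)%:R / 2 * ln (1 + u j) - xi j / e j / 2 + xi j / e j * r j) @ \oo --> - xiL.
  apply: (squeeze_seq (f := fun j => - xi j - e j * ((1 - 2 * rho j) * xi j ^+ 2 / (rho j * (1 - rho j)))) (h := fun j => - xi j)).
  - move=> j; have ug : - 2^-1 <= u j := edge_ratio_ge (rho0 j) (rho2 j) (e0 j) A0 (eA j) (xiA j).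
    have alE : (al j)%:R = (n j + al j)%:R - (n j)%:R :> R by rewrite natrD; ring.
    have E1 : (al j)%:R / 2 * u j - xi j / e j / 2 + xi j / e j * r j = - xi j by rewrite alE nE mE /u /r; field; rewrite !gt_eqF ?onerho.
    have E2 : (al j)%:R / 2 * (u j - 2 * u j ^+ 2) = (al j)%:R / 2 * u j - e j * ((1 - 2 * rho j) * xi j ^+ 2 / (rho j * (1 - rho j))).
      by rewrite alE nE mE /u; field; rewrite !gt_eqF ?onerho.
    have h1 : ln (1 + u j) <= u j by apply: le_ln1Dx; lra.
    (* A lower bound for the logarithm valid for [u >= - 1/2], the range granted by [edge_ratio_ge];
       its quadratic error is of order [e]. *)
    have h2 : u j - 2 * u j ^+ 2 <= ln (1 + u j).
      have u1 : 0 < 1 + u j by lra.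
      have h : ln (1 + u j)^-1 <= (1 + u j)^-1 - 1.
        have -> : (1 + u j)^-1 = 1 + ((1 + u j)^-1 - 1) by ring.
        rewrite addrAC subrr add0r; apply: le_ln1Dx.
        by have : 0 < (1 + u j)^-1 by [rewrite invr_gt0]; lra.
      rewrite lnV ?posrE // in h; apply: (@le_trans _ _ (1 - (1 + u j)^-1)); last by lra.
      have -> : 1 - (1 + u j)^-1 = u j / (1 + u j) by field; rewrite gt_eqF.
      rewrite ler_pdivlMr // -subr_ge0.
      have -> : u j - (u j - 2 * u j ^+ 2) * (1 + u j) = u j ^+ 2 * (1 + 2 * u j) by ring.
      by rewrite mulr_ge0 ?sqr_ge0 //; lra.
    have h3 : (al j)%:R / 2 * ln (1 + u j) <= (al j)%:R / 2 * u j by rewrite ler_wpM2l.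
    have h4 : (al j)%:R / 2 * (u j - 2 * u j ^+ 2) <= (al j)%:R / 2 * ln (1 + u j) by rewrite ler_wpM2l.
    by rewrite E2 in h4; apply/andP; split; lra.
  - apply: (@cvg_eq _ _ (- xiL - 0 * ((1 - 2 * rhoL) * xiL ^+ 2 / (rhoL * (1 - rhoL))))); first cvg_rat.
    by rewrite mul0r subr0.
  - exact: cvgN.
apply: cvg_as (cvg_adds (cvg_adds (cvg_adds c1 c2) c3) c4) _ _; last by ring.
by move=> j; rewrite /edge_log /u /r /=; ring.
Qed.

Let t (y : R) j := y / (r j / e j).

Lemma profile_angle_cvg y : t y @ \oo --> 0.
Proof.
have h : (fun j => y * (e j / r j)) @ \oo --> y * (0 / rhoL) by cvg_rat.
by apply: cvg_as h _ _; [move=> j; rewrite /t invf_div | rewrite mul0r mulr0].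
Qed.

Let xx j := edge_pt (rho j) (e j) (xi j).

(** At the angle [t = y e / r] the quotient [V] of [1 - cos t] by [e^2] tends to [y^2 / (2 rho^2)].
    Inserted in [lag_exp_ge] and [lag_exp_le], whose difference is of order [e], it squeezes the
    exponent. *)
Lemma profile_exp_cvg y : 0 <= y -> (fun j => lag_exp (n j + al j) (r j) (xx j * r j) (t y j)) @ \oo --> - y ^+ 2.
Proof.
move=> y0; pose V j := (1 - cos (t y j)) / e j ^+ 2.
have en j : e j != 0 by rewrite gt_eqF.
have rn j : r j != 0 by rewrite gt_eqF.
have r1n j : 1 - r j != 0 by rewrite gt_eqF // subr_gt0.
have t0 j : 0 <= t y j by rewrite divr_ge0 // divr_ge0 // ltW.
have Vc : V @ \oo --> y ^+ 2 / (2 * rhoL ^+ 2).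
  apply: (squeeze_seq (f := fun j => y ^+ 2 / (2 * r j ^+ 2) - y ^+ 4 * e j ^+ 2 / (24 * r j ^+ 4)) (h := fun j => y ^+ 2 / (2 * r j ^+ 2))).
  - move=> j; have e20 : 0 < e j ^+ 2 by rewrite exprn_gt0.
    apply/andP; split; rewrite /V.
    + rewrite ler_pdivlMr //; have := cos_le (t0 j).
      rewrite (_ : (_ - _ / _) * _ = t y j ^+ 2 / 2 - t y j ^+ 4 / 24); first by lra.
      by rewrite /t; field; rewrite rn en.
    + rewrite ler_pdivrMr //; have := cos_ge (t0 j).
      rewrite (_ : _ / _ * _ = t y j ^+ 2 / 2); first by lra.
      by rewrite /t; field; rewrite rn en.
  - apply: (@cvg_eq _ _ (y ^+ 2 / (2 * rhoL ^+ 2) - y ^+ 4 * 0 ^+ 2 / (24 * rhoL ^+ 4))); first cvg_rat.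
    by rewrite expr0n /= mulr0 mul0r subr0.
  - by cvg_rat.
pose U j := r j * V j * (- (rho j * (1 - rho j) * (2 - rho j - r j) / (1 - r j) ^+ 2) - e j * xi j).
have UE j : U j = r j * (1 - cos (t y j)) * ((n j + al j)%:R / (1 - r j) ^+ 2 - xx j).
  by rewrite /U /V /xx /edge_pt /edge mE; move: (r1n j) (en j); rewrite /r => h1 h2; field; rewrite h1 h2.
have Uc : U @ \oo --> - y ^+ 2.
  apply: (@cvg_eq _ _ (rhoL * (y ^+ 2 / (2 * rhoL ^+ 2)) *
    (- (rhoL * (1 - rhoL) * (2 - rhoL - rhoL) / (1 - rhoL) ^+ 2) - 0 * xiL))); first by rewrite /U; cvg_rat.
  by field; rewrite rhoLn onerhoL.
pose W j := U j - e j * (rho j * (1 - rho j) ^+ 3 * r j ^+ 2 * V j ^+ 2 / (1 - r j) ^+ 4).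
have Wc : W @ \oo --> - y ^+ 2.
  apply: (@cvg_eq _ _ (- y ^+ 2 - 0 * (rhoL * (1 - rhoL) ^+ 3 * rhoL ^+ 2 * (y ^+ 2 / (2 * rhoL ^+ 2)) ^+ 2 / (1 - rhoL) ^+ 4))); first by rewrite /W; cvg_rat.
  by rewrite mul0r subr0.
apply: (squeeze_seq _ Wc Uc) => j; rewrite UE lag_exp_le //= andbT.
apply: le_trans (lag_exp_ge (n j + al j) (r0 j) (r1 j) (xx j) (t y j)).
rewrite /W UE lerD2l lerN2 /V mE le_eqVlt; apply/orP; left; apply/eqP.
by move: (r1n j) (en j); rewrite /r => h1 h2; field; rewrite h1 h2.
Qed.

(** The drift yields the linear term [y (xi - 1)]; the rate, which is asymptotic to [2 rho^2 / e^3],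
    yields the cubic term [y^3 / 3]. *)
Lemma profile_phase_cvg y : 0 <= y -> (fun j => lag_phase (n j + al j) (n j) (r j) (xx j * r j) (t y j)) @ \oo --> airy_arg 1 xiL y.
Proof.
move=> y0; have en j : e j != 0 by rewrite gt_eqF.
have rn j : r j != 0 by rewrite gt_eqF.
have r1n j : 1 - r j != 0 by rewrite gt_eqF // subr_gt0.
have t0 j : 0 <= t y j by rewrite divr_ge0 // divr_ge0 // ltW.
pose D j := y * (xi j - rho j * (1 - rho j) / (r j * (1 - r j))).
have DE j : D j = phase_drift (n j + al j) (n j) (r j) (xx j) * t y j.
  rewrite /D /phase_drift /t /xx /edge_pt /edge mE nE.
  by move: (r1n j) (en j) (rn j); rewrite /r => h1 h2 h3; field; rewrite h1 h2 h3.
have Dc : D @ \oo --> y * (xiL - 1).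
  apply: (@cvg_eq _ _ (y * (xiL - rhoL * (1 - rhoL) / (rhoL * (1 - rhoL))))); first by rewrite /D; cvg_rat.
  by rewrite mulfV // mulf_neq0.
pose G (s : nat -> R) j := rho j * (1 - rho j) ^+ 3 * (1 + r j) / ((1 - r j) * ((1 - r j) ^+ 2 + 2 * r j * s j))
   - rho j * (1 - rho j) - xi j * e j ^+ 2.
have Gc s : s @ \oo --> 0 -> G s @ \oo --> 2 * rhoL ^+ 2.
  move=> sc; apply: (@cvg_eq _ _ (rhoL * (1 - rhoL) ^+ 3 * (1 + rhoL) / ((1 - rhoL) * ((1 - rhoL) ^+ 2 + 2 * rhoL * 0))
   - rhoL * (1 - rhoL) - xiL * 0 ^+ 2)); first rewrite /G; cvg_rat.
  - by rewrite mulr0 addr0 mulf_neq0 // expf_neq0.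
  - by rewrite mulr0 addr0; field; rewrite onerhoL.
have GE s j : 0 <= s j -> G s j = phase_rate (n j + al j) (r j) (xx j) (s j) * e j ^+ 3.
  move=> s0; rewrite /G /phase_rate /xx /edge_pt /edge mE.
  have : (1 - r j) ^+ 2 + 2 * r j * s j != 0.
    rewrite gt_eqF // ltr_pwDl ?exprn_gt0 ?subr_gt0 //.
    by rewrite !mulr_ge0 // ltW.
  by move: (r1n j) (en j); rewrite /r => h1 h2 h3; field; rewrite h1 h2 h3.
pose s j := t y j ^+ 2 / 2.
have sc : s @ \oo --> 0.
  apply: (@cvg_eq _ _ (0 ^+ 2 / 2)); last by rewrite expr0n /= mul0r.
  by have tc := profile_angle_cvg y; rewrite /s; cvg_rat.
have Gsc := Gc _ sc; have G0c : G (fun=> 0) @ \oo --> 2 * rhoL ^+ 2 by apply: Gc; exact: cvg_cst.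
pose lo j := D j + G s j * (1 - t y j ^+ 2 / 12) * y ^+ 3 / (6 * r j ^+ 2).
pose hi j := D j + G (fun=> 0) j * y ^+ 3 / (6 * r j ^+ 2).
have loc : lo @ \oo --> airy_arg 1 xiL y.
  apply: (@cvg_eq _ _ (y * (xiL - 1) + 2 * rhoL ^+ 2 * (1 - 0 ^+ 2 / 12) * y ^+ 3 / (6 * rhoL ^+ 2))).
    by have tc := profile_angle_cvg y; rewrite /lo; cvg_rat.
  by rewrite /airy_arg; field.
have hic : hi @ \oo --> airy_arg 1 xiL y.
  apply: (@cvg_eq _ _ (y * (xiL - 1) + 2 * rhoL ^+ 2 * y ^+ 3 / (6 * rhoL ^+ 2))).
    by rewrite /hi; cvg_rat.
  by rewrite /airy_arg; field.
apply: (squeeze_cvgr _ loc hic); near=> j.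
have s0 : 0 <= s j by rewrite divr_ge0 ?sqr_ge0.
have G0 : 0 <= G s j by near: j; apply: (cvgr_ge _ Gsc); rewrite mulr_gt0 // exprn_gt0.
have t12 : t y j ^+ 2 <= 12.
  have : s j <= 6 by near: j; apply: (cvgr_le _ sc).
  by rewrite /s; lra.
have P0 : 0 <= phase_rate (n j + al j) (r j) (xx j) (t y j ^+ 2 / 2) by move: G0; rewrite GE // pmulr_lge0 // exprn_gt0.
have /andP[h1 h2] := lag_phase_bounds (n j) (r0 j) (r1 j) (t0 j) t12 P0.
apply/andP; split.
- apply: le_trans h1; rewrite le_eqVlt; apply/orP; left; apply/eqP.
  rewrite /lo DE GE //; congr (_ + _); rewrite -/(s j).
  move: (phase_rate _ _ _ _) (1 - t y j ^+ 2 / 12) => p q.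
  by rewrite /t; move: (rn j) (en j) => g1 g2; field; rewrite g1 g2.
- apply: (le_trans h2); rewrite le_eqVlt; apply/orP; left; apply/eqP.
  rewrite /hi DE GE //; congr (_ + _).
  move: (phase_rate _ _ _ _) => p.
  by rewrite /t; move: (rn j) (en j) => g1 g2; field; rewrite g1 g2.
Unshelve. all: end_near. Qed.

(** The prefactor tends to [e^(1/3 - xi)] and the profile to [e^(-y^2) cos (airy_arg 1 xi y)];
    together they form the Airy integrand on the line [d = 1]. *)
Lemma lag_fun_cvg : (fun j => Num.sqrt (rho j * (1 - rho j)) / e j * lag_fun (al j) (n j) (xx j)) @ \oo --> Airy xiL.
Proof.
pose prof j := lag_profile (n j + al j) (n j) (r j) (xx j) (r j / e j).
have c0 j : 0 < r j / e j by rewrite divr_gt0.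
have mp j := @lag_profile_measurable R (n j + al j) (n j) (r j) (r0 j) (r1 j) (xx j) (r j / e j) Rge0 (c0 j).
have pc y : Rge0 y -> prof ^~ y @ \oo --> expR (- y ^+ 2) * cos (airy_arg 1 xiL y).
  rewrite /= in_itv /= andbT => y0.
  have h1 := cvg_exp (profile_exp_cvg y0).
  have h2 : (fun j => cos (lag_phase (n j + al j) (n j) (r j) (xx j * r j) (t y j))) @ \oo --> cos (airy_arg 1 xiL y).
    by apply: continuous_cvg; [exact: continuous_cos | exact: profile_phase_cvg].
  apply: cvg_trans (cvgM h1 h2); apply: near_eq_cvg; near=> j.
  rewrite /prof /lag_profile ifT // -ler_pdivrMl // mulrC; apply: (@le_trans _ _ 1).
    by near: j; apply: (cvgr_le _ (profile_angle_cvg y)).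
  by have := pi_ge2 R; lra.
have pl j y : Rge0 y -> `|prof j y| <= expR 1 * expR (- (4^-1 * y)).
  rewrite /= in_itv /= andbT.
  exact: (lag_profile_le (rho0 j) (rho2 j) (e0 j) A0 (eA j) (xiA j) (mE j)).
have [fi Ic] := cvg_Rintegral_leb (measurable_itv _) mp pc (lag_dom_integrable R) pl.
have Pc := cvg_exp edge_log_cvg.
have pic : (fun _ : nat => pi^-1 : R) @ \oo --> (pi^-1 : R) by exact: cvg_cst.
have H := cvg_muls Pc (cvg_muls pic Ic).
apply: (cvg_as H) => [j|].
  rewrite (lag_fun_profile _ _ _ (rho0 j) (rho2 j) (e0 j) A0 (eA j)) // (edge_prefE (rho0 j) (rho2 j) (e0 j) A0 (eA j) (xiA j)) //.
rewrite (Airy_shift xiL ltr01) mulrCA; congr (_ * _).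
rewrite -RintegralZl //.
apply: eq_Rintegral => y _; rewrite mulrA; congr (_ * _).
by rewrite -expRD /airy_mod; congr expR; rewrite expr1n; ring.
Unshelve. all: end_near. Qed.

End EdgeLimit.

(** * Gamma integrals and orthogonality *)

Section GammaIntegrals.
Variable R : realType.

Lemma expR_ge_pow (k : nat) (x : R) : 0 <= x -> x ^+ k / k`!%:R <= expR x.
Proof.
move=> x0; case: k => [|k]; first by rewrite expr0 fact0 divr1 -expR0 ler_expR.
by apply: le_trans (expR_ge1Dxn k x0); rewrite lerDr.
Qed.

Lemma pow_expRN_le (k : nat) (x : R) : 0 <= x -> x ^+ k * expR (- x) <= (2 ^+ k * k`!%:R) * expR (- (2^-1 * x)).
Proof.
move=> x0; have f0 : 0 < k`!%:R :> R by rewrite ltr0n fact_gt0.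
have := @expR_ge_pow k (x / 2) (divr_ge0 x0 (ler0n R 2)).
rewrite ler_pdivrMr // expr_div_n ler_pdivrMr ?exprn_gt0 // => h.
rewrite (_ : expR (- x) = expR (- (2^-1 * x)) * expR (- (2^-1 * x))); last by rewrite -expRD; congr expR; field.
rewrite mulrA ler_wpM2r ?expR_ge0 //.
rewrite expRN -ler_pdivlMr ?invr_gt0 ?expR_gt0 // invrK [2^-1 * x]mulrC; apply: le_trans h _.
rewrite le_eqVlt; apply/orP; left; apply/eqP; ring.
Qed.

Lemma is_derive_pow (k : nat) (x : R) : is_derive x 1 (fun y : R => y ^+ k.+1) (k.+1%:R * x ^+ k).
Proof.
elim: k => [|k IH]; first by rewrite expr0 mulr1; exact: is_derive_id.
rewrite (_ : (fun y => _) = fun y => y * y ^+ k.+1); last by apply/funext => y; rewrite exprS.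
by derive_eq; rewrite -[k.+2%:R]natr1 exprS; ring.
Qed.

Lemma pow_expRN_continuous (k : nat) : continuous (fun x : R => x ^+ k * expR (- x)).
Proof.
elim: k => [|k IH].
  have d (x : R) : is_derive x 1 (fun x : R => x ^+ 0 * expR (- x)) (- expR (- x)).
    rewrite (_ : (fun x => _) = fun x => expR (- x)); last by apply/funext => y; rewrite mul1r.
    by derive_eq; rewrite mulrN1.
  exact: is_derive_continuous d.
rewrite (_ : (fun x => _) = fun x => x * (x ^+ k * expR (- x))); last by apply/funext => x; rewrite exprS mulrA.
by move=> x; apply: cvgM; [exact: cvg_id | exact: IH].
Qed.

Lemma pow_expRN_integrable (k : nat) : mu.-integrable Rge0 (EFin \o (fun x : R => x ^+ k * expR (- x))).
Proof.
apply: (@integrable_leb_le _ _ _ (fun x : R => (2 ^+ k * k`!%:R) * expR (- (2^-1 * x)))) => //.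
- by apply: continuous_measurable_funS; exact: pow_expRN_continuous.
- move=> x; rewrite /= in_itv /= andbT => x0; rewrite ger0_norm ?pow_expRN_le //.
  by rewrite mulr_ge0 ?expR_ge0 ?exprn_ge0.
- by apply: integrable_lebZ => //; apply: integrable_expRN; rewrite invr_gt0.
Qed.

Lemma cvg_natr_pinfty : (fun n : nat => n%:R : R) @ \oo --> +oo.
Proof. exact: cvgr_idn. Qed.

Lemma gamma_integral (k : nat) : RInt Rge0 (fun x : R => x ^+ k * expR (- x)) = k`!%:R.
Proof.
elim: k => [|k IH].
- have c1 := cvg_Rintegral_itvcy (pow_expRN_integrable 0) cvg_natr_pinfty.
  have E n : RInt `[0, n%:R] (fun x : R => x ^+ 0 * expR (- x)) = 1 - expR (- n%:R).
    have := @Rintegral_FTC2 R (fun x => - expR (- x)) (fun x => x ^+ 0 * expR (- x)) 0 n%:R.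
    rewrite oppr0 expR0 opprK addrC; apply => //.
    + exact: pow_expRN_continuous.
    + by move=> x; derive_eq; rewrite expr0; ring.
  have c2 : (fun n => RInt `[0, n%:R] (fun x : R => x ^+ 0 * expR (- x))) @ \oo --> (1 : R).
    rewrite (_ : (fun n => _) = fun n => 1 - expR (- n%:R)); last by apply/funext => n; exact: E.
    apply: (@cvg_eq R _ (1 - 0)); last by rewrite subr0.
    apply: cvg_subs; first exact: cvg_cst.
    exact: (cvg_comp _ _ cvg_natr_pinfty (@cvgr_expR R)).
  by rewrite fact0; apply: (cvg_unique _ c1 c2).
- have c1 := cvg_Rintegral_itvcy (pow_expRN_integrable k.+1) cvg_natr_pinfty.
  have c0 := cvg_Rintegral_itvcy (pow_expRN_integrable k) cvg_natr_pinfty.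
  have E n : RInt `[0, n%:R] (fun x : R => x ^+ k.+1 * expR (- x)) =
     k.+1%:R * RInt `[0, n%:R] (fun x : R => x ^+ k * expR (- x)) - n%:R ^+ k.+1 * expR (- n%:R).
    have := @Rintegral_FTC2 R (fun x => x ^+ k.+1 * expR (- x)) (fun x => k.+1%:R * (x ^+ k * expR (- x)) - x ^+ k.+1 * expR (- x)) 0 n%:R.
    rewrite expr0n /= mul0r subr0 => /(_ _ _ _) h.
    have {}h : RInt `[0, n%:R] (fun x : R => k.+1%:R * (x ^+ k * expR (- x)) - x ^+ k.+1 * expR (- x)) = n%:R ^+ k.+1 * expR (- n%:R).
      apply: h => //.
      + by move=> x; apply: cvgB; [apply: cvgM; [exact: cvg_cst|]|]; exact: pow_expRN_continuous.
      + by move=> x; have dx := is_derive_pow k x; derive_eq; ring.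
    rewrite -h; rewrite RintegralB //; last 2 first.
    + by apply: integrable_lebZ => //; apply: integrable_continuous_itv; exact: pow_expRN_continuous.
    + by apply: integrable_continuous_itv; exact: pow_expRN_continuous.
    rewrite RintegralZl //; first by rewrite subKr.
    by apply: integrable_continuous_itv; exact: pow_expRN_continuous.
  have c2 : (fun n => RInt `[0, n%:R] (fun x : R => x ^+ k.+1 * expR (- x))) @ \oo --> (k.+1%:R * k`!%:R - 0 : R).
    rewrite (_ : (fun n => _) = fun n => k.+1%:R * RInt `[0, n%:R] (fun x : R => x ^+ k * expR (- x)) - n%:R ^+ k.+1 * expR (- n%:R)); last by apply/funext => n; exact: E.
    rewrite IH in c0; apply: cvg_subs; first by apply: cvg_muls c0; exact: cvg_cst.
    apply: (squeeze_seq (f := fun=> 0) (h := fun n => (2 ^+ k.+1 * k.+1`!%:R) * expR (- (2^-1 * n%:R)))).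
    + by move=> n; rewrite mulr_ge0 ?expR_ge0 ?exprn_ge0 //= pow_expRN_le.
    + exact: cvg_cst.
    + apply: (@cvg_eq R _ ((2 ^+ k.+1 * k.+1`!%:R) * 0)); last by rewrite mulr0.
      apply: cvg_muls; first exact: cvg_cst.
      apply: (cvg_comp (fun n : nat => 2^-1 * n%:R) (fun x => expR (- x))); last exact: cvgr_expR.
      apply: (cvg_comp (fun n : nat => n%:R : R) (fun x => 2^-1 * x) cvg_natr_pinfty).
      have h2 : 0 < 2^-1 :> R by rewrite invr_gt0.
      exact: gt0_cvgMry.
  by rewrite factS natrM -[RHS]subr0; apply: (cvg_unique _ c1 c2).
Qed.

(** Integration against [e^(-x)] as a linear form on coefficients, so that orthogonality becomes an
    identity between factorials. *)
Definition gamma_fun (p : {poly R}) := \sum_(i < size p) p`_i * i`!%:R.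

Lemma gamma_fun_poly (p : {poly R}) n : (size p <= n)%N -> gamma_fun p = \sum_(i < n) p`_i * i`!%:R.
Proof.
move=> pn; rewrite /gamma_fun (big_ord_widen n (fun i => p`_i * i`!%:R)) // big_mkcond.
by apply: eq_bigr => i _; case: ltnP => // /(nth_default 0) ->; rewrite mul0r.
Qed.

Lemma gamma_funD p q : gamma_fun (p + q) = gamma_fun p + gamma_fun q.
Proof.
set n := maxn (size p) (size q).
rewrite !(@gamma_fun_poly _ n) ?leq_maxl ?leq_maxr ?size_polyD // -big_split.
by apply: eq_bigr => i _; rewrite coefD mulrDl.
Qed.

Lemma gamma_funZ c p : gamma_fun (c *: p) = c * gamma_fun p.
Proof.
rewrite !(@gamma_fun_poly _ (size p)) ?size_scale_leq // mulr_sumr.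
by apply: eq_bigr => i _; rewrite coefZ mulrA.
Qed.

Lemma gamma_fun_sum (I : Type) (r : seq I) (P : pred I) (F : I -> {poly R}) :
  gamma_fun (\sum_(i <- r | P i) F i) = \sum_(i <- r | P i) gamma_fun (F i).
Proof.
elim/big_rec2: _ => [|i y x _ <-]; last by rewrite gamma_funD.
by rewrite /gamma_fun size_poly0 big_ord0.
Qed.

Lemma gamma_funXn k : gamma_fun 'X^k = k`!%:R.
Proof.
rewrite (@gamma_fun_poly _ k.+1) ?size_polyXn // big_ord_recr /= coefXn eqxx mul1r.
rewrite big1 ?add0r // => i _; rewrite coefXn ltn_eqF ?mul0r //.
Qed.

Lemma poly_expRN_integrable (p : {poly R}) (D : set R) : measurable D -> D `<=` Rge0 -> mu.-integrable D (EFin \o (fun x : R => p.[x] * expR (- x))).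
Proof.
move=> mD D0.
have h : mu.-integrable Rge0 (EFin \o (fun x : R => p.[x] * expR (- x))).
  rewrite (_ : (fun x => _) = fun x => \sum_(i < size p) p`_i * (x ^+ i * expR (- x))); last first.
    by apply/funext => x; rewrite horner_coef mulr_suml; apply: eq_bigr => i _; rewrite mulrA.
  rewrite (_ : EFin \o _ = fun x => \sum_(i < size p) (p`_i * (x ^+ i * expR (- x)))%:E)%E; last first.
    by apply/funext => x /=; rewrite sumEFin.
  apply: (@integrable_sum _ (measurableTypeR R) R mu) => // i _.
  by apply: integrable_lebZ => //; exact: pow_expRN_integrable.
exact: (integrable_subset (measurable_itv _) mD D0 h).
Qed.

Lemma gamma_funE (p : {poly R}) : RInt Rge0 (fun x : R => p.[x] * expR (- x)) = gamma_fun p.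
Proof.
rewrite /gamma_fun; move: {-1}(size p) (leqnn (size p)) => n.
elim: n p => [|n IH] p pn.
  rewrite big_ord0; transitivity (RInt Rge0 (fun=> (0 : R))).
    apply: eq_Rintegral => x _; move: pn; rewrite leqn0 size_poly_eq0 => /eqP ->.
    by rewrite horner0 mul0r.
  by rewrite Rintegral_cst // mul0r.
rewrite big_ord_recr /= -gamma_integral -RintegralZl //; last exact: pow_expRN_integrable.
pose q := \poly_(i < n) p`_i.
have qE x : p.[x] = q.[x] + p`_n * x ^+ n.
  rewrite (horner_coef_wide x pn) big_ord_recr /=; congr (_ + _).
  rewrite (@horner_coef_wide _ n) ?size_poly //.
  by apply: eq_bigr => i _; rewrite coef_poly ltn_ord.
transitivity (RInt Rge0 (fun x : R => q.[x] * expR (- x) + p`_n * (x ^+ n * expR (- x)))).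
  by apply: eq_Rintegral => x _; rewrite qE; ring.
rewrite RintegralD //; last 2 first.
- exact: poly_expRN_integrable.
- by apply: integrable_lebZ => //; exact: pow_expRN_integrable.
rewrite IH ?size_poly //; congr (_ + _).
by apply: eq_bigr => i _; rewrite coef_poly ltn_ord.
Qed.
End GammaIntegrals.

Section Orthonormality.
Variable R : realType.

(** The [n]-th forward difference, in [l], of a falling factorial power of degree [k]. *)
Definition fdiff (n k al : nat) : R := \sum_(l < n.+1) (-1) ^+ (n - l) * 'C(n, l)%:R * ((al + k + l) ^_ k)%:R.

Lemma fdiff_pascal n k al : fdiff n.+1 k al = fdiff n k al.+1 - fdiff n k al.
Proof.
pose G a m l : R := (-1) ^+ (m - l) * 'C(n, l)%:R * ((a + k + l) ^_ k)%:R.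
rewrite /fdiff big_ord_recl /= bin0 subn0.
rewrite [X in _ - X]big_ord_recl /= bin0 subn0.
under eq_bigr => l _ do rewrite /bump /= add1n subSS binS natrD mulrDr mulrDl.
rewrite big_split /= addrA addrC; congr (_ + _).
  by apply: eq_bigr => l _; rewrite addSn addSn addnS.
rewrite big_ord_recr /= bin_small // mulr0 mul0r addr0 opprD -sumrN exprS mulN1r !mulNr; congr (_ + _).
apply: eq_bigr => l _; rewrite /bump /= add1n; have -> : (n - l = (n - l.+1).+1)%N by rewrite subnSK.
by rewrite exprS mulN1r !mulNr.
Qed.

Lemma ffact_diff (y k : nat) : (y.+1 ^_ k.+1)%:R - (y ^_ k.+1)%:R = k.+1%:R * (y ^_ k)%:R :> R.
Proof.
have [ky|yk] := leqP k y; last first.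
  by rewrite !ffact_small ?mulr0 ?subrr // ltnS ltnW.
rewrite ffactSS ffactnSr natrM [in X in _ - X]natrM natrB // -natr1 -[in RHS]natr1; ring.
Qed.

Lemma fdiffE n k al : (k <= n)%N -> fdiff n k al = (k == n)%:R * n`!%:R.
Proof.
elim: n k al => [|n IH] k al.
  by rewrite leqn0 => /eqP ->; rewrite /fdiff big_ord1 /= subnn expr0 bin0 ffactn0 fact0 !mulr1.
rewrite fdiff_pascal; case: k => [_|k].
  rewrite mul0r; apply/eqP; rewrite subr_eq0; apply/eqP.
  by apply: eq_bigr => l _; rewrite !ffactn0.
rewrite ltnS => kn.
transitivity (k.+1%:R * fdiff n k al.+1).
  rewrite /fdiff -sumrB mulr_sumr; apply: eq_bigr => l _.
  rewrite -mulrBr addnS !addSn !addnS !addSn ffact_diff; ring.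
rewrite IH // eqSS; have [->|_] := eqVneq k n; last by rewrite !mul0r mulr0.
by rewrite !mul1r factS natrM.
Qed.

Definition lagp (m n : nat) : {poly R} := \poly_(k < n.+1) ((-1) ^+ (n - k) * 'C(m, n - k)%:R / k`!%:R).

Lemma lagpE m n x : (lagp m n).[x] = lagf m n x.
Proof.
rewrite (@horner_coef_wide _ n.+1) ?size_poly // /lagf; apply: eq_bigr => k _.
by rewrite coef_poly ltn_ord mulrAC mulrA.
Qed.

Lemma lagp_lead m n : (lagp m n)`_n = n`!%:R^-1.
Proof. by rewrite coef_poly ltnSn subnn expr0 bin0 mul1r mul1r. Qed.

(** The factorials produced by [gamma_fun] combine with the binomial coefficients to a finite
    difference of order [n] of a polynomial of degree [k <= n]. *)
Lemma lagp_moment al n k : (k <= n)%N -> gamma_fun ('X^(al + k) * lagp (n + al) n) = (k == n)%:R * (n + al)`!%:R.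
Proof.
move=> kn; have fn i : i`!%:R != 0 :> R by rewrite pnatr_eq0 -lt0n fact_gt0.
rewrite /lagp poly_def mulr_sumr gamma_fun_sum.
transitivity ((n + al)`!%:R / n`!%:R * fdiff n k al); last first.
  by rewrite fdiffE // mulrCA mulfVK.
rewrite /fdiff mulr_sumr; apply: eq_bigr => -[l /= ln] _; rewrite ltnS in ln.
rewrite -scalerAr -exprD gamma_funZ gamma_funXn.
have h1 : 'C(n + al, n - l)%:R * (n - l)`!%:R * (al + l)`!%:R = (n + al)`!%:R :> R.
  rewrite -!natrM -mulnA; congr (_%:R).
  have -> : (al + l = n + al - (n - l))%N by lia.
  by rewrite bin_fact //; lia.
have h2 : 'C(n, l)%:R * l`!%:R * (n - l)`!%:R = n`!%:R :> R by rewrite -!natrM -mulnA bin_fact.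
have h3 : ((al + k + l) ^_ k)%:R * (al + l)`!%:R = (al + k + l)`!%:R :> R.
  rewrite -!natrM; congr (_%:R).
  have -> : (al + l = al + k + l - k)%N by lia.
  by rewrite ffact_fact // addnAC leq_addl.
have e1 : 'C(n + al, n - l)%:R = (n + al)`!%:R / ((n - l)`!%:R * (al + l)`!%:R) :> R by rewrite -h1; field; rewrite !fn.
have e2 : 'C(n, l)%:R = n`!%:R / (l`!%:R * (n - l)`!%:R) :> R by rewrite -h2; field; rewrite !fn.
rewrite e1 e2 -h3; field.
by rewrite !fn.
Qed.

Lemma lagp_ortho al n n' : gamma_fun ('X^al * lagp (n + al) n * lagp (n' + al) n') = (n == n')%:R * ((n + al)`!%:R / n`!%:R).
Proof.
wlog nn : n n' / (n' <= n)%N.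
  move=> H; have [|/ltnW nn] := leqP n' n; first exact: H.
  rewrite mulrAC H // eq_sym; have [->//|_] := eqVneq n' n.
  by rewrite !mul0r.
rewrite {2}/lagp poly_def mulr_sumr gamma_fun_sum big_ord_recr /= big1 ?add0r.
- rewrite -scalerAr gamma_funZ (mulrAC 'X^al) -exprD lagp_moment // subnn expr0 bin0 !mul1r eq_sym.
  by have [->|_] := eqVneq n n'; rewrite ?mul1r ?mul0r ?mulr0 // mulrC.
- move=> k _; rewrite -scalerAr gamma_funZ (mulrAC 'X^al) -exprD lagp_moment ?(leq_trans (ltnW (ltn_ord k))) //.
  by rewrite ltn_eqF ?mul0r ?mulr0 // (leq_trans (ltn_ord k)).
Qed.

Definition lag_norm (al n : nat) : R := Num.sqrt (n`!%:R / (n + al)`!%:R).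

Lemma lag_funE al n x : 0 <= x -> lag_fun al n x = lag_norm al n * Num.sqrt (x ^+ al * expR (- x)) * (lagp (n + al) n).[x].
Proof.
move=> x0; rewrite /lag_fun lagpE -mulrA sqrtrM // divr_ge0 //.
Qed.

Lemma lag_fun_mul al n n' x : 0 <= x -> lag_fun al n x * lag_fun al n' x =
  (lag_norm al n * lag_norm al n' *: ('X^al * lagp (n + al) n * lagp (n' + al) n')).[x] * expR (- x).
Proof.
move=> x0; rewrite !lag_funE // hornerZ !hornerM hornerXn.
have : Num.sqrt (x ^+ al * expR (- x)) ^+ 2 = x ^+ al * expR (- x) by rewrite sqr_sqrtr // mulr_ge0 ?expR_ge0 ?exprn_ge0.
rewrite expr2 => h; transitivity (lag_norm al n * lag_norm al n' * (lagp (n + al) n).[x] * (lagp (n' + al) n').[x] *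
   (Num.sqrt (x ^+ al * expR (- x)) * Num.sqrt (x ^+ al * expR (- x)))); first by ring.
by rewrite h; ring.
Qed.

Lemma lag_fun_mul_integrable al n n' (D : set R) : measurable D -> D `<=` Rge0 ->
  mu.-integrable D (EFin \o (fun x => lag_fun al n x * lag_fun al n' x)).
Proof.
move=> mD D0; apply: (@eq_integrable _ (measurableTypeR R) R mu D mD _ _ _ (poly_expRN_integrable
   (lag_norm al n * lag_norm al n' *: ('X^al * lagp (n + al) n * lagp (n' + al) n')) mD D0)).
move=> x; rewrite inE => /D0; rewrite /= in_itv /= andbT => x0; by rewrite lag_fun_mul.
Qed.

Lemma lag_fun_orthonormal al n n' : RInt Rge0 (fun x : R => lag_fun al n x * lag_fun al n' x) = (n == n')%:R.
Proof.
transitivity (RInt Rge0 (fun x => (lag_norm al n * lag_norm al n' *: ('X^al * lagp (n + al) n * lagp (n' + al) n')).[x] * expR (- x))).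
  by apply: eq_Rintegral => x; rewrite inE /= in_itv /= andbT => x0; exact: lag_fun_mul.
rewrite gamma_funE gamma_funZ lagp_ortho.
have [<-|_] := eqVneq n n'; last by rewrite mul0r mulr0.
rewrite mul1r -expr2 sqr_sqrtr ?divr_ge0 //.
by rewrite mulrA divfK ?divff // pnatr_eq0 -lt0n fact_gt0.
Qed.
End Orthonormality.

(** * Gram determinants of Laguerre functions *)

Section GramMatrices.
Variable R : realType.

Lemma Rintegral_leb_sum (I : Type) (r : seq I) (D : set R) (f : I -> R -> R) : measurable D -> (forall i, mu.-integrable D (EFin \o f i)) ->
  RInt D (fun x => \sum_(i <- r) f i x) = \sum_(i <- r) RInt D (f i).
Proof.
move=> mD fi; elim: r => [|i r IH].
  rewrite big_nil; transitivity (RInt D (fun=> 0 : R)).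
    by apply: eq_Rintegral => x _; rewrite big_nil.
  by rewrite Rintegral_cst // mul0r.
transitivity (RInt D (fun x => f i x + \sum_(j <- r) f j x)).
  by apply: eq_Rintegral => x _; rewrite big_cons.
rewrite RintegralD // ?IH ?big_cons //.
rewrite (_ : EFin \o _ = fun x => \sum_(j <- r) (f j x)%:E)%E; last first.
  by apply/funext => x /=; rewrite sumEFin.
by apply: (@integrable_sum _ (measurableTypeR R) R mu) => // k _; exact: fi.
Qed.

Lemma psd_gram n (D : set R) (f : 'I_n -> R -> R) : measurable D -> (forall i j, mu.-integrable D (EFin \o (fun x => f i x * f j x))) ->
  psd (\matrix_(i, j) RInt D (fun x => f i x * f j x)).
Proof.
move=> mD fi; split.
  by apply/matrixP => i j; rewrite !mxE; apply: eq_Rintegral => x _; rewrite mulrC.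
move=> v; rewrite (_ : _ 0 0 = RInt D (fun x => (\sum_i v 0 i * f i x) ^+ 2)).
  by apply: Rintegral_ge0 => x _; exact: sqr_ge0.
rewrite mxE; transitivity (\sum_j \sum_i RInt D (fun x => v 0 i * v 0 j * (f i x * f j x))).
  apply: eq_bigr => j _; rewrite mxE mulr_suml; apply: eq_bigr => i _.
  by rewrite !mxE RintegralZl // mulrAC.
have iz i j : mu.-integrable D (EFin \o (fun x => v 0 i * v 0 j * (f i x * f j x))) by apply: integrable_lebZ.
transitivity (\sum_j RInt D (fun x => \sum_i v 0 i * v 0 j * (f i x * f j x))).
  by apply: eq_bigr => j _; rewrite Rintegral_leb_sum.
rewrite -Rintegral_leb_sum //.
  apply: eq_Rintegral => x _; rewrite expr2 mulr_suml exchange_big /=; apply: eq_bigr => i _.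
  by rewrite mulr_sumr; apply: eq_bigr => j _; ring.
move=> j; rewrite (_ : EFin \o _ = fun x => \sum_i (v 0 i * v 0 j * (f i x * f j x))%:E)%E; last first.
  by apply/funext => x /=; rewrite sumEFin.
by apply: (@integrable_sum _ (measurableTypeR R) R mu) => // k _; exact: iz.
Qed.
End GramMatrices.

Section LaguerreKernel.
Variable R : realType.

(** Indices count down from the top degree [N - 1], so that small indices are those that matter at
    the edge and the scaled index becomes the Airy variable. The value 0 outside the matrix is the
    convention of [fredholm_limit]. *)
Definition lag_kernel (al N : nat) (eta : R) (a b : nat) : R := if (a < N)%N && (b < N)%N then
    RInt `[eta, +oo[ (fun x => lag_fun al (N.-1 - a) x * lag_fun al (N.-1 - b) x)
  else 0.

Lemma itvcy_sub (eta : R) : 0 <= eta -> `[eta, +oo[%classic `<=` Rge0.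
Proof. by move=> e0 x; rewrite /= !in_itv /= !andbT => /(le_trans e0). Qed.

Lemma itvcc_sub (eta : R) : `[0, eta]%classic `<=` Rge0.
Proof. by move=> x; rewrite /= !in_itv /= andbT => /andP[]. Qed.

Lemma lag_kernel_psd al N eta : 0 <= eta -> psd (\matrix_(a < N, b < N) lag_kernel al N eta a b).
Proof.
move=> e0; rewrite (_ : \matrix_(a, b) _ = \matrix_(a < N, b < N)
   RInt `[eta, +oo[ (fun x => lag_fun al (N.-1 - a) x * lag_fun al (N.-1 - b) x)); last first.
  by apply/matrixP => a b; rewrite !mxE /lag_kernel !ltn_ord.
apply: psd_gram => // i j; apply: lag_fun_mul_integrable => //; exact: itvcy_sub.
Qed.

(** By orthonormality on the whole half line; consequently [1 - K] is a Gram matrix as well as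
    [K]. *)
Lemma lag_kernel_compl al N eta (a b : 'I_N) : 0 <= eta -> RInt `[0, eta] (fun x => lag_fun al (N.-1 - a) x * lag_fun al (N.-1 - b) x) =
  (a == b)%:R - lag_kernel al N eta a b.
Proof.
move=> e0; rewrite /lag_kernel !ltn_ord /=.
have -> : (a == b)%:R = RInt Rge0 (fun x : R => lag_fun al (N.-1 - a) x * lag_fun al (N.-1 - b) x).
  rewrite lag_fun_orthonormal; congr (_%:R); congr (nat_of_bool _).
  have := ltn_ord a; have := ltn_ord b => h1 h2; rewrite -val_eqE /=; lia.
have D0 : Rge0 = `[0, eta[%classic `|` `[eta, +oo[%classic :> set R.
  apply/seteqP; split=> x /=; rewrite !in_itv /= !andbT.
  - by move=> ->; case: ltP => /=; [left|right].
  - by case=> [/andP[]//|]; exact: le_trans.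
have ii (D : set R) : measurable D -> D `<=` Rge0 -> mu.-integrable D (EFin \o (fun x => lag_fun al (N.-1 - a) x * lag_fun al (N.-1 - b) x)).
  exact: lag_fun_mul_integrable.
rewrite D0 Rintegral_setU //.
- by rewrite addrK Rintegral_itv_bndo_bndc //; apply: ii => // x; rewrite /= !in_itv /= andbT => /andP[].
- by rewrite -D0; apply: ii.
- apply/disj_setPS => x [] /=; rewrite !in_itv /= andbT => /andP[_ h1] h2.
  by move: (lt_le_trans h1 h2); rewrite ltxx.
Qed.

Lemma lag_compl_psd al N eta : 0 <= eta -> psd (1%:M - \matrix_(a < N, b < N) lag_kernel al N eta a b).
Proof.
move=> e0; rewrite (_ : _ - _ = \matrix_(a < N, b < N) RInt `[0, eta] (fun x => lag_fun al (N.-1 - a) x * lag_fun al (N.-1 - b) x)); last first.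
  by apply/matrixP => a b; rewrite !mxE lag_kernel_compl.
apply: psd_gram => // i j; apply: lag_fun_mul_integrable => //; exact: itvcc_sub.
Qed.

Lemma det_poly_gram N (P : 'I_N -> {poly R}) (g : 'I_N -> R -> R) (D : set R) : measurable D ->
  (forall (i a : 'I_N), mu.-integrable D (EFin \o (fun x => x ^+ i * g a x))) ->
  (forall i : 'I_N, (size (P i) <= i.+1)%N) ->
  \det (\matrix_(i < N, a < N) RInt D (fun x => (P i).[x] * g a x)) =
  (\prod_i (P i)`_i) * \det (\matrix_(i < N, a < N) RInt D (fun x => x ^+ i * g a x)).
Proof.
move=> mD gi sP.
pose C := \matrix_(i < N, l < N) (P i)`_l.
have -> : \matrix_(i < N, a < N) RInt D (fun x => (P i).[x] * g a x) = C *m \matrix_(i < N, a < N) RInt D (fun x => x ^+ i * g a x).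
  apply/matrixP => i a; rewrite !mxE.
  transitivity (\sum_(l < N) RInt D (fun x => (P i)`_l * (x ^+ l * g a x))).
    rewrite -Rintegral_leb_sum //; last by move=> l; apply: integrable_lebZ.
    apply: eq_Rintegral => x _; rewrite (@horner_coef_wide _ N) ?(leq_trans (sP i)) //.
    by rewrite mulr_suml; apply: eq_bigr => l _; rewrite mulrA.
  by apply: eq_bigr => l _; rewrite !mxE RintegralZl.
rewrite det_mulmx; congr (_ * _); rewrite det_trig; last first.
  apply/is_trig_mxP => i l il; rewrite mxE nth_default // (leq_trans (sP i)) //.
by apply: eq_bigr => i _; rewrite mxE.
Qed.

Lemma det_rev N (A : 'I_N -> 'I_N -> R) : \det (\matrix_(i, j) A i (rev_ord j)) = (-1) ^+ perm (inv_inj (@rev_ordK N)) * \det (\matrix_(i, j) A i j).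
Proof.
rewrite [X in \det X = _](_ : _ = col_perm (perm (inv_inj (@rev_ordK N))) (\matrix_(i, j) A i j)); last first.
  by apply/matrixP => i j; rewrite !mxE permE.
by rewrite col_permE det_mulmx det_perm mulrC odd_permV.
Qed.

Lemma det_scale N (c d : 'I_N -> R) (A : 'I_N -> 'I_N -> R) :
  \det (\matrix_(i, j) (c i * d j * A i j)) = (\prod_i c i) * (\prod_j d j) * \det (\matrix_(i, j) A i j).
Proof.
rewrite (_ : \matrix_(i, j) (c i * d j * A i j) = diag_mx (\row_i c i) *m (\matrix_(i, j) A i j) *m diag_mx (\row_j d j)); last first.
  apply/matrixP => i j; rewrite mul_diag_mx mul_mx_diag !mxE; ring.
rewrite !det_mulmx !det_diag mulrAC; congr (_ * _ * _); by apply: eq_bigr => i _; rewrite mxE.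
Qed.

Lemma coef_onesubX_exp (eta : R) k : ((eta%:P - 'X) ^+ k)`_k = (-1) ^+ k /\ (size ((eta%:P - 'X) ^+ k) <= k.+1)%N.
Proof.
elim: k => [|k [IH1 IH2]]; first by rewrite !expr0 coef1 size_poly1.
rewrite exprS mulrBl; split.
  by rewrite coefB coefCM coefXM /= IH1 nth_default ?mulr0 ?sub0r ?exprS ?mulN1r.
apply: (leq_trans (size_polyD _ _)); rewrite geq_max size_polyN; apply/andP; split.
  by rewrite mul_polyC (leq_trans (size_scale_leq _ _)) // (leq_trans IH2).
by rewrite mulrC (leq_trans (size_polyMleq _ _)) // size_polyX addn2.
Qed.

(** Both determinants are triangular transforms of one moment determinant [H]: the left one through
    the polynomials [(eta - x)^i], the right one through Laguerre polynomials in both indices.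
    Leading coefficients, norms and the signs of the index reversals form [c], which does not depend
    on [eta]. *)
Lemma lag_det_formula al N : exists2 c : R, c != 0 & forall eta, 0 <= eta -> \det (\matrix_(i < N, a < N) RInt `[0, eta] (fun x =>
     (eta - x) ^+ i / i`!%:R * (x ^+ (N + al - a.+1) / (N + al - a.+1)`!%:R * expR (- x)))) =
  c * \det (1%:M - \matrix_(a < N, b < N) lag_kernel al N eta a b).
Proof.
have fn i : i`!%:R != 0 :> R by rewrite pnatr_eq0 -lt0n fact_gt0.
pose s : R := (-1) ^+ perm (inv_inj (@rev_ordK N)).
have s0 : s != 0 by rewrite /s signr_eq0.
pose c1 : R := \prod_(i < N) ((-1) ^+ i / i`!%:R).
pose c2 : R := \prod_(a < N) ((N + al - a.+1)`!%:R)^-1.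
pose c3 : R := \prod_(i < N) lag_norm R al i.
pose c4 : R := \prod_(i < N) (i`!%:R)^-1.
have c10 : c1 != 0 by apply/prodf_neq0 => i _; rewrite mulf_neq0 ?signr_eq0 ?invr_eq0.
have c20 : c2 != 0 by apply/prodf_neq0 => i _; rewrite invr_eq0.
have c30 : c3 != 0 by apply/prodf_neq0 => i _; rewrite sqrtr_eq0 -ltNge divr_gt0 // ltr0n fact_gt0.
have c40 : c4 != 0 by apply/prodf_neq0 => i _; rewrite invr_eq0.
exists (c1 * c2 * s / (s * s * (c3 * c3 * (c4 * c4)))).
  by rewrite !mulf_neq0 ?invr_eq0 ?mulf_neq0.
move=> eta e0; set D := `[0, eta]%classic.
have mD : measurable D by exact: measurable_itv.
have D0 : D `<=` Rge0 by exact: itvcc_sub.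
have ip p : mu.-integrable D (EFin \o (fun x : R => p.[x] * expR (- x))) := poly_expRN_integrable p mD D0.
have ipw (p : {poly R}) f : (forall x, f x = p.[x] * expR (- x)) -> mu.-integrable D (EFin \o f).
  by move=> E; rewrite (_ : f = fun x => p.[x] * expR (- x)) //; exact/funext.
pose H i a := RInt D (fun x => x ^+ i * (x ^+ (al + a) * expR (- x))).
have E1 : \det (\matrix_(i < N, a < N) RInt D (fun x => (eta - x) ^+ i / i`!%:R * (x ^+ (N + al - a.+1) / (N + al - a.+1)`!%:R * expR (- x)))) =
  c1 * c2 * s * \det (\matrix_(i < N, a < N) H i a).
  transitivity (\det (\matrix_(i < N, a < N) RInt D (fun x =>
     ((i`!%:R)^-1 *: (eta%:P - 'X) ^+ i).[x] * (x ^+ (N + al - a.+1) / (N + al - a.+1)`!%:R * expR (- x))))).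
    congr (\det _); apply/matrixP => i a; rewrite !mxE; apply: eq_Rintegral => x _.
    by rewrite hornerZ horner_exp hornerD hornerN hornerC hornerX [_^-1 * _]mulrC.
  rewrite det_poly_gram //; last first.
  - move=> i; apply: (leq_trans (size_scale_leq _ _)); exact: (coef_onesubX_exp eta i).2.
  - move=> i a; apply: (ipw (((N + al - a.+1)`!%:R)^-1 *: ('X^i * 'X^(N + al - a.+1)))) => x.
    by rewrite hornerZ hornerM !hornerXn; ring.
  rewrite -!mulrA; congr (_ * _).
    by apply: eq_bigr => i _; rewrite coefZ (coef_onesubX_exp eta i).1 mulrC.
  have one : \prod_(i < N) (1 : R) = 1 by rewrite big1_eq.
  have DS := det_scale (fun=> 1) (fun a : 'I_N => ((N + al - a.+1)`!%:R)^-1) (fun i a => H i (rev_ord a)).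
  rewrite one mul1r -/c2 in DS; rewrite -(det_rev (fun i a : 'I_N => H i a)) -DS.
  congr (\det _); apply/matrixP => i a; rewrite !mxE mul1r /H -RintegralZl //; last first.
    apply: (ipw ('X^i * 'X^(al + rev_ord a))) => x.
    by rewrite hornerM !hornerXn; ring.
  apply: eq_Rintegral => x _ /=.
  have -> : (al + (N - a.+1) = N + al - a.+1)%N by have := ltn_ord a; lia.
  ring.
have E2 : \det (1%:M - \matrix_(a < N, b < N) lag_kernel al N eta a b) = s * s * (c3 * c3 * (c4 * c4)) * \det (\matrix_(i < N, a < N) H i a).
  pose F i a := RInt D (fun x => lag_fun al i x * lag_fun al a x).
  transitivity (\det (\matrix_(a < N, b < N) F (rev_ord a) (rev_ord b))).
    congr (\det _); apply/matrixP => a b; rewrite !mxE -lag_kernel_compl // /F.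
    have rE (k : 'I_N) : (N.-1 - k = N - k.+1)%N by have := ltn_ord k; lia.
    by rewrite /= !rE.
  rewrite (det_rev (fun a b : 'I_N => F (rev_ord a) b)) -/s -!mulrA; congr (_ * _).
  rewrite -det_tr (_ : _^T = \matrix_(b < N, a < N) F (rev_ord a) b); last by apply/matrixP => a b; rewrite !mxE.
  rewrite (det_rev (fun b a : 'I_N => F a b)) -/s; congr (_ * _).
  transitivity (\det (\matrix_(b < N, a < N) (lag_norm R al b * lag_norm R al a *
      RInt D (fun x => (lagp R (b + al) b).[x] * ((lagp R (a + al) a).[x] * x ^+ al * expR (- x)))))).
    congr (\det _); apply/matrixP => b a; rewrite !mxE /F -RintegralZl //; last first.
      apply: (ipw (lagp R (b + al) b * lagp R (a + al) a * 'X^al)) => x.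
      by rewrite !hornerM hornerXn; ring.
    apply: eq_Rintegral => x; rewrite inE => /D0; rewrite /= in_itv /= andbT => x0.
    by rewrite lag_fun_mul // hornerZ !hornerM hornerXn; ring.
  rewrite det_scale -/c3 -!mulrA; congr (_ * (_ * _)).
  have lead : \prod_(i < N) (lagp R (i + al) i)`_i = c4 by apply: eq_bigr => i _; rewrite lagp_lead.
  rewrite (det_poly_gram (P := fun i : 'I_N => lagp R (i + al) i)) //; last first.
  - by move=> i; rewrite size_poly.
  - move=> i a; apply: (ipw ('X^i * (lagp R (a + al) a * 'X^al))) => x.
    by rewrite !hornerM !hornerXn; ring.
  rewrite lead; congr (_ * _).
  rewrite -det_tr (_ : _^T = \matrix_(a < N, i < N) RInt D (fun x => (lagp R (a + al) a).[x] * (x ^+ (al + i) * expR (- x)))); last first.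
    by apply/matrixP => a b; rewrite !mxE; apply: eq_Rintegral => x _; rewrite exprD; ring.
  rewrite (det_poly_gram (P := fun i : 'I_N => lagp R (i + al) i)) ?lead //.
  - move=> i a; apply: (ipw ('X^i * 'X^(al + a))) => x.
    by rewrite !hornerM !hornerXn; ring.
  - by move=> i; rewrite size_poly.
by rewrite E1 E2 mulrA mulfVK // !mulf_neq0.
Qed.
End LaguerreKernel.

(** * Edge scaling of the Laguerre kernel *)

Section EdgeParameters.
Variable R : realType.
Implicit Types (al n N : nat).

(** The critical point, and in [lag_e] the critical width, obtained by solving
    [n = rho^3 (1 - rho) / e^3] and [n + al = rho (1 - rho)^3 / e^3]. *)
Definition lag_rho al n : R := Num.sqrt n%:R / (Num.sqrt (n + al)%:R + Num.sqrt n%:R).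
Definition lag_e al n : R := (Num.sqrt (n + al)%:R * Num.sqrt n%:R / (Num.sqrt (n + al)%:R + Num.sqrt n%:R) ^+ 4) `^ (3^-1).

Section Positive.
Variables (al n : nat).
Hypothesis n0 : (0 < n)%N.
Let a : R := Num.sqrt (n + al)%:R.
Let b : R := Num.sqrt n%:R.
Let b0 : 0 < b. Proof. by rewrite sqrtr_gt0 ltr0n. Qed.
Let a0 : 0 < a. Proof. by rewrite sqrtr_gt0 ltr0n addn_gt0 n0. Qed.
Let ab : b <= a. Proof. by rewrite ler_wsqrtr // ler_nat leq_addr. Qed.
Let a2 : a ^+ 2 = (n + al)%:R. Proof. by rewrite sqr_sqrtr. Qed.
Let b2 : b ^+ 2 = n%:R. Proof. by rewrite sqr_sqrtr. Qed.

Lemma lag_rho_gt0 : 0 < lag_rho al n.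
Proof. by rewrite divr_gt0 // addr_gt0. Qed.

Lemma lag_rho_le : lag_rho al n <= 2^-1.
Proof. by rewrite /lag_rho ler_pdivrMr ?addr_gt0 // -/a -/b; have := ab; lra. Qed.

Lemma lag_e_gt0 : 0 < lag_e al n.
Proof.
have ab0 : 0 < a + b by rewrite addr_gt0.
by rewrite /lag_e -/a -/b powR_gt0 // divr_gt0 ?mulr_gt0 ?exprn_gt0.
Qed.

Lemma lag_e3 : lag_e al n ^+ 3 = a * b / (a + b) ^+ 4.
Proof.
rewrite /lag_e -powR_mulrn ?powR_ge0 // -powRrM mulVf ?pnatr_eq0 // powRr1 //.
Qed.

Let s0 : a + b != 0. Proof. by rewrite gt_eqF // addr_gt0. Qed.

Lemma lag_nE : n%:R = lag_rho al n ^+ 3 * (1 - lag_rho al n) / lag_e al n ^+ 3.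
Proof.
rewrite lag_e3 /lag_rho -/a -/b -b2; field.
by rewrite s0 gt_eqF ?mulr_gt0 //= ?gt_eqF.
Qed.

Lemma lag_mE : (n + al)%:R = lag_rho al n * (1 - lag_rho al n) ^+ 3 / lag_e al n ^+ 3.
Proof.
rewrite lag_e3 /lag_rho -/a -/b -a2; field.
by rewrite s0 gt_eqF ?mulr_gt0 //= ?gt_eqF.
Qed.

Lemma lag_edgeE : edge (lag_rho al n) (lag_e al n) = (a + b) ^+ 2.
Proof.
rewrite /edge lag_e3 /lag_rho -/a -/b; field.
by rewrite s0 gt_eqF ?mulr_gt0 //= ?gt_eqF.
Qed.

Lemma lag_rho_onem : (lag_rho al n * (1 - lag_rho al n))^-1 = (a + b) ^+ 2 / (a * b).
Proof.
rewrite /lag_rho -/a -/b; field.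
by rewrite s0 !gt_eqF //; rewrite addrK.
Qed.

Lemma lag_cube_e : lag_rho al n ^+ 3 * (1 - lag_rho al n) = n%:R * lag_e al n ^+ 3.
Proof. by rewrite lag_nE mulfVK // expf_neq0 // gt_eqF // lag_e_gt0. Qed.

End Positive.

(** When both squares grow by the same [k], the difference of the two sides times [a' b'] is the
    square of [a' b - a b']. *)
Lemma edge_gap_real (a b a' b' k : R) : 0 < a' -> 0 < b' -> a' ^+ 2 - a ^+ 2 = k -> b' ^+ 2 - b ^+ 2 = k ->
  k * ((a' + b') ^+ 2 / (a' * b')) <= (a' + b') ^+ 2 - (a + b) ^+ 2.
Proof.
move=> a0 b0 ka kb; rewrite mulrA ler_pdivrMr ?mulr_gt0 //.
rewrite -subr_ge0.
have -> : ((a' + b') ^+ 2 - (a + b) ^+ 2) * (a' * b') - k * (a' + b') ^+ 2 =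
   (a' * b - a * b') ^+ 2 + (a' ^+ 2 - a ^+ 2 - k) * (a' * b' + b' ^+ 2) + (b' ^+ 2 - b ^+ 2 - k) * (a' * b' + a' ^+ 2).
  by ring.
by rewrite ka kb !subrr !mul0r !addr0 sqr_ge0.
Qed.

(** Lowering the degree by [k] at fixed [al] moves the edge by about [k / (rho (1 - rho))]. The
    inequalities are not asymptotic, so the lower one also serves when [k] is comparable with
    [N]. *)
Lemma lag_edge_gap al n N : (0 < n <= N)%N -> (N - n)%:R / (lag_rho al N * (1 - lag_rho al N)) <=
    edge (lag_rho al N) (lag_e al N) - edge (lag_rho al n) (lag_e al n)
  <= (N - n)%:R / (lag_rho al n * (1 - lag_rho al n)).
Proof.
move=> /andP[n0 nN]; have N0 := leq_trans n0 nN.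
have p (k : nat) : (0 < k)%N -> 0 < Num.sqrt k%:R :> R by move=> k0; rewrite sqrtr_gt0 ltr0n.
rewrite !lag_rho_onem // !lag_edgeE //; apply/andP; split.
- apply: edge_gap_real; rewrite ?p ?addn_gt0 ?N0 //.
  + by rewrite !sqr_sqrtr // natrB // !natrD; ring.
  + by rewrite !sqr_sqrtr // natrB.
- rewrite -lerN2 opprB -mulNr; apply: edge_gap_real; rewrite ?p ?addn_gt0 ?n0 //.
  + by rewrite !sqr_sqrtr // natrB // !natrD; ring.
  + by rewrite !sqr_sqrtr // natrB // opprB.
Qed.

End EdgeParameters.

Section HalfLine.
Variable R : realType.

Lemma Rintegral_affine_itv (eta c T : R) (f : R -> R) : 0 < c -> 0 <= T -> continuous f -> RInt `[eta, eta + T / c] f =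
  c^-1 * RInt `[0, T] (fun z => f (eta + z / c)).
Proof.
move=> c0 T0 cf.
have dF (x : R) : is_derive x 1 (fun y => eta + y / c) c^-1.
  rewrite (_ : (fun y => _) = fun y => eta + c^-1 * y); last by apply/funext => y; rewrite mulrC.
  have d1 : is_derive x 1 (fun y : R => c^-1 * y) c^-1 by derive_eq; rewrite mulr1.
  by rewrite -[X in is_derive _ _ _ X]add0r; exact: is_deriveD.
have dFE : derive1 (fun y : R => eta + y / c) = (fun=> c^-1) by apply/funext => y; rewrite derive1E; have [_ ->] := dF y.
have cF := is_derive_continuous dF.
have cfc : continuous (fun y : R => f (eta + y / c)).
  by move=> y; apply: (@cvg_comp _ _ _ (fun y => eta + y / c) f (nbhs y) (nbhs (eta + y / c))); [exact: cF | exact: cf].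
have := @integration_by_substitution_increasing R (fun y => eta + y / c) f 0 T T0.
rewrite dFE mul0r addr0 => E.
rewrite /Rintegral E.
- rewrite -[RHS]RintegralZl //; last exact: integrable_continuous_itv.
  by apply: eq_Rintegral => y _ /=; rewrite mulrC.
- by move=> y z _ _; rewrite ltrD2l ltr_pM2r ?invr_gt0.
- by move=> y _; exact: cvg_cst.
- exact: is_cvg_cst.
- exact: is_cvg_cst.
- split=> [y _||].
  + by have [] := dF y.
  + by apply: cvg_at_right_filter; exact: cF.
  + by apply: cvg_at_left_filter; exact: cF.
- exact: continuous_subspaceT.
Qed.

Lemma Rintegral_affine (eta c : R) (f : R -> R) : 0 < c -> continuous f -> mu.-integrable `[eta, +oo[ (EFin \o f) ->
  mu.-integrable Rge0 (EFin \o (fun z => f (eta + z / c))) ->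
  RInt `[eta, +oo[ f =
  c^-1 * RInt Rge0 (fun z => f (eta + z / c)).
Proof.
move=> c0 cf fi gi.
have c1 := cvg_Rintegral_itvcy gi (@cvg_natr_pinfty R).
have Ty : (fun n : nat => eta + n%:R / c) @ \oo --> +oo.
  apply/cvgryPge => A; near=> n.
  rewrite -lerBlDl ler_pdivlMr //; near: n; apply: nbhs_infty_ger.
have c2 := cvg_Rintegral_itvcy fi Ty.
apply: (cvg_unique _ c2) => //=.
rewrite (_ : (fun n => _) = fun n => c^-1 * RInt `[0, n%:R] (fun z => f (eta + z / c))).
  by apply: cvg_muls c1; exact: cvg_cst.
by apply/funext => n; rewrite Rintegral_affine_itv.
Unshelve. all: end_near. Qed.

Lemma eventually_cvg (u : nat -> R) (l : R) (J : nat) : (fun j => u (j + J)%N) @ \oo --> l -> u @ \oo --> l.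
Proof. by move=> h; rewrite -(cvg_shiftn J). Qed.

Lemma shift_cvg (u : nat -> R) (l : R) (J : nat) : u @ \oo --> l -> (fun j => u (j + J)%N) @ \oo --> l.
Proof. by move=> h; rewrite (cvg_shiftn J). Qed.

Lemma cvg_cube1 (u : nat -> R) : (forall j, 0 <= u j) -> (fun j => u j ^+ 3) @ \oo --> (1 : R) -> u @ \oo --> (1 : R).
Proof.
move=> u0 u3; apply/cvgrPdist_le => e e0; near=> j.
have : `|1 - u j ^+ 3| <= e by near: j; move/cvgrPdist_le : u3; exact.
apply: le_trans; rewrite (_ : 1 - u j ^+ 3 = (1 - u j) * (1 + u j + u j ^+ 2)); last by ring.
rewrite normrM -[leLHS]mulr1 ler_wpM2l // ger0_norm ?addr_ge0 ?sqr_ge0 //.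
by rewrite -addrA lerDl addr_ge0 ?sqr_ge0.
Unshelve. all: end_near. Qed.

Lemma cvg_cube0 (u : nat -> R) : (forall j, 0 <= u j) -> (fun j => u j ^+ 3) @ \oo --> (0 : R) -> u @ \oo --> (0 : R).
Proof.
move=> u0 u3; apply/cvgrPdist_le => e e0; near=> j.
have : `|0 - u j ^+ 3| <= e ^+ 3 by near: j; move/cvgrPdist_le : u3; apply; rewrite exprn_gt0.
rewrite !sub0r !normrN !ger0_norm ?exprn_ge0 // => h.
by rewrite -(@ler_pXn2r _ 3) ?nnegrE ?u0 // ltW.
Unshelve. all: end_near. Qed.

Lemma cvg_sqrt (f : nat -> R) (l : R) : f @ \oo --> l -> (fun j => Num.sqrt (f j)) @ \oo --> Num.sqrt l.
Proof. by move=> fl; apply: continuous_cvg => //; exact: sqrt_continuous. Qed.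
End HalfLine.

Section EventualLimit.
Variable R : realType.

Lemma lag_fun_cvg_near (al n : nat -> nat) (rho e xi : nat -> R) (A rhoL xiL : R) :
  (forall j, 0 < rho j) -> (forall j, rho j <= 2^-1) -> (forall j, 0 < e j) -> 0 <= A ->
  (\forall j \near \oo, e j * (4 * A + 2) <= rho j /\ - A <= xi j) ->
  (forall j, (n j)%:R = rho j ^+ 3 * (1 - rho j) / e j ^+ 3) ->
  (forall j, (n j + al j)%:R = rho j * (1 - rho j) ^+ 3 / e j ^+ 3) ->
  0 < rhoL -> rhoL <= 2^-1 ->
  rho @ \oo --> rhoL -> e @ \oo --> 0 -> xi @ \oo --> xiL ->
  (fun j => Num.sqrt (rho j * (1 - rho j)) / e j * lag_fun (al j) (n j) (edge_pt (rho j) (e j) (xi j))) @ \oo --> Airy xiL.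
Proof.
move=> r0 r2 e0 A0 [J _ HJ] nE mE rL0 rL2 rc ec xc.
have H j : e (j + J)%N * (4 * A + 2) <= rho (j + J)%N /\ - A <= xi (j + J)%N by apply: HJ; rewrite /= leq_addl.
apply: (@eventually_cvg R _ _ J).
have H1 j := (H j).1; have H2 j := (H j).2.
exact: (@lag_fun_cvg R (fun j => al (j + J)%N) (fun j => n (j + J)%N) (fun j => rho (j + J)%N)
     (fun j => e (j + J)%N) (fun j => xi (j + J)%N) A rhoL xiL (fun j => r0 _) (fun j => r2 _) (fun j => e0 _)
     A0 H1 H2 (fun j => nE _) (fun j => mE _) rL0 rL2 (shift_cvg J rc) (shift_cvg J ec) (shift_cvg J xc)).
Qed.
End EventualLimit.

(** * Windows of degrees at the edge *)

Section EdgeSequences.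
Variable R : realType.
Variables (N al : nat -> nat) (delta : R).
Hypotheses (N0 : forall j, (0 < N j)%N) (Ny : (fun j => (N j)%:R : R) @ \oo --> +oo)
  (al_cvg : (fun j => (al j)%:R / (N j)%:R) @ \oo --> delta) (delta0 : 0 <= delta).

Let rhoL : R := (1 + Num.sqrt (1 + delta))^-1.

Lemma rhoL_gt0 : 0 < rhoL. Proof. by rewrite invr_gt0 ltr_pwDl. Qed.

Lemma rhoL_le : rhoL <= 2^-1.
Proof.
rewrite lef_pV2 ?posrE ?ltr_pwDl //.
have : 1 <= Num.sqrt (1 + delta) by rewrite -[leLHS]sqrtr1 ler_wsqrtr // lerDl.
by lra.
Qed.

Lemma rhoL_spec : [/\ 0 < rhoL, rhoL <= 2^-1, rhoL != 0 & 1 - rhoL != 0].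
Proof. by have r0 := rhoL_gt0; have r2 := rhoL_le; split => //; rewrite gt_eqF //; lra. Qed.

Lemma invN_cvg : (fun j => (N j)%:R^-1 : R) @ \oo --> (0 : R).
Proof. by apply/gtr0_cvgV0 => //; near=> j; rewrite ltr0n. Unshelve. all: end_near. Qed.

Section Index.
Variable n : nat -> nat.
Hypotheses (n0 : forall j, (0 < n j)%N) (n_cvg : (fun j => (n j)%:R / (N j)%:R) @ \oo --> (1 : R)).

Let NN j : (N j)%:R != 0 :> R. Proof. by rewrite pnatr_eq0 -lt0n. Qed.
Let nn j : (n j)%:R != 0 :> R. Proof. by rewrite pnatr_eq0 -lt0n. Qed.

Lemma lag_rho_cvg : (fun j => lag_rho R (al j) (n j)) @ \oo --> rhoL.
Proof.
have h : (fun j => 1 + (al j)%:R / (N j)%:R / ((n j)%:R / (N j)%:R)) @ \oo --> 1 + delta / 1 by cvg_rat.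
rewrite divr1 in h.
have h2 : (fun j => Num.sqrt (1 + (al j)%:R / (N j)%:R / ((n j)%:R / (N j)%:R))) @ \oo --> Num.sqrt (1 + delta) by exact: cvg_sqrt.
have h3 : (fun j => (1 + Num.sqrt (1 + (al j)%:R / (N j)%:R / ((n j)%:R / (N j)%:R)))^-1) @ \oo --> rhoL.
  apply: cvg_inv; last by cvg_rat.
  by rewrite gt_eqF // ltr_pwDl.
apply: (cvg_as h3) => // j; rewrite /lag_rho.
have -> : 1 + (al j)%:R / (N j)%:R / ((n j)%:R / (N j)%:R) = (n j + al j)%:R / (n j)%:R :> R by rewrite natrD; field; rewrite NN nn.
rewrite sqrtrM // sqrtrV //.
have s0 : Num.sqrt (n j)%:R != 0 :> R by rewrite gt_eqF // sqrtr_gt0 ltr0n.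
have s1 : Num.sqrt (n j + al j)%:R + Num.sqrt (n j)%:R != 0 :> R by rewrite gt_eqF // ltr_wpDl // ?sqrtr_gt0 ?ltr0n.
by field; rewrite s0 addrC s1.
Qed.

Lemma lag_e_cvg0 : (fun j => lag_e R (al j) (n j)) @ \oo --> (0 : R).
Proof.
apply: cvg_cube0 => [j|]; first by rewrite ltW // lag_e_gt0.
have h : (fun j => lag_rho R (al j) (n j) ^+ 3 * (1 - lag_rho R (al j) (n j)) / ((n j)%:R / (N j)%:R) * (N j)%:R^-1) @ \oo
    --> rhoL ^+ 3 * (1 - rhoL) / 1 * 0.
  have c1 := lag_rho_cvg; have c2 := invN_cvg; cvg_rat.
apply: (cvg_as h) => [j|]; last by rewrite mulr0.
have e0 : lag_e R (al j) (n j) != 0 by rewrite gt_eqF // lag_e_gt0.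
rewrite lag_cube_e //; by field; rewrite NN nn.
Qed.

End Index.

Lemma lag_e_ratio (n : nat -> nat) : (forall j, (0 < n j)%N) -> (fun j => (n j)%:R / (N j)%:R) @ \oo --> (1 : R) ->
  (fun j => lag_e R (al j) (n j) / lag_e R (al j) (N j)) @ \oo --> (1 : R).
Proof.
move=> n0 n_cvg.
have NN_cvg : (fun j => (N j)%:R / (N j)%:R) @ \oo --> (1 : R).
  apply: (cvg_as (cvg_cst (1 : R))) => // j; by rewrite divff // pnatr_eq0 -lt0n.
have c1 := lag_rho_cvg n0 n_cvg; have c2 := lag_rho_cvg N0 NN_cvg.
have [rL0 rL2 rLn rL1] := rhoL_spec.
apply: cvg_cube1 => [j|]; first by rewrite divr_ge0 // ltW // lag_e_gt0.
have h : (fun j => (lag_rho R (al j) (n j) ^+ 3 * (1 - lag_rho R (al j) (n j))) /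
   (lag_rho R (al j) (N j) ^+ 3 * (1 - lag_rho R (al j) (N j))) / ((n j)%:R / (N j)%:R)) @ \oo
    --> (rhoL ^+ 3 * (1 - rhoL)) / (rhoL ^+ 3 * (1 - rhoL)) / 1.
  by have rn : rhoL != 0 by [rewrite gt_eqF]; cvg_rat; rewrite mulf_neq0 // expf_neq0.
apply: (cvg_as h) => [j|]; last by rewrite divr1 divff // mulf_neq0 // expf_neq0 // gt_eqF.
rewrite !lag_cube_e //; field.
by rewrite !pnatr_eq0 -!lt0n N0 n0 gt_eqF // lag_e_gt0.
Qed.

(** Number of degrees per unit of the Airy variable: [k] degrees move the edge by about
    [k / (rho (1 - rho))], which is [k / lag_h] in the unit [1 / e]. *)
Definition lag_h j := lag_rho R (al j) (N j) * (1 - lag_rho R (al j) (N j)) / lag_e R (al j) (N j).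

Let NN_cvg : (fun j => (N j)%:R / (N j)%:R) @ \oo --> (1 : R).
Proof. apply: (cvg_as (cvg_cst (1 : R))) => // j; by rewrite divff // pnatr_eq0 -lt0n. Qed.

Let eN j := lag_e R (al j) (N j).
Let rN j := lag_rho R (al j) (N j).
Let eN0 j : 0 < eN j. Proof. exact: lag_e_gt0. Qed.
Let rN0 j : 0 < rN j. Proof. exact: lag_rho_gt0. Qed.
Let rN2 j : rN j <= 2^-1. Proof. exact: lag_rho_le. Qed.
Let rN1 j : 0 < 1 - rN j. Proof. by have := rN2 j; lra. Qed.
Let eN_cvg : eN @ \oo --> (0 : R). Proof. exact: lag_e_cvg0. Qed.
Let rN_cvg : rN @ \oo --> rhoL. Proof. exact: lag_rho_cvg. Qed.

Lemma lag_h_gt0 j : 0 < lag_h j.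
Proof. by rewrite divr_gt0 ?eN0 // mulr_gt0 ?rN0 ?rN1. Qed.

Lemma lag_h_inv_cvg : (fun j => (lag_h j)^-1) @ \oo --> (0 : R).
Proof.
have [rL0 rL2 rLn rL1] := rhoL_spec.
have rn : rhoL != 0 by rewrite gt_eqF.
have h : (fun j => eN j / (rN j * (1 - rN j))) @ \oo --> 0 / (rhoL * (1 - rhoL)) by cvg_rat.
by apply: (cvg_as h) => [j|]; [rewrite /lag_h invf_div | rewrite mul0r].
Qed.

Lemma edge_pt_change (r1 e1 r2 e2 c : R) : e1 != 0 -> e2 != 0 -> edge_pt r2 e2 (e2 / e1 * c + (edge r1 e1 - edge r2 e2) * e2) = edge r1 e1 + c / e1.
Proof. by move=> h1 h2; rewrite /edge_pt; move: (edge _ _) (edge _ _) => a b; field; rewrite h1 h2. Qed.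

Section Window.
Variables (k : nat -> nat) (kappa s : R) (ss : nat -> R) (z : R).
Hypotheses (kN : forall j, (k j < N j)%N) (k_cvg : (fun j => (k j)%:R / lag_h j) @ \oo --> kappa) (s_cvg : ss @ \oo --> s).

Let n j := (N j - k j)%N.
Let n0 j : (0 < n j)%N. Proof. by rewrite subn_gt0. Qed.

Lemma window_index_cvg : (fun j => (n j)%:R / (N j)%:R) @ \oo --> (1 : R).
Proof.
have [rL0 rL2 rLn rL1] := rhoL_spec.
have rn : rhoL != 0 by rewrite gt_eqF.
have h : (fun j => 1 - (k j)%:R / lag_h j * (eN j ^+ 2 / rN j ^+ 2)) @ \oo --> 1 - kappa * (0 ^+ 2 / rhoL ^+ 2) by cvg_rat.
apply: (cvg_as h) => [j|]; last by rewrite expr0n /= mul0r mulr0 subr0.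
rewrite /n natrB ?(ltnW (kN j)) // mulrBl divff ?pnatr_eq0 -?lt0n //; congr (1 - _).
have := lag_cube_e R (al j) (N0 j); rewrite -/(rN j) -/(eN j) /lag_h -/(rN j) -/(eN j) => E.
have e0 : eN j != 0 by rewrite gt_eqF.
have r0 : rN j != 0 by rewrite gt_eqF.
have r1 : 1 - rN j != 0 by rewrite gt_eqF.
have NE : (N j)%:R = rN j ^+ 3 * (1 - rN j) / eN j ^+ 3 by rewrite E mulfK // expf_neq0.
by rewrite NE; move: (rN j) (eN j) e0 r0 r1 => r e h1 h2 h3; field; rewrite h1 h2 h3.
Qed.

Let en j := lag_e R (al j) (n j).
Let rn j := lag_rho R (al j) (n j).

(** The same point measured from the edge of the lower degree [n] and in the unit of that degree;
    the displacement of the edge adds [kappa] to the Airy variable. *)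
Definition window_xi j := en j / eN j * (ss j + z) + (edge (rN j) (eN j) - edge (rn j) (en j)) * en j.

Lemma window_xi_cvg : window_xi @ \oo --> s + z + kappa.
Proof.
have [rL0 rL2 rLn rL1] := rhoL_spec.
have c1 := lag_e_ratio n0 window_index_cvg.
have c2 : rn @ \oo --> rhoL := lag_rho_cvg n0 window_index_cvg.
have en0 j : 0 < en j by exact: lag_e_gt0.
have rn0 j : 0 < rn j by exact: lag_rho_gt0.
have rn1 j : 0 < 1 - rn j by have := lag_rho_le R (al j) (n0 j); rewrite -/(rn j); lra.
have g1 : (fun j => en j / eN j * ((k j)%:R / lag_h j)) @ \oo --> 1 * kappa by cvg_rat.
have g2 : (fun j => en j / eN j * ((k j)%:R / lag_h j) * ((rN j * (1 - rN j)) / (rn j * (1 - rn j)))) @ \oo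
   --> 1 * kappa * ((rhoL * (1 - rhoL)) / (rhoL * (1 - rhoL))) by cvg_rat.
rewrite divff ?mulf_neq0 // mulr1 in g2; rewrite mul1r in g1 g2.
have g3 : (fun j => (edge (rN j) (eN j) - edge (rn j) (en j)) * en j) @ \oo --> kappa.
  apply: (squeeze_seq _ g1 g2) => j.
  have nk : (N j - n j = k j)%N by rewrite /n subKn // ltnW.
  have := @lag_edge_gap R (al j) (n j) (N j); rewrite n0 leq_subr /= nk => /(_ isT).
  rewrite -/(rN j) -/(eN j) -/(rn j) -/(en j) => /andP[h1 h2]; apply/andP; split.
  - have -> : en j / eN j * ((k j)%:R / lag_h j) = (k j)%:R / (rN j * (1 - rN j)) * en j; last by rewrite ler_pM2r.
    by rewrite /lag_h -/(rN j) -/(eN j); field; rewrite !gt_eqF.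
  - have -> : en j / eN j * ((k j)%:R / lag_h j) * ((rN j * (1 - rN j)) / (rn j * (1 - rn j))) =
      (k j)%:R / (rn j * (1 - rn j)) * en j; last by rewrite ler_pM2r.
    by rewrite /lag_h -/(rN j) -/(eN j); field; rewrite !gt_eqF.
have g4 : (fun j => en j / eN j * (ss j + z) + (edge (rN j) (eN j) - edge (rn j) (en j)) * en j) @ \oo --> 1 * (s + z) + kappa by cvg_rat; exact: c1.
by apply: (cvg_eq g4); rewrite mul1r.
Qed.

Lemma window_pt j : edge_pt (rn j) (en j) (window_xi j) = edge (rN j) (eN j) + (ss j + z) / eN j.
Proof.
have en0 : en j != 0 by rewrite gt_eqF // lag_e_gt0.
have e0 : eN j != 0 by rewrite gt_eqF.
exact: edge_pt_change.
Qed.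

Lemma window_lag_fun_cvg : (fun j => Num.sqrt (rN j * (1 - rN j)) / eN j *
     lag_fun (al j) (n j) (edge (rN j) (eN j) + (ss j + z) / eN j)) @ \oo --> Airy (s + z + kappa).
Proof.
have [rL0 rL2 rLn rL1] := rhoL_spec.
have c1 := lag_e_ratio n0 window_index_cvg.
have c2 : rn @ \oo --> rhoL := lag_rho_cvg n0 window_index_cvg.
have c3 : en @ \oo --> (0 : R) := lag_e_cvg0 n0 window_index_cvg.
have c4 := window_xi_cvg.
have en0 j : 0 < en j by exact: lag_e_gt0.
have rn0 j : 0 < rn j by exact: lag_rho_gt0.
have rn2 j : rn j <= 2^-1 := lag_rho_le R (al j) (n0 j).
have rn1 j : 0 < 1 - rn j by have := rn2 j; lra.
pose A := `|s + z + kappa| + 1.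
have A0 : 0 <= A by rewrite addr_ge0.
have near_ok : \forall j \near \oo, en j * (4 * A + 2) <= rn j /\ - A <= window_xi j.
  have d : (fun j => rn j - en j * (4 * A + 2)) @ \oo --> rhoL - 0 * (4 * A + 2) by cvg_rat.
  rewrite mul0r subr0 in d.
  near=> j; split.
    by rewrite -subr_ge0; near: j; exact: (cvgr_ge _ d).
  near: j; apply: (cvgr_ge _ c4); rewrite /A.
  by have := ler_norm (- (s + z + kappa)); rewrite normrN; lra.
have main := lag_fun_cvg_near rn0 rn2 en0 A0 near_ok (fun j => lag_nE R (al j) (n0 j)) (fun j => lag_mE R (al j) (n0 j)) rL0 rL2 c2 c3 c4.
have q1 : (fun j => (rN j * (1 - rN j)) / (rn j * (1 - rn j))) @ \oo --> (rhoL * (1 - rhoL)) / (rhoL * (1 - rhoL)) by cvg_rat.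
have one : rhoL * (1 - rhoL) / (rhoL * (1 - rhoL)) = 1 by apply: divff; rewrite mulf_neq0.
rewrite one in q1.
have q2 : (fun j => Num.sqrt ((rN j * (1 - rN j)) / (rn j * (1 - rn j)))) @ \oo --> (1 : R) by apply: (cvg_eq (cvg_sqrt q1)); rewrite sqrtr1.
have q3 := cvg_muls (cvg_muls q2 c1) main.
apply: (cvg_as q3) => [j|]; last by rewrite !mul1r.
rewrite window_pt; move: (lag_fun _ _ _) => F.
have sd (p q : R) : 0 <= p -> 0 <= q -> Num.sqrt (p / q) = Num.sqrt p / Num.sqrt q by move=> p0 q0; rewrite sqrtrM // sqrtrV.
have p1 : 0 <= rN j * (1 - rN j) by apply: mulr_ge0; apply: ltW; [exact: rN0 | exact: rN1].
have p2 : 0 <= rn j * (1 - rn j) by apply: mulr_ge0; apply: ltW; [exact: rn0 | exact: rn1].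
rewrite (sd _ _ p1 p2).
have s0 : Num.sqrt (rn j * (1 - rn j)) != 0 by rewrite gt_eqF // sqrtr_gt0 mulr_gt0.
have e0 : eN j != 0 by rewrite gt_eqF.
have e1 : en j != 0 by rewrite gt_eqF.
move: (Num.sqrt (rn j * _)) s0 => q s0; rewrite -/(en j) -/(eN j).
by field; rewrite s0 e0 e1.
Unshelve. all: end_near. Qed.
End Window.
End EdgeSequences.

(** * Bounds uniform in the degree *)

Section CrudeBound.
Variable R : realType.

(** The integrand is bounded by its largest possible modulus, with [|1 - r e^(i t)| <= 1 + r]. *)
Lemma lagf_crude (m n : nat) (r x : R) : 0 < r -> r < 1 -> 0 <= x -> `|lagf m n x| <= r ^- n * (1 + r) ^+ m * expR (x * r).
Proof.
move=> r0 r1 x0; have := lag_wave_int r0 r1 m (x * r) n; rewrite /= mulfK ?gt_eqF // => E.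
have rn0 : 0 < r ^+ n by rewrite exprn_gt0.
rewrite -mulrA -ler_pdivrMl ?invr_gt0 // invrK -[X in X * `|_|]gtr0_norm // -normrM -E.
have pi0 : 0 < pi^-1 :> R by rewrite invr_gt0 pi_gt0.
rewrite normrM gtr0_norm // ler_pdivrMl ?pi_gt0 // .
have iw := lag_wave_integrable r0 r1 m (x * r) n.
apply: le_trans (@le_normr_Rintegral _ (measurableTypeR R) R mu _ _ (measurable_itv _) iw) _.
have iN : mu.-integrable `[0, pi] (EFin \o (fun t => `|lag_wave r m (x * r) n t|)) by exact: (@integrable_norm _ (measurableTypeR R) _ mu).
set C := (1 + r) ^+ m * expR (x * r).
have iC : mu.-integrable `[0, pi] (EFin \o (fun=> C)) by apply: integrable_continuous_itv => t; exact: cvg_cst.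
apply: le_trans (le_Rintegral_leb (measurable_itv _) iN iC _) _.
- move=> t _; rewrite /lag_wave !normrM -[leRHS]mulr1; apply: ler_pM => //; last exact: cos_max.
  rewrite normrX ger0_norm ?sqrtr_ge0 // ger0_norm ?expR_ge0 //; apply: ler_pM => //.
  + apply: lerXn2r; rewrite ?nnegrE ?sqrtr_ge0 ?addr_ge0 // ?(ltW r0) //.
    rewrite -[leRHS]ger0_norm ?addr_ge0 // ?(ltW r0) // -sqrtr_sqr ler_wsqrtr // /chord2.
    have := cos_geN1 t; rewrite -(ler_pM2l r0); lra.
  + by rewrite ler_expR -[leRHS]mulr1 ler_wpM2l ?cos_le1 // mulr_ge0 // ltW.
- have E2 : mu `[0, pi]%classic = (pi : R)%:E by rewrite lebesgue_measure_itv /= lte_fin pi_gt0 -EFinD oppr0 addr0.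
  rewrite le_eqVlt; apply/orP; left; apply/eqP.
  apply: (etrans (@Rintegral_cst _ (measurableTypeR R) R mu _ (measurable_itv _) C)).
  by apply: (etrans (congr1 (fun y => C * fine y) E2)); rewrite mulrC.
Qed.

(** Meant for degrees far below the top one, where the edge scaling of the degree itself is useless:
    [r] and [kap] are free, and [x^al / al!] is traded for [kap^(-al) e^(kap x)]. *)
Lemma lag_fun_crude (al n : nat) (r kap x : R) : 0 < r -> r < 1 -> 0 < kap -> 0 <= x -> lag_fun al n x ^+ 2 <=
  expR (2 * n%:R * ln r^-1 + al%:R * ln kap^-1 + 2 * r * (n + al)%:R - x * (1 - 2 * r - kap)).
Proof.
move=> r0 r1 k0 x0; rewrite /lag_fun exprMn sqr_sqrtr; last first.
  by rewrite !mulr_ge0 ?expR_ge0 ?invr_ge0 ?exprn_ge0.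
have f0 i : 0 < i`!%:R :> R by rewrite ltr0n fact_gt0.
have h1 : n`!%:R / (n + al)`!%:R * x ^+ al <= expR (al%:R * ln kap^-1 + kap * x).
  have h2 : n`!%:R / (n + al)`!%:R <= (al`!%:R)^-1 :> R.
    rewrite ler_pdivrMr // ler_pdivlMl // -natrM ler_nat.
    rewrite -(@bin_fact (n + al) al) ?leq_addl // addnK.
    by rewrite leq_pmull // bin_gt0 leq_addl.
  apply: (@le_trans _ _ (al`!%:R^-1 * x ^+ al)); first by rewrite ler_wpM2r // exprn_ge0.
  rewrite expRD mulrC expRM_natl lnK ?posrE ?invr_gt0 //.
  have := @expR_ge_pow R al (kap * x) (mulr_ge0 (ltW k0) x0).
  rewrite exprMn -mulrA => /(ler_wpM2l (_ : 0 <= kap^-1 ^+ al)) h.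
  apply: le_trans (h _); last by rewrite exprn_ge0 // invr_ge0 ltW.
  by rewrite [leRHS]mulrA -exprMn mulVf ?gt_eqF // expr1n mul1r.
have h3 : lagf (n + al) n x ^+ 2 <= expR (2 * n%:R * ln r^-1 + 2 * r * (n + al)%:R + 2 * (x * r)).
  have h4 : `|lagf (n + al) n x| <= expR (n%:R * ln r^-1 + r * (n + al)%:R + x * r).
    apply: le_trans (lagf_crude (n + al) n r0 r1 x0) _.
    rewrite !expRD; apply: ler_wpM2r; first exact: expR_ge0.
    rewrite expRM_natl lnK ?posrE ?invr_gt0 // exprVn ler_wpM2l ?invr_ge0 ?exprn_ge0 // ?(ltW r0) //.
    rewrite expRM_natr; apply: lerXn2r; rewrite ?nnegrE ?addr_ge0 ?expR_ge0 // ?(ltW r0) //.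
    exact: expR_ge1Dx.
  rewrite -real_normK ?num_real // (_ : expR _ = expR (n%:R * ln r^-1 + r * (n + al)%:R + x * r) ^+ 2).
    by rewrite ler_sqr ?nnegrE ?expR_ge0.
  by rewrite -expRM_natr; congr expR; ring.
apply: (@le_trans _ _ (expR (al%:R * ln kap^-1 + kap * x) * expR (- x) * expR (2 * n%:R * ln r^-1 + 2 * r * (n + al)%:R + 2 * (x * r)))).
  apply: ler_pM => //; rewrite ?sqr_ge0 //.
  - by rewrite !mulr_ge0 ?expR_ge0 ?invr_ge0 ?exprn_ge0.
  - by rewrite ler_wpM2r ?expR_ge0.
by rewrite -!expRD ler_expR; lra.
Qed.

Lemma lag_rho_ge (al n : nat) (G : R) : (0 < n)%N -> al%:R <= G * n%:R -> (1 + Num.sqrt (1 + G))^-1 <= lag_rho R al n.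
Proof.
move=> n0 alG; have n0' : 0 < n%:R :> R by rewrite ltr0n.
have s0 : 0 < Num.sqrt n%:R :> R by rewrite sqrtr_gt0.
have ab : Num.sqrt (n + al)%:R <= Num.sqrt n%:R * Num.sqrt (1 + G) :> R.
  by rewrite -sqrtrM ?(ltW n0') // ler_wsqrtr // natrD mulrDr mulr1 lerD2l mulrC.
have t0 : 0 < 1 + Num.sqrt (1 + G) by rewrite ltr_pwDl.
have d0 : 0 < Num.sqrt (n + al)%:R + Num.sqrt n%:R :> R by rewrite ltr_wpDl.
rewrite /lag_rho -[leLHS]mul1r ler_pdivrMr // mulrAC ler_pdivlMr // mul1r mulrDr mulr1.
by lra.
Qed.

Lemma amp_ratio_le (pN pn eN en U lo : R) : 0 < lo -> lo <= 2^-1 -> 0 < pn -> pN <= 2^-1 ->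
  lo * 2^-1 <= pn -> 0 < eN -> 0 < en -> 0 < U -> en <= U * eN ->
  pN / eN ^+ 2 <= (U / lo) ^+ 2 * (pn / en ^+ 2).
Proof.
move=> lo0 lo2 pn0 pN2 lopn eN0 en0 U0 enU.
have d0 : 0 < lo ^+ 2 * en ^+ 2 by rewrite mulr_gt0 // exprn_gt0.
rewrite ler_pdivrMr ?exprn_gt0 //.
have -> : (U / lo) ^+ 2 * (pn / en ^+ 2) * eN ^+ 2 = U ^+ 2 * pn * eN ^+ 2 / (lo ^+ 2 * en ^+ 2) by field; rewrite !gt_eqF.
rewrite ler_pdivlMr // mulrA.
have e2 : en ^+ 2 <= (U * eN) ^+ 2 by rewrite ler_sqr ?nnegrE ?mulr_ge0 ?(ltW en0) ?(ltW U0) ?(ltW eN0).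
have p2 : pN * lo ^+ 2 <= pn.
  have h1 : lo * lo <= lo * 2^-1 by rewrite ler_pM2l.
  have h2 : pN * lo ^+ 2 <= 2^-1 * lo ^+ 2 by rewrite ler_pM2r // exprn_gt0.
  by rewrite -expr2 in h1; lra.
rewrite (_ : U ^+ 2 * pn * eN ^+ 2 = pn * (U * eN) ^+ 2); last by ring.
apply: (@le_trans _ _ (pn * en ^+ 2)); first by rewrite ler_pM2r ?exprn_gt0.
by rewrite ler_pM2l.
Qed.

Lemma gap_change (rN eN en k : R) : eN != 0 -> rN != 0 -> 1 - rN != 0 -> en / eN * (k / (rN * (1 - rN) / eN)) = k / (rN * (1 - rN)) * en.
Proof. by move=> h1 h2 h3; field; rewrite h1 h2 h3. Qed.
End CrudeBound.

Section Domination.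
Variable R : realType.
Variables (Gam S : R).
Hypotheses (Gam1 : 1 <= Gam) (S0 : 0 <= S).

(** [tau], [r] and [rho1] are the budget of the crude estimate: [tau * Gam = 1/2] controls the
    second order term in [al], [r * (8 + 4 * Gam) = tau] the terms proportional to [r], and
    [rho1 = tau * r / 4] the term [2 n / r]. For degrees at least [rho1 * N], [lo] bounds [lag_rho]
    from below, [U] bounds the ratio of the two critical widths, and [A] the negative part of
    [xi]. *)
Let tau : R := (2 * Gam)^-1.
Let r : R := tau / (8 + 4 * Gam).
Let rho1 : R := tau * r / 4.
Let lo : R := (1 + Num.sqrt (1 + Gam / rho1))^-1.
Let U : R := (lo ^+ 3 * rho1)^-1.
Let A : R := U * S.
Let L := lag_const R.

Let Gam0 : 0 < Gam. Proof. exact: lt_le_trans Gam1. Qed.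
Let tau0 : 0 < tau. Proof. by rewrite invr_gt0 mulr_gt0. Qed.
Let tau2 : tau <= 2^-1. Proof. by rewrite lef_pV2 ?posrE ?mulr_gt0 //; have := Gam1; lra. Qed.
Let tauGam : tau * Gam = 2^-1. Proof. by rewrite /tau; field; rewrite gt_eqF. Qed.
Let r0 : 0 < r. Proof. by rewrite divr_gt0 // addr_gt0 // mulr_gt0. Qed.
Let rE : r * (8 + 4 * Gam) = tau. Proof. by rewrite /r mulfVK // gt_eqF // addr_gt0 // mulr_gt0. Qed.
Let r4 : 4 * r <= tau.
Proof.
rewrite -rE mulrDr.
have : 0 <= r * (4 * Gam) := mulr_ge0 (ltW r0) (mulr_ge0 (ler0n R 4) (ltW Gam0)).
by have := r0; lra.
Qed.
Let r1 : r < 1. Proof. by have := r4; have := tau2; have := r0; lra. Qed.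
Let rho10 : 0 < rho1. Proof. by rewrite divr_gt0 // mulr_gt0. Qed.
Let rho11 : rho1 <= 1.
Proof.
rewrite /rho1 ler_pdivrMr // mul1r; have := ler_pM (ltW tau0) (ltW r0) tau2 (ltW r1).
by lra.
Qed.
Let lo0 : 0 < lo. Proof. by rewrite invr_gt0 ltr_pwDl. Qed.
Let lo2 : lo <= 2^-1.
Proof.
rewrite lef_pV2 ?posrE ?ltr_pwDl //.
have : 1 <= Num.sqrt (1 + Gam / rho1) by rewrite -[leLHS]sqrtr1 ler_wsqrtr // lerDl divr_ge0 // ltW.
by lra.
Qed.
Let lo3 : 0 < lo ^+ 3. Proof. by rewrite exprn_gt0. Qed.
Let lo31 : lo ^+ 3 <= 1. Proof. by rewrite exprn_ile1 // ?(ltW lo0) //; have := lo2; lra. Qed.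
Let UE : U * (lo ^+ 3 * rho1) = 1. Proof. by rewrite /U mulVf // gt_eqF // mulr_gt0. Qed.
Let U1 : 1 <= U.
Proof.
have p : 0 < lo ^+ 3 * rho1 by rewrite mulr_gt0.
have : lo ^+ 3 * rho1 <= 1 by apply: mulr_ile1; rewrite ?(ltW lo3) ?(ltW rho10).
by move=> h; rewrite /U -[X in X <= _]invr1 lef_pV2 ?posrE.
Qed.
Let U0 : 0 < U. Proof. exact: lt_le_trans U1. Qed.
Let A0 : 0 <= A. Proof. by rewrite mulr_ge0 // ltW. Qed.

Definition dom_rate : R := 2 * lo.
Definition dom_const : R := (U / lo) ^+ 2 * L ^+ 2 * expR (2 * (U * S) + 2 * lo * S) + 1.
(** Admissible width at the top degree. Besides 1, the entries of the minimum provide the smallness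
    hypothesis of [lag_fun_le] at lower degrees, the bound [S / e <= N], and a gain [tau * N / 2] of
    at least [2 / e^2]. *)
Definition dom_e : R := Num.min (Num.min 1 (lo / (U * (4 * A + 2)))) (Num.min (lo ^+ 3 / (2 * (S + 1))) (tau * lo ^+ 3 / 8)).

Let dA : 0 < U * (4 * A + 2). Proof. by rewrite mulr_gt0 // ltr_wpDl // mulr_ge0. Qed.
Let dS : 0 < 2 * (S + 1). Proof. by rewrite mulr_gt0 // ltr_wpDl. Qed.

Lemma dom_rate_gt0 : 0 < dom_rate. Proof. by rewrite mulr_gt0. Qed.

Lemma dom_e_gt0 : 0 < dom_e.
Proof.
have t8 : 0 < tau * lo ^+ 3 by rewrite mulr_gt0.
by rewrite !lt_min ltr01 (divr_gt0 lo0 dA) (divr_gt0 lo3 dS) (divr_gt0 t8).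
Qed.

Variables (al N k : nat) (ss z : R).
Hypotheses (N0 : (0 < N)%N) (kN : (k <= N)%N) (alG : al%:R <= Gam * N%:R) (sS : `|ss| <= S) (eN1 : lag_e R al N <= dom_e) (z0 : 0 <= z).

Let n := (N - k)%N.
Let eN := lag_e R al N.
Let rN := lag_rho R al N.
Let en := lag_e R al n.
Let rn := lag_rho R al n.
Let h := rN * (1 - rN) / eN.
Let eN0 : 0 < eN. Proof. exact: lag_e_gt0. Qed.
Let rN0 : 0 < rN. Proof. exact: lag_rho_gt0. Qed.
Let rN2 : rN <= 2^-1. Proof. exact: lag_rho_le. Qed.
Let rN1 : 2^-1 <= 1 - rN. Proof. by have := rN2; lra. Qed.
Let rN1p : 0 < 1 - rN. Proof. by have := rN1; lra. Qed.
Let rNN : 0 < rN * (1 - rN). Proof. exact: mulr_gt0. Qed.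
Let NR : 0 < N%:R :> R. Proof. by rewrite ltr0n. Qed.
Let nN : n%:R <= N%:R :> R. Proof. by rewrite ler_nat leq_subr. Qed.
Let h0 : 0 < h. Proof. by rewrite divr_gt0 // mulr_gt0 //; have := rN1; lra. Qed.
Let w := ss + z + k%:R / h.
Let kh0 : 0 <= k%:R / h. Proof. by rewrite divr_ge0 // ltW. Qed.
Let ss1 : - S <= ss <= S. Proof. by rewrite -ler_norml. Qed.
Let wS : z + k%:R / h - S <= w. Proof. by rewrite /w; case/andP: ss1; lra. Qed.
Let wS2 : - S <= w. Proof. by have := wS; have := z0; have := kh0; lra. Qed.

Let rN_lo : lo <= rN.
Proof.
apply: (@le_trans _ _ (1 + Num.sqrt (1 + Gam))^-1); last exact: lag_rho_ge.
rewrite lef_pV2 ?posrE ?ltr_pwDl // lerD2l ler_wsqrtr // lerD2l ler_pdivlMr //.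
exact: ler_piMr (ltW Gam0) rho11.
Qed.

Let cube_weight (q : R) : lo <= q -> q <= 2^-1 -> lo ^+ 3 / 2 <= q ^+ 3 * (1 - q) <= 8^-1.
Proof.
move=> lq q2; have q0 : 0 < q by apply: lt_le_trans lq.
have q3 : lo ^+ 3 <= q ^+ 3 by apply: lerXn2r; rewrite ?nnegrE // ltW.
have q32 : q ^+ 3 <= 2^-1 ^+ 3 by apply: lerXn2r; rewrite ?nnegrE // ltW.
apply/andP; split; first by apply: ler_pM => //; rewrite ?(ltW lo3) //; lra.
have -> : 8^-1 = 2^-1 ^+ 3 * 1 :> R by field.
by apply: ler_pM => //; rewrite ?exprn_ge0 ?(ltW q0) //; lra.
Qed.

Let N_ge : lo ^+ 3 / 2 <= N%:R * eN ^+ 3.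
Proof. by rewrite -lag_cube_e //; have /andP[] := cube_weight rN_lo rN2. Qed.

Let dom_eE : [/\ eN <= 1, eN * (U * (4 * A + 2)) <= lo, eN * (2 * (S + 1)) <= lo ^+ 3 & eN * 8 <= tau * lo ^+ 3].
Proof.
have := eN1; rewrite -/eN /dom_e !le_min => /andP[/andP[h1 h2] /andP[h3 h4]].
by move: h2 h3 h4; rewrite (ler_pdivlMr _ _ dA) (ler_pdivlMr _ _ dS) ler_pdivlMr //; split.
Qed.

(** Degrees comparable with [N]: the uniform estimate applies at the edge of the degree [n] itself,
    and the lower bound on the displacement of the edge converts the [k] missing degrees into decay
    in [k / h]. *)
Lemma lag_dom_large : rho1 * N%:R <= n%:R -> (Num.sqrt (rN * (1 - rN)) / eN * lag_fun al n (edge rN eN + (ss + z) / eN)) ^+ 2 <=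
  (U / lo) ^+ 2 * L ^+ 2 * expR (2 * (U * S) + 2 * lo * S) * expR (- (dom_rate * (z + k%:R / h))).
Proof.
move=> nlo.
have nR : 0 < n%:R :> R by apply: lt_le_trans nlo; rewrite mulr_gt0.
have n0 : (0 < n)%N by rewrite -(ltr0n R).
have en0 : 0 < en by exact: lag_e_gt0.
have rn0 : 0 < rn by exact: lag_rho_gt0.
have rn2 : rn <= 2^-1 by exact: lag_rho_le.
have rn1 : 2^-1 <= 1 - rn by lra.
have rn_lo : lo <= rn.
  apply: lag_rho_ge => //; apply: (le_trans alG).
  by rewrite mulrAC ler_pdivlMr // -mulrA ler_wpM2l ?(ltW Gam0) // mulrC.
have /andP[pn1 pn2] := cube_weight rn_lo rn2.
have /andP[pN1 pN2] := cube_weight rN_lo rN2.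
rewrite lag_cube_e // -/en in pn1 pn2; rewrite lag_cube_e // -/eN in pN1 pN2.
have e_lo : lo * eN <= en.
  rewrite -(@ler_pXn2r _ 3) ?nnegrE ?mulr_ge0 ?(ltW lo0) ?(ltW eN0) ?(ltW en0) // exprMn -(ler_pM2l nR).
  apply: le_trans pn1; rewrite mulrCA ler_pM2l //.
  apply: (@le_trans _ _ (N%:R * eN ^+ 3)); last by lra.
  by rewrite ler_wpM2r // exprn_ge0 // ltW.
have e_hi : en <= U * eN.
  rewrite -(@ler_pXn2r _ 3) ?nnegrE ?mulr_ge0 ?(ltW U0) ?(ltW eN0) ?(ltW en0) // exprMn -(ler_pM2l (mulr_gt0 rho10 NR)).
  apply: (@le_trans _ _ (n%:R * en ^+ 3)); first by rewrite ler_wpM2r // exprn_ge0 // ltW.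
  apply: (le_trans pn2); rewrite mulrACA.
  apply: (@le_trans _ _ (rho1 * U ^+ 3 * (lo ^+ 3 / 2))); last first.
    by rewrite ler_wpM2l // mulr_ge0 ?exprn_ge0 // ltW.
  have -> : rho1 * U ^+ 3 * (lo ^+ 3 / 2) = (U * (lo ^+ 3 * rho1)) * U ^+ 2 / 2 by ring.
  rewrite UE mul1r; have : 1 <= U ^+ 2 by rewrite exprn_ege1.
  by lra.
pose q := en / eN.
have q_lo : lo <= q by rewrite /q ler_pdivlMr.
have q_hi : q <= U by rewrite /q ler_pdivrMr.
pose xi := q * (ss + z) + (edge rN eN - edge rn en) * en.
have nk : (N - n = k)%N by rewrite /n subKn.
have gap : q * (k%:R / h) <= (edge rN eN - edge rn en) * en.
  have := @lag_edge_gap R al n N; rewrite n0 leq_subr nk => /(_ isT)/andP[g _].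
  rewrite /q /h (gap_change en k%:R (lt0r_neq0 eN0) (lt0r_neq0 rN0) (lt0r_neq0 rN1p)).
  by rewrite ler_pM2r.
have xi_w : q * w <= xi by rewrite /xi /w mulrDr lerD2l.
have qw : - A <= q * w.
  have [w0|w0] := leP 0 w; first by apply: (@le_trans _ _ 0); rewrite ?oppr_le0 // mulr_ge0 // (le_trans (ltW lo0)).
  have : U * w <= q * w by rewrite ler_wnM2r // ltW.
  have : U * - S <= U * w by rewrite ler_wpM2l // ltW.
  by rewrite /A -mulrN; exact: le_trans.
have qw2 : lo * w - U * S <= q * w.
  have [w0|w0] := leP 0 w.
    have : lo * w <= q * w by rewrite ler_wpM2r.
    by move=> hw; rewrite lerBlDr (le_trans hw) // lerDl; exact: A0.
  have : lo * w <= 0 by rewrite pmulr_rle0 // ltW.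
  by move=> hw; apply: le_trans qw; rewrite -[leRHS]add0r; apply: lerD.
have [_ d2 _ _] := dom_eE.
have eA : en * (4 * A + 2) <= rn.
  apply: le_trans rn_lo; apply: le_trans d2; rewrite [leRHS]mulrA [eN * U]mulrC ler_wpM2r //.
  by rewrite addr_ge0 // mulr_ge0.
have := lag_fun_le rn0 rn2 en0 A0 eA (le_trans qw xi_w) (lag_nE R al n0) (lag_mE R al n0).
have -> : edge_pt rn en xi = edge rN eN + (ss + z) / eN by exact: (edge_pt_change rN rn (ss + z) (lt0r_neq0 eN0) (lt0r_neq0 en0)).
move: (lag_fun _ _ _) => F bnd.
have rnn : 0 < rn * (1 - rn) by apply: mulr_gt0 rn0 (lt_le_trans _ rn1); rewrite invr_gt0.
have amp : (Num.sqrt (rN * (1 - rN)) / eN) ^+ 2 <= (U / lo) ^+ 2 * (Num.sqrt (rn * (1 - rn)) / en) ^+ 2.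
  rewrite [X in X <= _]expr_div_n [X in _ <= _ * X]expr_div_n (sqr_sqrtr (ltW rnn)) (sqr_sqrtr (ltW rNN)).
  apply: amp_ratio_le lo0 lo2 rnn _ _ eN0 en0 U0 e_hi.
  - have r1' : 1 - rN <= 1 by rewrite gerBl (ltW rN0).
    by have := ler_pM (ltW rN0) (ltW rN1p) rN2 r1'; rewrite mulr1.
  - exact: ler_pM (ltW lo0) _ rn_lo rn1.
rewrite exprMn; apply: (@le_trans _ _ ((U / lo) ^+ 2 * (Num.sqrt (rn * (1 - rn)) / en * F) ^+ 2)).
  by rewrite [X in _ <= _ * X]exprMn [leRHS]mulrA; apply: ler_wpM2r => //; rewrite sqr_ge0.
have F2 : (Num.sqrt (rn * (1 - rn)) / en * F) ^+ 2 <= L ^+ 2 * (expR (2 * (U * S) + 2 * lo * S) * expR (- (dom_rate * (z + k%:R / h)))).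
  rewrite -[X in X <= _]real_normK ?num_real //.
  apply: (@le_trans _ _ ((L * expR (- xi)) ^+ 2)).
    by rewrite ler_sqr ?nnegrE //; apply: le_trans bnd.
  rewrite exprMn; apply: ler_wpM2l; first exact: sqr_ge0.
  rewrite -expRM_natr -expRD ler_expR /dom_rate.
  have : lo * (z + k%:R / h - S) <= lo * w by rewrite ler_pM2l.
  move: qw2 xi_w; move: (q * w) (U * S) (k%:R / h) => *; lra.
rewrite -(mulrA ((U / lo) ^+ 2 * L ^+ 2)) -(mulrA ((U / lo) ^+ 2)).
by apply: ler_wpM2l; [exact: sqr_ge0 | exact: F2].
Qed.

(** Degrees below [rho1 * N]: the crude estimate gains [tau * N / 2] in the exponent, which pays for
    the amplitude and for the required decay in [k / h], each worth at most [e^-2]. *)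
Lemma lag_dom_small : n%:R <= rho1 * N%:R -> (Num.sqrt (rN * (1 - rN)) / eN * lag_fun al n (edge rN eN + (ss + z) / eN)) ^+ 2 <=
  expR (- (dom_rate * (z + k%:R / h))).
Proof.
move=> nlo; have [d1 d2 d3 d4] := dom_eE.
set x := edge rN eN + (ss + z) / eN.
have e30 : 0 < eN ^+ 3 by rewrite exprn_gt0.
have e20 : 0 < eN ^+ 2 by rewrite exprn_gt0.
have edge_ge : al%:R + 4 * N%:R <= edge rN eN.
  have nD : (N + al)%:R = N%:R + al%:R :> R by rewrite natrD.
  rewrite /rN /eN lag_edgeE // sqrrD !sqr_sqrtr //.
  have : N%:R <= Num.sqrt (N + al)%:R * Num.sqrt N%:R :> R.
    by rewrite -{1}(@sqr_sqrtr _ N%:R) // expr2 ler_wpM2r ?sqrtr_ge0 // ler_wsqrtr // ler_nat leq_addr.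
  by rewrite -(mulr_natr (_ * _)); lra.
have sN : S / eN <= N%:R.
  rewrite ler_pdivrMr // -(ler_pM2r e20) -mulrA -exprS.
  apply: le_trans N_ge; rewrite ler_pdivlMr //; apply: le_trans d3.
  have : S * eN ^+ 2 <= S * eN by rewrite ler_wpM2l // expr2 -[leRHS]mul1r ler_wpM2r // ltW.
  by have := eN0; lra.
have zE : 0 <= z / eN by rewrite divr_ge0 // ltW.
have x_ge : al%:R + 3 * N%:R + z / eN <= x.
  have : - S / eN <= ss / eN by rewrite ler_pM2r ?invr_gt0 //; case/andP: ss1.
  by rewrite /x mulrDl mulNr; lra.
have x0 : 0 <= x.
  apply: le_trans x_ge; exact: addr_ge0 (addr_ge0 (ler0n _ _) (mulr_ge0 (ler0n R 3) (ler0n R N))) zE.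
have kap0 : 0 < 1 - tau by have := tau2; lra.
have crude := lag_fun_crude al n r0 r1 kap0 x0.
have lr : ln r^-1 <= r^-1.
  have : 0 < r^-1 by rewrite invr_gt0.
  by move=> ri; have := ln_sublinear ri; lra.
have b1 : 2 * n%:R * ln r^-1 <= tau * N%:R / 2.
  apply: (@le_trans _ _ (2 * n%:R * r^-1)); first by rewrite ler_wpM2l // mulr_ge0.
  rewrite ler_pdivrMr //; apply: (@le_trans _ _ (2 * (rho1 * N%:R))); first by rewrite ler_pM2l.
  by rewrite /rho1 le_eqVlt; apply/orP; left; apply/eqP; field.
have b2 : ln (1 - tau)^-1 <= tau + 2 * tau ^+ 2.
  have i0 : 0 < (1 - tau)^-1 by rewrite invr_gt0.
  have -> : (1 - tau)^-1 = 1 + ((1 - tau)^-1 - 1) by ring.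
  apply: (@le_trans _ _ ((1 - tau)^-1 - 1)); first by apply: le_ln1Dx; lra.
  rewrite lerBlDr -[(1 - tau)^-1]mul1r ler_pdivrMr //.
  have : 0 <= tau ^+ 2 * (1 - 2 * tau) by rewrite mulr_ge0 ?sqr_ge0 //; have := tau2; lra.
  by rewrite !expr2; lra.
have al0 : 0 <= al%:R :> R by [].
have b3 : al%:R * ln (1 - tau)^-1 <= al%:R * tau + tau * N%:R.
  apply: le_trans (ler_wpM2l al0 b2) _; rewrite mulrDr lerD2l.
  have : al%:R * (2 * tau ^+ 2) <= Gam * N%:R * (2 * tau ^+ 2) by rewrite ler_wpM2r // mulr_ge0 ?sqr_ge0.
  have -> : Gam * N%:R * (2 * tau ^+ 2) = (tau * Gam) * 2 * (tau * N%:R) by ring.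
  by rewrite tauGam mulVf ?pnatr_eq0 // mul1r.
have b4 : 2 * r * (n + al)%:R + (al%:R + 3 * N%:R) * (2 * r) <= tau * N%:R.
  rewrite -rE natrD.
  have : r * n%:R <= r * N%:R by rewrite ler_pM2l.
  have : r * al%:R <= r * (Gam * N%:R) by rewrite ler_pM2l.
  by lra.
have b5 : (al%:R + 3 * N%:R) * (tau - 2 * r) + z / eN * (tau / 2) <= x * (1 - 2 * r - (1 - tau)).
  have -> : 1 - 2 * r - (1 - tau) = tau - 2 * r by ring.
  have t2 : tau / 2 <= tau - 2 * r by have := r4; lra.
  have : (al%:R + 3 * N%:R + z / eN) * (tau - 2 * r) <= x * (tau - 2 * r) by rewrite ler_wpM2r //; have := tau0; lra.
  have : z / eN * (tau / 2) <= z / eN * (tau - 2 * r) by rewrite ler_wpM2l.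
  by rewrite (mulrDl _ (z / eN)); lra.
have F2 : lag_fun al n x ^+ 2 <= expR (- (tau * N%:R / 2) - z / eN * (tau / 2)).
  apply: (le_trans crude); rewrite ler_expR; lra.
have e2V : 0 < (eN ^+ 2)^-1 by rewrite invr_gt0.
have amp : (Num.sqrt (rN * (1 - rN)) / eN) ^+ 2 <= expR (eN ^+ 2)^-1.
  rewrite expr_div_n (sqr_sqrtr (ltW rNN)).
  apply: (@le_trans _ _ (1 / eN ^+ 2)).
    rewrite ler_wpM2r ?invr_ge0 ?(ltW e20) //; have : rN * (1 - rN) <= 1 * 1.
      by apply: ler_pM; rewrite ?ltW //; have := rN1; have := rN2; have := rN0; lra.
    by rewrite mulr1.
  by rewrite mul1r; apply: le_trans (expR_ge1Dx _); rewrite lerDr.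
have kh : k%:R / h <= (eN ^+ 2)^-1.
  apply: (@le_trans _ _ (N%:R / h)); first by rewrite ler_wpM2r ?invr_ge0 ?(ltW h0) // ler_nat.
  have NE := lag_nE R al N0; rewrite -/rN -/eN in NE.
  have -> : N%:R / h = rN ^+ 2 / eN ^+ 2 by rewrite NE /h; field; rewrite !gt_eqF.
  rewrite -[leRHS]mul1r ler_wpM2r ?(ltW e2V) // exprn_ile1 ?(ltW rN0) //.
  by have := rN2; lra.
have big : 2 * (eN ^+ 2)^-1 <= tau * N%:R / 2.
  have -> : 2 * (eN ^+ 2)^-1 = 2 * eN / eN ^+ 3 by field; rewrite gt_eqF.
  rewrite ler_pdivrMr //.
  have : tau / 2 * (lo ^+ 3 / 2) <= tau / 2 * (N%:R * eN ^+ 3) by rewrite ler_wpM2l // divr_ge0 // ltW.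
  by lra.
have ze : z <= z / eN * (tau / 2).
  rewrite mulrAC -mulrA -[leLHS]mulr1 ler_wpM2l // ler_pdivlMr // mul1r.
  have : tau * lo ^+ 3 <= tau * 1 by rewrite ler_wpM2l // ltW.
  by have := eN0; have := tau0; lra.
rewrite exprMn; apply: (@le_trans _ _ (expR (eN ^+ 2)^-1 * expR (- (tau * N%:R / 2) - z / eN * (tau / 2)))).
  by apply: ler_pM => //; rewrite sqr_ge0.
rewrite -expRD ler_expR.
have : dom_rate * (z + k%:R / h) <= 1 * (z + k%:R / h) by rewrite ler_wpM2r ?addr_ge0 // /dom_rate; have := lo2; lra.
by lra.
Qed.

Lemma lag_dom : (Num.sqrt (rN * (1 - rN)) / eN * lag_fun al n (edge rN eN + (ss + z) / eN)) ^+ 2 <= dom_const * expR (- (dom_rate * (z + k%:R / h))).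
Proof.
rewrite /dom_const [X in _ <= X]mulrDl mul1r.
have [nlo|nlo] := leP (rho1 * N%:R) n%:R.
- by apply: (le_trans (lag_dom_large nlo)); rewrite lerDl expR_ge0.
- apply: (le_trans (lag_dom_small (ltW nlo))); rewrite lerDr mulr_ge0 ?expR_ge0 //.
  exact: mulr_ge0 (mulr_ge0 (sqr_ge0 _) (sqr_ge0 _)) (expR_ge0 _).
Qed.
End Domination.

(** * Convergence and domination of the kernel *)

Section KernelLimit.
Variable R : realType.
Variables (N al : nat -> nat) (ss : nat -> R) (delta s Gam S : R).
Hypotheses (N0 : forall j, (0 < N j)%N) (Ny : (fun j => (N j)%:R : R) @ \oo --> +oo)
  (al_cvg : (fun j => (al j)%:R / (N j)%:R) @ \oo --> delta) (delta0 : 0 <= delta)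
  (s_cvg : ss @ \oo --> s) (Gam1 : 1 <= Gam) (S0 : 0 <= S)
  (alG : forall j, (al j)%:R <= Gam * (N j)%:R) (sS : forall j, `|ss j| <= S)
  (eG : forall j, lag_e R (al j) (N j) <= dom_e Gam S).

Let eN j := lag_e R (al j) (N j).
Let rN j := lag_rho R (al j) (N j).
Let h := lag_h R N al.
Let eta j := edge (rN j) (eN j) + ss j / eN j.
Hypothesis eta0 : forall j, 0 <= eta j.

Let eN0 j : 0 < eN j. Proof. exact: lag_e_gt0. Qed.
Let h0 j : 0 < h j. Proof. exact: lag_h_gt0. Qed.
Let C := dom_const Gam S.
Let c := dom_rate Gam.
Let c0 : 0 < c. Proof. exact: dom_rate_gt0. Qed.

(** Degree [N - 1 - a] lies [a + 1] below [N], the reference degree that fixes the edge and the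
    scale. *)
Definition scaled_fun j (a : nat) (z : R) :=
  Num.sqrt (rN j * (1 - rN j)) / eN j * lag_fun (al j) (N j - a.+1) (edge (rN j) (eN j) + (ss j + z) / eN j).

Lemma scaled_fun_dom j a z : (a < N j)%N -> 0 <= z -> scaled_fun j a z ^+ 2 <= C * expR (- (c * (z + a.+1%:R / h j))).
Proof. by move=> aN z0; exact: (lag_dom Gam1 S0 (N0 j) aN (alG j) (sS j) (eG j) z0). Qed.

Lemma scaled_fun_mul_dom j a b z : (a < N j)%N -> (b < N j)%N -> 0 <= z -> `|scaled_fun j a z * scaled_fun j b z| <= C * expR (- (c * z)).
Proof.
move=> aN bN z0.
have C0 : 0 <= C.
  rewrite -(@pmulr_lge0 _ (expR (- (c * (z + a.+1%:R / h j))))) ?expR_gt0 //.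
  exact: le_trans (sqr_ge0 _) (scaled_fun_dom aN z0).
have dom k : (k < N j)%N -> scaled_fun j k z ^+ 2 <= C * expR (- (c * z)).
  move=> kN; apply: (le_trans (scaled_fun_dom kN z0)); apply: ler_wpM2l => //.
  by rewrite ler_expR lerN2 ler_pM2l // lerDl divr_ge0 // ltW.
have := dom _ aN; have := dom _ bN; rewrite normrM.
move: (scaled_fun j a z) (scaled_fun j b z) => u v.
rewrite -[u ^+ 2]real_normK ?num_real // -[v ^+ 2]real_normK ?num_real //.
have := sqr_ge0 (`|u| - `|v|); rewrite sqrrB; lra.
Qed.

Definition scaled_prod j a b (z : R) : R := if (a < N j)%N && (b < N j)%N then scaled_fun j a z * scaled_fun j b z else 0.

Lemma scaled_prodE j a b z : 0 <= z -> scaled_fun j a z * scaled_fun j b z = rN j * (1 - rN j) / eN j ^+ 2 *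
  ((lag_norm R (al j) (N j - a.+1) * lag_norm R (al j) (N j - b.+1) *:
    ('X^(al j) * lagp R (N j - a.+1 + al j) (N j - a.+1) * lagp R (N j - b.+1 + al j) (N j - b.+1))).[eta j + z / eN j]
    * expR (- (eta j + z / eN j))).
Proof.
move=> z0; rewrite -lag_fun_mul; last by rewrite addr_ge0 // divr_ge0 // ltW.
rewrite /scaled_fun /eta mulrDl addrA.
have : Num.sqrt (rN j * (1 - rN j)) ^+ 2 = rN j * (1 - rN j).
  rewrite sqr_sqrtr // mulr_ge0 //; first by rewrite ltW // lag_rho_gt0.
  by have := lag_rho_le R (al j) (N0 j); rewrite -/(rN j); lra.
rewrite expr2; move: (Num.sqrt _) (lag_fun _ _ _) (lag_fun _ _ _) => q f g E.
have e0 : eN j != 0 by rewrite gt_eqF.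
by rewrite -E; field.
Qed.

Lemma poly_expRN_continuous (p : {poly R}) : continuous (fun x : R => p.[x] * expR (- x)).
Proof.
rewrite (_ : (fun x => _) = fun x => \sum_(i < size p) p`_i * (x ^+ i * expR (- x))); last first.
  by apply/funext => x; rewrite horner_coef mulr_suml; apply: eq_bigr => i _; rewrite mulrA.
move=> x; apply: cvg_sum => i _; apply: cvgM; first exact: cvg_cst.
exact: pow_expRN_continuous.
Qed.

Lemma affine_continuous (a e : R) (f : R -> R) : continuous f -> continuous (fun z : R => f (a + z / e)).
Proof.
move=> cf z; apply: (@cvg_comp _ _ _ (fun z => a + z / e) f (nbhs z) (nbhs (a + z / e))); last exact: cf.
apply: (@cvgD _ _ _ _ _ (fun=> a) (fun z => z / e)); first exact: cvg_cst.
by apply: (@cvgM _ _ _ _ id (fun=> e^-1)); [exact: cvg_id | exact: cvg_cst].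
Qed.

Lemma scaled_prod_measurable j a b : measurable_fun (Rge0 : set R) (scaled_prod j a b).
Proof.
have [ab|ab] := boolP ((a < N j)%N && (b < N j)%N); last first.
  rewrite (_ : scaled_prod j a b = fun=> 0); first exact: measurable_cst.
  by apply/funext => z; rewrite /scaled_prod (negbTE ab).
pose q (z : R) := rN j * (1 - rN j) / eN j ^+ 2 * ((lag_norm R (al j) (N j - a.+1) * lag_norm R (al j) (N j - b.+1) *:
    ('X^(al j) * lagp R (N j - a.+1 + al j) (N j - a.+1) * lagp R (N j - b.+1 + al j) (N j - b.+1))).[eta j + z / eN j]
    * expR (- (eta j + z / eN j))).
apply: (eq_measurable_fun q).
  by move=> z; rewrite inE /= in_itv /= andbT => z0; rewrite /scaled_prod ab scaled_prodE.
apply: continuous_measurable_funS => z; apply: cvgM; first exact: cvg_cst.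
apply: (@affine_continuous _ _ (fun x => _.[x] * expR (- x))); exact: poly_expRN_continuous.
Qed.

Lemma dom_integrable : mu.-integrable Rge0 (EFin \o (fun z : R => C * expR (- (c * z)))).
Proof. by apply: integrable_lebZ => //; exact: integrable_expRN. Qed.

Lemma C_ge0 : 0 <= C.
Proof.
have := scaled_fun_dom (N0 0%N) (lexx 0); move/(le_trans (sqr_ge0 _)).
by rewrite pmulr_lge0 // expR_gt0.
Qed.

Lemma scaled_prod_dom j a b z : Rge0 z -> `|scaled_prod j a b z| <= C * expR (- (c * z)).
Proof.
rewrite /= in_itv /= andbT => z0; rewrite /scaled_prod; case: ifP => [/andP[aN bN]|_].
  exact: scaled_fun_mul_dom.
by rewrite normr0 mulr_ge0 ?expR_ge0 ?C_ge0.
Qed.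

Lemma scaled_prod_integrable j a b : mu.-integrable Rge0 (EFin \o scaled_prod j a b).
Proof.
exact: (integrable_leb_le (measurable_itv _) (@scaled_prod_measurable j a b) (@scaled_prod_dom j a b) dom_integrable).
Qed.

(** The substitution [x = eta + z / e] moves the integral to a fixed half line; [h] times the
    Jacobian [1 / e] is the square of the normalisation in [scaled_fun]. *)
Lemma scaled_kernel j a b : h j * lag_kernel (al j) (N j) (eta j) a b = RInt Rge0 (scaled_prod j a b).
Proof.
rewrite /lag_kernel; have [ab|ab] := boolP ((a < N j)%N && (b < N j)%N); last first.
  rewrite mulr0; transitivity (RInt Rge0 (fun=> 0 : R)).
    by rewrite Rintegral_cst // mul0r.
  by apply: eq_Rintegral => z _; rewrite /scaled_prod (negbTE ab).
set p := (lag_norm R (al j) (N j - a.+1) * lag_norm R (al j) (N j - b.+1) *: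
    ('X^(al j) * lagp R (N j - a.+1 + al j) (N j - a.+1) * lagp R (N j - b.+1 + al j) (N j - b.+1))).
have nE k : ((N j).-1 - k = N j - k.+1)%N by lia.
have E1 : RInt `[eta j, +oo[ (fun x => lag_fun (al j) ((N j).-1 - a) x * lag_fun (al j) ((N j).-1 - b) x) =
   RInt `[eta j, +oo[ (fun x => p.[x] * expR (- x)).
  apply: eq_Rintegral => x; rewrite inE => /(itvcy_sub (eta0 j)); rewrite /= in_itv /= andbT => x0.
  by rewrite !nE lag_fun_mul.
have K0 : rN j * (1 - rN j) / eN j ^+ 2 != 0.
  rewrite mulf_neq0 ?invr_eq0 ?expf_neq0 ?gt_eqF // mulr_gt0 //; first exact: lag_rho_gt0.
  by have := lag_rho_le R (al j) (N0 j); rewrite -/(rN j); lra.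
have pE z : 0 <= z -> scaled_prod j a b z = rN j * (1 - rN j) / eN j ^+ 2 * (p.[eta j + z / eN j] * expR (- (eta j + z / eN j))).
  by move=> z0; rewrite /scaled_prod ab scaled_prodE.
have i1 : mu.-integrable Rge0 (EFin \o (fun z => p.[eta j + z / eN j] * expR (- (eta j + z / eN j)))).
  apply: (@eq_integrable _ (measurableTypeR R) R mu _ (measurable_itv _) _ _ _
    (integrable_lebZ (rN j * (1 - rN j) / eN j ^+ 2)^-1 (measurable_itv _) (scaled_prod_integrable j a b))).
  move=> z; rewrite inE /= in_itv /= andbT => z0; by rewrite /= pE // mulKf.
rewrite E1 (Rintegral_affine (eN0 j) (@poly_expRN_continuous p) _ i1); last first.
  by apply: poly_expRN_integrable => //; exact: itvcy_sub.
rewrite mulrA; transitivity (rN j * (1 - rN j) / eN j ^+ 2 * RInt Rge0 (fun z => p.[eta j + z / eN j] * expR (- (eta j + z / eN j)))).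
  congr (_ * _); rewrite /h /lag_h -/(rN j) -/(eN j).
  by have e0 : eN j != 0 by [rewrite gt_eqF]; field.
rewrite -RintegralZl //; apply: eq_Rintegral => z; rewrite inE /= in_itv /= andbT => z0.
exact/esym/pE.
Qed.

Let idx j x := cell_index (h j) s x.

Lemma cell_index_bounds j x : s < x -> x - s <= (idx j x).+1%:R / h j <= x - s + (h j)^-1.
Proof.
move=> sx; have hx : 0 <= h j * (x - s) by rewrite mulr_ge0 ?ltW // subr_gt0.
have /andP[t1 t2] := truncn_itv hx.
rewrite -/(cell_index (h j) s x) -/(idx j x) in t1 t2.
apply/andP; split; first by rewrite ler_pdivlMr // mulrC ltW.
rewrite ler_pdivrMr // mulrDl mulVf ?gt_eqF // [_ * h j]mulrC -natr1 lerD2r //.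
Qed.

Lemma cell_index_cvg x : s < x -> (fun j => (idx j x).+1%:R / h j) @ \oo --> x - s.
Proof.
move=> sx; apply: (squeeze_seq (f := fun=> x - s) (h := fun j => x - s + (h j)^-1)).
- by move=> j; exact: cell_index_bounds.
- exact: cvg_cst.
- apply: (@cvg_eq _ _ (x - s + 0)); last by rewrite addr0.
  by apply: cvg_adds; [exact: cvg_cst | exact: (lag_h_inv_cvg N0 Ny al_cvg delta0)].
Qed.

Lemma cell_index_lt x : s < x -> \forall j \near \oo, ((idx j x).+1 < N j)%N.
Proof.
move=> sx; have c1 := cell_index_cvg sx.
have NN_cvg : (fun j => (N j)%:R / (N j)%:R) @ \oo --> (1 : R) by apply: (cvg_as (cvg_cst (1 : R))) => // j; rewrite divff // pnatr_eq0 -lt0n.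
have ec : eN @ \oo --> (0 : R) := lag_e_cvg0 N0 Ny al_cvg N0 NN_cvg.
have rc : rN @ \oo --> (1 + Num.sqrt (1 + delta))^-1 := lag_rho_cvg N0 al_cvg N0 NN_cvg.
have r0 : (1 + Num.sqrt (1 + delta))^-1 != 0 by rewrite gt_eqF // rhoL_gt0.
have c2 : (fun j => (idx j x).+1%:R / h j * (eN j ^+ 2 / rN j ^+ 2)) @ \oo --> (x - s) * (0 ^+ 2 / (1 + Num.sqrt (1 + delta))^-1 ^+ 2) by cvg_rat.
rewrite expr0n /= mul0r mulr0 in c2.
near=> j.
have : (idx j x).+1%:R / h j * (eN j ^+ 2 / rN j ^+ 2) < 1 by near: j; exact: (cvgr_lt _ c2).
have -> : (idx j x).+1%:R / h j * (eN j ^+ 2 / rN j ^+ 2) = (idx j x).+1%:R / (N j)%:R.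
  have e0 : eN j != 0 by rewrite gt_eqF.
  have rn0 : rN j != 0 by rewrite gt_eqF // lag_rho_gt0.
  have rn1 : 1 - rN j != 0 by rewrite gt_eqF //; have := lag_rho_le R (al j) (N0 j); rewrite -/(rN j); lra.
  have NE := lag_nE R (al j) (N0 j); rewrite -/(rN j) -/(eN j) in NE.
  rewrite NE /h /lag_h -/(rN j) -/(eN j); move: (rN j) (eN j) rn0 rn1 e0 => r e h1 h2 h3.
  by field; rewrite h1 h2 h3.
by rewrite ltr_pdivrMr ?ltr0n // mul1r ltr_nat.
Unshelve. all: end_near. Qed.

Lemma scaled_fun_cvg x z : s < x -> (fun j => scaled_fun j (idx j x) z) @ \oo --> Airy (x + z).
Proof.
(* The window limit asks for [k j < N j] at every [j]; the finitely many exceptional indices are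
   replaced by 0. *)
move=> sx; pose k j := if ((idx j x).+1 < N j)%N then (idx j x).+1 else 0%N.
have kN j : (k j < N j)%N by rewrite /k; case: ifP.
have kE : \forall j \near \oo, k j = (idx j x).+1 by apply: filterS (cell_index_lt sx) => j; rewrite /k => ->.
have kc : (fun j => (k j)%:R / h j) @ \oo --> x - s.
  apply: cvg_trans (cell_index_cvg sx); apply: near_eq_cvg; near=> j.
  by congr (_%:R / _); apply/esym; near: j.
have := @window_lag_fun_cvg R N al delta N0 Ny al_cvg delta0 k (x - s) s ss z kN kc s_cvg.
rewrite (_ : s + z + (x - s) = x + z); last by ring.
apply: cvg_trans; apply: near_eq_cvg; near=> j.
rewrite /scaled_fun (_ : k j = (idx j x).+1) //.
by near: j.
Unshelve. all: end_near. Qed.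

Lemma lag_kernel_cvg x y : s < x -> s < y -> (fun j => h j * lag_kernel (al j) (N j) (eta j) (idx j x) (idx j y)) @ \oo --> airy_kernel x y.
Proof.
move=> sx sy; under eq_fun do rewrite scaled_kernel.
have pc z : Rge0 z -> (fun j => scaled_prod j (idx j x) (idx j y) z) @ \oo --> Airy (x + z) * Airy (y + z).
  move=> _; have := cvg_muls (@scaled_fun_cvg x z sx) (@scaled_fun_cvg y z sy).
  apply: cvg_trans; apply: near_eq_cvg; near=> j.
  rewrite /scaled_prod ifT //; apply/andP; split; apply: ltnW; near: j; exact: cell_index_lt.
exact: (cvg_Rintegral_leb (measurable_itv _) (fun j => @scaled_prod_measurable j _ _) pc dom_integrable (fun j z => @scaled_prod_dom j _ _ z)).2.
Unshelve. all: end_near. Qed.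

Let I := RInt Rge0 (fun z : R => expR (- (c * z))).
Let gdom (x : R) := C * I * expR (c * s) * expR (- (c * x)).

(** [scaled_fun_dom] decays both in [z] and in the index, and [(idx j x + 1) / h j >= x - s]
    converts the latter into decay in [x]. *)
Lemma lag_kernel_diag_le j x : s < x -> h j * lag_kernel (al j) (N j) (eta j) (idx j x) (idx j x) <= gdom x.
Proof.
move=> sx; have C0 := C_ge0.
have I0 : 0 <= I by apply: Rintegral_ge0 => z _; exact: expR_ge0.
rewrite scaled_kernel.
have -> : gdom x = RInt Rge0 (fun z => C * expR (- (c * (x - s))) * expR (- (c * z))).
  rewrite RintegralZl //; last by apply: integrable_expRN.
  rewrite /gdom -/I (_ : - (c * (x - s)) = c * s - c * x); last by ring.
  by rewrite expRD; ring.
apply: le_Rintegral_leb => //.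
- exact: scaled_prod_integrable.
- by apply: integrable_lebZ => //; exact: integrable_expRN.
- move=> z; rewrite /= in_itv /= andbT => z0; rewrite /scaled_prod andbb; case: ifP => aN.
    rewrite -expr2; apply: (le_trans (scaled_fun_dom aN z0)).
    rewrite -mulrA -expRD; apply: ler_wpM2l => //; rewrite ler_expR mulrDr.
    have /andP[b1 _] := cell_index_bounds j sx.
    by have : c * (x - s) <= c * ((idx j x).+1%:R / h j); [rewrite ler_pM2l | lra].
  by rewrite !mulr_ge0 ?expR_ge0.
Qed.

Theorem lag_det_cvg_good :
  ((fun j => \det (1%:M - \matrix_(a < N j, b < N j) lag_kernel (al j) (N j) (eta j) a b)) @ \oo --> F_GUE s) /\
  ((fun j => \sum_(a < N j) lag_kernel (al j) (N j) (eta j) a a) @ \oo --> RInt `]s, +oo[ (fun x => airy_kernel x x)).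
Proof.
apply: (@fredholm_limit R s N h (fun j a b => lag_kernel (al j) (N j) (eta j) a b) gdom) => //.
- move=> m; have : \forall j \near \oo, m%:R <= (N j)%:R :> R by move/cvgryPge : Ny; exact.
  by apply: filterS => j; rewrite ler_nat.
- by move=> j; exact: lag_kernel_psd.
- by move=> j a b; rewrite /lag_kernel; case: (ltnP a (N j)); case: (ltnP b (N j)).
- exact: lag_kernel_cvg.
- have ig := @integrable_expRN R c s c0.
  have ig2 := integrable_subset (measurable_itv `[s, +oo[) (measurable_itv `]s, +oo[) _ ig.
  apply: integrable_lebZ => //; apply: ig2 => x /=; rewrite !in_itv /= !andbT; exact: ltW.
- exact: lag_kernel_diag_le.
Qed.
End KernelLimit.

Local Notation edge_pos al N s := (edge (lag_rho _ al N) (lag_e _ al N) + s / lag_e _ al N).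

Section LaguerreEdge.
Variable R : realType.

(** The uniform hypotheses of [lag_det_cvg_good] hold from some index on; a shift of the sequences
    makes them hold everywhere. *)
Theorem lag_det_cvg (N al : nat -> nat) (ss eta : nat -> R) (delta s : R) :
  (fun j => (N j)%:R : R) @ \oo --> +oo ->
  (fun j => (al j)%:R / (N j)%:R) @ \oo --> delta -> 0 <= delta -> ss @ \oo --> s ->
  (forall j, eta j = edge_pos (al j) (N j) (ss j)) ->
  (\forall j \near \oo, 0 <= eta j) ->
  ((fun j => \det (1%:M - \matrix_(a < N j, b < N j) lag_kernel (al j) (N j) (eta j) a b)) @ \oo --> F_GUE s) /\
  ((fun j => \sum_(a < N j) lag_kernel (al j) (N j) (eta j) a a) @ \oo --> RInt `]s, +oo[ (fun x => airy_kernel x x)).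
Proof.
move=> Ny ac d0 sc etaE [J0 _ HJ0].
pose Gam := delta + 1; pose S := `|s| + 1.
have Gam1 : 1 <= Gam by rewrite lerDr.
have S0 : 0 <= S by rewrite addr_ge0.
have [J1' _ HJ1'] : \forall j \near \oo, (0 < N j)%N.
  have : \forall j \near \oo, 1 <= (N j)%:R :> R by move/cvgryPge : Ny; exact.
  by apply: filterS => j; rewrite ler1n.
pose J1 := (J1' + J0)%N.
have eta0 j : 0 <= eta (j + J1)%N by apply: HJ0; rewrite /= /J1 addnA leq_addl.
have shy (u : nat -> R) J : u @ \oo --> +oo -> (fun j => u (j + J)%N) @ \oo --> +oo by move=> h; rewrite (cvg_shiftn J).
have N1 j : (0 < N (j + J1))%N by apply: HJ1'; rewrite /= /J1 addnCA leq_addr.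
have Ny1 := shy _ J1 Ny; have ac1 := shift_cvg J1 ac; have sc1 := shift_cvg J1 sc.
have NN_cvg : (fun j => (N (j + J1)%N)%:R / (N (j + J1)%N)%:R) @ \oo --> (1 : R).
  by apply: (cvg_as (cvg_cst (1 : R))) => // j; rewrite divff // pnatr_eq0 -lt0n.
have ec := @lag_e_cvg0 R (fun j => N (j + J1)%N) (fun j => al (j + J1)%N) delta N1 Ny1 ac1 _ N1 NN_cvg.
have [J2 _ HJ2] : \forall j \near \oo, [/\ (al (j + J1)%N)%:R <= Gam * (N (j + J1)%N)%:R, `|ss (j + J1)%N| <= S &
    lag_e R (al (j + J1)%N) (N (j + J1)%N) <= dom_e Gam S].
  have sn : (fun j => `|ss (j + J1)%N|) @ \oo --> `|s| by exact: cvg_norm.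
  near=> j; split.
  - rewrite -ler_pdivrMr ?ltr0n //; near: j; apply: (cvgr_le _ ac1); by rewrite /Gam; lra.
  - by near: j; apply: (cvgr_le _ sn); rewrite /S; lra.
  - by near: j; apply: (cvgr_le _ ec); exact: dom_e_gt0.
pose J := (J2 + J1)%N.
have H j : [/\ (al (j + J)%N)%:R <= Gam * (N (j + J)%N)%:R, `|ss (j + J)%N| <= S & lag_e R (al (j + J)%N) (N (j + J)%N) <= dom_e Gam S].
  by rewrite /J addnA; apply: HJ2; rewrite /= leq_addl.
have NJ j : (0 < N (j + J))%N by rewrite /J addnA.
have h1 j : (al (j + J)%N)%:R <= Gam * (N (j + J)%N)%:R by case: (H j).
have h2 j : `|ss (j + J)%N| <= S by case: (H j).
have h3 j : lag_e R (al (j + J)%N) (N (j + J)%N) <= dom_e Gam S by case: (H j).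
have h4 j : 0 <= edge_pos (al (j + J)%N) (N (j + J)%N) (ss (j + J)%N) by rewrite -etaE /J addnA.
have [c1 c2] := @lag_det_cvg_good R (fun j => N (j + J)%N) (fun j => al (j + J)%N) (fun j => ss (j + J)%N) delta s Gam S
   NJ (shy _ J Ny) (shift_cvg J ac) d0 (shift_cvg J sc) Gam1 S0 h1 h2 h3 h4.
split; apply: (@eventually_cvg R _ _ J); under eq_fun do rewrite etaE; [exact: c1 | exact: c2].
Unshelve. all: end_near. Qed.
End LaguerreEdge.

(** * The Tracy-Widom distribution *)

Section AiryDecay.
Variable R : realType.

Lemma shift_pinfty (u : nat -> R) J : u @ \oo --> +oo -> (fun j => u (j + J)%N) @ \oo --> +oo.
Proof. by move=> h; rewrite (cvg_shiftn J). Qed.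

Lemma seq_continuous (f : R -> R) : (forall (x : R) (u : nat -> R), u @ \oo --> x -> (fun n => f (u n)) @ \oo --> f x) -> continuous f.
Proof.
move=> H x; apply/cvgrPdist_lt => e e0; apply: contrapT => Hn.
have Hy n : exists y : R, `|x - y| < n.+1%:R^-1 /\ e <= `|f x - f y|.
  apply: contrapT => Hc; apply: Hn; exists (n.+1%:R^-1) => /=; first by rewrite invr_gt0.
  move=> y xy; rewrite ltNge; apply/negP => fy; apply: Hc; exists y; split => //.
have [u Hu] := choice Hy.
have /H/cvgrPdist_lt/(_ _ e0)[n _ /(_ n (leqnn n))] : u @ \oo --> x.
  apply/cvgrPdist_lt => d d0.
  have [n _ Hn'] : \forall n \near \oo, (n.+1%:R^-1 : R) < d by apply: (cvgr_lt (0 : R)) => //; exact: cvg_harmonic.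
  by exists n => // k nk; exact: lt_trans (Hu k).1 (Hn' k nk).
by rewrite ltNge (Hu n).2.
Qed.

Lemma Rintegral_cst_itv (c a b : R) : a <= b -> RInt `[a, b] (fun=> c) = c * (b - a).
Proof.
move=> ab; apply: (etrans (@Rintegral_cst _ (measurableTypeR R) R mu _ (measurable_itv _) c)).
have E2 : mu `[a, b]%classic = (b - a)%:E.
  rewrite lebesgue_measure_itv /= lte_fin; case: ltP => // ba.
  by have -> : b = a; [apply/eqP; rewrite eq_le ba ab | rewrite subrr].
by apply: (etrans (congr1 (fun y => c * fine y) E2)).
Qed.

Lemma Rintegral_expRN (c a : R) : 0 < c -> RInt `[a, +oo[ (fun y : R => expR (- (c * y))) = c^-1 * expR (- (c * a)).
Proof.
move=> c0; have cn0 : c != 0 by rewrite gt_eqF.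
have Ty : (fun n : nat => a + n%:R : R) @ \oo --> +oo.
  apply/cvgryPge => A; have /cvgryPge/(_ (A - a)) := @cvg_natr_pinfty R.
  by apply: filterS => n; lra.
have c1 := cvg_Rintegral_itvcy (integrable_expRN a c0) Ty.
have dF (x : R) : is_derive x 1 (fun x : R => - (c^-1 * expR (- (c * x)))) (expR (- (c * x))) by derive_eq; field.
have dG (x : R) : is_derive x 1 (fun x : R => expR (- (c * x))) (- (c * expR (- (c * x)))) by derive_eq; ring.
have cE := is_derive_continuous dG.
have c2 : (fun n : nat => RInt `[a, a + n%:R] (fun y : R => expR (- (c * y)))) @ \oo --> c^-1 * expR (- (c * a)); last first.
  exact: (cvg_unique _ c1 c2).
apply: (cvg_as (g := fun n : nat => c^-1 * expR (- (c * a)) - c^-1 * (expR (- (c * a)) * expR (- (c * n%:R))))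
   (l := c^-1 * expR (- (c * a)) - c^-1 * (expR (- (c * a)) * 0))).
- have e0 : (fun n : nat => expR (- (c * n%:R)) : R) @ \oo --> 0.
    apply: (cvg_comp (fun n : nat => c * n%:R : R) (fun x => expR (- x))); last exact: cvgr_expR.
    apply/cvgryPge => A; have /cvgryPge/(_ (A / c)) := @cvg_natr_pinfty R.
    by apply: filterS => n; rewrite ler_pdivrMr // mulrC.
  by cvg_rat.
- move=> n; rewrite (@Rintegral_FTC2 _ (fun x : R => - (c^-1 * expR (- (c * x))))) //; last by rewrite lerDl.
  by rewrite -expRD mulrDr opprD; ring.
- by rewrite !mulr0 subr0.
Qed.

Lemma subset_Rintegral_leb (A B : set R) f : measurable A -> measurable B -> A `<=` B ->
  mu.-integrable B (EFin \o f) -> (forall x, B x -> 0 <= f x) ->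
  RInt A f <= RInt B f.
Proof.
move=> mA mB AB fi f0.
have fA : mu.-integrable A (EFin \o f) by exact: (integrable_subset _ _ AB fi).
rewrite /Rintegral fine_le //.
- exact: (@integrable_fin_num _ (measurableTypeR R) R mu).
- exact: (@integrable_fin_num _ (measurableTypeR R) R mu).
- apply: (@ge0_subset_integral _ (measurableTypeR R) R mu) => //; last exact: (measurable_int mu).
Qed.

Definition airy_const : R := pi^-1 * (expR (3^-1 + 1) * RInt Rge0 (fun y : R => expR (- (2 * y)))).

Let pi0 : 0 <= pi^-1 :> R. Proof. by rewrite invr_ge0 pi_ge0. Qed.

Lemma Airy_le (x : R) : `|Airy x| <= airy_const * expR (- x).
Proof.
rewrite (Airy_shift x ltr01) normrM (ger0_norm pi0) /airy_const -mulrA; apply: ler_wpM2l => //.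
have i1 := airy_integrand_integrable x (ltr01 : 0 < 1 :> R).
have i2 := @integrable_expRN R 2 0 (ltr0Sn R 1).
apply: le_trans (@le_normr_Rintegral _ (measurableTypeR R) R mu _ _ (measurable_itv _) i1) _.
rewrite mulrAC -RintegralZl //; apply: le_Rintegral_leb => //.
- exact: (@integrable_norm _ (measurableTypeR R) _ mu).
- exact: integrable_lebZ.
- move=> y; rewrite /= in_itv /= andbT => y0; rewrite normrM -[leRHS]mulr1.
  apply: ler_pM => //; last exact: cos_max.
  rewrite ger0_norm ?expR_ge0 //; apply: le_trans (airy_mod_le x y ler01) _.
  by rewrite -!expRD ler_expR !expr1n; lra.
Qed.

Lemma Airy_continuous : continuous (@Airy R).
Proof.
apply: seq_continuous => x u ux.
have [J _ HJ] : \forall j \near \oo, x - 1 <= u j by apply: (cvgr_ge _ ux); lra.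
apply: (@eventually_cvg R _ _ J).
have uJ j : x - 1 <= u (j + J)%N by apply: HJ; rewrite /= leq_addl.
have uc := shift_cvg J ux.
under eq_fun do rewrite (Airy_shift _ ltr01); rewrite (Airy_shift x ltr01).
apply: cvg_muls; first exact: cvg_cst.
have mf j : measurable_fun (Rge0 : set R) (fun y => airy_mod 1 (u (j + J)%N) y * cos (airy_arg 1 (u (j + J)%N) y)).
  by apply: continuous_measurable_funS; exact: airy_integrand_continuous.
have pc y : Rge0 y -> (fun j => airy_mod 1 (u (j + J)%N) y * cos (airy_arg 1 (u (j + J)%N) y)) @ \oo --> airy_mod 1 x y * cos (airy_arg 1 x y).
  move=> _; apply: cvg_muls.
  - apply: cvg_exp; cvg_rat; exact: uc.
  - apply: (@continuous_cvg _ _ _ _ _ _ cos); first exact: continuous_cos.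
    by rewrite /airy_arg; cvg_rat; exact: uc.
have dm j y : Rge0 y -> `|airy_mod 1 (u (j + J)%N) y * cos (airy_arg 1 (u (j + J)%N) y)| <= expR (3^-1 + 1 - (x - 1)) * expR (- (2 * y)).
  rewrite /= in_itv /= andbT => y0; rewrite normrM -[leRHS]mulr1.
  apply: ler_pM => //; last exact: cos_max.
  rewrite ger0_norm ?expR_ge0 //; apply: le_trans (airy_mod_le _ y ler01) _.
  by rewrite -!expRD ler_expR !expr1n; have := uJ j; lra.
have di : mu.-integrable Rge0 (EFin \o (fun y : R => expR (3^-1 + 1 - (x - 1)) * expR (- (2 * y)))).
  by apply: integrable_lebZ => //; exact: integrable_expRN.
exact: (cvg_Rintegral_leb (measurable_itv _) mf pc di dm).2.
Qed.

(** The Airy integral with [d = 2] and [x = 4], where the linear terms of the argument cancel. The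
    part up to [1/2] is at least [17/72], the part between [1/2] and 1 is nonnegative, and the rest
    is at least [-1/6]. *)
Lemma Airy2_gt0 : mu.-integrable Rge0 (EFin \o (fun y : R => expR (- (2 * y ^+ 2)) * cos (y ^+ 3 / 3))) /\
  0 < RInt Rge0 (fun y : R => expR (- (2 * y ^+ 2)) * cos (y ^+ 3 / 3)).
Proof.
pose f (y : R) := expR (- (2 * y ^+ 2)) * cos (y ^+ 3 / 3).
have cf : continuous f by rewrite /f; derivable_continuous.
have i2 := @integrable_expRN R 2 0 (ltr0Sn R 1).
have fd y : Rge0 y -> `|f y| <= expR 2 * expR (- (2 * y)).
  move=> _; rewrite normrM -[leRHS]mulr1; apply: ler_pM => //; last exact: cos_max.
  rewrite ger0_norm ?expR_ge0 // -expRD ler_expR; have := sqr_ge0 (y - 2^-1); rewrite sqrrB; lra.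
have fi : mu.-integrable Rge0 (EFin \o f).
  apply: integrable_leb_le fd _ => //; last by apply: integrable_lebZ.
  by exact: continuous_measurable_funS.
have mE (a b : itv_bound R) : measurable ([set` Interval a b] : set R) by exact: measurable_itv.
have sub (A : set R) : A `<=` Rge0 -> measurable A -> mu.-integrable A (EFin \o f) by move=> As mA; apply: (integrable_subset _ _ As fi).
have E1 : Rge0 = `[0, 2^-1]%classic `|` `]2^-1, +oo[%classic :> set R by apply: itv_bndbnd_setU => //; rewrite bnd_simp; lra.
have E2 : `]2^-1, +oo[%classic = `]2^-1, 1]%classic `|` `]1, +oo[%classic :> set R by apply: itv_bndbnd_setU => //; rewrite bnd_simp; lra.
have cosge (y : R) : 0 <= y <= 1 -> 17 / 18 <= cos (y ^+ 3 / 3).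
  move=> /andP[y0 y1].
  have h3 : y ^+ 3 <= 1 by rewrite exprn_ile1.
  have h0 : 0 <= y ^+ 3 by rewrite exprn_ge0.
  have y30 : 0 <= y ^+ 3 / 3 by lra.
  apply: le_trans (cos_ge y30).
  have : (y ^+ 3 / 3) ^+ 2 <= (3^-1) ^+ 2 by rewrite ler_sqr ?nnegrE; lra.
  by rewrite !expr2; lra.
split; first exact: fi.
rewrite -/f E1 Rintegral_setU ?E2 //; last 2 first.
- by rewrite -E2 -E1.
- apply/disj_set2P; rewrite -subset0 => y [] /=; rewrite !in_itv /= => /andP[_ y1] [/andP[]|]; rewrite ?andbT; lra.
rewrite Rintegral_setU //; last 2 first.
- by rewrite -E2; apply: sub => // y /=; rewrite !in_itv /= !andbT; lra.
- apply/disj_set2P; rewrite -subset0 => y [] /=; rewrite !in_itv /= !andbT => /andP[_ y1]; lra.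
have ic c a b : mu.-integrable `[a, b] (EFin \o (fun=> c : R)) by exact: integrable_continuous_itv (@cst_continuous _ _ _).
have I1 : 17 / 72 <= RInt `[0, 2^-1] f.
  apply: (@le_trans _ _ (RInt `[0, 2^-1] (fun=> 17 / 36 : R))).
    by rewrite Rintegral_cst_itv //; lra.
  apply: le_Rintegral_leb => //; first by apply: sub => // y /=; rewrite !in_itv /= andbT => /andP[].
  move=> y; rewrite /= in_itv /= => /andP[y0 y1].
  have c1 : 17 / 18 <= cos (y ^+ 3 / 3) by apply: cosge; lra.
  have : 2^-1 <= expR (- (2 * y ^+ 2)).
    apply: le_trans (expR_ge1Dx _).
    have : y ^+ 2 <= 2^-1 ^+ 2 by rewrite ler_sqr ?nnegrE; lra.
    by rewrite [2^-1 ^+ 2]expr2; lra.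
  rewrite /f; move: (expR _) (cos _) c1 => E C; nra.
have I2 : 0 <= RInt `]2^-1, 1] f.
  apply: Rintegral_ge0 => y /=; rewrite in_itv /= => /andP[y0 y1].
  by rewrite mulr_ge0 ?expR_ge0 //; apply: le_trans (cosge _ _); lra.
have I3 : - 6^-1 <= RInt `]1, +oo[ f.
  have ie := integrable_expRN 1 (ltr0Sn R 1).
  have s1 : (`]1, +oo[%classic : set R) `<=` `[1, +oo[%classic by move=> y /=; rewrite !in_itv /= !andbT; exact: ltW.
  have ie' : mu.-integrable `]1, +oo[ (EFin \o (fun y : R => expR (- (2 * y)))) by exact: (integrable_subset _ _ s1 ie).
  have if' : mu.-integrable `]1, +oo[ (EFin \o f) by apply: sub => // y /=; rewrite !in_itv /= !andbT; lra.
  have h1 : RInt `]1, +oo[ (fun y : R => expR (- (2 * y))) <= 6^-1.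
    apply: (le_trans (@subset_Rintegral_leb _ _ (fun y : R => expR (- (2 * y))) _ _ s1 ie _)) => //.
    rewrite Rintegral_expRN // mulr1 expRN.
    have h : 3 <= expR 2 :> R by have := expR_ge1Dx (2 : R); lra.
    have : (expR 2)^-1 <= 3^-1 :> R by rewrite lef_pV2 ?posrE ?expR_gt0.
    lra.
  have h2 : RInt `]1, +oo[ (fun y : R => - 1 * expR (- (2 * y))) <= RInt `]1, +oo[ f.
    apply: le_Rintegral_leb => //; first exact: integrable_lebZ.
    move=> y; rewrite /= in_itv /= andbT => y1; rewrite /f mulN1r.
    have c1 := cos_geN1 (y ^+ 3 / 3).
    have e1 : expR (- (2 * y ^+ 2)) <= expR (- (2 * y)) by rewrite ler_expR lerN2 ler_pM2l // expr2 ler_peMl //; lra.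
    have e0 := expR_ge0 (- (2 * y ^+ 2)).
    move: (expR _) (expR _) (cos _) c1 e1 e0 => E E' C; nra.
  rewrite RintegralZl // in h2; lra.
by rewrite -/f in I1 I2 I3 *; move: (Rintegral _ _ _) (Rintegral _ _ _) (Rintegral _ _ _) I1 I2 I3 => a b c; lra.
exact: measurableU.
Qed.

Lemma Airy4_gt0 : 0 < Airy (4 : R).
Proof.
rewrite (@Airy_shift R 2 4) //; apply: mulr_gt0; first by rewrite invr_gt0 pi_gt0.
rewrite (_ : (fun y => _) = fun y : R => expR (2 ^+ 3 / 3 - 4 * 2) * (expR (- (2 * y ^+ 2)) * cos (y ^+ 3 / 3))); last first.
  apply/funext => y; rewrite /airy_mod /airy_arg mulrA -expRD; congr (expR _ * cos _); ring.
have [i2 p2] := Airy2_gt0; rewrite RintegralZl //.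
by rewrite mulr_gt0 ?expR_gt0.
Qed.

Definition airy_diag (x : R) : R := airy_kernel x x.

Lemma airy_sqr_le (x z : R) : `|Airy (x + z) * Airy (x + z)| <= airy_const ^+ 2 * expR (- (2 * x)) * expR (- (2 * z)).
Proof.
rewrite normrM -expr2 -mulrA -expRD (_ : - (2 * x) + - (2 * z) = - (x + z) + - (x + z)); last by ring.
rewrite expRD -expr2 -exprMn ler_sqr ?nnegrE ?normr_ge0 ?Airy_le //.
exact: le_trans (normr_ge0 _) (Airy_le _).
Qed.

Lemma airy_sqr_continuous x : continuous (fun z : R => Airy (x + z) * Airy (x + z)).
Proof.
have h : continuous (fun z : R => Airy (x + z)) by have := @affine_continuous R x 1 _ Airy_continuous; under eq_fun do rewrite divr1.
by move=> z; apply: cvgM; exact: h.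
Qed.

Lemma airy_sqr_integrable x : mu.-integrable Rge0 (EFin \o (fun z : R => Airy (x + z) * Airy (x + z))).
Proof.
apply: (@integrable_leb_le _ _ _ (fun z => airy_const ^+ 2 * expR (- (2 * x)) * expR (- (2 * z)))) => //.
- by apply: continuous_measurable_funS; exact: airy_sqr_continuous.
- by move=> z _; exact: airy_sqr_le.
- by apply: integrable_lebZ => //; exact: integrable_expRN.
Qed.

Lemma airy_diag_ge0 x : 0 <= airy_diag x.
Proof. by apply: Rintegral_ge0 => z _; rewrite -expr2 sqr_ge0. Qed.

Lemma airy_diag_le x : airy_diag x <= airy_const ^+ 2 / 2 * expR (- (2 * x)).
Proof.
apply: (@le_trans _ _ (RInt Rge0 (fun z => airy_const ^+ 2 * expR (- (2 * x)) * expR (- (2 * z))))).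
  apply: le_Rintegral_leb => //; first exact: airy_sqr_integrable.
  - by apply: integrable_lebZ => //; exact: integrable_expRN.
  - by move=> z _; apply: le_trans (ler_norm _) (airy_sqr_le _ _).
rewrite RintegralZl //; last exact: integrable_expRN.
by rewrite Rintegral_expRN // mulr0 oppr0 expR0; lra.
Qed.

Lemma airy_diag_continuous : continuous airy_diag.
Proof.
apply: seq_continuous => x u ux.
have [J _ HJ] : \forall j \near \oo, x - 1 <= u j by apply: (cvgr_ge _ ux); lra.
apply: (@eventually_cvg R _ _ J).
have uJ j : x - 1 <= u (j + J)%N by apply: HJ; rewrite /= leq_addl.
have uc := shift_cvg J ux.
have mf j : measurable_fun (Rge0 : set R) (fun z => Airy (u (j + J)%N + z) * Airy (u (j + J)%N + z)).
  by apply: continuous_measurable_funS; exact: airy_sqr_continuous.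
have pc z : Rge0 z -> (fun j => Airy (u (j + J)%N + z) * Airy (u (j + J)%N + z)) @ \oo --> Airy (x + z) * Airy (x + z).
  move=> _; have h : (fun j => Airy (u (j + J)%N + z)) @ \oo --> Airy (x + z).
    apply: (@continuous_cvg _ _ _ _ _ _ (@Airy R)); first exact: Airy_continuous.
    by apply: cvg_adds => //; exact: cvg_cst.
  exact: cvg_muls.
have dm j z : Rge0 z -> `|Airy (u (j + J)%N + z) * Airy (u (j + J)%N + z)| <= airy_const ^+ 2 * expR (- (2 * (x - 1))) * expR (- (2 * z)).
  move=> _; apply: (le_trans (airy_sqr_le _ _)); apply: ler_wpM2r; first exact: expR_ge0.
  by apply: ler_wpM2l; [exact: sqr_ge0 | rewrite ler_expR; have := uJ j; lra].
have di : mu.-integrable Rge0 (EFin \o (fun y : R => airy_const ^+ 2 * expR (- (2 * (x - 1))) * expR (- (2 * y)))).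
  by apply: integrable_lebZ => //; exact: integrable_expRN.
exact: (cvg_Rintegral_leb (measurable_itv _) mf pc di dm).2.
Qed.

Lemma airy_diag_integrable s : mu.-integrable `]s, +oo[ (EFin \o airy_diag).
Proof.
apply: (@integrable_leb_le _ _ _ (fun x => airy_const ^+ 2 / 2 * expR (- (2 * x)))) => //.
- by apply: continuous_measurable_funS; exact: airy_diag_continuous.
- by move=> x _; rewrite ger0_norm ?airy_diag_ge0 ?airy_diag_le.
- apply: integrable_lebZ => //.
  apply: (integrable_subset _ _ _ (@integrable_expRN R 2 s _)) => //.
  by move=> x /=; rewrite !in_itv /= !andbT; exact: ltW.
Qed.

Lemma airy_sq_integrable x : mu.-integrable `[x, +oo[ (EFin \o (fun z : R => Airy z * Airy z)).
Proof.
have h : continuous (fun z : R => Airy z * Airy z) by move=> z; apply: cvgM; exact: Airy_continuous.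
apply: (@integrable_leb_le _ _ _ (fun z => airy_const ^+ 2 * expR (- (2 * 0)) * expR (- (2 * z)))) => //.
- by exact: continuous_measurable_funS.
- by move=> z _; have := airy_sqr_le 0 z; rewrite add0r.
- by apply: integrable_lebZ => //; exact: integrable_expRN.
Qed.

Lemma airy_diagE x : airy_diag x = RInt `[x, +oo[ (fun z : R => Airy z * Airy z).
Proof.
have h : continuous (fun z : R => Airy z * Airy z) by move=> z; apply: cvgM; exact: Airy_continuous.
rewrite (@Rintegral_affine R x 1) //.
- by rewrite invr1 mul1r; apply: (congr1 (Rintegral mu _)); apply/funext => z; rewrite mulr1.
- exact: airy_sq_integrable.
- rewrite (_ : (fun z => _) = fun z => Airy (x + z) * Airy (x + z)); first exact: airy_sqr_integrable.
  by apply/funext => z; rewrite divr1.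
Qed.

(** By continuity [Airy] stays positive on an interval to the right of 4, which contributes to the
    integral of its square. This strict positivity makes the trace diverge at [-oo]. *)
Lemma airy_diag0_gt0 : 0 < airy_diag 0.
Proof.
have [e /= e0 He] : \forall y \near (4 : R), Airy 4 / 2 < Airy y by apply: (cvgr_gt (Airy 4) (@Airy_continuous 4)); have := Airy4_gt0; lra.
have A4 := Airy4_gt0.
have e20 : 0 < e / 2 by rewrite divr_gt0.
have sq_i := airy_sq_integrable 0.
apply: (@lt_le_trans _ _ (RInt `[4, 4 + e / 2] (fun=> (Airy 4 / 2) ^+ 2))).
  by rewrite Rintegral_cst_itv ?lerDl ?(ltW e20) // mulr_gt0 // ?exprn_gt0 ?divr_gt0 // addrAC subrr add0r.
apply: (@le_trans _ _ (RInt `[4, 4 + e / 2] (fun z => Airy z * Airy z))).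
  apply: le_Rintegral_leb => //.
  - exact: integrable_continuous_itv (@cst_continuous _ _ _).
  - apply: (integrable_subset _ _ _ sq_i) => //.
    by move=> x /=; rewrite !in_itv /= andbT => /andP[]; lra.
  - move=> x; rewrite /= in_itv /= => /andP[x4 x4e]; rewrite -expr2.
    have h : Airy 4 / 2 < Airy x by apply: He; rewrite /= distrC ger0_norm; lra.
    by rewrite ler_sqr ?nnegrE; lra.
rewrite airy_diagE; apply: subset_Rintegral_leb => //.
- by move=> x /=; rewrite !in_itv /= andbT => /andP[]; lra.
- by move=> x _; rewrite -expr2 sqr_ge0.
Qed.

(** By [airy_diagE] the diagonal of the kernel is nonincreasing, so on [[s, 0]] it is at least its
    value at 0. *)
Lemma airy_trace_ge s : s <= 0 -> - s * airy_diag 0 <= RInt `]s, +oo[ airy_diag.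
Proof.
move=> s0.
have sub2 : (`[s, 0]%classic : set R) `<=` `[s, +oo[%classic by move=> x /=; rewrite !in_itv /= andbT => /andP[].
rewrite Rintegral_itv_obnd_cbnd; last exact: airy_diag_integrable.
have i2 : mu.-integrable `[s, +oo[ (EFin \o airy_diag).
  apply: (integrable_subset _ _ _ (airy_diag_integrable (s - 1))) => //.
  by move=> x /=; rewrite !in_itv /= !andbT; lra.
apply: (@le_trans _ _ (RInt `[s, 0] airy_diag)); last first.
  apply: subset_Rintegral_leb; [exact: measurable_itv|exact: measurable_itv|exact: sub2|exact: i2|].
  by move=> x _; exact: airy_diag_ge0.
apply: (@le_trans _ _ (RInt `[s, 0] (fun=> airy_diag 0))).
  by rewrite Rintegral_cst_itv // sub0r mulrC.
apply: le_Rintegral_leb.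
- exact: measurable_itv.
- exact: integrable_continuous_itv (@cst_continuous _ _ _).
- exact: (integrable_subset _ _ sub2 i2).
move=> x; rewrite /= in_itv /= => /andP[_ x0]; rewrite !airy_diagE.
apply: subset_Rintegral_leb => //.
- by move=> y /=; rewrite !in_itv /= !andbT; exact: le_trans.
- exact: airy_sq_integrable.
- by move=> y _; rewrite -expr2 sqr_ge0.
Qed.

Lemma lag_edge_near (N al : nat -> nat) (ss : nat -> R) (delta s : R) : (forall j, (0 < N j)%N) -> (fun j => (N j)%:R : R) @ \oo --> +oo ->
  (fun j => (al j)%:R / (N j)%:R) @ \oo --> delta -> 0 <= delta -> ss @ \oo --> s ->
  \forall j \near \oo, 0 <= edge_pos (al j) (N j) (ss j).
Proof.
move=> N0 Ny ac d0 sc.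
have NN : (fun j => (N j)%:R / (N j)%:R) @ \oo --> (1 : R) by apply: (cvg_as (cvg_cst (1 : R))) => // j; rewrite divff // pnatr_eq0 -lt0n.
have ec := lag_e_cvg0 N0 Ny ac N0 NN.
have rc := lag_rho_cvg N0 ac N0 NN.
set rL := (1 + Num.sqrt (1 + delta))^-1 in rc.
have c1 : (fun j => lag_rho R (al j) (N j) * (1 - lag_rho R (al j) (N j)) + ss j * lag_e R (al j) (N j) ^+ 2) @ \oo --> rL * (1 - rL) + s * 0 ^+ 2.
  by cvg_rat.
have [J _ HJ] : \forall j \near \oo, 0 <= lag_rho R (al j) (N j) * (1 - lag_rho R (al j) (N j)) + ss j * lag_e R (al j) (N j) ^+ 2.
  apply: (cvgr_ge _ c1); rewrite expr0n /= mulr0 addr0 mulr_gt0 ?rhoL_gt0 //.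
  by have := rhoL_le d0; rewrite -/rL; lra.
exists J => // j Jj; have /= := HJ j Jj; have e0 := lag_e_gt0 R (al j) (N0 j).
rewrite /edge; move: (lag_rho _ _ _) (lag_e _ _ _) e0 => r e e0 h.
rewrite (_ : _ + _ = (r * (1 - r) + ss j * e ^+ 2) / e ^+ 3); last by field; rewrite gt_eqF.
by rewrite divr_ge0 // exprn_ge0 // ltW.
Qed.

(** Hadamard's inequality for the positive semidefinite matrix [1 - K], whose diagonal entries
    satisfy [1 - k <= e^(-k)]. *)
Lemma lag_det_bounds al N (eta : R) : 0 <= eta -> 0 <= \det (1%:M - \matrix_(a < N, b < N) lag_kernel al N eta a b) <=
  @expR R (- \sum_(a < N) lag_kernel al N eta a a).
Proof.
move=> e0; have /andP[h0 h1] := psd_det (lag_compl_psd al N e0); rewrite h0 /=.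
apply: (le_trans h1); rewrite -sumrN expR_sum; apply: ler_prod => i _.
rewrite (psd_diag i (lag_compl_psd al N e0)) /= !mxE eqxx.
exact: expR_ge1Dx.
Qed.

Lemma square_params : (fun j => j.+1%:R : R) @ \oo --> +oo /\ (fun j => 0%N%:R / j.+1%:R) @ \oo --> (0 : R).
Proof.
split; last by under eq_fun do rewrite mul0r; exact: cvg_cst.
by have := shift_pinfty 1 (@cvg_natr_pinfty R); under eq_fun do rewrite addn1.
Qed.

(** Passage to the limit in the bounds for the Laguerre determinants with [al = 0]. *)
Lemma F_GUE_bounds (s : R) : 0 <= F_GUE s <= expR (- RInt `]s, +oo[ airy_diag).
Proof.
pose N (j : nat) := j.+1; pose al (j : nat) := 0%N.
have N0 j : (0 < N j)%N by [].
have [Ny ac] := square_params.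
have sc : (fun=> s) @ \oo --> s by exact: cvg_cst.
have near0 := lag_edge_near N0 Ny ac (lexx 0) sc.
have [c1 c2] := lag_det_cvg Ny ac (lexx 0) sc (fun=> erefl) near0.
have c3 := cvg_exp (cvg_opps c2).
apply/andP; split.
- apply: (cvgr_to_ge c1); case: near0 => J _ HJ; exists J => // j Jj.
  by have /andP[] := lag_det_bounds (al j) (N j) (HJ j Jj).
- apply: (ler_cvg_to c1 c3); case: near0 => J _ HJ; exists J => // j Jj.
  by have /andP[] := lag_det_bounds (al j) (N j) (HJ j Jj).
Qed.

Lemma F_GUE_ge0 (s : R) : 0 <= F_GUE s.
Proof. by have /andP[] := F_GUE_bounds s. Qed.

Lemma F_GUE_lower_tail (eps : R) : 0 < eps -> exists A : R, forall s, s <= A -> F_GUE s < eps.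
Proof.
move=> eps0; have k0 := airy_diag0_gt0.
exists (- (`|ln (eps / 2)| / airy_diag 0)) => s sA.
have q0 : 0 <= `|ln (eps / 2)| / airy_diag 0 by rewrite divr_ge0 ?(ltW k0).
have s0 : s <= 0 by apply: le_trans sA _; rewrite oppr_le0.
have /andP[_ h] := F_GUE_bounds s.
apply: (@le_lt_trans _ _ (eps / 2)); last by lra.
apply: (le_trans h); rewrite -[leRHS]lnK ?posrE ?divr_gt0 // ler_expR.
have h1 := airy_trace_ge s0.
have h2 : `|ln (eps / 2)| <= - s * airy_diag 0 by rewrite -ler_pdivrMr //; lra.
have := ler_norm (- ln (eps / 2)); rewrite normrN; lra.
Qed.

(** The Laguerre determinants [D j] satisfy [D j (ss j) --> F_GUE s] along every sequence
    [ss --> s]; such convergence forces continuity of the limit, by a diagonal argument. *)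
Lemma F_GUE_continuous : continuous (@F_GUE R).
Proof.
apply: seq_continuous => x u ux.
pose N (j : nat) := j.+1; pose al (j : nat) := 0%N.
have N0 j : (0 < N j)%N by [].
have [Ny ac] := square_params.
pose D j (s : R) := \det (1%:M - \matrix_(a < N j, b < N j) lag_kernel (al j) (N j) (edge_pos (al j) (N j) s) a b).
have key (ss : nat -> R) s : ss @ \oo --> s -> (fun j => D j (ss j)) @ \oo --> F_GUE s.
  move=> sc; have near0 := lag_edge_near N0 Ny ac (lexx 0) sc.
  exact: (lag_det_cvg Ny ac (lexx 0) sc (fun=> erefl) near0).1.
apply/cvgrPdist_lt => e e0; apply: contrapT => Hn.
have Hw n : exists m, (n <= m)%N /\ e <= `|F_GUE x - F_GUE (u m)|.
  apply: contrapT => Hc; apply: Hn; exists n => // m nm; rewrite ltNge.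
  by apply/negP => h; apply: Hc; exists m.
have [w Hw2] := choice Hw; pose v n := u (w n).
have Hj n : exists j, forall k, (j <= k)%N -> `|F_GUE (v n) - D k (v n)| < e / 2.
  have sc : (fun=> v n) @ \oo --> v n by exact: cvg_cst.
  have e20 : 0 < e / 2 by rewrite divr_gt0.
  have /cvgrPdist_lt/(_ (e / 2) e20)[j _ Hj] := key _ _ sc.
  by exists j => k; exact: Hj.
have [J HJ] := choice Hj.
(* The largest [n <= j] whose threshold [J n] has been passed, so that [D j] is already close to
   [F_GUE] at [v n]. It tends to infinity, hence [v (phi j)] still tends to [x]. *)
pose phi j := (\max_(n < j.+1 | (J n <= j)%N) n)%N.
have phi1 j : (J 0%N <= j)%N -> (J (phi j) <= j)%N.
  move=> Jj; have [|i Ji E] := @eq_bigmax_cond _ [pred n : 'I_j.+1 | J n <= j]%N (fun n : 'I_j.+1 => n : nat).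
    by apply/card_gt0P; exists ord0; rewrite inE.
  by rewrite /phi E; rewrite inE in Ji.
have phi2 m j : (J m <= j)%N -> (m <= j)%N -> (m <= phi j)%N.
  move=> Jm mj; rewrite /phi.
  exact: (@leq_bigmax_cond _ [pred n : 'I_j.+1 | J n <= j]%N (fun n : 'I_j.+1 => n : nat) (Ordinal (mj : (m < j.+1)%N))).
have vc : (fun j => v (phi j)) @ \oo --> x.
  apply/cvgrPdist_lt => a a0; have /cvgrPdist_lt/(_ a a0)[M _ HM] := ux.
  exists (maxn M (J M)) => // j; rewrite /= geq_max => /andP[Mj JMj].
  by apply: HM => /=; apply: leq_trans (Hw2 _).1; exact: phi2.
have e20 : 0 < e / 2 by rewrite divr_gt0.
have /cvgrPdist_lt/(_ (e / 2) e20)[M _ HM] := key _ _ vc.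
pose j := maxn M (J 0%N).
have h1 : `|F_GUE x - D j (v (phi j))| < e / 2 by apply: HM; rewrite /= leq_maxl.
have h2 := HJ (phi j) j (phi1 j (leq_maxr _ _)).
have h3 := (Hw2 (phi j)).2; rewrite -/(v (phi j)) in h3.
have := ler_distD (D j (v (phi j))) (F_GUE x) (F_GUE (v (phi j))).
by rewrite [`|D _ _ - _|]distrC; lra.
Qed.

End AiryDecay.

(** * Last passage times *)

Section Growth.
Variable R : realType.
Implicit Types w : nat -> nat -> R.

Fixpoint grow_row (x v : nat -> R) (j : nat) : R := if j is j'.+1 then Num.max (x j'.+1) (grow_row x v j') + v j' else 0.

(* With nonnegative weights the zero boundary values are harmless, and [grow w m n] is the
   last passage value over the m * n rectangle with corner (0, 0), both endpoints included. *)
Fixpoint grow w (i : nat) : nat -> R := if i is i'.+1 then grow_row (grow w i') (w i') else fun=> 0.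

Lemma growS w i j : grow w i.+1 j.+1 = Num.max (grow w i j.+1) (grow w i.+1 j) + w i j.
Proof. by []. Qed.

Lemma grow0 w i : grow w i 0 = 0. Proof. by case: i. Qed.

Lemma grow_le w w' m n : (forall i j, (i < m)%N -> (j < n)%N -> w i j <= w' i j) -> grow w m n <= grow w' m n.
Proof.
elim: m n => [|m IHm] // n; elim: n => [|n IHn] // ww.
rewrite !growS lerD ?ww // ge_max !le_max.
rewrite IHm => [|i j im jn]; last by apply: ww => //; exact: leqW.
by rewrite IHn ?orbT // => i j im jn; apply: ww => //; exact: leqW.
Qed.

Lemma eq_grow w w' m n : (forall i j, (i < m)%N -> (j < n)%N -> w i j = w' i j) -> grow w m n = grow w' m n.
Proof. by move=> ww; apply/eqP; rewrite eq_le !grow_le // => i j im jn; rewrite ww. Qed.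

(** A path through the rectangle has at most [m + n] cells; this bounds the effect of rounding all
    weights. *)
Lemma grow_addn w (c : R) m n : 0 <= c -> grow (fun i j => w i j + c) m n <= grow w m n + (m + n)%:R * c.
Proof.
move=> c0; elim: m n => [|m IHm] n; first by rewrite /= add0r mulr_ge0.
elim: n => [|n IHn]; first by rewrite !grow0 add0r mulr_ge0.
have h1 := IHm n.+1; rewrite !growS.
have -> : (m.+1 + n.+1)%:R * c = (m.+1 + n)%:R * c + c by rewrite addnS -natr1 mulrDl mul1r.
rewrite addnS -addSn in h1; move: h1 IHn.
move: (_ * c) (grow _ m n.+1) (grow _ m.+1 n) (grow w m n.+1) (grow w m.+1 n) => k a b a' b' h1 h2.
suff : Num.max a b <= Num.max a' b' + k by lra.
by rewrite ge_max (le_trans h1) ?(le_trans h2) // lerD2r le_max lexx ?orbT.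
Qed.

Lemma growZ w (c : R) m n : 0 <= c -> grow (fun i j => c * w i j) m n = c * grow w m n.
Proof.
move=> c0; elim: m n => [|m IHm] n; first by rewrite mulr0.
elim: n => [|n IHn]; first by rewrite !grow0 mulr0.
by rewrite !growS IHm IHn mulrDr maxr_pMr.
Qed.

Lemma grow_tr w m n : grow (fun i j => w j i) n m = grow w m n.
Proof.
elim: m n => [|m IHm] n; first by rewrite grow0.
elim: n => [|n IHn]; first by rewrite grow0.
by rewrite !growS IHm IHn maxC.
Qed.

Section Nonnegative.
Variable w : nat -> nat -> R.
Hypothesis w0 : forall i j, 0 <= w i j.

Lemma grow_ge0 m n : 0 <= grow w m n.
Proof.
elim: m n => [|m IHm] // n; elim: n => [|n IHn] //.
by rewrite growS addr_ge0 // le_max IHm.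
Qed.

Lemma grow_monol m n : grow w m n <= grow w m.+1 n.
Proof. by case: n => [|n]; rewrite ?grow0 // growS -[leLHS]addr0 lerD ?w0 // le_max lexx. Qed.

Lemma grow_monor m n : grow w m n <= grow w m n.+1.
Proof. by case: m => [|m]; rewrite // growS -[leLHS]addr0 lerD ?w0 // le_max lexx orbT. Qed.

Lemma grow_mono m n m' n' : (m <= m')%N -> (n <= n')%N -> grow w m n <= grow w m' n'.
Proof.
move=> /subnKC <- /subnKC <-; move: (m' - m)%N (n' - n)%N => a b.
apply: (@le_trans _ _ (grow w (m + a) n)).
  by elim: a => [|a IH]; rewrite ?addn0 // addnS (le_trans IH) // grow_monol.
by elim: b => [|b IH]; rewrite ?addn0 // addnS (le_trans IH) // grow_monor.
Qed.

Lemma grow_ge m n i j : (i < m)%N -> (j < n)%N -> w i j <= grow w m n.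
Proof.
move=> im jn; apply: le_trans (grow_mono im jn).
by rewrite growS -[leLHS]add0r lerD // le_max grow_ge0.
Qed.
End Nonnegative.

Lemma nth_col_heights y x v j : size v = size x -> (j < size x)%N -> nth 0%N (col_heights y x v) j =
  (maxn (if j is j'.+1 then nth 0 (col_heights y x v) j' else y) (nth 0 x j) + nth 0 v j)%N.
Proof.
elim: x y v j => [|a x IH] y [|b v] [|j] //= [vx] jx.
by rewrite IH //; case: j jx.
Qed.

(** [lpp_cols] consumes the first column first, while [grow] is a recursion on the last one; this
    exchanges the two. *)
Lemma lpp_colsS m n x s : size s = (m.+1 * n)%N -> lpp_cols m.+1 n x s = col_heights 0 (lpp_cols m n x (take (m * n) s)) (drop (m * n) s).
Proof.
elim: m x s => [|m IH] x s ss; first by rewrite /= drop0 take_oversize // ss mul1n.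
rewrite -[LHS]/(lpp_cols m.+1 n (col_heights 0 x (take n s)) (drop n s)) IH; last first.
  by rewrite size_drop ss !mulSn addKn.
rewrite -[lpp_cols m.+1 n x _]/(lpp_cols m n (col_heights 0 x (take n (take (m.+1 * n) s))) (drop n (take (m.+1 * n) s))).
rewrite take_takel ?mulSn ?leq_addr // drop_drop addnC.
by rewrite take_drop [(m * n + n)%N]addnC -mulSn.
Qed.

Lemma nth_lpp_cols m n s j : size s = (m * n)%N -> (j < n)%N -> (nth 0%N (lpp_cols m n (nseq n 0%N) s) j)%:R =
  grow (fun i j => (nth 0%N s (i * n + j))%:R) m j.+1.
Proof.
elim: m s j => [|m IHm] s j ss jn; first by rewrite /= nth_nseq jn.
have st : size (take (m * n) s) = (m * n)%N by rewrite size_takel // ss mulSn leq_addl.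
have sl := @size_lpp_cols m n (nseq n 0%N) (take (m * n) s) (size_nseq _ _) st.
have sd : size (drop (m * n) s) = n by rewrite size_drop ss mulSn addnK.
rewrite lpp_colsS //.
have IHm' k : (k < n)%N -> (nth 0%N (lpp_cols m n (nseq n 0%N) (take (m * n) s)) k)%:R = grow (fun i j => (nth 0%N s (i * n + j))%:R) m k.+1.
  move=> kn; rewrite IHm //; apply: eq_grow => i k' im k'k; rewrite nth_take //.
  have k'n : (k' < n)%N by exact: leq_trans k'k kn.
  nia.
elim: j jn => [|j IHj] jn.
  rewrite nth_col_heights ?sl ?sd // growS natrD natr_max nth_drop addn0 maxC IHm' //.
by rewrite nth_col_heights ?sl ?sd // growS natrD natr_max nth_drop maxC IHm' // IHj // ltnW.
Qed.

Lemma lpp_last_grow m n s : (0 < n)%N -> size s = (m * n)%N -> (lpp_last n m s)%:R = grow (fun i j => (nth 0%N s (i * n + j))%:R) m n.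
Proof.
case: n => // n _ ss; rewrite -nth_lpp_cols // /lpp_last -nth_last.
by rewrite size_lpp_cols ?size_nseq.
Qed.
End Growth.

(** * Up-right paths *)

Section Paths.
Variable R : realType.
Implicit Types (w : int * int -> R) (a b : int * int) (s : seq (int * int)).

Definition step a b := (b == (a.1 + 1, a.2)) || (b == (a.1, a.2 + 1)).

Definition path_sum w a s : R := \sum_(p <- a :: s) w p.

Definition rect w a (i j : nat) : R := w (a.1 + i%:Z, a.2 + j%:Z).

(** Both end points are counted. The absolute values only make the function total; it is the maximum
    over paths when [le_pt a b]. *)
Definition passage w a b : R := grow (rect w a) `|b.1 - a.1|.+1 `|b.2 - a.2|.+1.

Lemma passageE w a (i j : nat) : passage w a (a.1 + i%:Z, a.2 + j%:Z) = grow (rect w a) i.+1 j.+1.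
Proof. by rewrite /passage /= addrC addKr addrC addKr. Qed.

Definition le_pt a b := (a.1 <= b.1) && (a.2 <= b.2).

Lemma le_ptP a b : le_pt a b -> exists i j : nat, b = (a.1 + i%:Z, a.2 + j%:Z).
Proof.
case: a b => [a1 a2] [b1 b2] /= /andP[/= h1 h2]; exists `|b1 - a1|%N, `|b2 - a2|%N.
by congr pair; lia.
Qed.

Lemma path_sum_rcons w a s b : path_sum w a (rcons s b) = path_sum w a s + w b.
Proof. by rewrite /path_sum -rcons_cons big_rcons. Qed.

Lemma path_sum_cat w a s1 s2 : path_sum w a (s1 ++ s2) = path_sum w a s1 + \sum_(p <- s2) w p.
Proof. by rewrite /path_sum -cat_cons big_cat. Qed.

Lemma path_le_pt a s : path step a s -> le_pt a (last a s).
Proof.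
elim/last_ind: s => [|s b IH]; first by rewrite /le_pt !lexx.
rewrite rcons_path last_rcons => /andP[/IH /andP[h1 h2]].
by rewrite /step => /orP[] /eqP ->; rewrite /le_pt /=; apply/andP; split => //; lia.
Qed.

Section Nonnegative.
Variable w : int * int -> R.
Hypothesis w0 : forall p, 0 <= w p.

Lemma rect_ge0 a i j : 0 <= rect w a i j. Proof. exact: w0. Qed.

Lemma passage_ge0 a b : 0 <= passage w a b. Proof. by apply: grow_ge0 => i j; exact: rect_ge0. Qed.

Lemma path_sum_le a s : path step a s -> path_sum w a s <= passage w a (last a s).
Proof.
elim/last_ind: s => [|s b IH].
  by rewrite /path_sum big_seq1 /passage !subrr growS /= maxxx add0r /rect !addr0 -surjective_pairing.
rewrite rcons_path last_rcons path_sum_rcons => /andP[ps st].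
have [i [j E]] := le_ptP (path_le_pt ps).
have := IH ps; rewrite E passageE => h.
move: st; rewrite /step E /= => /orP[] /eqP ->.
- have -> : a.1 + i%:Z + 1 = a.1 + i.+1%:Z by lia.
  rewrite passageE [leRHS]growS lerD // le_max; first by rewrite h.
- have -> : a.2 + j%:Z + 1 = a.2 + j.+1%:Z by lia.
  by rewrite passageE [leRHS]growS lerD // le_max h orbT.
Qed.

(** A maximal path is built along the recursion, by always extending one to the predecessor with the
    larger value; nonnegativity settles the boundary rows, where one predecessor is missing. *)
Lemma passage_path a b : le_pt a b -> exists s, [/\ path step a s, last a s = b & path_sum w a s = passage w a b].
Proof.
move=> /le_ptP[i [j ->]]; rewrite passageE.
have extend (i' j' k l : nat) : step (a.1 + i'%:Z, a.2 + j'%:Z) (a.1 + k%:Z, a.2 + l%:Z) ->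
    grow (rect w a) k.+1 l.+1 = grow (rect w a) i'.+1 j'.+1 + rect w a k l ->
    (exists s, [/\ path step a s, last a s = (a.1 + i'%:Z, a.2 + j'%:Z) & path_sum w a s = grow (rect w a) i'.+1 j'.+1]) ->
    exists s, [/\ path step a s, last a s = (a.1 + k%:Z, a.2 + l%:Z) & path_sum w a s = grow (rect w a) k.+1 l.+1].
  move=> st E [s [ps ls ss]]; exists (rcons s (a.1 + k%:Z, a.2 + l%:Z)).
  by rewrite rcons_path last_rcons path_sum_rcons ps ls ss E.
have stepl (i' j' : nat) : step (a.1 + i'%:Z, a.2 + j'%:Z) (a.1 + i'.+1%:Z, a.2 + j'%:Z).
  by rewrite /step /=; apply/orP; left; apply/eqP; congr pair; lia.
have stepr (i' j' : nat) : step (a.1 + i'%:Z, a.2 + j'%:Z) (a.1 + i'%:Z, a.2 + j'.+1%:Z).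
  by rewrite /step /=; apply/orP; right; apply/eqP; congr pair; lia.
have g0 k l : 0 <= grow (rect w a) k l by apply: grow_ge0 => *; exact: rect_ge0.
elim: i j => [|i IHi] j.
  elim: j => [|j IHj].
    exists [::]; split => //=; first by rewrite !addr0 -surjective_pairing.
    by rewrite /path_sum big_seq1 maxxx add0r /rect !addr0 -surjective_pairing.
  by apply: (extend 0%N j) => //; rewrite growS max_r.
elim: j => [|j IHj].
  by apply: (extend i 0%N) => //; rewrite growS grow0 max_l.
case: (leP (grow (rect w a) i.+1 j.+2) (grow (rect w a) i.+2 j.+1)) => h.
- by apply: (extend i.+1 j) => //; rewrite growS max_r.
- by apply: (extend i j.+1) => //; rewrite growS max_l // ltW.
Qed.

Lemma passage_le_pt a' a b b' : le_pt a' a -> le_pt a b -> le_pt b b' -> passage w a b <= passage w a' b'.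
Proof.
move=> /passage_path[s1 [p1 l1 _]] /passage_path[s [p l <-]] /passage_path[s2 [p2 l2 _]].
have P : path step a' (s1 ++ s ++ s2) by rewrite cat_path p1 l1 cat_path p l p2.
have := path_sum_le P; rewrite !last_cat l1 l l2; apply: le_trans.
rewrite path_sum_cat big_cat /=.
have E : path_sum w a' s1 = \sum_(q <- belast a' s1) w q + w a by rewrite /path_sum lastI big_rcons l1.
rewrite E /path_sum big_cons -addrA [w a + (_ + _)]addrA.
have h1 : 0 <= \sum_(q <- belast a' s1) w q by exact: sumr_ge0.
have h2 : 0 <= \sum_(q <- s2) w q by exact: sumr_ge0.
lra.
Qed.

(** The second path starts one step after the end of the first, so that no weight is counted
    twice. *)
Lemma passage_join a b b' c : le_pt a b -> step b b' -> le_pt b' c -> passage w a b + passage w b' c <= passage w a c.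
Proof.
move=> /passage_path[s1 [p1 l1 <-]] st /passage_path[s2 [p2 l2 <-]].
have P : path step a (s1 ++ b' :: s2) by rewrite cat_path p1 l1 /= st p2.
by have := path_sum_le P; rewrite last_cat /= l2 path_sum_cat.
Qed.

Lemma path_sum_split a s p : path step a s -> p \in a :: s ->
  [/\ le_pt a p, le_pt p (last a s) & path_sum w a s <= passage w a p + passage w p (last a s)].
Proof.
move=> ps; rewrite inE => /orP[/eqP ->|pin].
  split; [by rewrite /le_pt !lexx | exact: path_le_pt |].
  by apply: (le_trans (path_sum_le ps)); rewrite lerDr passage_ge0.
move: ps; case/splitPr: pin => s1 s2 ps.
have [q1 q2] : path step a (rcons s1 p) /\ path step p s2 by move: ps; rewrite -cat_rcons cat_path last_rcons => /andP.
have e1 := path_le_pt q1; have e2 := path_le_pt q2; rewrite last_rcons in e1.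
rewrite last_cat /=; split => //.
have := path_sum_le q1; have := path_sum_le q2; rewrite last_rcons -cat_rcons path_sum_cat /path_sum big_cons => h2 h1.
have := w0 p; lra.
Qed.

End Nonnegative.

(** The difference of the coordinates changes by one at each step and cannot jump over 0. *)
Lemma path_crossing a s p : path step a s -> a.1 < a.2 -> p \in a :: s -> p.2 <= p.1 -> exists q, (q, q) \in a :: s.
Proof.
elim: s a => [|b s IH] a /=.
  by move=> _ a12; rewrite inE => /eqP -> ; rewrite leNgt a12.
move=> /andP[st ps] a12; rewrite inE => /orP[/eqP -> | pin]; first by rewrite leNgt a12.
move=> p12; have [b12|b12] := ltP b.1 b.2.
  by have [q qin] := IH b ps b12 pin p12; exists q; rewrite inE qin orbT.
exists b.1; have -> : (b.1, b.1) = b.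
  by move: st b12; rewrite /step => /orP[] /eqP -> /= h; congr pair; lia.
by rewrite !inE eqxx orbT.
Qed.

(** With the weights on and below the diagonal erased, passage times depend only on the weights
    strictly above it, which is what independence of the two sides rests on. *)
Definition above w (p : int * int) : R := if p.1 < p.2 then w p else 0.

Lemma passage_above w a b : (forall p, 0 <= w p) -> le_pt a b -> a.1 < a.2 -> passage w a b <= passage (above w) a b \/
  exists q, [/\ le_pt a (q, q), le_pt (q, q) b & passage w a b <= passage w a (q, q) + passage w (q, q) b].
Proof.
move=> w0 /(passage_path w0)[s [ps ls <-]] a12.
have aw0 p : 0 <= above w p by rewrite /above; case: ifP.
have [/hasP[p pin p12]|/hasPn hn] := boolP (has (fun p : int * int => p.2 <= p.1) (a :: s)).
  have [q qin] := path_crossing ps a12 pin p12; right; exists q.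
  by have := path_sum_split w0 ps qin; rewrite ls.
left; have := @path_sum_le (above w) _ _ ps; rewrite ls; apply: le_trans; rewrite le_eqVlt; apply/orP; left; apply/eqP.
rewrite /path_sum big_seq [RHS]big_seq; apply: eq_bigr => p /hn; rewrite -ltNge /above => -> //.
Qed.

Lemma le_passage w w' a b : (forall p, w p <= w' p) -> passage w a b <= passage w' a b.
Proof. by move=> ww; apply: grow_le => i j _ _; exact: ww. Qed.

Definition swap (p : int * int) := (p.2, p.1).

Lemma passage_swap w a b : passage (w \o swap) (swap a) (swap b) = passage w a b.
Proof. by rewrite /passage -[RHS]grow_tr. Qed.

Lemma up_rightP (p : seq (int * int)) : up_right p <-> p <> [::] /\ path step (head (0, 0) p) (behead p).
Proof.
case: p => [|a s]; first by split=> -[].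
split=> -[_ H]; split=> //=; last first.
  move=> i; rewrite /= ltnS => si; have := pathP (0, 0) H i si.
  by rewrite /step => /orP[] /eqP ->; [left|right].
apply/(pathP (0, 0)) => i si; have := H i; rewrite /= ltnS => /(_ si).
by rewrite /step => -[->|->]; rewrite eqxx ?orbT.
Qed.

(** Leaving out the starting set in the sum amounts to giving its two points weight 0; the supremum
    then splits according to the starting point. *)
Lemma LPP_passage w (a1 a2 b : int * int) : (forall p, 0 <= w p) -> le_pt a1 b -> le_pt a2 b ->
  let w' p := if (p == a1) || (p == a2) then 0 else w p in
  LPP w [set a | a = a1 \/ a = a2] b = Num.max (passage w' a1 b) (passage w' a2 b).
Proof.
move=> w0 h1 h2 w'.
have w'0 p : 0 <= w' p by rewrite /w'; case: ifP.
have sumE s a : \sum_(q <- a :: s | q \notin [set a | a = a1 \/ a = a2]) w q = path_sum w' a s.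
  rewrite /path_sum big_mkcond; apply: eq_bigr => q _; rewrite /w'.
  have -> : (q \notin [set a | a = a1 \/ a = a2]) = ~~ ((q == a1) || (q == a2)).
    congr (~~ _); apply/idP/idP; first by rewrite inE /= => -[] ->; rewrite eqxx ?orbT.
    by move=> /orP[] /eqP ->; rewrite inE /=; [left|right].
  by case: (_ || _).
rewrite /LPP; set V := [set v | _].
have ubV : ubound V (Num.max (passage w' a1 b) (passage w' a2 b)).
  move=> v [[|a s] [/up_rightP[//= _ ps] sa lb ->]]; rewrite sumE le_max.
  have := @path_sum_le w' _ _ ps; rewrite -lb /=; case: sa => /= -> ->; rewrite ?orbT //.
have memV a : le_pt a b -> a = a1 \/ a = a2 -> V (passage w' a b).
  move=> ab aa; have [s [ps ls <-]] := passage_path w'0 ab.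
  by exists (a :: s); rewrite sumE; split => //; apply/up_rightP.
have V1 := memV a1 h1 (or_introl erefl); have V2 := memV a2 h2 (or_intror erefl).
have hs : has_sup V by split; [exists (passage w' a1 b) | exists (Num.max (passage w' a1 b) (passage w' a2 b))].
apply/eqP; rewrite eq_le; apply/andP; split; first by apply: ge_sup => //; case: hs.
by rewrite ge_max !ub_le_sup //; case: hs.
Qed.

End Paths.

(** * The random field and its integer levels *)

Local Notation grow_set w a m n c := [set x | grow (rect (w^~ x) a) m n <= c].
Local Notation passage_set w a b c := [set x | passage (w^~ x) a b <= c].
Section Field.
Variables (R : realType) (d : measure_display) (T : measurableType d) (P : probability T R).

Definition prb (A : set T) : R := fine (P A).

Lemma prb_fin (A : set T) : measurable A -> P A \is a fin_num.
Proof. by move=> mA; exact: fin_num_measure. Qed.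

Lemma prbE (A : set T) : measurable A -> (prb A)%:E = P A.
Proof. by move=> mA; rewrite fineK // prb_fin. Qed.

Lemma prb_le (A B : set T) : measurable A -> measurable B -> A `<=` B -> prb A <= prb B.
Proof. by move=> mA mB AB; rewrite fine_le ?prb_fin // le_measure ?inE. Qed.

Lemma prb_ge0 (A : set T) : 0 <= prb A. Proof. exact: fine_ge0. Qed.

Lemma prb_le1 (A : set T) : measurable A -> prb A <= 1.
Proof. by move=> mA; rewrite -lee_fin prbE // probability_le1. Qed.

Lemma prbDI (A B : set T) : measurable A -> measurable B -> prb A = prb (A `\` B) + prb (A `&` B).
Proof.
move=> mA mB; apply: EFin_inj; rewrite EFinD !prbE //; first exact: measureDI.
- exact: measurableI.
- exact: measurableD.
Qed.

Lemma prb_setC (A : set T) : measurable A -> prb (~` A) = 1 - prb A.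
Proof.
by move=> mA; apply: EFin_inj; rewrite EFinB !prbE ?probability_setC //; exact: measurableC.
Qed.

Lemma prb_bigcup (I : eqType) (r : seq I) (F : I -> set T) : (forall i, measurable (F i)) -> measurable (\bigcup_(i in [set i | i \in r]) F i) /\
  prb (\bigcup_(i in [set i | i \in r]) F i) <= \sum_(i <- r) prb (F i).
Proof.
move=> mF; elim: r => [|i r [mr IH]].
  rewrite (_ : \bigcup_(i in _) _ = set0); last by apply/seteqP; split => x //= [].
  by rewrite big_nil /prb measure0.
have -> : \bigcup_(j in [set j | j \in i :: r]) F j = F i `|` \bigcup_(j in [set j | j \in r]) F j.
  apply/seteqP; split => x /=.
    by move=> [j]; rewrite /= inE => /orP[/eqP ->|jr] Fx; [left | right; exists j].
  by move=> [Fx|[j jr Fx]]; [exists i => //=; rewrite mem_head | exists j => //=; rewrite inE jr orbT].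
have mU := measurableU _ _ (mF i) mr.
split => //; rewrite big_cons -lee_fin EFinD !prbE //.
apply: (le_trans (measureU2 P (mF i) mr)); apply: leeD2l.
by move: IH; rewrite -lee_fin (prbE mr).
Qed.

(* The only way independence and the exponential law are used: the integer parts of the
   weights rescaled by K are independent geometric variables. *)
Definition exp_field (X : int * int -> T -> R) := [/\ forall p, measurable_fun setT (X p), forall p x, 0 <= X p x &
      forall (K : R) (J : seq (int * int)) (w : int * int -> nat), 0 < K -> uniq J -> P [set x | forall p, p \in J -> truncn (K * X p x) = w p] =
        (\prod_(p <- J) ((1 - expR (- K^-1)) * expR (- K^-1) ^+ w p))%:E].

Lemma exp_field_swap X : exp_field X -> exp_field (fun p => X (swap p)).
Proof.
case=> mX X0 Xl; split => // K J w K0 uJ.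
have sK : cancel swap swap by case.
have uJ' : uniq (map swap J) by rewrite map_inj_uniq //; exact: can_inj sK.
have := Xl K (map swap J) (fun p => w (swap p)) K0 uJ'.
rewrite big_map => E; rewrite -[RHS]/(_%:E) (eq_bigr (fun p => (1 - expR (- K^-1)) * expR (- K^-1) ^+ w (swap (swap p)))) => [|p _]; last by rewrite sK.
rewrite -E; congr (P _); apply/seteqP; split => x /= H p.
- by move=> /mapP[p' pJ ->]; rewrite H // sK.
- by move=> pJ; rewrite (H (swap p)) ?sK // map_f.
Qed.

Definition nonneg_field (X : int * int -> T -> R) := (forall p, measurable_fun setT (X p)) /\ (forall p x, 0 <= X p x).

Lemma exp_field_nonneg X : exp_field X -> nonneg_field X.
Proof. by case. Qed.

Section Levels.
Variables (X : int * int -> T -> R).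
Hypothesis nX : nonneg_field X.

Let mX p : measurable_fun setT (X p). Proof. by case: nX. Qed.
Let X0 p x : 0 <= X p x. Proof. by case: nX. Qed.

Definition level (K : R) p x : nat := truncn (K * X p x).

Lemma measurable_level K p v : 0 <= K -> measurable [set x | level K p x = v].
Proof.
move=> K0; rewrite (_ : [set x | _] = (fun x => K * X p x) @^-1` `[v%:R, v.+1%:R[%classic).
  by rewrite -[X in measurable X]setTI; apply: measurable_funM => //; exact: measurable_cst.
apply/seteqP; split => x /=; rewrite in_itv /=.
- by move=> <-; apply: truncn_itv; rewrite mulr_ge0.
- by move=> h; exact: truncn_def.
Qed.

Lemma measurable_levels K J (G : seq nat -> Prop) : 0 <= K -> measurable [set x | G [seq level K p x | p <- J]].
Proof.
move=> K0; elim: J G => [|p J IH] G /=.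
  by have [g|g] := pselect (G [::]); [rewrite (_ : [set _ | _] = setT) // | rewrite (_ : [set _ | _] = set0) //]; apply/seteqP; split.
rewrite (_ : [set x | _] = \bigcup_v ([set x | level K p x = v] `&` [set x | G (v :: [seq level K p x | p <- J])])).
  apply: bigcupT_measurable => v; apply: measurableI; first exact: measurable_level.
  exact: (IH (fun s => G (v :: s))).
apply/seteqP; split => x /=; last by case=> v _ /= [<-].
by move=> g; exists (level K p x).
Qed.

Definition rect_pts (a : int * int) (m n : nat) : seq (int * int) := [seq (a.1 + (k %/ n)%:Z, a.2 + (k %% n)%:Z) | k <- iota 0 (m * n)].

Lemma size_rect_pts a m n : size (rect_pts a m n) = (m * n)%N.
Proof. by rewrite size_map size_iota. Qed.

Lemma uniq_rect_pts a m n : uniq (rect_pts a m n).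
Proof.
rewrite map_inj_uniq ?iota_uniq // => k l [/addrI [h1] /addrI [h2]].
by rewrite (divn_eq k n) (divn_eq l n) h1 h2.
Qed.

Lemma nth_rect_pts a m n i j b : (i < m)%N -> (j < n)%N -> nth b (rect_pts a m n) (i * n + j) = (a.1 + i%:Z, a.2 + j%:Z).
Proof.
move=> im jn; have n0 : (0 < n)%N by case: (n) jn.
have k : (i * n + j < m * n)%N by nia.
rewrite (nth_map 0%N) ?size_iota // nth_iota // add0n divnMDl // modnMDl.
by rewrite divn_small // modn_small // addn0.
Qed.

Lemma mem_rect_pts a m n p : p \in rect_pts a m n -> exists i j, [/\ (i < m)%N, (j < n)%N & p = (a.1 + i%:Z, a.2 + j%:Z)].
Proof.
move=> /mapP[k]; rewrite mem_iota add0n => /= km ->; exists (k %/ n)%N, (k %% n)%N.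
have n0 : (0 < n)%N by case: (n) km; rewrite ?muln0.
by rewrite ltn_mod n0 ltn_divLR.
Qed.

Definition level_grow (K : R) a m n x : R := grow (rect (fun p => (level K p x)%:R) a) m n.

Lemma level_growE K a m n x : (0 < n)%N -> level_grow K a m n x = (lpp_last n m [seq level K p x | p <- rect_pts a m n])%:R.
Proof.
move=> n0; rewrite lpp_last_grow ?size_map ?size_iota //; apply: eq_grow => i j im jn.
rewrite (nth_map (0, 0)) ?size_rect_pts ?nth_rect_pts //; nia.
Qed.

Lemma level_grow_le K a m n x : 0 <= K -> level_grow K a m n x <= K * grow (rect (X^~ x) a) m n.
Proof.
move=> K0; rewrite -growZ //; apply: grow_le => i j _ _; rewrite /rect /level.
by have /andP[] := truncn_itv (mulr_ge0 K0 (X0 (a.1 + i%:Z, a.2 + j%:Z) x)).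
Qed.

Lemma level_grow_ge K a m n x : 0 <= K -> K * grow (rect (X^~ x) a) m n <= level_grow K a m n x + (m + n)%:R.
Proof.
move=> K0; rewrite -growZ //; have := grow_addn (rect (fun p => (level K p x)%:R : R) a) m n ler01.
rewrite mulr1; apply: le_trans; apply: grow_le => i j _ _; rewrite /rect /level natr1.
by apply: ltW; have /andP[] := truncn_itv (mulr_ge0 K0 (X0 (a.1 + i%:Z, a.2 + j%:Z) x)).
Qed.

Lemma measurable_grow (f : nat -> nat -> T -> R) m n : (forall i j, measurable_fun setT (f i j)) ->
  measurable_fun setT (fun x => grow (fun i j => f i j x) m n).
Proof.
move=> mf; elim: m n => [|m IHm] n; first exact: measurable_cst.
elim: n => [|n IHn]; first exact: measurable_cst.
by apply: measurable_funD => //; exact: measurable_maxr.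
Qed.

Lemma measurable_passage a b : measurable_fun setT (fun x => passage (X^~ x) a b).
Proof. by apply: measurable_grow => i j; exact: mX. Qed.

Lemma measurable_grow_le a m n (eta : R) : measurable (grow_set X a m n eta).
Proof.
rewrite (_ : [set x | _] = (fun x => grow (rect (X^~ x) a) m n) @^-1` `]-oo, eta]%classic); last first.
  by apply/seteqP; split => x /=; rewrite in_itv.
rewrite -[X in measurable X]setTI.
by apply: (measurable_grow (f := fun i j x => rect (X^~ x) a i j)) => // i j; exact: mX.
Qed.

(** Rounding lowers each weight by less than [1 / K] and hence the passage time by at most
    [(m + n) / K], which puts the discrete event between two continuous ones. *)
Lemma grow_cdf_squeeze a m n (eta : R) k : 0 <= eta -> let K : R := k.+1%:R in
  (grow_set X a m n eta) `<=` [set x | level_grow K a m n x <= (truncn (K * eta))%:R] /\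
  [set x | level_grow K a m n x <= (truncn (K * eta))%:R] `<=`
  (grow_set X a m n (eta + (m + n)%:R / K)).
Proof.
move=> e0 K; have K0 : 0 < K by rewrite ltr0n.
have Ke : 0 <= K * eta by rewrite mulr_ge0 // ltW.
split => x /= h.
- have : level_grow K a m n x <= K * eta by apply: le_trans (level_grow_le _ _ _ _ (ltW K0)) _; rewrite ler_pM2l.
  have [->|n0] := posnP n; first by rewrite /level_grow grow0 ler0n.
  by rewrite level_growE // ler_nat truncn_ge_nat.
- rewrite -(ler_pM2l K0) mulrDr mulrCA divff ?gt_eqF // mulr1.
  apply: le_trans (level_grow_ge _ _ _ _ (ltW K0)) _; rewrite lerD2r (le_trans h) //.
  by have /andP[] := truncn_itv Ke.
Qed.

(** Continuity from above along the outer events, whose intersection is [A]; a possible atom of the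
    law at the threshold is therefore harmless. *)
Lemma cvg_prob_squeeze (A : set T) (E F : nat -> set T) : measurable A ->
  (forall k, measurable (E k)) -> (forall k, measurable (F k)) -> nonincreasing_seq F ->
  (forall k, A `<=` E k) -> (forall k, E k `<=` F k) -> \bigcap_k F k `<=` A ->
  (fun k => prb (E k)) @ \oo --> prb A.
Proof.
move=> mA mE mF Fd AE EF FA.
have E1 : \bigcap_k F k = A by apply/seteqP; split => // x Ax k _; apply: EF; exact: AE.
have mcap : measurable (\bigcap_k F k) by rewrite E1.
have c : (P \o F) @ \oo --> P (\bigcap_k F k) by apply: nonincreasing_cvg_mu => //; rewrite (le_lt_trans (probability_le1 _ _)) ?ltry.
have c' : (P \o F) @ \oo --> (fine (P (\bigcap_k F k)))%:E by rewrite fineK ?prb_fin.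
have c2 := fine_cvg c'.
apply: (squeeze_seq (f := fun=> prb A) (h := fun k => prb (F k))).
- by move=> k; rewrite !prb_le.
- exact: cvg_cst.
- rewrite -E1; exact: c2.
Qed.

Lemma measurable_level_grow K a m n (t : nat) : 0 <= K -> measurable [set x | level_grow K a m n x <= t%:R].
Proof.
move=> K0; have [n0|n0] := posnP n.
  rewrite (_ : [set x | _] = setT) //; apply/seteqP; split => x //= _.
  by rewrite n0 /level_grow grow0 ler0n.
rewrite (_ : [set x | _] = [set x | (fun s => (lpp_last n m s <= t)%N) [seq level K p x | p <- rect_pts a m n]]).
  exact: (measurable_levels _ (fun s => (lpp_last n m s <= t)%N)).
by apply/seteqP; split => x /=; rewrite level_growE // ler_nat.
Qed.

Lemma le_grow_addV a m n (eta : R) x : (forall k : nat, grow (rect (X^~ x) a) m n <= eta + (m + n)%:R / k.+1%:R) -> grow (rect (X^~ x) a) m n <= eta.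
Proof.
move=> h; apply/ler_addgt0Pr => e ep.
have [k] : exists k : nat, (m + n)%:R / k.+1%:R <= e.
  exists (truncn ((m + n)%:R / e)); rewrite ler_pdivrMr ?ltr0n // mulrC -ler_pdivrMr //.
  by have /andP[_ /ltW] := @truncn_itv R ((m + n)%:R / e) (divr_ge0 (ler0n _ _) (ltW ep)).
by move=> ke; apply: le_trans (h k) _; rewrite lerD2l.
Qed.

Lemma le_grow_addV_mono a m n (eta : R) : nonincreasing_seq (fun k => (grow_set X a m n (eta + (m + n)%:R / k.+1%:R))).
Proof.
move=> k l kl; apply/subsetPset => x /= h; apply: le_trans h _.
by rewrite lerD2l ler_wpM2l // lef_pV2 ?posrE ?ltr0n // ler_nat.
Qed.

Lemma grow_cdf_cvg a m n (eta : R) : 0 <= eta -> (fun k : nat => prb [set x | level_grow k.+1%:R a m n x <= (truncn (k.+1%:R * eta))%:R]) @ \oo -->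
  prb (grow_set X a m n eta).
Proof.
move=> e0.
apply: (@cvg_prob_squeeze _ _ (fun k => (grow_set X a m n (eta + (m + n)%:R / k.+1%:R)))).
- exact: measurable_grow_le.
- by move=> k; exact: measurable_level_grow.
- by move=> k; exact: measurable_grow_le.
- exact: le_grow_addV_mono.
- by move=> k; have [] := grow_cdf_squeeze a m n k e0.
- by move=> k; have [] := grow_cdf_squeeze a m n k e0.
- by move=> x /= h; apply: le_grow_addV => k; exact: h.
Qed.
End Levels.

Section Law.
Variables (X : int * int -> T -> R).
Hypothesis fX : exp_field X.

Let nX := exp_field_nonneg fX.

(** Points move one at a time from the free list [J] to the list [J1] of prescribed levels; summing
    over the level of the moved point reproduces the recursion of [gexp]. *)
Lemma levels_law_given (K : R) B (J J1 : seq (int * int)) (w : int * int -> nat) (F : seq nat -> bool) : 0 < K -> uniq (J1 ++ J) ->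
  P [set x | (forall p, p \in J1 -> level X K p x = w p) /\ F [seq level X K p x | p <- J] && all (fun v => (v < B)%N) [seq level X K p x | p <- J]] =
  (\prod_(p <- J1) ((1 - expR (- K^-1)) * expR (- K^-1) ^+ w p) * gexp (expR (- K^-1)) B (size J) (fun s => (F s)%:R))%:E.
Proof.
move=> K0; elim: J J1 w F => [|j J IH] J1 w F.
  rewrite cats0 /= => u1; case: (F [::]) => /=; last first.
    by rewrite mulr0 (_ : [set x | _] = set0) ?measure0 //; apply/seteqP; split => x //= [].
  by rewrite mulr1; case: fX => _ _ /(_ K J1 w K0 u1) <-; congr (P _); apply/seteqP; split => x //= -[].
move=> uJ.
have jJ1 : j \notin J1 by move: uJ; rewrite cat_uniq /= => /and3P[_ + _]; rewrite negb_or => /andP[].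
pose w' v p := if p == j then v else w p.
pose S (v : nat) := [set x | (forall p, p \in j :: J1 -> level X K p x = w' v p) /\
   F (v :: [seq level X K p x | p <- J]) && all (fun v => (v < B)%N) [seq level X K p x | p <- J]].
rewrite (_ : [set x | _] = \big[setU/set0]_(v < B) S v); last first.
  rewrite -(bigcup_mkord B S); apply/seteqP; split => x /=.
    move=> [h /and3P[h1 h2 h3]]; exists (level X K j x); [exact: h2|split]; last by rewrite h1 h3.
    by move=> p; rewrite inE /w'; case: eqVneq => [-> //|_ /= pJ]; exact: h.
  move=> [v /= vB [h h1]]; have hj : level X K j x = v by rewrite h ?mem_head // /w' eqxx.
  split; last by move: h1; rewrite hj vB.
  move=> p pJ; rewrite h ?inE ?pJ ?orbT // /w'; case: eqP => // pj.
  by move: jJ1; rewrite -pj pJ.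
have mS v : measurable (S v).
  rewrite (_ : S v = [set x | (fun s => forall i : nat, (i < (size J1).+1)%N -> nth 0%N s i = w' v (nth j (j :: J1) i)) [seq level X K p x | p <- j :: J1]] `&`
    [set x | (fun s => F (v :: s) && all (fun v => (v < B)%N) s) [seq level X K p x | p <- J]]).
    apply: measurableI.
      exact: (measurable_levels nX (j :: J1) (fun s => forall i : nat, (i < (size J1).+1)%N -> nth 0%N s i = w' v (nth j (j :: J1) i)) (ltW K0)).
    exact: (measurable_levels nX J (fun s => F (v :: s) && all (fun v => (v < B)%N) s) (ltW K0)).
  apply/seteqP; split => x [/= h h1]; split => //.
    by move=> i i1; rewrite -[RHS]h ?mem_nth // -(nth_map j 0%N (fun p => level X K p x)).
  by move=> p /(nthP j) [i i1 <-]; rewrite -h // -(nth_map j 0%N (fun p => level X K p x)).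
rewrite measure_semi_additive_ord //; last 2 first.
- apply/trivIsetP => v v' _ _ vv'; apply/seteqP; split => x //= [[h _] [h' _]].
  move: vv'; rewrite -val_eqE /=; move: (h j (mem_head _ _)) (h' j (mem_head _ _)).
  by rewrite /w' eqxx => <- <-; rewrite eqxx.
- exact: bigsetU_measurable.
rewrite (eq_bigr (fun v : 'I_B => (\prod_(p <- J1) ((1 - expR (- K^-1)) * expR (- K^-1) ^+ w p) *
   ((1 - expR (- K^-1)) * expR (- K^-1) ^+ v * gexp (expR (- K^-1)) B (size J) (fun s => (F (nat_of_ord v :: s))%:R)))%:E)).
  by rewrite sumEFin -mulr_sumr.
move=> v _; have u2 : uniq ((j :: J1) ++ J).
  move: uJ; rewrite -cat_rcons (perm_uniq (_ : perm_eq _ ((j :: J1) ++ J))) //.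
  by rewrite perm_cat2r perm_rcons.
apply: (etrans (IH (j :: J1) (w' v) (fun s => F (nat_of_ord v :: s)) u2)); rewrite big_cons /w' eqxx.
rewrite (eq_big_seq (fun p => (1 - expR (- K^-1)) * expR (- K^-1) ^+ w p)); last first.
  by move=> p pJ; case: eqP => // pj; move: jJ1; rewrite -pj pJ.
by rewrite mulrCA !mulrA.
Qed.

Lemma levels_law (K : R) B (J : seq (int * int)) (F : seq nat -> bool) : 0 < K -> uniq J ->
  (forall s, size s = size J -> F s -> all (fun v => (v < B)%N) s) ->
  P [set x | F [seq level X K p x | p <- J]] =
  (gexp (expR (- K^-1)) B (size J) (fun s => (F s)%:R))%:E.
Proof.
move=> K0 uJ FB; have := @levels_law_given K B J [::] (fun=> 0%N) F K0 uJ.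
rewrite big_nil mul1r => <-; congr (P _); apply/seteqP; split => x /=; last by case=> _ /andP[].
by move=> h; split => //; rewrite h FB // size_map.
Qed.

(** A single weight is at most the passage time, so on the event all weights are below [B] and the
    truncation is exact. *)
Lemma level_grow_law K B a m n t : 0 < K -> (0 < n)%N -> (t < B)%N -> P [set x | level_grow X K a m n x <= t%:R] =
  (gexp (expR (- K^-1)) B (m * n) (fun s => (lpp_last n m s <= t)%N%:R))%:E.
Proof.
move=> K0 n0 tB; rewrite -[in RHS](size_rect_pts a m n) -levels_law //.
- by congr (P _); apply/seteqP; split => x /=; rewrite level_growE // ler_nat.
- exact: uniq_rect_pts.
move=> s ss st; rewrite size_rect_pts in ss; apply/(all_nthP 0%N) => k; rewrite ss => km.
apply: leq_ltn_trans tB; apply: leq_trans st; rewrite -(ler_nat R) lpp_last_grow //.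
rewrite {1}(divn_eq k n); apply: (@grow_ge R (fun i j => (nth 0%N s (i * n + j))%:R)) => //.
- by rewrite ltn_divLR.
- by rewrite ltn_mod.
Qed.

End Law.

Section Independence.
Variables (X : int * int -> T -> R).
Hypothesis fX : exp_field X.

Let nX := exp_field_nonneg fX.

Definition restrict_field (D : pred (int * int)) p x := if D p then X p x else 0.

Lemma restrict_field_nonneg D : nonneg_field (restrict_field D).
Proof.
have [mX X0] := nX; split=> p; rewrite /restrict_field; case: (D p) => //.
Qed.

Section Restricted.
Variables (D : pred (int * int)) (a : int * int) (m n : nat).

Let J := seq.filter D (rect_pts a m n).
Let Y := restrict_field D.

Let lpp_at (s : seq nat) : R := grow (rect (fun p => if D p then (nth 0%N s (index p J))%:R else 0) a) m n.

Lemma level_grow_restrict K x : level_grow Y K a m n x = lpp_at [seq level X K p x | p <- J].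
Proof.
apply: eq_grow => i j im jn; rewrite /rect /level /Y /restrict_field.
set p := (_, _); case: ifP => Dp; last by rewrite mulr0 truncn0.
have pJ : p \in J.
  rewrite mem_filter Dp /= /p -(nth_rect_pts a (0, 0) im jn) mem_nth // size_rect_pts; nia.
by rewrite (nth_map p) ?index_mem // nth_index.
Qed.

Lemma lpp_at_bound (t B : nat) s : size s = size J -> lpp_at s <= t%:R -> (t < B)%N -> all (fun v => (v < B)%N) s.
Proof.
move=> sJ st tB; apply/(all_nthP 0%N) => k; rewrite sJ => kJ.
apply: leq_ltn_trans tB; rewrite -(ler_nat R); apply: le_trans st.
have : nth (0, 0) J k \in J by rewrite mem_nth.
rewrite mem_filter => /andP[Dp /mem_rect_pts[i [j [im jn E]]]].
have uJ : uniq J by rewrite filter_uniq // uniq_rect_pts.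
have := @grow_ge R (rect (fun p => if D p then (nth 0%N s (index p J))%:R else 0) a) _ m n i j im jn.
by rewrite /rect -E Dp index_uniq //; apply => i' j'; case: ifP.
Qed.
End Restricted.

(** At integer level the two events are functions of disjoint lists of independent geometric
    variables, and [gexpM] factorises the expectation. The product rule then survives the limit
    [K -> oo] of the three probabilities. *)
Lemma restrict_indep (D1 D2 : pred (int * int)) a1 m1 n1 a2 m2 n2 (s1 s2 : R) : (forall p, ~~ (D1 p && D2 p)) -> 0 <= s1 -> 0 <= s2 ->
  let S1 := (grow_set (restrict_field D1) a1 m1 n1 s1) in
  let S2 := (grow_set (restrict_field D2) a2 m2 n2 s2) in
  prb (S1 `&` S2) = prb S1 * prb S2.
Proof.
move=> D12 s10 s20 S1 S2.
have n1' := restrict_field_nonneg D1; have n2' := restrict_field_nonneg D2.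
pose E1 (k : nat) := [set x | level_grow (restrict_field D1) k.+1%:R a1 m1 n1 x <= (truncn (k.+1%:R * s1))%:R].
pose E2 (k : nat) := [set x | level_grow (restrict_field D2) k.+1%:R a2 m2 n2 x <= (truncn (k.+1%:R * s2))%:R].
pose F1 (k : nat) := grow_set (restrict_field D1) a1 m1 n1 (s1 + (m1 + n1)%:R / k.+1%:R).
pose F2 (k : nat) := grow_set (restrict_field D2) a2 m2 n2 (s2 + (m2 + n2)%:R / k.+1%:R).
have c1 : (fun k => prb (E1 k)) @ \oo --> prb S1 by exact: grow_cdf_cvg.
have c2 : (fun k => prb (E2 k)) @ \oo --> prb S2 by exact: grow_cdf_cvg.
have c3 : (fun k => prb (E1 k `&` E2 k)) @ \oo --> prb (S1 `&` S2).
  apply: (@cvg_prob_squeeze _ _ (fun k => F1 k `&` F2 k)).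
  - by apply: measurableI; exact: measurable_grow_le.
  - by move=> k; apply: measurableI; exact: measurable_level_grow.
  - by move=> k; apply: measurableI; exact: measurable_grow_le.
  - move=> k l kl; apply/subsetPset => x [h1 h2].
    have /subsetPset g1 := @le_grow_addV_mono (restrict_field D1) a1 m1 n1 s1 _ _ kl.
    have /subsetPset g2 := @le_grow_addV_mono (restrict_field D2) a2 m2 n2 s2 _ _ kl.
    by split; [exact: g1 | exact: g2].
  - move=> k x [h1 h2]; have [g1 _] := grow_cdf_squeeze n1' a1 m1 n1 k s10.
    by have [g2 _] := grow_cdf_squeeze n2' a2 m2 n2 k s20; split; [exact: g1 | exact: g2].
  - move=> k x [h1 h2]; have [_ g1] := grow_cdf_squeeze n1' a1 m1 n1 k s10.
    by have [_ g2] := grow_cdf_squeeze n2' a2 m2 n2 k s20; split; [exact: g1 | exact: g2].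
  - move=> x h; split; apply: le_grow_addV => k; by have [] := h k I.
suff E k : prb (E1 k `&` E2 k) = prb (E1 k) * prb (E2 k).
  have c4 : (fun k => prb (E1 k `&` E2 k)) @ \oo --> prb S1 * prb S2.
    by rewrite (_ : (fun k => _) = fun k => prb (E1 k) * prb (E2 k)); [exact: cvg_muls | exact/funext].
  exact: (cvg_unique _ c3 c4).
pose K : R := k.+1%:R; pose q := expR (- K^-1).
have K0 : 0 < K by rewrite ltr0n.
pose J1 := seq.filter D1 (rect_pts a1 m1 n1); pose J2 := seq.filter D2 (rect_pts a2 m2 n2).
pose t1 := truncn (K * s1); pose t2 := truncn (K * s2); pose B := (t1 + t2).+1.
have t1B : (t1 < B)%N by rewrite ltnS leq_addr.
have t2B : (t2 < B)%N by rewrite ltnS leq_addl.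
pose f1 s := (grow (rect (fun p => if D1 p then (nth 0%N s (index p J1))%:R else 0) a1) m1 n1 <= t1%:R :> R).
pose f2 s := (grow (rect (fun p => if D2 p then (nth 0%N s (index p J2))%:R else 0) a2) m2 n2 <= t2%:R :> R).
have u1 : uniq J1 by rewrite filter_uniq // uniq_rect_pts.
have u2 : uniq J2 by rewrite filter_uniq // uniq_rect_pts.
have u12 : uniq (J1 ++ J2).
  rewrite cat_uniq u1 u2 andbT /=; apply/hasPn => p; rewrite !mem_filter => /andP[d2 _].
  by apply/negP => /andP[d1 _]; have := D12 p; rewrite d1 d2.
have P1 : P (E1 k) = (gexp q B (size J1) (fun s => (f1 s)%:R))%:E.
  rewrite -(levels_law fX (B := B) (F := f1)) //.
    by congr (P _); apply/seteqP; split => x /=; rewrite /f1 -level_grow_restrict.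
  by move=> s ss h; exact: (lpp_at_bound ss h).
have P2 : P (E2 k) = (gexp q B (size J2) (fun s => (f2 s)%:R))%:E.
  rewrite -(levels_law fX (B := B) (F := f2)) //.
    by congr (P _); apply/seteqP; split => x /=; rewrite /f2 -level_grow_restrict.
  by move=> s ss h; exact: (lpp_at_bound ss h).
have P12 : P (E1 k `&` E2 k) = (gexp q B (size J1) (fun s => (f1 s)%:R) * gexp q B (size J2) (fun s => (f2 s)%:R))%:E.
  rewrite -gexpM -size_cat.
  transitivity (gexp q B (size (J1 ++ J2)) (fun s => (f1 (take (size J1) s) && f2 (drop (size J1) s))%:R))%:E; last first.
    by congr (_%:E); apply: eq_gexp => s _; rewrite -natrM mulnb.
  rewrite -(levels_law fX (B := B) (F := fun s => f1 (take (size J1) s) && f2 (drop (size J1) s))) //.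
    congr (P _); apply/seteqP; split => x /=.
      move=> [h1 h2]; rewrite map_cat take_size_cat ?size_map // drop_size_cat ?size_map //.
      by rewrite /f1 /f2 -!level_grow_restrict; apply/andP.
    rewrite map_cat take_size_cat ?size_map // drop_size_cat ?size_map //.
    by rewrite /f1 /f2 -!level_grow_restrict => /andP.
  move=> s; rewrite size_cat => ss /andP[h1 h2].
  rewrite -(cat_take_drop (size J1) s) all_cat; apply/andP; split.
    by apply: (lpp_at_bound _ h1) => //; rewrite size_takel // ss leq_addr.
  by apply: (lpp_at_bound _ h2) => //; rewrite size_drop ss addKn.
by rewrite /prb P12 P1 P2.
Qed.
End Independence.
End Field.

(** * From the geometric to the exponential determinant *)

Section RiemannSum.
Variable R : realType.

Lemma bin_scaled_cvg (z : nat -> nat) (x : R) i : (fun k => (z k)%:R / k.+1%:R) @ \oo --> x ->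
  (fun k => 'C(z k + i, i)%:R / k.+1%:R ^+ i) @ \oo --> x ^+ i / i`!%:R.
Proof.
move=> zx; elim: i => [|i IH].
  apply: (cvg_as (cvg_cst (1 : R))) => [j|]; last by rewrite expr0 fact0 divr1.
  by rewrite bin0 expr0 divr1.
have kz : (fun k : nat => k.+1%:R^-1 : R) @ \oo --> 0 by exact: cvg_harmonic.
have c : (fun k => 'C(z k + i, i)%:R / k.+1%:R ^+ i * (((z k)%:R / k.+1%:R + i.+1%:R * k.+1%:R^-1) / i.+1%:R)) @ \oo
   --> x ^+ i / i`!%:R * ((x + i.+1%:R * 0) / i.+1%:R).
  apply: cvg_muls => //; apply: cvg_muls; last exact: cvg_cst.
  by apply: cvg_adds => //; apply: cvg_muls => //; exact: cvg_cst.
apply: (cvg_as c) => [j|].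
  have E : ('C(z j + i.+1, i.+1)%:R : R) = (z j + i.+1)%:R * 'C(z j + i, i)%:R / i.+1%:R.
    apply: (@mulIf _ i.+1%:R); rewrite ?pnatr_eq0 // mulfVK ?pnatr_eq0 // -!natrM; congr _%:R.
    by rewrite mulnC addnS mul_bin_diag.
  have k0 : (j.+1%:R : R) != 0 by rewrite pnatr_eq0.
  have i0 : (i.+1%:R : R) != 0 by rewrite pnatr_eq0.
  rewrite E natrD exprS; move: j.+1%:R i.+1%:R k0 i0 => a b k0 i0; field.
  by rewrite expf_neq0 // k0 i0.
rewrite mulr0 addr0 factS natrM exprS; field.
by rewrite [1 + _]addrC natr1 !pnatr_eq0 -!lt0n fact_gt0.
Qed.

Lemma bin_scaled_le (z k i : nat) (c : R) : (z + i)%:R <= c * k.+1%:R -> 'C(z + i, i)%:R / k.+1%:R ^+ i <= c ^+ i.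
Proof.
move=> h; rewrite ler_pdivrMr ?exprn_gt0 // -exprMn.
apply: (@le_trans _ _ ((z + i)%:R ^+ i)); last by rewrite lerXn2r ?nnegrE ?(le_trans _ h).
rewrite -natrX ler_nat.
have [->|i0] := posnP i; first by rewrite bin0.
apply: (@leq_trans ((z + i) ^_ i)); first by rewrite -bin_ffact leq_pmulr // fact_gt0.
have -> : ((z + i) ^ i = \prod_(j < i) (z + i))%N by rewrite prod_nat_const card_ord.
by rewrite ffact_prod; apply: leq_prod => j _; exact: leq_subr.
Qed.

Variables (eta : R) (n i k : nat).
Hypotheses (eta0 : 0 <= eta) (i_n : (i < n)%N).

Let t j := truncn (j.+1%:R * eta).
Let f (y : nat) : R := if (n < y)%N then 'C(y - n.+1 + i, i)%:R else 0.
Let G j (z : nat) : R := 'C(z + k, k)%:R / j.+1%:R ^+ k * expR (- j.+1%:R^-1) ^+ z * (f (n + n + t j - i - z) / j.+1%:R ^+ i).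

(** By [iter_qsumE] the iterated sum is the integral of the step function [G] of mesh [1 / K] with
    [K = j + 1]: the negative binomial weights tend to [x^k / k! e^(-x)], the remaining binomial
    coefficient to [(eta - x)^i / i!], and the bounded offset [n + n - i] disappears. *)
Lemma riemann_sum_cvg : (fun j => iter k.+1 (qsum (expR (- j.+1%:R^-1))) f (n + n + t j - i)%N / j.+1%:R ^+ (k + i).+1) @ \oo -->
  RInt `[0, eta] (fun x => (eta - x) ^+ i / i`!%:R * (x ^+ k / k`!%:R * expR (- x))).
Proof.
have f0 : f 0 = 0 by [].
pose g (x : R) := if x <= eta then (eta - x) ^+ i / i`!%:R * (x ^+ k / k`!%:R * expR (- x)) else 0.
have G0 j z : (n + n + t j - i <= z)%N -> G j z = 0 by move=> h; rewrite /G /f ltnNge (leq_trans (n := 0%N)) ?mul0r ?mulr0 //; lia.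
have -> : RInt `[0, eta] (fun x => (eta - x) ^+ i / i`!%:R * (x ^+ k / k`!%:R * expR (- x))) = RInt `]0, +oo[ g.
  have cp : continuous (fun x : R => (eta - x) ^+ i / i`!%:R * (x ^+ k / k`!%:R * expR (- x))).
    rewrite (_ : (fun x => _) = fun x => ((i`!%:R^-1 * k`!%:R^-1) *: ((eta%:P - 'X) ^+ i * 'X^k)).[x] * expR (- x)).
      exact: poly_expRN_continuous.
    by apply/funext => x; rewrite hornerZ hornerM horner_exp hornerXn hornerD hornerN hornerC hornerX; ring.
  rewrite -Rintegral_itv_obnd_cbnd; last first.
    apply: (integrable_subset _ _ _ (integrable_continuous_itv 0 eta cp)) => //.
    by move=> x /=; rewrite !in_itv /= => /andP[/ltW -> ->].
  have -> : `]0, eta]%classic = `]0, +oo[%classic `&` `[0, eta]%classic :> set R.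
    apply/seteqP; split => x /=; rewrite !in_itv /= ?andbT.
      by move=> /andP[h1 h2]; rewrite h1 h2 (ltW h1).
    by move=> [-> /andP[_ ->]].
  rewrite Rintegral_mkcondr; apply: eq_Rintegral => x; rewrite inE /= in_itv /= andbT => x0.
  by rewrite patchE /g mem_setE in_itv /= (ltW x0).
have sE j : iter k.+1 (qsum (expR (- j.+1%:R^-1))) f (n + n + t j - i)%N / j.+1%:R ^+ (k + i).+1 =
   RInt `]0, +oo[ (fun x => G j (cell_index j.+1%:R 0 x)).
  have [_ ->] := @step_function R j.+1%:R 0 (ltr0Sn R j) (G j) (n + n + t j - i).+1 (fun z h => G0 j z (ltnW h)).
  rewrite iter_qsumE // mulr_suml mulr_sumr; apply: eq_bigr => z _; rewrite /G exprS exprD.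
  by field; rewrite ?expf_neq0 //=; lra.
under eq_fun do rewrite sE.
have jz : (fun j : nat => j.+1%:R^-1 : R) @ \oo --> 0 by exact: cvg_harmonic.
have tc (x : R) : 0 <= x -> (fun j : nat => (truncn (j.+1%:R * x))%:R / j.+1%:R : R) @ \oo --> x.
  move=> x0; apply: (squeeze_seq (f := fun j => x - j.+1%:R^-1) (h := fun=> x)).
  - move=> j; have /andP[h1 h2] := truncn_itv (mulr_ge0 (ler0n R j.+1) x0).
    have K0 : 0 < j.+1%:R :> R by rewrite ltr0n.
    rewrite ler_pdivrMr // ler_pdivlMr // mulrBl mulVf ?gt_eqF // [x * _]mulrC h1 andbT.
    by rewrite lerBlDr natr1 ltW.
  - by apply: (@cvg_eq _ _ (x - 0)); [apply: cvg_subs => //; exact: cvg_cst | rewrite subr0].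
  - exact: cvg_cst.
pose c := eta + (n + n + k + i)%:R + 1.
have mf j : measurable_fun (`]0, +oo[%classic : set R) (fun x => G j (cell_index j.+1%:R 0 x)).
  exact: (@step_function R j.+1%:R 0 (ltr0Sn R j) (G j) (n + n + t j - i).+1 (fun z h => G0 j z (ltnW h))).1.
have pc x : `]0, +oo[%classic x -> (fun j => G j (cell_index j.+1%:R 0 x)) @ \oo --> g x.
  rewrite /= in_itv /= andbT => x0; rewrite /g /cell_index subr0; case: leP => xe.
    have zt j : (truncn (j.+1%:R * x)%R <= t j)%N by apply: le_truncn; rewrite ler_wpM2l.
    apply: (cvg_as (g := fun j => 'C(truncn (j.+1%:R * x)%R + k, k)%:R / j.+1%:R ^+ k * expR (- ((truncn (j.+1%:R * x))%:R / j.+1%:R)) *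
       ('C((n - i.+1 + (t j - truncn (j.+1%:R * x)%R)) + i, i)%:R / j.+1%:R ^+ i))
       (l := x ^+ k / k`!%:R * expR (- x) * ((eta - x) ^+ i / i`!%:R))).
    - have c1 := @bin_scaled_cvg _ x k (tc x (ltW x0)).
      have c2 := cvg_exp (cvg_opps (tc x (ltW x0))).
      have c3 : (fun j => (n - i.+1 + (t j - truncn (j.+1%:R * x)%R))%N%:R / j.+1%:R : R) @ \oo --> eta - x.
        have := tc x (ltW x0); have := tc eta eta0 => c4 c5.
        have cn : (fun=> (n - i.+1)%N%:R : R) @ \oo --> ((n - i.+1)%N%:R : R) by exact: cvg_cst.
        apply: (cvg_as (cvg_adds (cvg_muls cn jz) (cvg_subs c4 c5))) => [j|]; last by rewrite mulr0 add0r.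
        by rewrite natrD (natrB _ (zt j)) /t !mulrDl mulNr.
      have c4 := @bin_scaled_cvg _ _ i c3.
      by apply: cvg_muls => //; apply: cvg_muls.
    - move=> j; rewrite /G /f; have z := zt j.
      have -> : (n < n + n + t j - i - truncn (j.+1%:R * x)%R)%N by lia.
      have -> : (n + n + t j - i - truncn (j.+1%:R * x)%R - n.+1 = n - i.+1 + (t j - truncn (j.+1%:R * x)%R))%N by lia.
      by rewrite -expRM_natl mulrN.
    - by ring.
  (* For [x > eta] the argument of [f] is at most [n] from this index on, so [G] is then exactly
     zero. *)
  apply: (@eventually_cvg _ _ _ (truncn ((n + 1)%:R / (x - eta)))).
  apply: (cvg_as (cvg_cst (0 : R))) => // j.
  set K : R := (j + _).+1%:R.
  have xe0 : 0 < x - eta by lra.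
  have K1 : (n + 1)%:R < K * (x - eta).
    rewrite -ltr_pdivrMr //.
    have /andP[_] := @truncn_itv R ((n + 1)%:R / (x - eta)) (divr_ge0 (ler0n _ _) (ltW xe0)).
    by move=> h; apply: (lt_le_trans h); rewrite ler_nat ltnS leq_addl.
  rewrite /G /f ifF ?mul0r ?mulr0 //; apply/negbTE; rewrite -leqNgt.
  suff : (n + t (j + truncn ((n + 1)%:R / (x - eta))%R) <= truncn (K * x)%R)%N by rewrite -/K; lia.
  rewrite truncn_ge_nat; last by rewrite mulr_ge0 // ltW.
  have /andP[h _] := truncn_itv (mulr_ge0 (ler0n R (j + truncn ((n + 1)%:R / (x - eta))).+1) eta0).
  rewrite -/K in h; rewrite natrD /t -/K; rewrite natrD in K1; lra.
have dm j x : `]0, +oo[%classic x -> `|G j (cell_index j.+1%:R 0 x)| <= c ^+ k * c ^+ i * expR c * expR (- (1 * x)).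
  rewrite /= in_itv /= andbT mul1r => x0; rewrite /cell_index subr0.
  set K : R := j.+1%:R; set z := truncn _.
  have K0 : 0 < K by rewrite ltr0n.
  have K1 : 1 <= K by rewrite ler1n.
  have c1 : 1 <= c by rewrite lerDr addr_ge0.
  have c0 : 0 <= c by lra.
  have /andP[t1 _] := truncn_itv (mulr_ge0 (ltW K0) eta0); rewrite -/(t j) in t1.
  have /andP[z1 z2] := truncn_itv (mulr_ge0 (ltW K0) (ltW x0)); rewrite -/z in z1 z2.
  have cK (m : nat) : (m <= n + n + k + i + t j)%N -> m%:R <= c * K.
    move=> h; apply: (@le_trans _ _ (n + n + k + i + t j)%:R); first by rewrite ler_nat.
    rewrite natrD /c !mulrDl [eta * K]mulrC mul1r.
    have : (n + n + k + i)%:R * 1 <= (n + n + k + i)%:R * K by rewrite ler_wpM2l.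
    lra.
  rewrite /G /f; case: ifP => fz; last first.
    by rewrite mul0r mulr0 normr0 !mulr_ge0 ?expR_ge0 ?exprn_ge0.
  have b1 : 'C(z + k, k)%:R / K ^+ k <= c ^+ k by apply: bin_scaled_le; apply: cK; move: fz; clear; lia.
  have b2 : 'C(n + n + t j - i - z - n.+1 + i, i)%:R / K ^+ i <= c ^+ i by apply: bin_scaled_le; apply: cK; move: fz; clear; lia.
  have b3 : expR (- K^-1) ^+ z <= expR c * expR (- x).
    rewrite -expRM_natl -expRD ler_expR mulrN lerNl opprD opprK.
    rewrite ler_pdivlMr // mulrDl mulNr; rewrite -natr1 in z2.
    have : 1 * K <= c * K by rewrite ler_wpM2r // ltW.
    by rewrite mulrC in z2; lra.
  rewrite ger0_norm; last by rewrite !mulr_ge0 ?exprn_ge0 ?expR_ge0 ?invr_ge0 ?exprn_ge0 // ltW.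
  have -> : c ^+ k * c ^+ i * expR c * expR (- x) = c ^+ k * (expR c * expR (- x)) * c ^+ i by ring.
  have bin0' (a b : nat) : 0 <= 'C(a, b)%:R / K ^+ b by rewrite divr_ge0 // exprn_ge0 // ltW.
  have q0 : 0 <= expR (- K^-1) ^+ z by rewrite exprn_ge0 // expR_ge0.
  by apply: ler_pM; [rewrite mulr_ge0 | | apply: ler_pM |].
have di : mu.-integrable `]0, +oo[ (EFin \o (fun x : R => c ^+ k * c ^+ i * expR c * expR (- (1 * x)))).
  apply: integrable_lebZ => //.
  apply: (integrable_subset _ _ _ (@integrable_expRN R 1 0 _)) => //.
  by move=> x /=; rewrite !in_itv /= !andbT; exact: ltW.
exact: (cvg_Rintegral_leb (measurable_itv _) mf pc di dm).2.
Qed.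
End RiemannSum.

Section PassageLaw.
Variables (R : realType) (d : measure_display) (T : measurableType d) (P : probability T R).
Variables (X : int * int -> T -> R).
Hypothesis fX : exp_field P X.

Let grow_det m n (eta : R) : R := \det (\matrix_(i < n, a < n) RInt `[0, eta] (fun x =>
     (eta - x) ^+ i / i`!%:R * (x ^+ (m - a.+1) / (m - a.+1)`!%:R * expR (- x)))).

(** The determinants at both levels carry the same constant [K] of [gexp_lpp_det], and
    cross-multiplication eliminates it. The factor [sc] distributes powers of the mesh over rows and
    columns so that every entry has a limit. *)
Lemma grow_cdf_det a m n (eta eta' : R) : (0 < n)%N -> (n <= m)%N -> 0 <= eta -> 0 <= eta' -> prb P (grow_set X a m n eta) * grow_det m n eta' =
  prb P (grow_set X a m n eta') * grow_det m n eta.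
Proof.
move=> n0 nm e0 e'0.
pose q (k : nat) : R := expR (- k.+1%:R^-1).
pose g k (eta : R) := prb P [set x | level_grow X k.+1%:R a m n x <= (truncn (k.+1%:R * eta))%:R].
pose M k (eta : R) : 'M[R]_n := \matrix_(i < n, b < n) iter (m - b) (qsum (q k)) (fun y => if (n < y)%N then 'C(y - n.+1 + i, i)%:R else 0)
        (n + n + truncn (k.+1%:R * eta)%R - i)%N.
pose sc k : R := (\prod_(i < n) (k.+1%:R ^+ i)^-1) * (\prod_(b < n) (k.+1%:R ^+ (m - b))^-1).
have scE k (B : 'M[R]_n) : sc k * \det B = \det (\matrix_(i < n, b < n) (B i b / k.+1%:R ^+ (m - b.+1 + i).+1)).
  rewrite (_ : \matrix_(i, b) _ = diag_mx (\row_(i < n) (k.+1%:R ^+ i)^-1) *m B *m diag_mx (\row_(b < n) (k.+1%:R ^+ (m - b))^-1)).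
    rewrite !det_mulmx !det_diag /sc mulrAC.
    by congr (_ * _ * _); apply: eq_bigr => i _; rewrite mxE.
  apply/matrixP => i b; rewrite mul_mx_diag mul_diag_mx !mxE.
  have -> : ((m - b.+1 + i).+1 = i + (m - b))%N by have := ltn_ord b; lia.
  by rewrite exprD invfM mulrCA mulrA.
have dc (e : R) : 0 <= e -> (fun k => sc k * \det (M k e)) @ \oo --> grow_det m n e.
  move=> e_0; under eq_fun do rewrite scE; rewrite /grow_det /determinant.
  apply: cvg_sum => s _; apply: cvg_muls; first exact: cvg_cst.
  apply: cvg_prod => i _; rewrite !mxE.
  rewrite (_ : (fun x => _) = fun k => iter (m - (s i).+1).+1 (qsum (q k)) (fun y => if (n < y)%N then 'C(y - n.+1 + i, i)%:R else 0)
        (n + n + truncn (k.+1%:R * e)%R - i)%N / k.+1%:R ^+ (m - (s i).+1 + i).+1); last first.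
    apply/funext => k; rewrite !mxE.
    by have -> : (m - s i = (m - (s i).+1).+1)%N by have := ltn_ord (s i); lia.
  exact: riemann_sum_cvg.
have key k : g k eta * \det (M k eta') = g k eta' * \det (M k eta).
  have [K KE] := gexp_lpp_det (q k) nm.
  have K0 : 0 < k.+1%:R :> R by rewrite ltr0n.
  have A0 : (1 - q k) ^+ (m * n) != 0.
    rewrite expf_neq0 // subr_eq0 eq_sym lt_eqF // /q expR_lt1 oppr_lt0 invr_gt0 //.
  have gE (e : R) B : (n + n + truncn (k.+1%:R * e)%R < B)%N ->
      g k e = gexp (q k) B (m * n) (fun w => (lpp_last n m w <= truncn (k.+1%:R * e)%R)%N%:R).
    move=> h; rewrite /g /prb (level_grow_law fX (B := B)) //.
    by apply: leq_ltn_trans h; rewrite leq_addl.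
  pose B := (n + n + truncn (k.+1%:R * eta)%R + truncn (k.+1%:R * eta')%R).+1.
  have h1 : (n + n + truncn (k.+1%:R * eta)%R < B)%N by rewrite ltnS leq_addr.
  have h2 : (n + n + truncn (k.+1%:R * eta')%R < B)%N by rewrite /B; lia.
  have E1 := KE B _ h1; have E2 := KE B _ h2; rewrite -gE // in E1; rewrite -gE // in E2.
  apply: (mulfI A0); rewrite mulrCA -E2 [RHS]mulrCA -E1; ring.
have c1 := cvg_muls (@grow_cdf_cvg _ _ _ P _ (exp_field_nonneg fX) a m n _ e0) (dc _ e'0).
have c2 := cvg_muls (@grow_cdf_cvg _ _ _ P _ (exp_field_nonneg fX) a m n _ e'0) (dc _ e0).
have E : (fun k => g k eta * (sc k * \det (M k eta'))) = (fun k => g k eta' * (sc k * \det (M k eta))).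
  by apply/funext => k; rewrite mulrCA key mulrCA.
have c3 : (fun k => g k eta * (sc k * \det (M k eta'))) @ \oo --> prb P (grow_set X a m n eta) * grow_det m n eta' := c1.
by rewrite E in c3; exact: (cvg_unique _ c3 c2).
Qed.

Lemma lag_kernel_cvg0 al N (a b : nat) : (fun k : nat => lag_kernel al N (k%:R : R) a b) @ \oo --> (0 : R).
Proof.
have [/andP[aN bN]|ab] := boolP ((a < N)%N && (b < N)%N); last first.
  apply: (cvg_as (cvg_cst (0 : R))) => // k; rewrite /lag_kernel.
  by move: ab; case: (ltnP a N); case: (ltnP b N).
pose a' := Ordinal aN; pose b' := Ordinal bN.
pose f (x : R) := lag_fun al (N.-1 - a) x * lag_fun al (N.-1 - b) x.
have fi : mu.-integrable Rge0 (EFin \o f) by exact: lag_fun_mul_integrable.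
have c1 := cvg_Rintegral_itvcy fi (@cvg_natr_pinfty R).
have K0 := lag_kernel_compl al a' b' (lexx (0 : R)).
have c2 : (fun k : nat => RInt Rge0 f - RInt `[0, k%:R] f) @ \oo --> RInt Rge0 f - RInt Rge0 f by apply: cvg_subs => //; exact: cvg_cst.
apply: (cvg_as c2) => [k|]; last by rewrite subrr.
have -> : RInt Rge0 f = lag_kernel al N 0 a b by rewrite /lag_kernel aN bN.
have Kk := lag_kernel_compl al a' b' (ler0n R k).
rewrite /f [X in _ - X]Kk opprB addrCA -[LHS]addr0; congr (_ + _).
have : RInt `[0, 0] (fun x : R => lag_fun al (N.-1 - a') x * lag_fun al (N.-1 - b') x) = 0 by rewrite set_itv1 Rintegral_set1.
by rewrite K0 /= => /eqP; rewrite subr_eq0 => /eqP ->; rewrite subrr.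
Qed.

(** The remaining normalisation: when the second level tends to infinity its probability tends to 1
    and its kernel to 0. *)
Theorem grow_cdf a m n (eta : R) : (0 < n)%N -> (n <= m)%N -> 0 <= eta ->
  prb P (grow_set X a m n eta) =
  \det (1%:M - \matrix_(i < n, j < n) lag_kernel (m - n) n eta i j).
Proof.
move=> n0 nm e0; have [c c0 cE] := lag_det_formula R (m - n) n.
have gE (e : R) : 0 <= e -> grow_det m n e = c * \det (1%:M - \matrix_(i < n, j < n) lag_kernel (m - n) n e i j).
  move=> e_0; rewrite -cE // /grow_det; congr (\det _); apply/matrixP => i j; rewrite !mxE.
  by have -> : (n + (m - n) - j.+1 = m - j.+1)%N by lia.
have c1 : (fun k : nat => prb P (grow_set X a m n (k%:R))) @ \oo --> (1 : R).
  have mE k : measurable (grow_set X a m n (k%:R)) by exact: (measurable_grow_le (exp_field_nonneg fX)).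
  have cup : \bigcup_k (grow_set X a m n (k%:R)) = setT.
    apply/seteqP; split => // x _; exists (truncn (grow (rect (X^~ x) a) m n)).+1 => //=.
    have g0 : 0 <= grow (rect (X^~ x) a) m n by apply: grow_ge0 => i j; have [_ X0 _] := fX; exact: X0.
    by have /andP[_ /ltW] := truncn_itv g0.
  have c' : (P \o (fun k : nat => (grow_set X a m n (k%:R)))) @ \oo --> (1 : R)%:E.
    rewrite -(probability_setT P) -cup; apply: nondecreasing_cvg_mu => //; first by rewrite cup.
    by move=> k l kl; apply/subsetPset => x /= h; apply: le_trans h _; rewrite ler_nat.
  exact: (fine_cvg c').
have c2 : (fun k : nat => \det (1%:M - \matrix_(i < n, j < n) lag_kernel (m - n) n (k%:R : R) i j)) @ \oo --> (1 : R).
  apply: (cvg_eq (l := \det (1%:M : 'M[R]_n))); last exact: det1.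
  rewrite /determinant; apply: cvg_sum => s _; apply: cvg_muls; first exact: cvg_cst.
  apply: cvg_prod => i _.
  apply: (cvg_as (cvg_subs (cvg_cst ((1%:M : 'M[R]_n) i (s i))) (lag_kernel_cvg0 (m - n) n i (s i)))).
    by move=> j; rewrite !mxE.
  by rewrite subr0.
apply: (mulfI c0).
have E k : prb P (grow_set X a m n eta) * (c * \det (1%:M - \matrix_(i < n, j < n) lag_kernel (m - n) n (k%:R : R) i j)) =
   prb P (grow_set X a m n (k%:R)) * grow_det m n eta.
  by rewrite -gE // grow_cdf_det.
set p0 := prb P (grow_set X a m n eta) in E *.
pose D k := \det (1%:M - \matrix_(i < n, j < n) lag_kernel (m - n) n (k%:R : R) i j).
have c3 : (fun k => p0 * (c * D k)) @ \oo --> p0 * (c * 1) by apply: cvg_muls; [exact: cvg_cst | apply: cvg_muls; [exact: cvg_cst | exact: c2]].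
have c4 : (fun k => p0 * (c * D k)) @ \oo --> 1 * grow_det m n eta.
  rewrite (_ : (fun k => _) = fun k : nat => prb P (grow_set X a m n (k%:R)) * grow_det m n eta).
    by apply: cvg_muls; [exact: c1 | exact: cvg_cst].
  by apply/funext => k; exact: E.
have E2 : p0 * (c * 1) = 1 * grow_det m n eta by exact: (cvg_unique _ c3 c4).
by move: E2; rewrite gE // mul1r mulr1 [c * p0]mulrC.
Qed.
End PassageLaw.

(** * One-point limit *)

Section UpperTail.
Variable R : realType.

(** By Hadamard's inequality the sum of the minors of order [n] lies between 0 and [(tr A)^n], so
    the terms after the leading 1 are dominated by a geometric series of ratio [1/2]. *)
Lemma det1B_ge N (A : 'M[R]_N) : psd A -> \tr A <= 2^-1 -> 1 - 2 * \tr A <= \det (1%:M - A).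
Proof.
move=> pA tA; rewrite det1B_expansion big_ord_recl /= expr0 fact0 divr1 mul1r.
have -> : \sum_(f : {ffun 'I_0 -> 'I_N}) \det (submx_at f A) = 1.
  rewrite (eq_bigr (fun=> 1)) => [|f _]; last exact: det_mx00.
  by rewrite sumr_const card_ffun !card_ord expn0.
have t0 : 0 <= \tr A by apply: sumr_ge0 => i _; exact: psd_diag.
have Sb n : 0 <= \sum_(f : {ffun 'I_n -> 'I_N}) \det (submx_at f A) <= (\tr A) ^+ n.
  apply/andP; split.
    by apply: sumr_ge0 => f _; have /andP[] := psd_det (psd_submx_at f pA).
  have -> : (\tr A) ^+ n = \sum_(f : {ffun 'I_n -> 'I_N}) \prod_i A (f i) (f i).
    by rewrite -(bigA_distr_bigA (fun (_ : 'I_n) (j : 'I_N) => A j j)) /= prodr_const card_ord.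
  apply: ler_sum => f _; have /andP[_] := psd_det (psd_submx_at f pA).
  by move=> h; apply: (le_trans h); apply: ler_prod => i _; rewrite mxE lexx andbT psd_diag.
have geo m : \sum_(n < m) \tr A * 2^-1 ^+ n <= 2 * \tr A.
  rewrite -mulr_sumr mulrC ler_wpM2r //.
  suff -> : \sum_(n < m) (2^-1 : R) ^+ n = 2 - 2 * 2^-1 ^+ m.
    by rewrite lerBlDr lerDl mulr_ge0 ?exprn_ge0.
  elim: m => [|m IH]; first by rewrite big_ord0 expr0 mulr1 subrr.
  by rewrite big_ord_recr /= IH exprS; field.
rewrite lerD2l lerNl -sumrN; apply: le_trans (geo N); apply: ler_sum => n _.
have /andP[S0 S1] := Sb (bump 0 n).
rewrite (_ : bump 0 n = n.+1) // in S0 S1 *.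
rewrite -mulNr -mulNr exprS mulN1r opprK.
apply: (@le_trans _ _ (1 * (\tr A) ^+ n.+1)).
  apply: (@le_trans _ _ (1 * \sum_(f : {ffun 'I_n.+1 -> 'I_N}) \det (submx_at f A))).
    rewrite ler_wpM2r //.
    rewrite ler_pdivrMr ?ltr0n ?fact_gt0 // mul1r.
    apply: (@le_trans _ _ 1); last by rewrite ler1n fact_gt0.
    by apply: le_trans (ler_norm _) _; rewrite normrX normrN1 expr1n.
  by rewrite !mul1r.
by rewrite mul1r exprS ler_wpM2l // lerXn2r ?nnegrE.
Qed.

Lemma airy_trace_le (s : R) : RInt `]s, +oo[ (@airy_diag R) <= airy_const R ^+ 2 / 4 * expR (- (2 * s)).
Proof.
have ie : mu.-integrable `]s, +oo[ (EFin \o (fun x : R => expR (- (2 * x)))).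
  apply: (integrable_subset _ _ _ (@integrable_expRN R 2 s _)) => //.
  by move=> x /=; rewrite !in_itv /= !andbT; exact: ltW.
apply: (@le_trans _ _ (RInt `]s, +oo[ (fun x => airy_const R ^+ 2 / 2 * expR (- (2 * x))))).
  apply: le_Rintegral_leb; [exact: measurable_itv|exact: airy_diag_integrable|exact: integrable_lebZ|].
  by move=> x _; exact: airy_diag_le.
rewrite RintegralZl // Rintegral_itv_obnd_cbnd // Rintegral_expRN // le_eqVlt; apply/orP; left; apply/eqP.
by move: (expR _) => E; field.
Qed.

Lemma F_GUE_ge (s : R) : RInt `]s, +oo[ (@airy_diag R) < 2^-1 -> 1 - 2 * RInt `]s, +oo[ (@airy_diag R) <= F_GUE s.
Proof.
move=> Ts.
pose N (j : nat) := j.+1; pose al (j : nat) := 0%N.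
have N0 j : (0 < N j)%N by [].
have [Ny ac] := @square_params R.
have sc : (fun=> s) @ \oo --> s by exact: cvg_cst.
have near0 := lag_edge_near N0 Ny ac (lexx 0) sc.
have [c1 c2] := lag_det_cvg Ny ac (lexx 0) sc (fun=> erefl) near0.
have c3 : (fun j => 1 - 2 * \sum_(a < N j) lag_kernel (al j) (N j) (edge_pos (al j) (N j) s) a a) @ \oo --> 1 - 2 * RInt `]s, +oo[ (@airy_diag R).
  by apply: cvg_subs; [exact: cvg_cst | apply: cvg_muls; [exact: cvg_cst | exact: c2]].
apply: (ler_cvg_to c3 c1).
have [J1 _ HJ1] := cvgr_le _ c2 _ Ts; case: near0 => J _ HJ.
exists (maxn J J1) => // j; rewrite /= geq_max => /andP[Jj J1j].
have := @det1B_ge (N j) _ (lag_kernel_psd (al j) (N j) (HJ j Jj)).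
set eta := _ + _; have -> : \tr (\matrix_(a < N j, b < N j) lag_kernel (al j) (N j) eta a b) =
    \sum_(a < N j) lag_kernel (al j) (N j) eta a a by apply: eq_bigr => a _; rewrite mxE.
by apply; exact: HJ1.
Qed.

Lemma F_GUE_upper_tail (eps : R) : 0 < eps -> exists A : R, forall s, A <= s -> 1 - eps < F_GUE s.
Proof.
move=> e0; pose C := airy_const R ^+ 2 / 4.
have C0 : 0 <= C by rewrite divr_ge0 ?sqr_ge0.
pose e := Num.min (eps / 4) 4^-1.
have ep : 0 < e by rewrite lt_min invr_gt0 ltr0n divr_gt0.
exists ((C + 1) / e) => s sA.
have s0 : 0 < s by apply: lt_le_trans sA; rewrite divr_gt0 // ltr_pwDr.
have Te : RInt `]s, +oo[ (@airy_diag R) <= e.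
  apply: le_trans (airy_trace_le s) _; rewrite expRN -/C ler_pdivrMr ?expR_gt0 //.
  have h1 : 1 + 2 * s <= expR (2 * s) := expR_ge1Dx _.
  have h2 : C + 1 <= e * s by move: sA; rewrite ler_pdivrMr // mulrC.
  have h3 : e * (1 + 2 * s) <= e * expR (2 * s) by rewrite ler_wpM2l // ltW.
  have : 0 <= e * s by rewrite mulr_ge0 // ltW.
  by rewrite mulrDr mulr1 in h3; lra.
have [e1 e2] : e <= eps / 4 /\ e <= 4^-1 by rewrite /e !ge_min !lexx orbT.
have := @F_GUE_ge s; have : RInt `]s, +oo[ (@airy_diag R) < 2^-1 by lra.
by move=> h /(_ h); lra.
Qed.
End UpperTail.

Section OnePoint.
Variables (R : realType) (d : measure_display) (T : measurableType d) (P : probability T R).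

(** At [x = 1 + beta] this is the constant [sigma] of the theorem. It is the limit of [1 / (e r)],
    with [e] the critical width and [r] the cube root of the large parameter. *)
Definition tw_scale (x : R) : R := (1 + Num.sqrt x) `^ (4 / 3) / x `^ (6^-1).

Lemma tw_scale_gt0 x : 0 < x -> 0 < tw_scale x.
Proof. by move=> x0; rewrite divr_gt0 // powR_gt0 // ltr_pwDl // sqrtr_ge0. Qed.

Lemma tw_scale3 x : 0 < x -> tw_scale x ^+ 3 = (1 + Num.sqrt x) ^+ 4 / Num.sqrt x.
Proof.
move=> x0; have s0 : 0 < 1 + Num.sqrt x by rewrite ltr_pwDl // sqrtr_ge0.
rewrite /tw_scale expr_div_n -!powR_mulrn ?powR_ge0 // -!powRrM.
rewrite divfK ?pnatr_eq0 // powR_mulrn ?(ltW s0) //; congr (_ / _).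
rewrite -powR12_sqrt ?(ltW x0) //; congr (_ `^ _).
by field.
Qed.

Variable X : int * int -> T -> R.
Hypothesis fX : exp_field P X.

Lemma inv_pinfty (r : nat -> R) : r @ \oo --> +oo -> (fun j => (r j)^-1) @ \oo --> (0 : R).
Proof.
move=> ry; apply/cvgrPdist_lt => e e0.
have /cvgryPge/(_ (e^-1 + 1)) := ry; apply: filterS => j h.
have r0 : 0 < r j by apply: lt_le_trans h; rewrite ltr_wpDl // invr_ge0 ltW.
rewrite sub0r normrN gtr0_norm ?invr_gt0 // invf_plt ?posrE //.
by apply: lt_le_trans h; rewrite ltrDl.
Qed.

Section Good.
Variables (a : nat -> int * int) (m n : nat -> nat) (r ss : nat -> R) (x v v' s : R).
Hypotheses (x1 : 1 < x) (ry : r @ \oo --> +oo) (r1 : forall j, 1 <= r j) (n0 : forall j, (0 < n j)%N) (nm : forall j, (n j <= m j)%N)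
  (mv : (fun j => ((m j)%:R - x * r j ^+ 3) / r j) @ \oo --> v)
  (nv : (fun j => ((n j)%:R - r j ^+ 3) / r j) @ \oo --> v')
  (sc : ss @ \oo --> s).

Let x0 : 0 < x. Proof. exact: lt_trans x1. Qed.
Let q := Num.sqrt x.
Let q0 : 0 < q. Proof. by rewrite sqrtr_gt0. Qed.
Let q2 : q ^+ 2 = x. Proof. by rewrite sqr_sqrtr // ltW. Qed.
Let r0 j : 0 < r j. Proof. exact: lt_le_trans (r1 j). Qed.
Let ri : (fun j => (r j)^-1) @ \oo --> (0 : R). Proof. exact: inv_pinfty. Qed.

Let mt : (fun j => (m j)%:R / r j ^+ 3) @ \oo --> x.
Proof.
have c : (fun j => x + ((m j)%:R - x * r j ^+ 3) / r j * (r j)^-1 ^+ 2) @ \oo --> x + v * 0 ^+ 2.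
  by apply: cvg_adds; [exact: cvg_cst | apply: cvg_muls => //; exact: cvg_pow].
apply: (cvg_as c) => [j|]; last by rewrite expr0n /= mulr0 addr0.
by field; rewrite gt_eqF.
Qed.

Let nt : (fun j => (n j)%:R / r j ^+ 3) @ \oo --> (1 : R).
Proof.
have c : (fun j => 1 + ((n j)%:R - r j ^+ 3) / r j * (r j)^-1 ^+ 2) @ \oo --> 1 + v' * 0 ^+ 2.
  by apply: cvg_adds; [exact: cvg_cst | apply: cvg_muls => //; exact: cvg_pow].
apply: (cvg_as c) => [j|]; last by rewrite expr0n /= mulr0 addr0.
by field; rewrite gt_eqF.
Qed.

Let Ny : (fun j => (n j)%:R : R) @ \oo --> +oo.
Proof.
apply/cvgryPge => A; near=> j.
have h1 : 2^-1 <= (n j)%:R / r j ^+ 3 by near: j; apply: (cvgr_ge _ nt); lra.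
have h2 : 2 * `|A| <= r j by near: j; exact: cvgry_ge.
rewrite ler_pdivlMr ?exprn_gt0 // in h1.
have h3 : r j <= r j ^+ 3 by rewrite ler_eXnr.
by have := ler_norm A; lra.
Unshelve. all: end_near. Qed.

Let al j := (m j - n j)%N.
Let alE j : (n j + al j)%N = m j. Proof. by rewrite subnKC. Qed.

Let ac : (fun j => (al j)%:R / (n j)%:R) @ \oo --> x - 1.
Proof.
have c : (fun j => ((m j)%:R / r j ^+ 3 - (n j)%:R / r j ^+ 3) / ((n j)%:R / r j ^+ 3)) @ \oo --> (x - 1) / 1 by cvg_rat.
apply: (cvg_as c) => [j|]; last by rewrite divr1.
rewrite /al natrB //; field.
by rewrite gt_eqF //= pnatr_eq0 -lt0n.
Qed.

Let A j := Num.sqrt ((m j)%:R / r j ^+ 3).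
Let B j := Num.sqrt ((n j)%:R / r j ^+ 3).
Let Ac : A @ \oo --> q. Proof. exact: cvg_sqrt. Qed.
Let Bc : B @ \oo --> (1 : R). Proof. by rewrite -[X in _ --> X]sqrtr1; exact: cvg_sqrt. Qed.
Let t j := Num.sqrt (r j ^+ 3).
Let t0 j : 0 < t j. Proof. by rewrite sqrtr_gt0 exprn_gt0. Qed.
Let t2 j : t j ^+ 2 = r j ^+ 3. Proof. by rewrite sqr_sqrtr // exprn_ge0 // ltW. Qed.
Let At j : Num.sqrt (m j)%:R = A j * t j.
Proof. by rewrite -sqrtrM ?divr_ge0 ?exprn_ge0 ?(ltW (r0 j)) // divfK // expf_neq0 // gt_eqF. Qed.
Let Bt j : Num.sqrt (n j)%:R = B j * t j.
Proof. by rewrite -sqrtrM ?divr_ge0 ?exprn_ge0 ?(ltW (r0 j)) // divfK // expf_neq0 // gt_eqF. Qed.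
Let A2 j : A j ^+ 2 = (m j)%:R / r j ^+ 3.
Proof. by rewrite sqr_sqrtr // divr_ge0 ?exprn_ge0 // ltW. Qed.
Let B2 j : B j ^+ 2 = (n j)%:R / r j ^+ 3.
Proof. by rewrite sqr_sqrtr // divr_ge0 ?exprn_ge0 // ltW. Qed.
Let A0 j : 0 < A j.
Proof. by rewrite sqrtr_gt0 divr_gt0 ?exprn_gt0 // ltr0n (leq_trans (n0 j)). Qed.
Let B0 j : 0 < B j. Proof. by rewrite sqrtr_gt0 divr_gt0 ?exprn_gt0 // ltr0n. Qed.

Let e j := lag_e R (al j) (n j).
Let e0 j : 0 < e j. Proof. exact: lag_e_gt0. Qed.

(** The limit is taken for cubes, because [lag_e3] gives
    [e^3 = sqrt (m n) / (sqrt m + sqrt n)^4]. *)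
Let er_cvg : (fun j => e j * r j) @ \oo --> (tw_scale x)^-1.
Proof.
have w0 := tw_scale_gt0 x0.
have c : (fun j => A j * B j / (A j + B j) ^+ 4 * tw_scale x ^+ 3) @ \oo --> q * 1 / (q + 1) ^+ 4 * tw_scale x ^+ 3.
  apply: cvg_muls; last exact: cvg_cst.
  by cvg_rat; rewrite expf_neq0 // gt_eqF // addr_gt0.
have c1 : (fun j => e j * r j * tw_scale x) @ \oo --> (1 : R).
  apply: cvg_cube1 => [j|]; first by apply: mulr_ge0; [apply: mulr_ge0|]; exact: ltW.
  apply: (cvg_as c) => [j|]; last first.
    rewrite tw_scale3 // -/q; field.
    by rewrite gt_eqF //= addrC gt_eqF // addr_gt0.
  rewrite (exprMn 3 (e j * r j)) (exprMn 3 (e j)) lag_e3 // alE At Bt -t2; have := A0 j; have := B0 j; have := t0 j.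
  move: (tw_scale x) (A j) (B j) (t j) => W a' b' t' t'0 b'0 a'0; field.
  by rewrite !gt_eqF // ?addr_gt0 ?mulr_gt0.
have c2 : (fun j => e j * r j * tw_scale x * (tw_scale x)^-1) @ \oo --> 1 * (tw_scale x)^-1 by apply: cvg_muls => //; exact: cvg_cst.
apply: (cvg_as c2) => [j|]; last by rewrite mul1r.
by rewrite mulfK // gt_eqF.
Qed.

(** Its limit linearises [(sqrt m + sqrt n)^2 = m + n + 2 sqrt (m n)] at [(x, 1) r^3]. The partial
    derivatives [1 + 1/q] and [1 + q], with [q = sqrt x], are the origin of [mu_+] and [mu_-]. *)
Let gap j := (edge (lag_rho R (al j) (n j)) (e j) - (1 + q) ^+ 2 * r j ^+ 3) / r j.

Let gap_cvg : gap @ \oo --> (1 + q^-1) * v + (1 + q) * v'.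
Proof.
pose vj j := ((m j)%:R - x * r j ^+ 3) / r j.
pose vj' j := ((n j)%:R - r j ^+ 3) / r j.
have c : (fun j => vj j + vj' j + 2 * ((x * vj' j + vj j + vj j * vj' j * (r j)^-1 ^+ 2) / (A j * B j + q))) @ \oo -->
   v + v' + 2 * ((x * v' + v + v * v' * 0 ^+ 2) / (q * 1 + q)).
  have hm : vj @ \oo --> v := mv.
  have hn : vj' @ \oo --> v' := nv.
  have cx : (fun=> x) @ \oo --> x by exact: cvg_cst.
  have cq : (fun=> q) @ \oo --> q by exact: cvg_cst.
  have c2 : (fun=> 2 : R) @ \oo --> (2 : R) by exact: cvg_cst.
  apply: cvg_adds; first exact: cvg_adds.
  apply: cvg_muls => //; apply: cvg_muls.
    apply: cvg_adds; first by apply: cvg_adds => //; exact: cvg_muls.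
    by apply: cvg_muls; [exact: cvg_muls | exact: cvg_pow].
  apply: cvg_inv; last by apply: cvg_adds => //; exact: cvg_muls.
  by rewrite gt_eqF // mulr1 addr_gt0.
apply: (cvg_as c) => [j|]; last first.
  by rewrite expr0n /= mulr0 addr0 -q2; rewrite mulr1 -mulr2n -mulr_natl; field; rewrite gt_eqF.
rewrite /gap lag_edgeE // alE At Bt -mulrDl exprMn t2.
have mE : (m j)%:R = A j ^+ 2 * r j ^+ 3 by rewrite A2 divfK // expf_neq0 // gt_eqF.
have nE : (n j)%:R = B j ^+ 2 * r j ^+ 3 by rewrite B2 divfK // expf_neq0 // gt_eqF.
have h1 : r j != 0 by rewrite gt_eqF.
have h2 : A j * B j + q != 0 by rewrite gt_eqF // addr_gt0 // mulr_gt0.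
rewrite /vj /vj' mE nE -q2; field.
by rewrite h1 h2.
Qed.

Lemma grow_cdf_cvg_good : (fun j => prb P (grow_set X (a j) (m j) (n j) ((1 + q) ^+ 2 * r j ^+ 3 + ss j * r j))) @ \oo -->
  F_GUE ((s - (1 + q^-1) * v - (1 + q) * v') / tw_scale x).
Proof.
pose ss' j := (ss j - gap j) * (e j * r j).
have ss'c : ss' @ \oo --> (s - (1 + q^-1) * v - (1 + q) * v') / tw_scale x.
  rewrite -addrA -opprD; apply: cvg_muls; last exact: er_cvg.
  exact: (cvg_subs sc gap_cvg).
have x10 : 0 <= x - 1 by rewrite subr_ge0 ltW.
have etaE j : (1 + q) ^+ 2 * r j ^+ 3 + ss j * r j = edge (lag_rho R (al j) (n j)) (e j) + ss' j / e j by rewrite /ss' /gap; field; rewrite !gt_eqF.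
have near0 := lag_edge_near n0 Ny ac x10 ss'c.
have [c _] := lag_det_cvg Ny ac x10 ss'c (fun=> erefl) near0.
case: near0 => J _ HJ; apply: (@eventually_cvg _ _ _ J).
apply: (cvg_as (shift_cvg J c)) => // j; rewrite etaE grow_cdf //.
by apply: HJ; rewrite /= leq_addl.
Qed.
End Good.

(** [1 < x] gives [n <= m] from some index on, the case covered by [grow_cdf]; an initial segment is
    dropped. *)
Theorem grow_cdf_cvg_edge (a : nat -> int * int) (m n : nat -> nat) (r ss : nat -> R) (x v v' s : R) :
  1 < x -> r @ \oo --> +oo ->
  (fun j => ((m j)%:R - x * r j ^+ 3) / r j) @ \oo --> v ->
  (fun j => ((n j)%:R - r j ^+ 3) / r j) @ \oo --> v' ->
  ss @ \oo --> s ->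
  (fun j => prb P (grow_set X (a j) (m j) (n j) ((1 + Num.sqrt x) ^+ 2 * r j ^+ 3 + ss j * r j))) @ \oo -->
  F_GUE ((s - (1 + (Num.sqrt x)^-1) * v - (1 + Num.sqrt x) * v') / tw_scale x).
Proof.
move=> x1 ry mv nv sc.
have [J0 _ HJ0] : \forall j \near \oo, 1 <= r j by move/cvgryPge : ry; exact.
have r10 j : 1 <= r (j + J0)%N by apply: HJ0; rewrite /= leq_addl.
have lim (k : nat -> nat) (y w : R) : (fun j => ((k j)%:R - y * r j ^+ 3) / r j) @ \oo --> w ->
    (fun j => (k (j + J0)%N)%:R / r (j + J0)%N ^+ 3) @ \oo --> y.
  move=> c1; have c0 := shift_cvg J0 c1; have ri := inv_pinfty (shift_pinfty J0 ry).
  have c : (fun j => y + ((k (j + J0)%N)%:R - y * r (j + J0)%N ^+ 3) / r (j + J0)%N * (r (j + J0)%N)^-1 ^+ 2) @ \oo --> y + w * 0 ^+ 2.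
    by apply: cvg_adds; [exact: cvg_cst | apply: cvg_muls => //; exact: cvg_pow].
  apply: (cvg_as c) => [j|]; last by rewrite expr0n /= mulr0 addr0.
  by field; rewrite gt_eqF // (lt_le_trans ltr01).
have mt := lim _ _ _ mv.
have nt : (fun j => (n (j + J0)%N)%:R / r (j + J0)%N ^+ 3) @ \oo --> (1 : R) by apply: (lim _ _ v'); under eq_fun do rewrite mul1r.
have [J1 _ HJ1] : \forall j \near \oo, (1 + x) / 2 <= (m (j + J0)%N)%:R / r (j + J0)%N ^+ 3 by apply: (cvgr_ge _ mt); lra.
have [J2 _ HJ2] : \forall j \near \oo, (n (j + J0)%N)%:R / r (j + J0)%N ^+ 3 <= (1 + x) / 2 by apply: (cvgr_le _ nt); lra.
have [J3 _ HJ3] : \forall j \near \oo, 2^-1 <= (n (j + J0)%N)%:R / r (j + J0)%N ^+ 3 by apply: (cvgr_ge _ nt); lra.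
pose J := (maxn J1 (maxn J2 J3) + J0)%N.
have jJ j : (j + J = j + maxn J1 (maxn J2 J3) + J0)%N by rewrite /J addnA.
have r1 j : 1 <= r (j + J)%N by rewrite jJ.
have r3 j : 0 < r (j + J)%N ^+ 3 by rewrite exprn_gt0 // (lt_le_trans ltr01).
have n0 j : (0 < n (j + J)%N)%N.
  have := HJ3 (j + maxn J1 (maxn J2 J3))%N; rewrite /= -jJ ler_pdivlMr // => h.
  rewrite -(ltr0n R); apply: lt_le_trans (h _); first by rewrite mulr_gt0.
  by lia.
have nm j : (n (j + J)%N <= m (j + J)%N)%N.
  have h1 := HJ1 (j + maxn J1 (maxn J2 J3))%N; have h2 := HJ2 (j + maxn J1 (maxn J2 J3))%N.
  rewrite /= -jJ in h1 h2; rewrite -(ler_nat R) -(ler_pM2r (_ : 0 < (r (j + J)%N ^+ 3)^-1)) ?invr_gt0 //.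
  by apply: (le_trans (h2 _)); [lia | apply: h1; lia].
apply: (@eventually_cvg _ _ _ J).
exact: (@grow_cdf_cvg_good (fun j => a (j + J)%N) _ _ _ _ _ _ _ _ x1 (shift_pinfty J ry) r1 n0 nm (shift_cvg J mv) (shift_cvg J nv) (shift_cvg J sc)).
Qed.
End OnePoint.

Section PassageLimits.
Variables (R : realType) (d : measure_display) (T : measurableType d) (P : probability T R).

Lemma cvg_near_eq (f g : nat -> R) (l : R) : g @ \oo --> l -> (\forall j \near \oo, f j = g j) -> f @ \oo --> l.
Proof.
move=> gl [J _ H]; apply: (@eventually_cvg _ _ _ J); apply: (cvg_as (shift_cvg J gl)) => // j.
by apply: H; rewrite /= leq_addl.
Qed.

Lemma passage_tr (w : int * int -> R) a b : passage (w \o swap) a b = passage w (swap a) (swap b).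
Proof. by case: a b => a1 a2 [b1 b2]; exact: (passage_swap w (a2, a1) (b2, b1)). Qed.

Section Sequence.
Variable r : nat -> R.
Hypothesis ry : r @ \oo --> +oo.

Let ri : (fun j => (r j)^-1) @ \oo --> (0 : R). Proof. exact: inv_pinfty. Qed.

Let r_pos : \forall j \near \oo, 0 < r j.
Proof. by move/cvgryPge : ry => /(_ 1); apply: filterS => j; exact: lt_le_trans. Qed.

Lemma floor_err (y : R) : `|(Num.floor y)%:~R - y| <= 1.
Proof.
have := Num.Theory.floor_itv y; rewrite intrD => /andP[h1 h2].
by rewrite ler0_norm; lra.
Qed.

(* Rounding coordinates, or moving them by a bounded amount, is invisible at scale r. *)
Lemma bounded_shift_cvg (f g : nat -> R) (C v : R) : (forall j, `|f j - g j| <= C) ->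
  (fun j => g j / r j) @ \oo --> v -> (fun j => f j / r j) @ \oo --> v.
Proof.
move=> fgC gv; have C0 : 0 <= C := le_trans (normr_ge0 _) (fgC 0%N).
have c0 : (fun j => (f j - g j) / r j) @ \oo --> (0 : R).
  apply/cvgrPdist_lt => e e0; have /cvgryPge/(_ ((C + 1) / e)) := ry; apply: filterS => j h.
  have rj : 0 < r j by apply: lt_le_trans h; rewrite divr_gt0 // ltr_wpDl.
  rewrite sub0r normrN normrM [`|_^-1|]gtr0_norm ?invr_gt0 // ltr_pdivrMr //.
  apply: (le_lt_trans (fgC j)); rewrite ler_pdivrMr // mulrC in h.
  by apply: lt_le_trans h; rewrite ltrDl.
apply: (cvg_as (cvg_adds c0 gv)) => [j|]; last by rewrite add0r.
by rewrite -mulrDl subrK.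
Qed.

Lemma floor_cvg (c v : R) : (fun j => ((Num.floor (c * r j ^+ 3 + v * r j))%:~R - c * r j ^+ 3) / r j) @ \oo --> v.
Proof.
apply: (@bounded_shift_cvg _ (fun j => v * r j) 1).
  move=> j; rewrite -addrA -opprD; exact: floor_err.
apply: (cvg_near_eq (cvg_cst v)); near=> j; rewrite mulfK // gt_eqF //.
by near: j; exact: r_pos.
Unshelve. all: end_near. Qed.

Section Edge.
Variable X : int * int -> T -> R.
Hypothesis fX : exp_field P X.
Variables (x k v v' : R) (a b : nat -> int * int).
Hypotheses (x1 : 1 < x) (k0 : 0 < k) (bv : (fun j => (((b j).1 - (a j).1)%:~R - x * (k * r j) ^+ 3) / r j) @ \oo --> v)
  (bv' : (fun j => (((b j).2 - (a j).2)%:~R - (k * r j) ^+ 3) / r j) @ \oo --> v').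

Let kr : (fun j => k * r j) @ \oo --> +oo.
Proof.
apply/cvgryPge => A; have /cvgryPge/(_ (A / k)) := ry.
by apply: filterS => j; rewrite ler_pdivrMr // mulrC.
Qed.

Let pos (y w : R) (c : nat -> int) : 0 < y -> (fun j => ((c j)%:~R - y * (k * r j) ^+ 3) / r j) @ \oo --> w -> \forall j \near \oo, 0 <= c j.
Proof.
move=> y0 cw.
have c1 : (fun j => ((c j)%:~R - y * (k * r j) ^+ 3) / r j * (r j)^-1 ^+ 2) @ \oo --> w * 0 ^+ 2 by apply: cvg_muls => //; exact: cvg_pow.
rewrite expr0n /= mulr0 in c1; near=> j.
have r0 : 0 < r j by near: j; exact: r_pos.
have : - (y * k ^+ 3) < ((c j)%:~R - y * (k * r j) ^+ 3) / r j * (r j)^-1 ^+ 2.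
  by near: j; apply: (cvgr_gt _ c1); rewrite oppr_lt0 mulr_gt0 // exprn_gt0.
rewrite (_ : ((c j)%:~R - y * (k * r j) ^+ 3) / r j * (r j)^-1 ^+ 2 = (c j)%:~R / r j ^+ 3 - y * k ^+ 3); last by field; rewrite gt_eqF.
rewrite -subr_gt0 opprK subrK pmulr_lgt0 ?invr_gt0 ?exprn_gt0 // ltr0z; exact: ltW.
Unshelve. all: end_near. Qed.

Let dims : \forall j \near \oo, 0 <= (b j).1 - (a j).1 /\ 0 <= (b j).2 - (a j).2.
Proof.
near=> j; split; near: j.
- by apply: (pos (lt_trans ltr01 x1) bv).
- by apply: (@pos 1 v') => //; under eq_fun do rewrite mul1r.
Unshelve. all: end_near. Qed.

(** The factor [k] allows legs that cover a fixed fraction of the distance to be measured with the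
    same [r]. The extra row and column of cells, from counting both end points, is invisible at
    scale [r]. *)
Lemma passage_cdf_cvg (ss : nat -> R) (s : R) : ss @ \oo --> s ->
  (fun j => prb P (passage_set X (a j) (b j) ((1 + Num.sqrt x) ^+ 2 * (k * r j) ^+ 3 + ss j * r j))) @ \oo -->
  F_GUE ((s - (1 + (Num.sqrt x)^-1) * v - (1 + Num.sqrt x) * v') / (k * tw_scale x)).
Proof.
move=> sc; have kn0 : k != 0 by rewrite gt_eqF.
pose m j := `|(b j).1 - (a j).1|.+1%N; pose n j := `|(b j).2 - (a j).2|.+1%N.
have lim (y w : R) (c : nat -> int) : (\forall j \near \oo, 0 <= c j) -> (fun j => ((c j)%:~R - y * (k * r j) ^+ 3) / r j) @ \oo --> w ->
   (fun j => ((`|c j|.+1)%:R - y * (k * r j) ^+ 3) / (k * r j)) @ \oo --> w / k.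
  move=> cpos cw.
  have c1 : (fun j => (((c j)%:~R - y * (k * r j) ^+ 3) / r j + (r j)^-1) / k) @ \oo --> (w + 0) / k.
    by apply: cvg_muls; [exact: cvg_adds | exact: cvg_cst].
  rewrite addr0 in c1; apply: (cvg_near_eq c1); near=> j.
  have r0 : 0 < r j by near: j; exact: r_pos.
  have cj : 0 <= c j by near: j.
  have -> : (`|c j|.+1)%:R = (c j)%:~R + 1 :> R by rewrite -natr1 -[in RHS](gez0_abs cj).
  by field; rewrite kn0 gt_eqF.
have mv : (fun j => ((m j)%:R - x * (k * r j) ^+ 3) / (k * r j)) @ \oo --> v / k by apply: lim => //; apply: filterS dims => j [].
have nv : (fun j => ((n j)%:R - (k * r j) ^+ 3) / (k * r j)) @ \oo --> v' / k.
  have bv1 : (fun j => (((b j).2 - (a j).2)%:~R - 1 * (k * r j) ^+ 3) / r j) @ \oo --> v' by apply: (cvg_as bv') => // j; rewrite mul1r.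
  have d2 : \forall j \near \oo, 0 <= (b j).2 - (a j).2 by apply: filterS dims => j [].
  by apply: (cvg_as (lim _ _ _ d2 bv1)) => // j; rewrite mul1r.
have sk : (fun j => ss j / k) @ \oo --> s / k by apply: cvg_muls => //; exact: cvg_cst.
have c := grow_cdf_cvg_edge fX a x1 kr mv nv sk.
apply: (cvg_as c) => [j|].
  by congr (prb P _); apply/seteqP; split => w /=; rewrite /passage mulrA divfK.
have w0 := tw_scale_gt0 (lt_trans ltr01 x1); have q0 : 0 < Num.sqrt x by rewrite sqrtr_gt0 (lt_trans ltr01).
congr F_GUE; move: (tw_scale x) (Num.sqrt x) w0 q0 => W q W0 q0; field.
by rewrite kn0 !gt_eqF.
Unshelve. all: end_near. Qed.

(** [e * r^3] eventually exceeds any fixed multiple of [r], so the probability is bounded by the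
    tail of [F_GUE] at an arbitrarily large constant. *)
Lemma passage_upper_lln (e : R) : 0 < e ->
  (fun j => prb P [set w | ((1 + Num.sqrt x) ^+ 2 * k ^+ 3 + e) * r j ^+ 3 < passage (X^~ w) (a j) (b j)]) @ \oo --> (0 : R).
Proof.
move=> e0; apply/cvgrPdist_lt => eps eps0.
have [A HA] := F_GUE_upper_tail eps0.
have w0 := tw_scale_gt0 (lt_trans ltr01 x1).
pose s := A * (k * tw_scale x) + (1 + (Num.sqrt x)^-1) * v + (1 + Num.sqrt x) * v'.
have sc : (fun=> s) @ \oo --> s by exact: cvg_cst.
have c := passage_cdf_cvg sc.
have FA : 1 - eps < F_GUE ((s - (1 + (Num.sqrt x)^-1) * v - (1 + Num.sqrt x) * v') / (k * tw_scale x)).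
  have -> : s - (1 + (Num.sqrt x)^-1) * v - (1 + Num.sqrt x) * v' = A * (k * tw_scale x) by rewrite /s; ring.
  by rewrite mulfK ?HA // gt_eqF // mulr_gt0.
near=> j.
have r0 : 0 < r j by near: j; exact: r_pos.
have h1 : 1 - eps < prb P (passage_set X (a j) (b j) ((1 + Num.sqrt x) ^+ 2 * (k * r j) ^+ 3 + s * r j)) by near: j; exact: (cvgr_gt _ c).
have h2 : `|s| / e + 1 <= r j by near: j; exact: cvgry_ge.
have mE (y : R) : measurable (passage_set X (a j) (b j) y) by exact: (measurable_grow_le (exp_field_nonneg fX)).
rewrite sub0r normrN ger0_norm ?prb_ge0 //.
rewrite (_ : [set w | _] = ~` (passage_set X (a j) (b j) (((1 + Num.sqrt x) ^+ 2 * k ^+ 3 + e) * r j ^+ 3))); last first.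
  by apply/seteqP; split => w /=; rewrite ltNge; move/negP.
rewrite prb_setC //; suff : prb P (passage_set X (a j) (b j) ((1 + Num.sqrt x) ^+ 2 * (k * r j) ^+ 3 + s * r j)) <=
   prb P (passage_set X (a j) (b j) (((1 + Num.sqrt x) ^+ 2 * k ^+ 3 + e) * r j ^+ 3)) by lra.
apply: prb_le => // w /= h; apply: (le_trans h).
have -> : ((1 + Num.sqrt x) ^+ 2 * k ^+ 3 + e) * r j ^+ 3 = (1 + Num.sqrt x) ^+ 2 * (k * r j) ^+ 3 + e * r j ^+ 3 by move: (Num.sqrt x) => q; ring.
rewrite lerD2l.
have h3 : 1 <= r j by apply: le_trans h2; rewrite lerDr divr_ge0 // ltW.
have h4 : `|s| <= e * r j.
  rewrite -ler_pdivrMl // mulrC; apply: le_trans h2; by rewrite lerDl.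
apply: (@le_trans _ _ (e * r j * r j)).
  by rewrite ler_wpM2r ?(ltW r0) // (le_trans (ler_norm _)).
rewrite -mulrA -expr2 ler_wpM2l ?(ltW e0) //; exact: ler_weXn2l.
Unshelve. all: end_near. Qed.

Lemma passage_lower_lln (e : R) : 0 < e ->
  (fun j => prb P (passage_set X (a j) (b j) (((1 + Num.sqrt x) ^+ 2 * k ^+ 3 - e) * r j ^+ 3))) @ \oo --> (0 : R).
Proof.
move=> e0; apply/cvgrPdist_lt => eps eps0.
have [A HA] := @F_GUE_lower_tail R _ eps0.
have w0 := tw_scale_gt0 (lt_trans ltr01 x1).
pose s := A * (k * tw_scale x) + (1 + (Num.sqrt x)^-1) * v + (1 + Num.sqrt x) * v'.
have sc : (fun=> s) @ \oo --> s by exact: cvg_cst.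
have c := passage_cdf_cvg sc.
have FA : F_GUE ((s - (1 + (Num.sqrt x)^-1) * v - (1 + Num.sqrt x) * v') / (k * tw_scale x)) < eps.
  have -> : s - (1 + (Num.sqrt x)^-1) * v - (1 + Num.sqrt x) * v' = A * (k * tw_scale x) by rewrite /s; ring.
  by rewrite mulfK ?HA // gt_eqF // mulr_gt0.
near=> j.
have r0 : 0 < r j by near: j; exact: r_pos.
have h1 : prb P (passage_set X (a j) (b j) ((1 + Num.sqrt x) ^+ 2 * (k * r j) ^+ 3 + s * r j)) < eps by near: j; exact: (cvgr_lt _ c).
have h2 : `|s| / e + 1 <= r j by near: j; exact: cvgry_ge.
have mE (y : R) : measurable (passage_set X (a j) (b j) y) by exact: (measurable_grow_le (exp_field_nonneg fX)).
rewrite sub0r normrN ger0_norm ?prb_ge0 //; apply: le_lt_trans h1.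
apply: prb_le => // w /= h; apply: (le_trans h).
have -> : ((1 + Num.sqrt x) ^+ 2 * k ^+ 3 - e) * r j ^+ 3 = (1 + Num.sqrt x) ^+ 2 * (k * r j) ^+ 3 - e * r j ^+ 3 by move: (Num.sqrt x) => q; ring.
rewrite lerD2l.
have h3 : 1 <= r j by apply: le_trans h2; rewrite lerDr divr_ge0 // ltW.
have h4 : `|s| <= e * r j.
  rewrite -ler_pdivrMl // mulrC; apply: le_trans h2; by rewrite lerDl.
rewrite lerNl -mulNr; apply: (@le_trans _ _ (e * r j * r j)).
  by rewrite ler_wpM2r ?(ltW r0) // (le_trans _ h4) // -normrN ler_norm.
rewrite -mulrA -expr2 ler_wpM2l ?(ltW e0) //; exact: ler_weXn2l.
Unshelve. all: end_near. Qed.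
End Edge.
End Sequence.
End PassageLimits.

(** * Localization *)

Section Concavity.
Variable R : realType.

Definition lpp_shape (a b : R) : R := (Num.sqrt a + Num.sqrt b) ^+ 2.

Lemma lpp_shapeC a b : lpp_shape a b = lpp_shape b a.
Proof. by rewrite /lpp_shape addrC. Qed.

(* The right-hand side is the supporting linear function of the concave function lpp_shape
   in the direction (g^2, 1); the last term measures the angle to that direction. *)
Lemma lpp_shape_le (a b g : R) : 0 <= a -> 0 <= b -> 0 < g -> lpp_shape a b <= a * (1 + g^-1) + b * (1 + g).
Proof.
move=> a0 b0 g0; rewrite /lpp_shape -[a in leRHS]sqr_sqrtr // -[b in leRHS]sqr_sqrtr //.
move: (Num.sqrt a) (Num.sqrt b) => p s.
have : 0 <= (p / g - s) ^+ 2 * g by rewrite mulr_ge0 ?sqr_ge0 // ltW.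
have -> : (p / g - s) ^+ 2 * g = p ^+ 2 * g^-1 - 2 * (p * s) + s ^+ 2 * g by field; rewrite gt_eqF.
rewrite sqrrD -mulr_natl !mulrDr !mulr1; lra.
Qed.

(** With [p^2 = a / g] and [s^2 = b g] the defect of the linear bound is [(p - s)^2]; it is bounded
    through [p^2 - s^2 = (p - s)(p + s)] and [(p + s)^2 <= 2 M]. *)
Lemma lpp_shape_gap (a b g c M : R) : 0 <= a -> 0 <= b -> 0 < g -> 0 <= c -> 0 < M -> c <= a / g - b * g -> a / g + b * g <= M ->
  lpp_shape a b <= a * (1 + g^-1) + b * (1 + g) - c ^+ 2 / (2 * M).
Proof.
move=> a0 b0 g0 c0 M0 hc hM; rewrite /lpp_shape.
have [p p0 pE] : exists2 p, 0 <= p & a / g = p ^+ 2 by exists (Num.sqrt (a / g)); rewrite ?sqrtr_ge0 // sqr_sqrtr // divr_ge0 // ltW.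
have [s s0 sE] : exists2 s, 0 <= s & b * g = s ^+ 2 by exists (Num.sqrt (b * g)); rewrite ?sqrtr_ge0 // sqr_sqrtr // mulr_ge0 // ltW.
have E : Num.sqrt a * Num.sqrt b = p * s.
  rewrite -sqrtrM // -[RHS]ger0_norm ?mulr_ge0 // -sqrtr_sqr.
  by congr Num.sqrt; rewrite exprMn -pE -sE; field; rewrite gt_eqF.
rewrite sqrrD !sqr_sqrtr // -mulr_natl E !mulrDr !mulr1.
have aE : a * g^-1 = p ^+ 2 by [].
rewrite aE sE.
suff : c ^+ 2 / (2 * M) <= (p - s) ^+ 2 by rewrite sqrrB; lra.
rewrite ler_pdivrMr; last by rewrite mulr_gt0.
rewrite pE sE in hc hM.
have h1 : c ^+ 2 <= (p ^+ 2 - s ^+ 2) ^+ 2 by rewrite ler_sqr ?nnegrE // (le_trans c0).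
apply: (le_trans h1); rewrite subr_sqr exprMn ler_wpM2l ?sqr_ge0 //.
have := sqr_ge0 (p - s); rewrite sqrrB sqrrD; lra.
Qed.

(** The linear bounds of the two legs add up to the time along the characteristic, whose direction
    is [(g^2, 1)]. The first leg misses that direction by an angle bounded below, because [y] stays
    below the abscissa of the split point, and this produces the loss. The term in [y - z] is the
    price of letting the first leg end and the second one start at opposite corners of a grid
    cell. *)
Lemma two_legs_gap (beta delta y z g : R) : 0 < g -> g ^+ 2 = 1 + beta -> 0 < beta -> 0 < delta -> delta * (1 + beta) < 1 ->
  0 < y -> y <= 1 - delta * (1 + beta) -> z <= 1 - delta * (1 + beta) ->
  lpp_shape (y + beta) y + lpp_shape (1 - delta * (1 + beta) - z) (1 - delta - z) <=
  (1 + g) ^+ 2 * (1 - delta) + (y - z) * (2 + g + g^-1) - (beta * delta * g) ^+ 2 / (4 * g).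
Proof.
move=> g0 g2 b0 d0 db y0 y1 z1.
have bE : beta = g ^+ 2 - 1 by rewrite g2; lra.
have dle : delta <= delta * (1 + beta) by rewrite ler_peMr ?(ltW d0) //; lra.
have h1 : lpp_shape (y + beta) y <= (y + beta) * (1 + g^-1) + y * (1 + g) - (beta * delta * g) ^+ 2 / (2 * (2 * g)).
  apply: lpp_shape_gap => //; try lra.
  - by rewrite !mulr_ge0 ?(ltW b0) ?(ltW d0) ?(ltW g0).
  - have -> : (y + beta) / g - y * g = beta * (1 - y) / g by rewrite bE; field; rewrite gt_eqF.
    have -> : beta * delta * g = beta * (delta * (1 + beta)) / g by rewrite -g2; field; rewrite gt_eqF.
    by rewrite ler_pM2r ?invr_gt0 // ler_pM2l //; lra.
  - have -> : (y + beta) / g + y * g = 2 * g - (1 - y) * (g^-1 + g) by rewrite bE; field; rewrite gt_eqF.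
    rewrite gerBl mulr_ge0 //; first by lra.
    by rewrite addr_ge0 ?invr_ge0 // ltW.
have h2 : lpp_shape (1 - delta * (1 + beta) - z) (1 - delta - z) <= (1 - delta * (1 + beta) - z) * (1 + g^-1) + (1 - delta - z) * (1 + g).
  by apply: lpp_shape_le => //; lra.
apply: (le_trans (lerD h1 h2)).
rewrite -!g2 bE mulrA -natrM.
rewrite le_eqVlt; apply/orP; left; apply/eqP; field; rewrite gt_eqF //.
Qed.
Lemma legs_too_short (L S1 S2 gp t A B B' C C' : R) : 0 < t -> 0 < gp -> S1 + S2 <= L - gp / 2 ->
  (L - gp / 8) * t < A -> B' <= (S1 + gp / 8) * t -> C' <= (S2 + gp / 8) * t ->
  B <= B' -> C <= C' -> A <= B + C -> False.
Proof.
move=> t0 gp0 hS hA hB hC BB CC hA2.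
have h1 : (L - gp / 8) * t < (S1 + gp / 8) * t + (S2 + gp / 8) * t.
  by apply: (lt_le_trans hA); apply: (le_trans hA2); apply: lerD; [apply: le_trans hB | apply: le_trans hC].
by rewrite -mulrDl ltr_pM2r // in h1; lra.
Qed.
End Concavity.

Section Localization.
Variables (R : realType) (d : measure_display) (T : measurableType d) (P : probability T R).
Variables (r : nat -> R).
Hypothesis ry : r @ \oo --> +oo.

Lemma prbU (A B : set T) : measurable A -> measurable B -> prb P (A `|` B) <= prb P A + prb P B.
Proof.
move=> mA mB; rewrite -lee_fin EFinD !prbE //; last exact: measurableU.
exact: measureU2.
Qed.

(** With [t = r^3], the integer coordinate is [c t + v t^(1/3)] up to a smaller error; floors and
    unit displacements do not affect it. *)
Definition tracks (A : nat -> int) (c v : R) := (fun j => ((A j)%:~R - c * r j ^+ 3) / r j) @ \oo --> v.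

Lemma tracks_floor (c v : R) : tracks (fun j => Num.floor (c * r j ^+ 3 + v * r j)) c v.
Proof. exact: floor_cvg. Qed.

Lemma tracks_floor0 (c : R) : tracks (fun j => Num.floor (c * r j ^+ 3)) c 0.
Proof. rewrite /tracks (_ : (fun j => _) = fun j => ((Num.floor (c * r j ^+ 3 + 0 * r j))%:~R - c * r j ^+ 3) / r j).
  exact: floor_cvg.
by apply/funext => j; rewrite mul0r addr0. Qed.

Lemma tracks0 : tracks (fun=> 0) 0 0.
Proof.
apply: (cvg_as (cvg_cst (0 : R))) => // j.
by rewrite mul0r subrr mul0r.
Qed.

Lemma tracks_shift A c v (z : int) : tracks A c v -> tracks (fun j => A j + z) c v.
Proof.
move=> h; apply: (@bounded_shift_cvg _ r ry _ (fun j => (A j)%:~R - c * r j ^+ 3) `|z%:~R|) => // j.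
have -> : (A j + z)%:~R - c * r j ^+ 3 - ((A j)%:~R - c * r j ^+ 3) = z%:~R by rewrite intrD; ring.
by [].
Qed.

Lemma tracks_sub A B c c' v v' : tracks A c v -> tracks B c' v' -> tracks (fun j => A j - B j) (c - c') (v - v').
Proof.
move=> hA hB; apply: (cvg_as (cvg_subs hA hB)) => // j.
by rewrite -mulrBl intrB; congr (_ / _); ring.
Qed.

Definition cbrt (y : R) : R := y `^ 3^-1.

Lemma cbrt_gt0 y : 0 < y -> 0 < cbrt y. Proof. exact: powR_gt0. Qed.

Lemma cbrtK y : 0 <= y -> cbrt y ^+ 3 = y.
Proof. by move=> y0; rewrite -powR_mulrn ?powR_ge0 // -powRrM mulVf ?pnatr_eq0 // powRr1. Qed.

Lemma lpp_shapeE (c1 c2 : R) : 0 < c1 -> 0 < c2 -> lpp_shape c1 c2 = (1 + Num.sqrt (c1 / c2)) ^+ 2 * c2.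
Proof.
move=> c10 c20; rewrite sqrtrM ?(ltW c10) // sqrtrV ?(ltW c20) // /lpp_shape.
rewrite -[c2 in RHS]sqr_sqrtr ?(ltW c20) // sqrtr_sqr ger0_norm ?sqrtr_ge0 //.
have : Num.sqrt c2 != 0 by rewrite gt_eqF // sqrtr_gt0.
by move: (Num.sqrt c1) (Num.sqrt c2) => p q q0; field.
Qed.

Lemma leg_lower (X : int * int -> T -> R) (c1 c2 v v' e : R) (a b : nat -> int * int) : exp_field P X -> 0 < c2 -> c2 < c1 ->
  tracks (fun j => (b j).1 - (a j).1) c1 v -> tracks (fun j => (b j).2 - (a j).2) c2 v' -> 0 < e ->
  (fun j => prb P (passage_set X (a j) (b j) ((lpp_shape c1 c2 - e) * r j ^+ 3))) @ \oo --> (0 : R).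
Proof.
move=> fX c20 c12 t1 t2 e0.
have x1 : 1 < c1 / c2 by rewrite ltr_pdivlMr // mul1r.
have k3 := cbrtK (ltW c20).
have b1 : (fun j => (((b j).1 - (a j).1)%:~R - c1 / c2 * (cbrt c2 * r j) ^+ 3) / r j) @ \oo --> v.
  by apply: (cvg_as t1) => // j; rewrite exprMn k3 mulrA divfK // gt_eqF.
have b2 : (fun j => (((b j).2 - (a j).2)%:~R - (cbrt c2 * r j) ^+ 3) / r j) @ \oo --> v' by apply: (cvg_as t2) => // j; rewrite exprMn k3.
apply: (cvg_as (passage_lower_lln ry fX x1 (cbrt_gt0 c20) b1 b2 e0)) => // j.
by rewrite lpp_shapeE ?k3 // (lt_trans c20).
Qed.

Lemma leg_upper_lt (X : int * int -> T -> R) (c1 c2 v v' e : R) (a b : nat -> int * int) : exp_field P X -> 0 < c2 -> c2 < c1 ->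
  tracks (fun j => (b j).1 - (a j).1) c1 v -> tracks (fun j => (b j).2 - (a j).2) c2 v' -> 0 < e ->
  (fun j => prb P [set w | (lpp_shape c1 c2 + e) * r j ^+ 3 < passage (X^~ w) (a j) (b j)]) @ \oo --> (0 : R).
Proof.
move=> fX c20 c12 t1 t2 e0.
have x1 : 1 < c1 / c2 by rewrite ltr_pdivlMr // mul1r.
have k3 := cbrtK (ltW c20).
have b1 : (fun j => (((b j).1 - (a j).1)%:~R - c1 / c2 * (cbrt c2 * r j) ^+ 3) / r j) @ \oo --> v.
  by apply: (cvg_as t1) => // j; rewrite exprMn k3 mulrA divfK // gt_eqF.
have b2 : (fun j => (((b j).2 - (a j).2)%:~R - (cbrt c2 * r j) ^+ 3) / r j) @ \oo --> v' by apply: (cvg_as t2) => // j; rewrite exprMn k3.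
apply: (cvg_as (passage_upper_lln ry fX x1 (cbrt_gt0 c20) b1 b2 e0)) => // j.
by rewrite lpp_shapeE ?k3 // (lt_trans c20).
Qed.

(** The one-point law covers [c2 < c1], and reflection gives the other case. Both occur: legs to the
    diagonal are longer horizontally, legs from the diagonal to the split point vertically. *)
Lemma leg_upper (X : int * int -> T -> R) (c1 c2 v v' e : R) (a b : nat -> int * int) : exp_field P X -> 0 < c1 -> 0 < c2 -> c1 != c2 ->
  tracks (fun j => (b j).1 - (a j).1) c1 v -> tracks (fun j => (b j).2 - (a j).2) c2 v' -> 0 < e ->
  (fun j => prb P [set w | (lpp_shape c1 c2 + e) * r j ^+ 3 < passage (X^~ w) (a j) (b j)]) @ \oo --> (0 : R).
Proof.
move=> fX c10 c20; case: (ltgtP c1 c2) => // c12 _ t1 t2 e0; last exact: (leg_upper_lt fX c20 c12 t1 t2 e0).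
have h := @leg_upper_lt _ c2 c1 v' v e (fun j => swap (a j)) (fun j => swap (b j)) (exp_field_swap fX) c10 c12 t2 t1 e0.
apply: (cvg_as h) => // j; rewrite lpp_shapeC; congr (prb P _); apply/seteqP; split => w /=.
  by rewrite -passage_swap.
by rewrite -[passage (X^~ w) _ _]passage_swap.
Qed.

Section Crossing.
Variable X : int * int -> T -> R.
Hypothesis fX : exp_field P X.
Variables (beta delta g : R).
Hypotheses (b0 : 0 < beta) (d0 : 0 < delta) (db : delta * (1 + beta) < 1) (g0 : 0 < g) (g2 : g ^+ 2 = 1 + beta).

(** One step to the right of the starting point, whose own weight is excluded from the maximum;
    paths from here meet only unaltered weights. *)
Definition lpp_start (j : nat) : int * int := (Num.floor (- beta * r j ^+ 3) + 1, 0).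

(** The point of the characteristic from [(-beta t, 0)] to [(t, t)] at the fraction [delta] before
    its end; for large [t] it lies strictly above the diagonal. *)
Definition lpp_split (j : nat) : int * int := (Num.floor ((1 - delta * (1 + beta)) * r j ^+ 3), Num.floor ((1 - delta) * r j ^+ 3)).

Let e1 := 1 - delta * (1 + beta).
Let e10 : 0 < e1. Proof. by rewrite /e1; have := db; lra. Qed.
Let e12 : e1 < 1 - delta.
Proof.
have h : delta * 1 < delta * (1 + beta) by rewrite ltr_pM2l // ltrDl.
by rewrite /e1; lra.
Qed.

Let start1 : tracks (fun j => (lpp_start j).1) (- beta) 0.
Proof. exact: tracks_shift (tracks_floor0 _). Qed.

Lemma split_dims : tracks (fun j => (lpp_split j).1 - (lpp_start j).1) ((1 - delta) * (1 + beta)) 0 /\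
  tracks (fun j => (lpp_split j).2 - (lpp_start j).2) (1 - delta) 0.
Proof.
split.
- have := tracks_sub (tracks_floor0 e1) start1; rewrite subr0.
  by have -> : e1 - - beta = (1 - delta) * (1 + beta) by rewrite /e1; ring.
- by have := tracks_sub (tracks_floor0 (1 - delta)) tracks0; rewrite !subr0.
Qed.

Let gap := (beta * delta * g) ^+ 2 / (4 * g).
Let gap0 : 0 < gap. Proof. by rewrite divr_gt0 ?exprn_gt0 ?mulr_gt0. Qed.
(** Number of grid cells on the diagonal, fine enough for the corner term of [two_legs_gap] to cost
    at most half of the gap. *)
Let n := (truncn (2 * e1 * (2 + g + g^-1) / gap)%R).+1.
Let y (i : nat) : R := e1 * (i%:R / n%:R).
Let Q (i j : nat) : int := Num.floor (y i * r j ^+ 3).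
Let nR : 0 < n%:R :> R. Proof. by rewrite ltr0n. Qed.

Let y_step i : (y i.+1 - y i) * (2 + g + g^-1) <= gap / 2.
Proof.
have h : 0 <= 2 * e1 * (2 + g + g^-1) / gap.
  have hg := ltW g0; have hi : 0 <= g^-1 by rewrite invr_ge0.
  by rewrite divr_ge0 ?(ltW gap0) // mulr_ge0 //; [rewrite mulr_ge0 // ltW | lra].
have /andP[_] := truncn_itv h; rewrite -/n ltr_pdivrMr // => h2.
have -> : y i.+1 - y i = e1 / n%:R by rewrite /y -natr1; field; rewrite gt_eqF.
by rewrite mulrAC ler_pdivrMr //; lra.
Qed.

(** Deviation events, each by an eighth of the gap: a leg to the diagonal too long ([U]), a leg from
    the diagonal too long ([U']), the whole time too short ([U0]). *)
Let U i j := [set w | (lpp_shape (y i.+1 + beta) (y i.+1) + gap / 8) * r j ^+ 3 < passage (X^~ w) (lpp_start j) (Q i.+1 j, Q i.+1 j)].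
Let U' i j := [set w | (lpp_shape (e1 - y i) (1 - delta - y i) + gap / 8) * r j ^+ 3 < passage (X^~ w) (Q i j, Q i j) (lpp_split j)].
Let U0 j := passage_set X (lpp_start j) (lpp_split j) ((lpp_shape ((1 - delta) * (1 + beta)) (1 - delta) - gap / 8) * r j ^+ 3).

Let gap8 : 0 < gap / 8. Proof. by rewrite divr_gt0. Qed.
Let y0 i : 0 <= y i. Proof. by rewrite mulr_ge0 ?divr_ge0 // ltW. Qed.
Let yS0 i : 0 < y i.+1. Proof. by rewrite mulr_gt0 // divr_gt0. Qed.
Let y_lt i : (i < n)%N -> y i < e1.
Proof. by move=> h; rewrite gtr_pMr // ltr_pdivrMr // mul1r ltr_nat. Qed.
Let y_le i : (i <= n)%N -> y i <= e1.
Proof. by move=> h; rewrite ger_pMr // ler_pdivrMr // mul1r ler_nat. Qed.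

Let U_cvg i : (fun j => prb P (U i j)) @ \oo --> (0 : R).
Proof.
apply: (@leg_upper X _ _ 0 0) => //.
- by rewrite addr_gt0.
- by rewrite gt_eqF // ltrDl.
- have := tracks_sub (tracks_floor0 (y i.+1)) start1; rewrite subr0.
  by have -> : y i.+1 - - beta = y i.+1 + beta by ring.
- by have := tracks_sub (tracks_floor0 (y i.+1)) tracks0; rewrite !subr0.
Qed.

Let U'_cvg i : (i < n)%N -> (fun j => prb P (U' i j)) @ \oo --> (0 : R).
Proof.
move=> /y_lt yi; apply: (@leg_upper X _ _ 0 0) => //.
- by rewrite subr_gt0.
- by rewrite subr_gt0 (lt_trans yi).
- by rewrite lt_eqF // ltrD2r.
- by have := tracks_sub (tracks_floor0 e1) (tracks_floor0 (y i)); rewrite subr0.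
- by have := tracks_sub (tracks_floor0 (1 - delta)) (tracks_floor0 (y i)); rewrite subr0.
Qed.

Let U0_cvg : (fun j => prb P (U0 j)) @ \oo --> (0 : R).
Proof.
have d1 : 0 < 1 - delta by exact: lt_trans e12.
have [t1 t2] := split_dims; apply: (leg_lower fX _ _ t1 t2) => //.
by rewrite ltr_pMr // ltrDl.
Qed.

Let mpass a b (s : R) : measurable (passage_set X a b s).
Proof. exact: (measurable_grow_le (exp_field_nonneg fX)). Qed.
Let mpass' a b (s : R) : measurable [set w | s < passage (X^~ w) a b].
Proof.
rewrite (_ : [set w | _] = ~` (passage_set X a b s)); first exact: measurableC.
by apply/seteqP; split => w /=; rewrite ltNge; move/negP.
Qed.

(* A maximal path touching the diagonal splits into two legs whose lengths are too short by
   strict concavity; finitely many grid points on the diagonal suffice. *)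
Let bad_sub : \forall j \near \oo, [set w | passage (above (X^~ w)) (lpp_start j) (lpp_split j) < passage (X^~ w) (lpp_start j) (lpp_split j)] `<=`
  \bigcup_(i in [set i | i \in iota 0 n]) (U0 j `|` (U i j `|` U' i j)).
Proof.
near=> j.
have r1 : 1 <= r j by near: j; exact: cvgry_ge.
have rb : beta^-1 < r j by near: j; move/cvgryPgt : ry; exact.
have r3 : 0 < r j ^+ 3 by rewrite exprn_gt0 // (lt_le_trans ltr01).
have rb3 : 1 < beta * r j ^+ 3.
  have h : r j <= r j ^+ 3 by rewrite ler_eXnr.
  rewrite -ltr_pdivrMl // mulr1; exact: lt_le_trans h.
have s1 : (lpp_start j).1 < 0.
  have := floor_err (- beta * r j ^+ 3); rewrite ler_norml => /andP[_ h].
  rewrite -(ltrz0 R) intrD; have := Num.Theory.floor_itv (- beta * r j ^+ 3) => /andP[h2 _].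
  by rewrite mulNr in h2 *; lra.
have Q0 i : 0 <= Q i j by rewrite floor_ge_int mulr_ge0 // ltW.
have p2 : 0 <= (lpp_split j).2 by rewrite floor_ge_int mulr_ge0 ?(ltW r3) //; have := lt_trans e10 e12; exact: ltW.
have p1 : 0 <= (lpp_split j).1 by rewrite floor_ge_int mulr_ge0 ?(ltW r3) //; exact: ltW.
have [_ X0 _] := fX.
have le0 : le_pt (lpp_start j) (lpp_split j) by rewrite /le_pt p2 (le_trans (ltW s1) p1).
move=> w /= bad.
have [|[q [/andP[/= q1 q2] /andP[/= q3 q4] hq]]] := passage_above (X0 ^~ w) le0 s1.
  by rewrite leNgt bad.
have QnE : Q n j = (lpp_split j).1 by rewrite /Q /y divff ?mulr1 // gt_eqF.
have [i iN /andP[Qi Qi1]] : exists2 i, (i < n)%N & Q i j <= q <= Q i.+1 j.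
  have ex : exists i, (q <= Q i j) && (i <= n)%N by exists n; rewrite QnE q3 leqnn.
  case: (ex_minnP ex) => -[|m] /andP[h1 h2] hmin.
    exists 0%N => //; have Q00 : Q 0%N j = 0 by rewrite /Q /y mul0r mulr0 mul0r floor0.
    by rewrite Q00 in h1 *; rewrite q2 (le_trans h1).
  exists m => //; rewrite h1 andbT; apply: ltW; rewrite ltNge; apply/negP => h3.
  by have := hmin m; rewrite h3 (ltnW h2) => /(_ isT); rewrite ltnn.
have iin : i \in iota 0 n by rewrite mem_iota.
exists i; first exact: iin.
apply: contrapT => hn.
have n0 : ~ U0 j w by move=> h; apply: hn; left.
have n1 : ~ U i j w by move=> h; apply: hn; right; left.
have n2 : ~ U' i j w by move=> h; apply: hn; right; right.
move: n0 n1 n2; rewrite /U0 /U /U' /= => /negP n0 /negP n1 /negP n2; rewrite -ltNge in n0; rewrite -leNgt in n1; rewrite -leNgt in n2.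
have w0 p : 0 <= X p w by exact: X0.
have l1 : passage (X^~ w) (lpp_start j) (q, q) <= passage (X^~ w) (lpp_start j) (Q i.+1 j, Q i.+1 j).
  by apply: passage_le_pt => //; rewrite /le_pt /= ?lexx ?Qi1 ?q1 ?q2.
have l2 : passage (X^~ w) (q, q) (lpp_split j) <= passage (X^~ w) (Q i j, Q i j) (lpp_split j).
  by apply: passage_le_pt => //; rewrite /le_pt /= ?lexx ?Qi ?q3 ?q4.
have G := @two_legs_gap R beta delta (y i.+1) (y i) g g0 g2 b0 d0 db (yS0 i) (y_le iN) (y_le (ltnW iN)).
have shE : lpp_shape ((1 - delta) * (1 + beta)) (1 - delta) = (1 + g) ^+ 2 * (1 - delta).
  have d1 : 0 < 1 - delta by exact: lt_trans e12.
  have E : (1 - delta) * (1 + beta) / (1 - delta) = g ^+ 2 by rewrite g2 mulrAC divff ?mul1r // gt_eqF.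
  have p1' : 0 < (1 - delta) * (1 + beta) by rewrite mulr_gt0 // addr_gt0.
  by rewrite (lpp_shapeE p1' d1) E sqrtr_sqr ger0_norm // ltW.
rewrite shE in n0; have st := y_step i; rewrite -/gap -/e1 in G.
have hS : lpp_shape (y i.+1 + beta) (y i.+1) + lpp_shape (e1 - y i) (1 - delta - y i) <= (1 + g) ^+ 2 * (1 - delta) - gap / 2 by lra.
have hF := legs_too_short r3 gap0 hS n0 n1 n2 l1 l2 hq; exact: hF.
Unshelve. all: end_near. Qed.

Lemma localization : (fun j => prb P [set w | passage (above (X^~ w)) (lpp_start j) (lpp_split j) <
   passage (X^~ w) (lpp_start j) (lpp_split j)]) @ \oo --> (0 : R).
Proof.
have mU0 j : measurable (U0 j) by exact: mpass.
have mU i j : measurable (U i j) by exact: mpass'.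
have mU' i j : measurable (U' i j) by exact: mpass'.
have aN : nonneg_field (fun p w => above (X^~ w) p) := restrict_field_nonneg fX (fun p => p.1 < p.2).
have mbad j : measurable [set w | passage (above (X^~ w)) (lpp_start j) (lpp_split j) < passage (X^~ w) (lpp_start j) (lpp_split j)].
  have mf : measurable_fun setT (fun w => passage (X^~ w) (lpp_start j) (lpp_split j) - passage (above (X^~ w)) (lpp_start j) (lpp_split j)).
    by apply: measurable_funB; [exact: (measurable_passage (exp_field_nonneg fX)) | exact: (measurable_passage aN)].
  rewrite (_ : [set w | _] = (fun w => passage (X^~ w) (lpp_start j) (lpp_split j) - passage (above (X^~ w)) (lpp_start j) (lpp_split j)) @^-1` `]0, +oo[%classic); last first.
    by apply/seteqP; split => w /=; rewrite in_itv /= andbT subr_gt0.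
  by rewrite -[X in measurable X]setTI; exact: mf.
have c : (fun j => \sum_(i <- iota 0 n) (prb P (U0 j) + (prb P (U i j) + prb P (U' i j)))) @ \oo --> \sum_(i <- iota 0 n) (0 + (0 + 0) : R).
  rewrite big_seq; under eq_fun do rewrite big_seq.
  apply: cvg_sum => i; rewrite mem_iota => /andP[_ iN].
  by apply: cvg_adds; [exact: U0_cvg | apply: cvg_adds; [exact: U_cvg | exact: U'_cvg]].
rewrite !addr0 big1 // in c.
apply/cvgrPdist_lt => e ep; near=> j.
have hs : [set w | passage (above (X^~ w)) (lpp_start j) (lpp_split j) < passage (X^~ w) (lpp_start j) (lpp_split j)] `<=`
  \bigcup_(i in [set i | i \in iota 0 n]) (U0 j `|` (U i j `|` U' i j)) by near: j; exact: bad_sub.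
have hc : \sum_(i <- iota 0 n) (prb P (U0 j) + (prb P (U i j) + prb P (U' i j))) < e by near: j; exact: (cvgr_lt _ c).
rewrite sub0r normrN ger0_norm ?prb_ge0 //; apply: le_lt_trans hc.
have mUU i : measurable (U0 j `|` (U i j `|` U' i j)) by apply: measurableU => //; exact: measurableU.
have [mB hB] := prb_bigcup P (iota 0 n) mUU.
apply: (le_trans (prb_le P (mbad j) mB hs)); apply: (le_trans hB); apply: ler_sum => i _.
apply: (le_trans (prbU _ _)) => //; first exact: measurableU.
by rewrite lerD2l; exact: prbU.
Unshelve. all: end_near. Qed.
End Crossing.
End Localization.

(** * Reduction of one side to a single time above the diagonal *)

Local Notation above_set r beta w delta j c :=
  [set x | passage (above (w^~ x)) (lpp_start r beta j) (lpp_split r beta delta j) <= c].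

Section Side.
Variables (R : realType) (d : measure_display) (T : measurableType d) (P : probability T R).
Variables (r : nat -> R).
Hypothesis ry : r @ \oo --> +oo.
Variable beta : R.
Hypothesis b0 : 0 < beta.

Let g := Num.sqrt (1 + beta).
Let b1 : 1 < 1 + beta. Proof. by rewrite ltrDl. Qed.
Let b10 : 0 < 1 + beta. Proof. by rewrite addr_gt0. Qed.
Let g0 : 0 < g. Proof. by rewrite sqrtr_gt0. Qed.
Let g2 : g ^+ 2 = 1 + beta. Proof. by rewrite sqr_sqrtr // ltW. Qed.
Let sigma := tw_scale (1 + beta).
Let sigma0 : 0 < sigma. Proof. exact: tw_scale_gt0. Qed.
Let Lam := (1 + g) ^+ 2.

Lemma tracks_ge0 (A : nat -> int) (c v : R) : 0 < c -> tracks r A c v -> \forall j \near \oo, 0 <= A j.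
Proof.
move=> c0 tA; have c1 : (fun j => ((A j)%:~R - c * r j ^+ 3) / r j * (r j)^-1 ^+ 2) @ \oo --> v * 0 ^+ 2.
  by apply: cvg_muls => //; apply: cvg_pow; exact: inv_pinfty.
rewrite expr0n /= mulr0 in c1; near=> j.
have r0 : 0 < r j by near: j; move/cvgryPgt : ry; exact.
have : - c < ((A j)%:~R - c * r j ^+ 3) / r j * (r j)^-1 ^+ 2 by near: j; apply: (cvgr_gt _ c1); rewrite oppr_lt0.
have -> : ((A j)%:~R - c * r j ^+ 3) / r j * (r j)^-1 ^+ 2 = (A j)%:~R / r j ^+ 3 - c by field; rewrite gt_eqF.
rewrite -subr_gt0 opprK subrK pmulr_lgt0 ?invr_gt0 ?exprn_gt0 // ltr0z; exact: ltW.
Unshelve. all: end_near. Qed.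

Lemma cut_arith (L dl r3 rj y z et x u h : R) : L * (1 - dl) * r3 + (y - z + et) * rj < x -> x + u <= h -> h <= L * r3 + y * rj ->
  u <= L * dl * r3 + (z - et) * rj.
Proof.
move=> h1 h2 h3.
have -> : L * dl * r3 + (z - et) * rj = L * r3 + y * rj - (L * (1 - dl) * r3 + (y - z + et) * rj) by ring.
lra.
Qed.

Lemma near_all (I : finType) (Q : I -> nat -> Prop) : (forall k, \forall j \near \oo, Q k j) -> \forall j \near \oo, forall k, Q k j.
Proof.
move=> h; have hJ k : exists J : nat, forall j, (J <= j)%N -> Q k j by have [J _ HJ] := h k; exists J.
have [J HJ] := choice hJ; exists (\max_k J k)%N => // j Jj k; apply: HJ.
exact: leq_trans (leq_bigmax k) Jj.
Qed.

Section FieldX.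
Variable X : int * int -> T -> R.
Hypothesis fX : exp_field P X.

Lemma corner_cdf (a b : nat -> int * int) (c v v' s : R) : 0 < c ->
  tracks r (fun j => (b j).1 - (a j).1) (c * (1 + beta)) v -> tracks r (fun j => (b j).2 - (a j).2) c v' ->
  (fun j => prb P (passage_set X (a j) (b j) (Lam * c * r j ^+ 3 + s * r j))) @ \oo -->
  F_GUE ((s - ((1 + g^-1) * v + (1 + g) * v')) / (cbrt c * sigma)).
Proof.
move=> c0 t1 t2; have k3 := cbrtK (ltW c0).
have h1 : (fun j => (((b j).1 - (a j).1)%:~R - (1 + beta) * (cbrt c * r j) ^+ 3) / r j) @ \oo --> v.
  by apply: (cvg_as t1) => // j; rewrite exprMn k3 mulrA [(1 + beta) * c]mulrC.
have h2 : (fun j => (((b j).2 - (a j).2)%:~R - (cbrt c * r j) ^+ 3) / r j) @ \oo --> v' by apply: (cvg_as t2) => // j; rewrite exprMn k3.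
have sc : (fun=> s) @ \oo --> s by exact: cvg_cst.
apply: (cvg_as (passage_cdf_cvg ry fX b1 (cbrt_gt0 c0) h1 h2 sc)) => [j|].
  have E : (1 + Num.sqrt (1 + beta)) ^+ 2 * (cbrt c * r j) ^+ 3 = Lam * c * r j ^+ 3 by rewrite exprMn k3 mulrA.
  by rewrite E.
by rewrite opprD addrA.
Qed.

(** [H] stands for the time from the starting point with the starting weights erased. It lies
    between the time from the neighbouring point and the time from the corner with all weights kept,
    and these two have the same limit law. *)
Variables (n : nat) (v v' s : 'I_n.+1 -> R) (H : nat -> 'I_n.+1 -> T -> R).

Definition lpp_corner (j : nat) : int * int := (Num.floor (- beta * r j ^+ 3), 0).
Definition lpp_end (j : nat) (k : 'I_n.+1) : int * int := (Num.floor (r j ^+ 3 + v k * r j), Num.floor (r j ^+ 3 + v' k * r j)).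

Hypothesis mH : forall j k, measurable_fun setT (H j k).
Hypothesis Hbounds : forall k, \forall j \near \oo, forall w,
  passage (X^~ w) (lpp_start r beta j) (lpp_end j k) <= H j k w <= passage (X^~ w) (lpp_corner j) (lpp_end j k).

Let c k := (1 + g^-1) * v k + (1 + g) * v' k.
Local Notation cdf_gap e t k := (F_GUE ((s k - c k + e) / t) - F_GUE ((s k - c k) / sigma)).
(** The thresholds are compared after subtraction of [c k], the shift of the mean caused by the
    displacement of the end point. *)
Let bmin := \big[Num.min/ s ord0 - c ord0]_(k < n.+1) (s k - c k).

Let bmin_le k : bmin <= s k - c k.
Proof. by rewrite /bmin; apply: bigmin_le_cond. Qed.

Let bmin_at : exists k, bmin = s k - c k.
Proof.
rewrite /bmin; elim/big_rec: _ => [|i y _ [k ->]]; first by exists ord0.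
by case: leP => _; [exists i | exists k].
Qed.

Let end1 k : tracks r (fun j => (lpp_end j k).1) 1 (v k).
Proof.
by rewrite /tracks; apply: (cvg_as (@tracks_floor _ _ ry 1 (v k))) => // j; rewrite mul1r.
Qed.

Let end2 k : tracks r (fun j => (lpp_end j k).2) 1 (v' k).
Proof.
by rewrite /tracks; apply: (cvg_as (@tracks_floor _ _ ry 1 (v' k))) => // j; rewrite mul1r.
Qed.

Let corner1 : tracks r (fun j => (lpp_corner j).1) (- beta) 0.
Proof. exact: (@tracks_floor0 _ _ ry (- beta)). Qed.

Let start1 : tracks r (fun j => (lpp_start r beta j).1) (- beta) 0.
Proof. exact: (@tracks_shift _ _ ry _ _ _ 1 corner1). Qed.

Let full_cdf (a : nat -> int * int) k y : tracks r (fun j => (a j).1) (- beta) 0 -> (forall j, (a j).2 = 0) ->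
  (fun j => prb P (passage_set X (a j) (lpp_end j k) (Lam * r j ^+ 3 + y * r j))) @ \oo -->
  F_GUE ((y - c k) / sigma).
Proof.
move=> ta a2.
have t1 : tracks r (fun j => (lpp_end j k).1 - (a j).1) (1 * (1 + beta)) (v k) by have := tracks_sub (@end1 k) ta; rewrite opprK subr0 mul1r.
have t2 : tracks r (fun j => (lpp_end j k).2 - (a j).2) 1 (v' k).
  by have := tracks_sub (@end2 k) (tracks0 r); rewrite !subr0 => h; rewrite /tracks; apply: (cvg_as h) => // j; rewrite a2.
apply: (cvg_as (@corner_cdf _ _ _ _ _ y ltr01 t1 t2)) => [j|]; first by rewrite mulr1.
by rewrite /cbrt powR1 mul1r.
Qed.

Section Cut.
Variables (delta eta : R).
Hypotheses (d0 : 0 < delta) (db : delta * (1 + beta) < 1) (eta0 : 0 < eta).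

Let d1 : 0 < 1 - delta.
Proof. by rewrite subr_gt0 (le_lt_trans _ db) // ler_peMr ?(ltW d0) // ltW. Qed.

Let start := lpp_start r beta.
Let split := lpp_split r beta delta.
(** One step beyond the split point, so that the two legs share no weight. *)
Let split' j := ((split j).1 + 1, (split j).2).
Let XA j w := passage (above (X^~ w)) (start j) (split j).
Let G j k w := passage (X^~ w) (split' j) (lpp_end j k).

Let bad j := [set w | XA j w < passage (X^~ w) (start j) (split j)].

Let aN : nonneg_field (fun p w => above (X^~ w) p).
Proof. exact: (restrict_field_nonneg fX (fun p => p.1 < p.2)). Qed.

Let mXA j y : measurable [set w | XA j w <= y].
Proof. exact: (measurable_grow_le aN). Qed.

Let mpass a b y : measurable (passage_set X a b y).
Proof. exact: (measurable_grow_le (exp_field_nonneg fX)). Qed.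

Let mbad j : measurable (bad j).
Proof.
have mf : measurable_fun setT (fun w => passage (X^~ w) (start j) (split j) - XA j w).
  by apply: measurable_funB; [exact: (measurable_passage (exp_field_nonneg fX)) | exact: (measurable_passage aN)].
rewrite (_ : bad j = (fun w => passage (X^~ w) (start j) (split j) - XA j w) @^-1` `]0, +oo[%classic); last first.
  by apply/seteqP; split => w /=; rewrite in_itv /= andbT subr_gt0.
by rewrite -[X in measurable X]setTI; exact: mf.
Qed.

Let X0 p w : 0 <= X p w. Proof. by have [_ h _] := fX; exact: h. Qed.

Let XA_le j w : XA j w <= passage (X^~ w) (start j) (split j).
Proof. by apply: le_passage => p; rewrite /above; case: ifP. Qed.

(** Outside [bad], whose probability vanishes by [localization], erasing the weights does not change
    the time; the restricted time therefore inherits the one-point law. *)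
Let XA_cdf y : (fun j => prb P [set w | XA j w <= Lam * (1 - delta) * r j ^+ 3 + y * r j]) @ \oo --> F_GUE (y / (cbrt (1 - delta) * sigma)).
Proof.
have [t1 t2] := @split_dims _ _ ry beta delta.
have cX := @corner_cdf _ _ _ _ _ y d1 t1 t2; rewrite !mulr0 addr0 subr0 in cX.
have cb := localization ry fX b0 d0 db g0 g2.
have cu := cvg_adds cX cb; rewrite addr0 in cu.
apply: squeeze_seq cX cu => j; apply/andP; split.
  by apply: prb_le => // w /=; exact: le_trans (XA_le _ _).
apply: (le_trans _ (prbU P (mpass _ _ _) (mbad j))).
apply: prb_le => //; first exact: measurableU.
move=> w /= h; have [hb|hb] := ltP (XA j w) (passage (X^~ w) (start j) (split j)); first by right.
by left; exact: le_trans hb h.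
Qed.

Let G_cdf k y : (fun j => prb P [set w | G j k w <= Lam * delta * r j ^+ 3 + y * r j]) @ \oo --> F_GUE ((y - c k) / (cbrt delta * sigma)).
Proof.
have t1 : tracks r (fun j => (lpp_end j k).1 - (split' j).1) (delta * (1 + beta)) (v k).
  have := tracks_sub (@end1 k) (@tracks_shift _ _ ry _ _ _ 1 (@tracks_floor0 _ _ ry (1 - delta * (1 + beta)))).
  by rewrite subr0 subKr.
have t2 : tracks r (fun j => (lpp_end j k).2 - (split' j).2) delta (v' k).
  by have := tracks_sub (@end2 k) (@tracks_floor0 _ _ ry (1 - delta)); rewrite subr0 subKr.
exact: corner_cdf.
Qed.

Let join k : \forall j \near \oo, forall w, XA j w + G j k w <= H j k w.
Proof.
have [s1 s2] := @split_dims _ _ ry beta delta.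
have t1 : tracks r (fun j => (lpp_end j k).1 - (split' j).1) (delta * (1 + beta)) (v k).
  have := tracks_sub (@end1 k) (@tracks_shift _ _ ry _ _ _ 1 (@tracks_floor0 _ _ ry (1 - delta * (1 + beta)))).
  by rewrite subr0 subKr.
have t2 : tracks r (fun j => (lpp_end j k).2 - (split' j).2) delta (v' k).
  by have := tracks_sub (@end2 k) (@tracks_floor0 _ _ ry (1 - delta)); rewrite subr0 subKr.
near=> j.
have hH : forall w, passage (X^~ w) (start j) (lpp_end j k) <= H j k w <= passage (X^~ w) (lpp_corner j) (lpp_end j k) by near: j; exact: Hbounds.
have l1 : le_pt (start j) (split j).
  rewrite /le_pt -subr_ge0 -[X in _ && X]subr_ge0; apply/andP; split; near: j.
    by apply: tracks_ge0 s1; rewrite mulr_gt0.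
  exact: tracks_ge0 s2.
have l2 : le_pt (split' j) (lpp_end j k).
  rewrite /le_pt -subr_ge0 -[X in _ && X]subr_ge0; apply/andP; split; near: j.
    by apply: tracks_ge0 t1; rewrite mulr_gt0.
  exact: tracks_ge0 t2.
move=> w; have /andP[hb _] := hH w; apply: le_trans hb.
apply: (@le_trans _ _ (passage (X^~ w) (start j) (split j) + G j k w)); first by rewrite lerD2r.
by apply: passage_join => //; rewrite /step eqxx.
Unshelve. all: end_near. Qed.

Let A j := [set w | forall k, H j k w <= Lam * r j ^+ 3 + s k * r j].
Let A' j := [set w | XA j w <= Lam * (1 - delta) * r j ^+ 3 + (bmin + eta) * r j].

Lemma measurable_all_le j (y : 'I_n.+1 -> R) : measurable [set w | forall k, H j k w <= y k].
Proof.
rewrite (_ : [set w | _] = \bigcap_(k in [set: 'I_n.+1]) [set w | H j k w <= y k]); last first.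
  by apply/seteqP; split => w h k; [move=> _; exact: h | exact: h].
apply: fin_bigcap_measurable => [|k _]; first exact: finite_finset.
rewrite (_ : [set w | _] = H j k @^-1` `]-oo, y k]%classic); last first.
  by apply/seteqP; split => w /=; rewrite in_itv.
by rewrite -[X in measurable X]setTI; exact: mH.
Qed.

Let mA j : measurable (A j). Proof. exact: measurable_all_le. Qed.
Let mA' j : measurable (A' j). Proof. exact: mXA. Qed.

(** For the [k] attaining [bmin]: if [H] respects its threshold although the first leg is too long
    by [eta], the second leg must be too short by [eta]. Its fluctuations are of order [cbrt delta],
    so this is a far lower tail when [delta] is small. *)
Lemma cut_diff (e : R) : 0 < e -> \forall j \near \oo, prb P (A j `\` A' j) <= F_GUE (- eta / (cbrt delta * sigma)) + e.
Proof.
move=> e0; have [k bk] := bmin_at.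
have cG := @G_cdf k (c k - eta); rewrite (_ : c k - eta - c k = - eta) in cG; last by move: (c k) => y; ring.
near=> j.
have hj : forall w, XA j w + G j k w <= H j k w by near: j; exact: join.
apply: (@le_trans _ _ (prb P [set w | G j k w <= Lam * delta * r j ^+ 3 + (c k - eta) * r j])).
  apply: prb_le; [exact: measurableD | exact: mpass |].
  move=> w [/= hA /negP]; rewrite -ltNge bk => hX; exact: (cut_arith hX (hj w) (hA k)).
by near: j; apply: (cvgr_le _ cG); rewrite ltrDl.
Unshelve. all: end_near. Qed.

(** The two legs bound [H] only from below, so laws are compared: the probability of [S] without
    [Hu] equals [P S - P Hu] plus the probability of [Hu] without [S]. The limits of [P S] and
    [P Hu] nearly agree, and [Hu] without [S] again forces a short second leg, the event [V]. *)
Lemma cut_diff' (e : R) : 0 < e -> \forall j \near \oo,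
  prb P (A' j `\` A j) <= \sum_(k < n.+1) (cdf_gap eta (cbrt (1 - delta) * sigma) k + F_GUE (- eta / (cbrt delta * sigma))) + e.
Proof.
move=> e0.
pose S j k := [set w | XA j w <= Lam * (1 - delta) * r j ^+ 3 + (s k - c k + eta) * r j].
pose Hu j k := passage_set X (lpp_corner j) (lpp_end j k) (Lam * r j ^+ 3 + s k * r j).
pose V j k := [set w | G j k w <= Lam * delta * r j ^+ 3 + (c k - eta) * r j].
have mS j k : measurable (S j k) by exact: mXA.
have mHu j k : measurable (Hu j k) by exact: mpass.
have mV j k : measurable (V j k) by exact: mpass.
have cc : (fun j => \sum_(k < n.+1) (prb P (S j k) - prb P (Hu j k) + prb P (V j k))) @ \oo -->
   \sum_(k < n.+1) (cdf_gap eta (cbrt (1 - delta) * sigma) k + F_GUE (- eta / (cbrt delta * sigma))).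
  apply: cvg_sum => k _; apply: cvg_adds; first apply: cvg_subs.
  - exact: XA_cdf.
  - exact: full_cdf.
  - by have := @G_cdf k (c k - eta); rewrite (_ : c k - eta - c k = - eta) //; move: (c k) => y; ring.
near=> j.
have r0 : 0 <= r j by near: j; exact: cvgry_ge.
have hj : forall k w, XA j w + G j k w <= passage (X^~ w) (lpp_corner j) (lpp_end j k).
  near: j; apply: near_all => k; apply: filterS2 (join k) (Hbounds k) => j h1 h2 w.
  by apply: le_trans (h1 w) _; have /andP[] := h2 w.
have hH : forall k w, H j k w <= passage (X^~ w) (lpp_corner j) (lpp_end j k).
  by near: j; apply: near_all => k; apply: filterS (Hbounds k) => j h2 w; have /andP[] := h2 w.
apply: (@le_trans _ _ (\sum_(k < n.+1) (prb P (S j k) - prb P (Hu j k) + prb P (V j k)))); last first.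
  by near: j; apply: (cvgr_le _ cc); rewrite ltrDl.
have mF k : measurable (S j k `\` Hu j k) by exact: measurableD.
have [mB hB] := prb_bigcup P (index_enum 'I_n.+1) mF.
apply: le_trans (le_trans (prb_le P _ mB _) hB) _.
- exact: measurableD.
- move=> w [/= hX hn]; have [k hk] : exists k, ~ (H j k w <= Lam * r j ^+ 3 + s k * r j) by exact/existsNP.
  exists k; first by rewrite /= mem_index_enum.
  split; rewrite /S /Hu /=.
    apply: (le_trans hX); rewrite lerD2l ler_wpM2r // lerD2r; exact: bmin_le.
  by move=> h; apply: hk; apply: le_trans h; exact: hH.
apply: ler_sum => k _.
have e1 := prbDI P (mS j k) (mHu j k); have e2 := prbDI P (mHu j k) (mS j k).
have e3 : prb P (Hu j k `\` S j k) <= prb P (V j k).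
  apply: prb_le => //; first exact: measurableD.
  move=> w [/= h1 /negP]; rewrite -ltNge /V /= => h2; exact: (cut_arith h2 (hj k w) h1).
by rewrite setIC in e2; lra.
Unshelve. all: end_near. Qed.
Lemma cut_cdf : (fun j => prb P (A' j)) @ \oo --> F_GUE ((bmin + eta) / (cbrt (1 - delta) * sigma)).
Proof. exact: XA_cdf. Qed.
End Cut.

Lemma F_GUE_comp (u : nat -> R) (l : R) : u @ \oo --> l -> (fun i => F_GUE (u i)) @ \oo --> F_GUE l.
Proof. by move=> ul; apply: continuous_cvg => //; exact: F_GUE_continuous. Qed.

Lemma choose_eta (e : R) : 0 < e -> exists2 eta, 0 < eta & \sum_(k < n.+1) cdf_gap eta sigma k <= e /\
  `|F_GUE (bmin / sigma) - F_GUE ((bmin + eta) / sigma)| <= e.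
Proof.
move=> e0.
have jz : (fun k : nat => k.+1%:R^-1 : R) @ \oo --> 0 by exact: cvg_harmonic.
have h (y : R) : (fun i : nat => F_GUE ((y + i.+1%:R^-1) / sigma)) @ \oo --> F_GUE (y / sigma).
  apply: F_GUE_comp; have c1 : (fun i : nat => (y + i.+1%:R^-1) / sigma) @ \oo --> (y + 0) / sigma.
    by apply: cvg_muls; [apply: cvg_adds => //; exact: cvg_cst | exact: cvg_cst].
  by rewrite addr0 in c1.
have c1 : (fun i : nat => \sum_(k < n.+1) cdf_gap (i.+1%:R^-1) sigma k) @ \oo -->
   \sum_(k < n.+1) (F_GUE ((s k - c k) / sigma) - F_GUE ((s k - c k) / sigma)).
  by apply: cvg_sum => k _; apply: cvg_subs; [exact: h | exact: cvg_cst].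
rewrite big1 in c1; last by move=> k _; rewrite subrr.
have [J1 _ H1] := cvgr_le _ c1 _ e0.
have /cvgrPdist_le/(_ e e0)[J2 _ H2] := h bmin.
exists ((maxn J1 J2).+1%:R^-1); first by rewrite invr_gt0.
by split; [apply: H1; rewrite /= leq_maxl | apply: H2; rewrite /= leq_maxr].
Qed.

(** With [eta] already fixed by continuity of [F_GUE], [delta] is taken so small that
    [- eta / cbrt delta] lies in the lower tail while [cbrt (1 - delta)] is close to 1. *)
Lemma choose_delta (eta e : R) : 0 < eta -> 0 < e -> exists delta, [/\ 0 < delta, delta * (1 + beta) < 1, F_GUE (- eta / (cbrt delta * sigma)) <= e,
      \sum_(k < n.+1) (cdf_gap eta (cbrt (1 - delta) * sigma) k + F_GUE (- eta / (cbrt delta * sigma))) <=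
      \sum_(k < n.+1) (cdf_gap eta sigma k) + e &
      `|F_GUE ((bmin + eta) / sigma) - F_GUE ((bmin + eta) / (cbrt (1 - delta) * sigma))| <= e].
Proof.
move=> eta0 e0.
have jz : (fun k : nat => k.+1%:R^-1 : R) @ \oo --> 0 by exact: cvg_harmonic.
pose dl (i : nat) : R := i.+1%:R^-1 * (2 * (1 + beta))^-1.
have dl0 i : 0 < dl i by rewrite mulr_gt0 ?invr_gt0 // mulr_gt0.
have dlb i : dl i * (1 + beta) <= 2^-1.
  rewrite /dl invfM -!mulrA mulVf ?gt_eqF // mulr1 ger_pMl ?invr_gt0 //.
  by rewrite invf_le1 ?ler1n.
have dl1 i : dl i < 1.
  have : dl i <= dl i * (1 + beta) by rewrite ler_peMr ?(ltW (dl0 i)) // ltW.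
  have := dlb i; lra.
have dlc : dl @ \oo --> 0.
  have h : dl @ \oo --> 0 * (2 * (1 + beta))^-1 by apply: cvg_muls => //; exact: cvg_cst.
  by rewrite mul0r in h.
have k2 : (fun i => cbrt (dl i)) @ \oo --> 0 by apply: cvg_cube0 => [i|]; [exact: powR_ge0 | apply: (cvg_as dlc) => // i; rewrite cbrtK // ltW].
have k1 : (fun i => cbrt (1 - dl i)) @ \oo --> (1 : R).
  apply: cvg_cube1 => [i|]; first exact: powR_ge0.
  have h : (fun i => 1 - dl i) @ \oo --> (1 - 0 : R) by apply: cvg_subs => //; exact: cvg_cst.
  by rewrite subr0 in h; apply: (cvg_as h) => // i; rewrite cbrtK // subr_ge0 ltW.
have hF (y : R) : (fun i => F_GUE (y / (cbrt (1 - dl i) * sigma))) @ \oo --> F_GUE (y / sigma).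
  apply: F_GUE_comp; have h : (fun i => y / (cbrt (1 - dl i) * sigma)) @ \oo --> y / (1 * sigma).
    apply: cvg_muls; first exact: cvg_cst.
    by apply: cvg_inv; [rewrite mul1r gt_eqF | apply: cvg_muls => //; exact: cvg_cst].
  by rewrite mul1r in h.
have hL : (fun i => F_GUE (- eta / (cbrt (dl i) * sigma))) @ \oo --> 0.
  apply/cvgrPdist_lt => e' e'0; have [A HA] := @F_GUE_lower_tail R _ e'0.
  have [J _ HJ] : \forall i \near \oo, cbrt (dl i) < eta / (sigma * (`|A| + 1)) by apply: (cvgr_lt _ k2); rewrite divr_gt0 // mulr_gt0 // ltr_wpDl.
  exists J => // i /HJ; rewrite ltr_pdivlMr; last by rewrite mulr_gt0 // ltr_wpDl.
  move=> h; rewrite sub0r normrN ger0_norm ?F_GUE_ge0 //; apply: HA.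
  rewrite mulNr lerNl ler_pdivlMr; last by rewrite mulr_gt0 // cbrt_gt0.
  have := ler_norm (- A); rewrite normrN => hA.
  have cs0 : 0 < cbrt (dl i) * sigma by rewrite mulr_gt0 // cbrt_gt0.
  rewrite mulrA in h; rewrite mulrC; apply: le_trans (ltW h).
  by rewrite ler_wpM2l ?(ltW cs0) // (le_trans hA) // lerDl.
have c2 : (fun i => \sum_(k < n.+1) (cdf_gap eta (cbrt (1 - dl i) * sigma) k + F_GUE (- eta / (cbrt (dl i) * sigma)))) @ \oo -->
   \sum_(k < n.+1) (cdf_gap eta sigma k + 0).
  by apply: cvg_sum => k _; apply: cvg_adds => //; apply: cvg_subs; [exact: hF | exact: cvg_cst].
have [J1 _ H1] := cvgr_le _ hL _ e0.
have [J2 _ H2] : \forall i \near \oo, \sum_(k < n.+1) (cdf_gap eta (cbrt (1 - dl i) * sigma) k +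
         F_GUE (- eta / (cbrt (dl i) * sigma))) <= \sum_(k < n.+1) (cdf_gap eta sigma k) + e.
  apply: (cvgr_le _ c2); rewrite (eq_bigr (fun k => cdf_gap eta sigma k)).
    by rewrite ltrDl.
  by move=> k _; rewrite addr0.
have /cvgrPdist_le/(_ e e0)[J3 _ H3] := hF (bmin + eta).
exists (dl (maxn J1 (maxn J2 J3))); split => //.
- have := dlb (maxn J1 (maxn J2 J3)); lra.
- by apply: H1; rewrite /= leq_maxl.
- by apply: H2; rewrite /= leq_max leq_maxl orbT.
- by apply: H3; rewrite /= !leq_max leqnn !orbT.
Qed.

(** The approximating event involves only weights strictly above the diagonal. Its level is
    eventually nonnegative, as [restrict_indep] asks. *)
Theorem side_compare (e : R) : 0 < e -> exists delta (y : nat -> R),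
  [/\ 0 < delta, \forall j \near \oo, 0 <= y j & let A j := [set w | forall k, H j k w <= Lam * r j ^+ 3 + s k * r j] in
   let A' j := (above_set r beta X delta j (y j)) in
   \forall j \near \oo, [/\ prb P (A j `\` A' j) <= e, prb P (A' j `\` A j) <= e & `|F_GUE (bmin / sigma) - prb P (A' j)| <= e]].
Proof.
move=> e0; have e40 : 0 < e / 4 by rewrite divr_gt0.
have [eta eta0 [h1 h2]] := choose_eta e40.
have [delta [d0 db h3 h4 h5]] := choose_delta eta0 e40.
exists delta, (fun j => Lam * (1 - delta) * r j ^+ 3 + (bmin + eta) * r j); split => //.
  have L0 : 0 < Lam * (1 - delta).
    have d1 : 0 < 1 - delta by rewrite subr_gt0 (le_lt_trans _ db) // ler_peMr ?(ltW d0) // ltW.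
    by rewrite mulr_gt0 // exprn_gt0 // addr_gt0.
  near=> j.
  have r1 : 1 <= r j by near: j; exact: cvgry_ge.
  have r2 : `|bmin + eta| / (Lam * (1 - delta)) <= r j by near: j; exact: cvgry_ge.
  rewrite ler_pdivrMr // in r2.
  have r0 : 0 <= r j by lra.
  have -> : Lam * (1 - delta) * r j ^+ 3 + (bmin + eta) * r j = (r j * (Lam * (1 - delta)) * r j + (bmin + eta)) * r j by ring.
  rewrite mulr_ge0 //.
  have h : r j * (Lam * (1 - delta)) <= r j * (Lam * (1 - delta)) * r j by rewrite ler_peMr // mulr_ge0 // ltW.
  have := ler_norm (- (bmin + eta)); rewrite normrN; lra.
have hc := @cut_cdf delta eta d0 db.
near=> j; split.
- have : prb P ([set w | forall k, H j k w <= Lam * r j ^+ 3 + s k * r j] `\`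
     (above_set r beta X delta j (Lam * (1 - delta) * r j ^+ 3 + (bmin + eta) * r j)))
     <= F_GUE (- eta / (cbrt delta * sigma)) + e / 4.
    by near: j; exact: cut_diff.
  lra.
- have : prb P ((above_set r beta X delta j (Lam * (1 - delta) * r j ^+ 3 + (bmin + eta) * r j)) `\`
     [set w | forall k, H j k w <= Lam * r j ^+ 3 + s k * r j])
     <= \sum_(k < n.+1) (cdf_gap eta (cbrt (1 - delta) * sigma) k + F_GUE (- eta / (cbrt delta * sigma))) + e / 4.
    by near: j; exact: cut_diff'.
  lra.
- have : `|F_GUE ((bmin + eta) / (cbrt (1 - delta) * sigma)) - prb P (above_set r beta X delta j (Lam * (1 - delta) * r j ^+ 3 + (bmin + eta) * r j))| <= e / 4.
    by near: j; move/cvgrPdist_le : hc; exact.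
  move: h2 h5; rewrite !ler_norml => /andP[? ?] /andP[? ?] /andP[? ?]; apply/andP; split; lra.
Unshelve. all: end_near. Qed.
End FieldX.
End Side.

(** * Measurability and the exponential law *)

Section MeasurableLPP.
Variables (R : realType) (d : measure_display) (T : measurableType d).
Variable w : int * int -> T -> R.
Hypothesis mw : forall p, measurable_fun setT (w p).

Lemma countable_bigcap_measurable (J : countType) (F : J -> set T) : (forall i, measurable (F i)) -> measurable (\bigcap_i F i).
Proof.
move=> mF; pose G k := if unpickle k is Some i then F i else setT.
rewrite (_ : \bigcap_i F i = \bigcap_k G k).
  by apply: bigcapT_measurable => k; rewrite /G; case: unpickle.
apply/seteqP; split => x h k _; first by rewrite /G; case: unpickle => // i; exact: h.
by have := h (pickle k) I; rewrite /G pickleK.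
Qed.

(** There are countably many lists of lattice points, so the event is a countable intersection over
    the valid paths. If there is none, the supremum is that of the empty set, a constant. *)
Lemma measurable_LPP_le (a1 a2 b : int * int) (c : R) : measurable [set x | LPP (w^~ x) [set a | a = a1 \/ a = a2] b <= c].
Proof.
pose SA : set (int * int) := [set a | a = a1 \/ a = a2]; rewrite -/SA.
pose valid (p : seq (int * int)) := [/\ up_right p, SA (head (0, 0) p) & last (0, 0) p = b].
have [[p0 v0]|nv] := pselect (exists p, valid p); last first.
  rewrite (_ : [set x | _] = [set x | (sup set0 : R) <= c]).
    have [h|h] := pselect ((sup set0 : R) <= c).
      by rewrite (_ : [set x | _] = setT) //; apply/seteqP; split.
    by rewrite (_ : [set x | _] = set0) //; apply/seteqP; split.
  apply/seteqP; split => x /=; rewrite /LPP (_ : [set v | _] = set0) //.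
    by apply/seteqP; split => y //= [p [h1 h2 h3 _]]; apply: nv; exists p.
  by apply/seteqP; split => y //= [p [h1 h2 h3 _]]; apply: nv; exists p.
pose S p := if pselect (valid p) then [set x | \sum_(q <- p | q \notin SA) w q x <= c] else setT.
rewrite (_ : [set x | _] = \bigcap_p S p).
  apply: countable_bigcap_measurable => p; rewrite /S; case: (pselect (valid p)) => [vp|nvp]; last exact: measurableT.
  rewrite (_ : [set x | _] = (fun x => \sum_(q <- p | q \notin SA) w q x) @^-1` `]-oo, c]%classic); last first.
    by apply/seteqP; split => x /=; rewrite in_itv.
  rewrite -[X in measurable X]setTI.
  apply: (_ : measurable_fun setT (fun x => \sum_(q <- p | q \notin SA) w q x)) => //.
  under eq_fun do rewrite big_mkcond.
  apply: measurable_sum => q; case: (q \notin SA) => //; exact: measurable_cst.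
apply/seteqP; split => x /=.
- move=> h p _; rewrite /S; case: pselect => // vp /=; apply: le_trans h.
  apply: ub_le_sup; last by exists p; case: vp.
  pose w' q := if q \notin SA then w q x else 0.
  exists (Num.max (passage w' a1 b) (passage w' a2 b)) => y [[|a s] [/up_rightP[//= _ ps] sa lb ->]].
  rewrite big_mkcond le_max; have := @path_sum_le R w' _ _ ps; rewrite /path_sum -lb /=.
  by case: sa => /= -> ->; rewrite ?orbT.
- move=> h; rewrite /LPP; apply: ge_sup.
    by exists (\sum_(q <- p0 | q \notin SA) w q x); exists p0; case: v0.
  move=> y [p [h1 h2 h3 ->]]; have := h p I; rewrite /S; case: pselect => //.
  by case; split.
Qed.
End MeasurableLPP.

Section ExponentialWeights.
Variables (R : realType) (d : measure_display) (T : measurableType d) (P : probability T R).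
Variable omega : int * int -> {RV P >-> R}.
Hypothesis ind : mutually_independent P (fun p => (omega p : T -> R)).
Hypothesis law : forall p A, measurable A -> distribution P (omega p) A = exponential_prob 1 A.

(** The weights are nonnegative only almost surely; the positive part is nonnegative everywhere, as
    the pathwise inequalities demand. *)
Definition pos_weight p x : R := Num.max (omega p x) 0.

Lemma exponential_prob_cell (K : R) (v : nat) (A : set R) : 0 < K -> measurable A -> A `&` Rge0 = `[v%:R / K, v.+1%:R / K[%classic ->
  exponential_prob 1 A = ((1 - expR (- K^-1)) * expR (- K^-1) ^+ v)%:E.
Proof.
move=> K0 mA AE.
have ce : continuous (fun x : R => expR (- x)) by derivable_continuous.
have -> : exponential_prob 1 A = (RInt `[v%:R / K, v.+1%:R / K] (fun x : R => expR (- x)))%:E.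
  rewrite /exponential_prob /Rintegral fineK; last first.
    exact: (@integrable_fin_num _ (measurableTypeR R) R mu _ (measurable_itv _) _ (integrable_continuous_itv _ _ ce)).
  rewrite -integral_itv_bndo_bndc; last first.
    by apply/measurable_EFinP; exact: continuous_measurable_funS.
  rewrite -AE integral_mkcondr; apply: eq_integral => x _; rewrite /exponential_pdf !patchE.
  by case: ifP => // _; rewrite mul1r mulN1r.
have dF (x : R) : is_derive x 1 (fun x : R => - expR (- x)) (expR (- x)) by derive_eq; ring.
rewrite (@Rintegral_FTC2 R (fun x : R => - expR (- x))) //; last first.
  by rewrite ler_pM2r ?invr_gt0 // ler_nat.
congr (_%:E); rewrite -!expRM_natl !mulrN -natr1 mulrDl mul1r opprD expRD; ring.
Qed.

Lemma omega_nonneg : exists2 N : set T, measurable N /\ P N = 0%E & forall x, ~ N x -> forall p, 0 <= omega p x.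
Proof.
pose F (k : nat) := if unpickle k is Some p then [set x | omega p x < 0] else set0.
have mlt p : measurable [set x | omega p x < 0].
  rewrite (_ : [set x | _] = omega p @^-1` `]-oo, 0[%classic); last first.
    by apply/seteqP; split => x /=; rewrite in_itv.
  by rewrite -[X in measurable X]setTI; exact: measurable_funP.
have P0 p : P [set x | omega p x < 0] = 0%E.
  have -> : [set x | omega p x < 0] = omega p @^-1` `]-oo, 0[%classic by apply/seteqP; split => x /=; rewrite in_itv.
  rewrite -[LHS]/(distribution P (omega p) `]-oo, 0[%classic) law //.
  rewrite /exponential_prob integral0_eq // => x; rewrite /= in_itv /= => x0.
  by rewrite lt0_exponential_pdf.
have nF k : P.-negligible (F k).
  rewrite /F; case: unpickle => [p|]; last exact: negligible_set0.
  by apply/negligibleP; [exact: mlt | exact: P0].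
have /negligibleP := negligible_bigcup nF.
have mF : measurable (\bigcup_k F k) by apply: bigcupT_measurable => k; rewrite /F; case: unpickle.
move=> /(_ mF) PF; exists (\bigcup_k F k) => // x Nx p; rewrite leNgt; apply/negP => h.
by apply: Nx; exists (pickle p); [exact: I | rewrite /F pickleK].
Qed.

Lemma pos_weight_exp_field : exp_field P pos_weight.
Proof.
have mpos p : measurable_fun setT (pos_weight p) by apply: measurable_maxr; [exact: measurable_funP | exact: measurable_cst].
split => // [p x|K J v K0 uJ]; first by rewrite /pos_weight le_max lexx orbT.
(* The cell of level 0 extends to [-oo], because the positive part sends all negative values to
   level 0. *)
pose B p : set R := if v p is k.+1 then `[k.+1%:R / K, k.+2%:R / K[%classic else `]-oo, K^-1[%classic.
have mB p : measurable (B p) by rewrite /B; case: (v p) => [|k]; exact: measurable_itv.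
rewrite (_ : [set x | _] = \bigcap_(p in [set p | p \in J]) (omega p @^-1` B p)).
  rewrite ind // (big_morph EFin (@EFinM R) (erefl _)); apply: eq_bigr => p _.
  rewrite -[LHS]/(distribution P (omega p) (B p)) law //; apply: exponential_prob_cell => //.
  apply/seteqP; split => x; rewrite /B; case: (v p) => [|k] /=; rewrite !in_itv /= ?andbT ?mul0r ?div1r.
  - by move=> [-> ->].
  - by move=> [/andP[-> ->]].
  - by move=> /andP[-> ->].
  - by move=> /andP[h1 h2]; rewrite h1 h2; split => //; apply: le_trans h1; rewrite divr_ge0 // ltW.
have key p x : (truncn (K * pos_weight p x) = v p) <-> B p (omega p x).
  have h0 : 0 <= K * pos_weight p x by rewrite mulr_ge0 ?(ltW K0) // /pos_weight le_max lexx orbT.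
  have E1 k : (truncn (K * pos_weight p x) = k) <-> (k%:R / K <= pos_weight p x < k.+1%:R / K).
    rewrite ler_pdivrMr // ltr_pdivlMr // [pos_weight p x * K]mulrC.
    by split => [<-|]; [exact: truncn_itv | exact: truncn_def].
  rewrite E1 /B; case: (v p) => [|k] /=; rewrite in_itv /= /pos_weight.
  - by rewrite mul0r div1r le_max lexx orbT /= gt_max invr_gt0 K0 andbT.
  - by rewrite le_max gt_max divr_gt0 // andbT [_ <= 0]leNgt divr_gt0 // orbF.
apply/seteqP; split => x /= h p pJ; first by apply/key; exact: h.
by apply/key; exact: h.
Qed.
End ExponentialWeights.

(** * Both starting points together *)

Section Assembly.
Variables (R : realType) (d : measure_display) (T : measurableType d) (P : probability T R).
Variables (r : nat -> R).
Hypothesis ry : r @ \oo --> +oo.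
Variable beta : R.
Hypothesis b0 : 0 < beta.

Let corner j := lpp_corner r beta j.

Definition off_start j (w : int * int -> R) p : R := if (p == corner j) || (p == swap (corner j)) then 0 else w p.

Let corner_neg : \forall j \near \oo, (corner j).1 < 0.
Proof.
near=> j.
have r1 : 1 <= r j by near: j; exact: cvgry_ge.
have h : 0 < beta * r j ^+ 3 by rewrite mulr_gt0 // exprn_gt0 // (lt_le_trans ltr01).
by rewrite floor_lt_int mulNr oppr_lt0.
Unshelve. all: end_near. Qed.

(** A path from the neighbour of the corner meets no erased weight: its abscissae exceed that of the
    corner, and its ordinates are nonnegative while that of the reflected corner is negative. *)
Lemma off_start_bounds (X : int * int -> T -> R) n (v v' : 'I_n.+1 -> R) k : nonneg_field X -> \forall j \near \oo, forall w,
  passage (X^~ w) (lpp_start r beta j) (lpp_end r v v' j k) <=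
  passage (off_start j (X^~ w)) (corner j) (lpp_end r v v' j k) <=
  passage (X^~ w) (corner j) (lpp_end r v v' j k).
Proof.
move=> [_ X0].
have t1 : tracks r (fun j => (lpp_end r v v' j k).1 - (lpp_start r beta j).1) (1 - - beta) (v k - 0).
  apply: tracks_sub; last exact: (@tracks_shift _ _ ry _ _ _ 1 (@tracks_floor0 _ _ ry (- beta))).
  by rewrite /tracks; apply: (cvg_as (@tracks_floor _ _ ry 1 (v k))) => // j; rewrite mul1r.
have t2 : tracks r (fun j => (lpp_end r v v' j k).2) 1 (v' k).
  by rewrite /tracks; apply: (cvg_as (@tracks_floor _ _ ry 1 (v' k))) => // j; rewrite mul1r.
near=> j.
have cneg : (corner j).1 < 0 by near: j; exact: corner_neg.
have le1 : 0 <= (lpp_end r v v' j k).1 - (lpp_start r beta j).1 by near: j; apply: tracks_ge0 t1 => //; rewrite opprK addr_gt0.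
have le2 : 0 <= (lpp_end r v v' j k).2 by near: j; apply: tracks_ge0 t2.
move=> w; have off0 p : 0 <= off_start j (X^~ w) p by rewrite /off_start; case: ifP.
apply/andP; split; last by apply: le_passage => p; rewrite /off_start; case: ifP.
rewrite (_ : passage (X^~ w) _ _ = passage (off_start j (X^~ w)) (lpp_start r beta j) (lpp_end r v v' j k)).
  apply: passage_le_pt => //.
  - by rewrite /le_pt /= lexx andbT lerDl.
  - by rewrite /le_pt -subr_ge0 le1 /=.
  - by rewrite /le_pt !lexx.
apply: eq_grow => i l _ _; rewrite /rect /off_start ifF //.
apply/negbTE; rewrite negb_or; apply/andP; split; apply/eqP => /(congr1 (fun q => (q.1, q.2))) [].
- by move: (Num.floor _) => f; lia.
- by move: cneg; rewrite /corner /=; move: (Num.floor _) => f; lia.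
Unshelve. all: end_near. Qed.

Lemma prb_inter_le (A1 A2 B1 B2 : set T) : measurable A1 -> measurable A2 -> measurable B1 -> measurable B2 ->
  prb P (A1 `&` A2) <= prb P (B1 `&` B2) + (prb P (A1 `\` B1) + prb P (A2 `\` B2)).
Proof.
move=> mA1 mA2 mB1 mB2.
have m1 := measurableD mA1 mB1; have m2 := measurableD mA2 mB2.
have mU := measurableU _ _ m1 m2; have mB := measurableI _ _ mB1 mB2.
apply: (@le_trans _ _ (prb P ((B1 `&` B2) `|` ((A1 `\` B1) `|` (A2 `\` B2))))).
  apply: prb_le => //; [exact: measurableI | exact: measurableU |].
  move=> x [a1 a2]; have [b1|b1] := pselect (B1 x); last by right; left.
  by have [b2|b2] := pselect (B2 x); [left | right; right].
by apply: (le_trans (prbU P mB mU)); rewrite lerD2l; exact: prbU.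
Qed.

Lemma F_GUE_le1 (s : R) : F_GUE s <= 1.
Proof.
have /andP[_ h] := F_GUE_bounds s; apply: (le_trans h).
rewrite -[leRHS]expR0 ler_expR oppr_le0; apply: Rintegral_ge0 => x _; exact: airy_diag_ge0.
Qed.

Lemma prod_close (p q F1 F2 e : R) : 0 <= p -> p <= 1 -> 0 <= F2 -> F2 <= 1 -> `|F1 - p| <= e -> `|F2 - q| <= e -> `|F1 * F2 - p * q| <= e + e.
Proof.
move=> p0 p1 F0 F21 h1 h2; have -> : F1 * F2 - p * q = (F1 - p) * F2 + p * (F2 - q) by ring.
apply: (le_trans (ler_normD _ _)); rewrite !normrM; apply: lerD.
- by rewrite -[leRHS]mulr1 ler_pM // ger0_norm.
- by rewrite -[leRHS]mul1r ler_pM // ger0_norm.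
Qed.

Variable X : int * int -> T -> R.
Hypothesis fX : exp_field P X.
Variables (n : nat) (u s : 'I_n.+1 -> R).

Let g := Num.sqrt (1 + beta).
Let sigma := tw_scale (1 + beta).
Let minp := \big[Num.min/ s ord0 - (1 + g^-1) * u ord0]_(k < n.+1) (s k - (1 + g^-1) * u k).
Let minm := \big[Num.min/ s ord0 - (1 + g) * u ord0]_(k < n.+1) (s k - (1 + g) * u k).

Let Pk j k : int * int := (Num.floor (r j ^+ 3 + u k * r j), Num.floor (r j ^+ 3)).

(** Reflection takes the second starting point to the first and exchanges horizontal with vertical
    displacements, so [side_compare] applies with [(u, 0)] and with [(0, u)]. The two approximating
    events use weights strictly above and strictly below the diagonal, so they are independent, and
    the intersection is approximated by a product. *)
Theorem two_sides_cvg :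
  (fun j => prb P [set w | forall k, Num.max (passage (off_start j (X^~ w)) (corner j) (Pk j k))
      (passage (off_start j (X^~ w)) (swap (corner j)) (Pk j k)) <= (1 + g) ^+ 2 * r j ^+ 3 + s k * r j]) @ \oo -->
  F_GUE (minp / sigma) * F_GUE (minm / sigma).
Proof.
pose Y p := X (swap p).
have fY : exp_field P Y := exp_field_swap fX.
pose z : 'I_n.+1 -> R := fun=> 0.
pose H1 j k w := passage (off_start j (X^~ w)) (corner j) (lpp_end r u z j k).
pose H2 j k w := passage (off_start j (Y^~ w)) (corner j) (lpp_end r z u j k).
have moff (Z : int * int -> T -> R) j : nonneg_field Z -> nonneg_field (fun p w => off_start j (Z^~ w) p).
  move=> [mZ Z0]; split => [p|p w]; rewrite /off_start; case: (_ || _) => //.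
have mH1 j k : measurable_fun setT (H1 j k) by exact: (measurable_passage (moff _ j (exp_field_nonneg fX))).
have mH2 j k : measurable_fun setT (H2 j k) by exact: (measurable_passage (moff _ j (exp_field_nonneg fY))).
have B1 k := off_start_bounds u z k (exp_field_nonneg fX).
have B2 k := off_start_bounds z u k (exp_field_nonneg fY).
apply/cvgrPdist_le => e e0; have e80 : 0 < e / 8 by rewrite divr_gt0.
have [dl1 [y1 [d1 y10 C1]]] := side_compare ry b0 fX s mH1 B1 e80.
have [dl2 [y2 [d2 y20 C2]]] := side_compare ry b0 fY s mH2 B2 e80.
have Ep : \big[Num.min/ s ord0 - ((1 + g^-1) * u ord0 + (1 + g) * z ord0)]_(k < n.+1) (s k - ((1 + g^-1) * u k + (1 + g) * z k)) = minp.
  by rewrite /minp /z /= mulr0 addr0; apply: eq_bigr => k _; rewrite addr0.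
have Em : \big[Num.min/ s ord0 - ((1 + g^-1) * z ord0 + (1 + g) * u ord0)]_(k < n.+1) (s k - ((1 + g^-1) * z k + (1 + g) * u k)) = minm.
  by rewrite /minm /z /= mulr0 add0r; apply: eq_bigr => k _; rewrite add0r.
rewrite -/g Ep -/sigma in C1; rewrite -/g Em -/sigma in C2.
pose A1 j := [set w | forall k, H1 j k w <= (1 + g) ^+ 2 * r j ^+ 3 + s k * r j].
pose A2 j := [set w | forall k, H2 j k w <= (1 + g) ^+ 2 * r j ^+ 3 + s k * r j].
pose B1' j := (above_set r beta X dl1 j (y1 j)).
pose B2' j := (above_set r beta Y dl2 j (y2 j)).
have mA1 j : measurable (A1 j) := measurable_all_le mH1 j _.
have mA2 j : measurable (A2 j) := measurable_all_le mH2 j _.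
have mB1 j : measurable (B1' j) by exact: (measurable_grow_le (restrict_field_nonneg fX (fun p => p.1 < p.2))).
have mB2 j : measurable (B2' j) by exact: (measurable_grow_le (restrict_field_nonneg fY (fun p => p.1 < p.2))).
have indep j : 0 <= y1 j -> 0 <= y2 j -> prb P (B1' j `&` B2' j) = prb P (B1' j) * prb P (B2' j).
  move=> y1j y2j; have E2 : B2' j = (passage_set (restrict_field X (fun p => p.2 < p.1)) (swap (lpp_start r beta j)) (swap (lpp_split r beta dl2 j)) (y2 j)).
    by apply/seteqP; split => w /=; rewrite -passage_tr.
  rewrite E2; apply: (restrict_indep fX (D1 := fun p => p.1 < p.2) (D2 := fun p => p.2 < p.1)) => //.
  by move=> p; case: ltgtP.
have setE j : [set w | forall k, Num.max (passage (off_start j (X^~ w)) (corner j) (Pk j k))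
      (passage (off_start j (X^~ w)) (swap (corner j)) (Pk j k)) <= (1 + g) ^+ 2 * r j ^+ 3 + s k * r j] = A1 j `&` A2 j.
  have h1 k w : passage (off_start j (X^~ w)) (corner j) (Pk j k) = H1 j k w by rewrite /H1 /lpp_end /z mul0r addr0.
  have h2 k w : passage (off_start j (X^~ w)) (swap (corner j)) (Pk j k) = H2 j k w.
    rewrite /H2 /lpp_end /z mul0r addr0 -passage_swap; congr (passage _ _ _); apply/funext => p.
    rewrite /off_start /= /Y; have sK : cancel swap swap by case.
    by rewrite (can2_eq sK sK) (inj_eq (can_inj sK)) orbC.
  apply/seteqP; split => w /=.
    by move=> h; split => k; have := h k; rewrite h1 h2 ge_max => /andP[].
  by move=> [g1 g2] k; rewrite h1 h2 ge_max g1 g2.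
near=> j; rewrite setE.
have [p1 p2 p3] : [/\ prb P (A1 j `\` B1' j) <= e / 8, prb P (B1' j `\` A1 j) <= e / 8 &
     `|F_GUE (minp / sigma) - prb P (B1' j)| <= e / 8] by near: j; exact: C1.
have [q1 q2 q3] : [/\ prb P (A2 j `\` B2' j) <= e / 8, prb P (B2' j `\` A2 j) <= e / 8 &
     `|F_GUE (minm / sigma) - prb P (B2' j)| <= e / 8] by near: j; exact: C2.
have y1j : 0 <= y1 j by near: j.
have y2j : 0 <= y2 j by near: j.
have h1 := prb_inter_le (mA1 j) (mA2 j) (mB1 j) (mB2 j).
have h2 := prb_inter_le (mB1 j) (mB2 j) (mA1 j) (mA2 j).
rewrite (indep j y1j y2j) in h1 h2.
have h3 := prod_close (prb_ge0 P _) (prb_le1 P (mB1 j)) (F_GUE_ge0 _) (F_GUE_le1 _) p3 q3.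
move: h3; rewrite !ler_norml => /andP[h3 h4]; apply/andP; split; lra.
Unshelve. all: end_near. Qed.
End Assembly.

Lemma prb_eq_off_null (R : realType) (d : measure_display) (T : measurableType d) (P : probability T R) (A B N : set T) :
  measurable A -> measurable B -> measurable N -> P N = 0%E ->
  (forall x, ~ N x -> (A x <-> B x)) -> prb P A = prb P B.
Proof.
move=> mA mB mN N0 AB.
have le (C D : set T) : measurable C -> measurable D -> (forall x, ~ N x -> C x -> D x) -> prb P C <= prb P D.
  move=> mC mD CD; have mU := measurableU _ _ mD mN.
  apply: (@le_trans _ _ (prb P (D `|` N))).
    by apply: prb_le => // x Cx; have [Nx|Nx] := pselect (N x); [right | left; exact: CD].
  by apply: (le_trans (prbU P mD mN)); rewrite /prb N0 /= addr0.
by apply/le_anti; rewrite !le // => x Nx; [move=> /(AB x Nx) | move=> /(AB x Nx)].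
Qed.

Lemma cube_root_cvg (R : realType) (t : nat -> R) : t @ \oo --> +oo -> (fun j => t j `^ (3^-1)) @ \oo --> +oo.
Proof.
move=> ty; apply/cvgryPge => M; near=> j.
have tj : (Num.max M 1) ^+ 3 <= t j by near: j; exact: cvgry_ge.
have m0 : 0 <= Num.max M 1 by rewrite le_max ler01 orbT.
apply: (@le_trans _ _ (Num.max M 1)); first by rewrite le_max lexx.
have -> : Num.max M 1 = (Num.max M 1 ^+ 3) `^ (3^-1) by rewrite -powR_mulrn // -powRrM mulfV ?powRr1.
by apply: ge0_ler_powR => //; rewrite ?invr_ge0 // nnegrE ?exprn_ge0 // (le_trans _ tj) // exprn_ge0.
Unshelve. all: end_near. Qed.

Theorem theorem3p1 (R : realType) (d : measure_display) (T : measurableType d)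
  (P : probability T R) (omega : int * int -> {RV P >-> R})
  (beta : R) (n : nat) (u s : 'I_n.+1 -> R) :
  0 < beta ->
  (forall i j : 'I_n.+1, (i < j)%N -> u i < u j) ->
  mutually_independent P (fun p => (omega p : T -> R)) ->
  (forall p A, measurable A -> distribution P (omega p) A = exponential_prob 1 A) ->
  let mu_p := 1 + (Num.sqrt (1 + beta))^-1 in
  let mu_m := 1 + Num.sqrt (1 + beta) in
  let sigma := (1 + Num.sqrt (1 + beta)) `^ (4 / 3) / (1 + beta) `^ (6^-1) in
  let L t := [set a : int * int | a = (Num.floor (- beta * t), 0%R) \/ a = (0%R, Num.floor (- beta * t))] in
  let Pk t k := (Num.floor (t + u k * t `^ (3^-1)), Num.floor t) in
  let minp := \big[Num.min/ s ord0 - mu_p * u ord0]_(k < n.+1) (s k - mu_p * u k) in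
  let minm := \big[Num.min/ s ord0 - mu_m * u ord0]_(k < n.+1) (s k - mu_m * u k) in
  P [set x | forall k : 'I_n.+1, LPP (fun p => omega p x) (L t) (Pk t k) <= (1 + Num.sqrt (1 + beta)) ^+ 2 * t + s k * t `^ (3^-1)]
    @[t --> +oo] --> ((F_GUE (minp / sigma) * F_GUE (minm / sigma))%:E)%E.
Proof.
move=> b0 _ ind law mu_p mu_m sigma L Pk minp minm.
pose X := pos_weight omega; have fX : exp_field P X := pos_weight_exp_field ind law.
pose A (w : int * int -> T -> R) t := [set x | forall k : 'I_n.+1,
  LPP (w^~ x) (L t) (Pk t k) <= (1 + Num.sqrt (1 + beta)) ^+ 2 * t + s k * t `^ (3^-1)].
have mA w t : (forall p, measurable_fun setT (w p)) -> measurable (A w t).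
  move=> mw; rewrite (_ : A w t = \bigcap_k [set x | LPP (w^~ x) (L t) (Pk t k) <= (1 + Num.sqrt (1 + beta)) ^+ 2 * t + s k * t `^ (3^-1)]).
    by apply: countable_bigcap_measurable => k; exact: measurable_LPP_le.
  by apply/seteqP; split => x h k => [_|]; exact: h.
have mom p : measurable_fun setT (omega p) by exact: measurable_funP.
have mX p : measurable_fun setT (X p) by case: (exp_field_nonneg fX) => + _; exact.
apply: cvg_EFin; first by apply: nearW => t; exact/prb_fin/mA.
(* The limit at infinity is tested along sequences, the form of all preceding limits; [r] is the
   cube root of [t]. *)
apply/cvg_pinftyP => t ty.
have ry := cube_root_cvg ty; pose r j := t j `^ (3^-1).
have [N [mN N0] om0] := omega_nonneg law.
have Pk_ge0 : \forall j \near \oo, 0 <= Num.floor (r j ^+ 3) /\ forall k, 0 <= Num.floor (r j ^+ 3 + u k * r j).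
  have ge0 v : \forall j \near \oo, 0 <= Num.floor (r j ^+ 3 + v * r j).
    have tr : tracks r (fun j => Num.floor (r j ^+ 3 + v * r j)) 1 v.
      by rewrite /tracks; apply: (cvg_as (@tracks_floor _ _ ry 1 v)) => // j; rewrite mul1r.
    exact: (tracks_ge0 ry ltr01 tr).
  have all0 : \forall j \near \oo, forall k, 0 <= Num.floor (r j ^+ 3 + u k * r j) by apply: filter_forall => k; exact: ge0.
  near=> j; split; last by near: j.
  have -> : r j ^+ 3 = r j ^+ 3 + 0 * r j by rewrite mul0r addr0.
  by near: j; exact: ge0.
apply: (cvg_trans _ (@two_sides_cvg _ _ _ P _ ry _ b0 _ fX _ u s)); apply: near_eq_cvg; near=> j.
have t0 : 0 <= t j by near: j; exact: cvgry_ge.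
have r3 : r j ^+ 3 = t j by rewrite /r -powR_mulrn ?powR_ge0 // -powRrM mulVf ?powRr1.
(* Off the null set [N] the weights coincide with their positive parts. *)
have AE : prb P (A (fun p => omega p) (t j)) = prb P (A X (t j)).
  apply: (prb_eq_off_null (N := N)) => //; first exact: mA.
  - exact: mA.
  - move=> x Nx; rewrite /A /= (_ : X^~ x = (fun p => omega p x)) //.
    by apply/funext => p; rewrite /X /pos_weight max_l // om0.
rewrite /comp -/(prb P _) -[RHS]/(prb P (A (fun p => omega p) (t j))) AE; congr (prb P _).
have [p0 pk] : 0 <= Num.floor (r j ^+ 3) /\ forall k, 0 <= Num.floor (r j ^+ 3 + u k * r j) by near: j.
have c0 : Num.floor (- beta * t j) <= 0 by rewrite floor_le0 mulNr (le_lt_trans _ ltr01) // oppr_le0 mulr_ge0 // ltW.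
rewrite r3 in p0 pk.
have LE w k : LPP (X^~ w) (L (t j)) (Pk (t j) k) = Num.max (passage (off_start r beta j (X^~ w)) (lpp_corner r beta j) (Pk (t j) k))
      (passage (off_start r beta j (X^~ w)) (swap (lpp_corner r beta j)) (Pk (t j) k)).
  rewrite /off_start /lpp_corner /swap /= r3; apply: LPP_passage.
  - by move=> p; rewrite /X /pos_weight le_max lexx orbT.
  - by rewrite /le_pt /= (le_trans c0) //= pk.
  - by rewrite /le_pt /= pk (le_trans c0).
by rewrite /A; apply/seteqP; split => x /= h k; have := h k; rewrite -/(r j) r3 LE.
Unshelve. all: end_near. Qed.
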